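(* The staged unique assembly verification problem is $\mathrm{coNP}^{\mathrm{NP}}$-hard, even when restricted to staged systems with 7 stages and temperature $\tau=2$.
   Context: Tile assembly model. A tile is a non-rotatable unit square each of whose four edges is labeled with a glue from a finite set $\Sigma$; each glue $g$ has a nonnegative integer strength $\mathrm{str}(g,g)$, distinct glues have strength $0$ with each other, and there is a null glue of strength $0$. A configuration is a partial function $A:\mathbb{Z}^2\to T$ for a tile set $T$; an assembly is a configuration up to translation; its size $|A|$ is its number of tiles, and its shape is its domain up to translation. The bond graph of a configuration has one vertex per occupied position and an edge between each pair of adjacent occupied positions, weighted by the strength of the pair of abutting glues. An assembly is $\tau$-stable if every edge cut of its bond graph has total weight at least $\tau$. Assemblies $A,B$ are $\tau$-combinable into $C$ if some translates of $A$ and $B$ have disjoint domains, their union is a translate of $C$, and $C$ is $\tau$-stable. For a bin $(S,\tau)$ with set $S$ of initial assemblies, the set of produced assemblies is the smallest set containing $S$ and closed under: if produced $A,B$ are $\tau$-combinable into $C$ then $C$ is produced. A produced assembly is terminal if it is not $\tau$-combinable with any produced assembly. Staged systems. An $r$-stage $b$-bin mix graph is a directed graph on vertices $m_{i,j}$ ($1\le i\le r$, $1\le j\le b$) whose edges all have the form $(m_{i,j},m_{i+1,j'})$. A staged system $\langle M, \{T_1,\dots,T_b\},\tau\rangle$ consists of such a mix graph $M$, tile sets $T_1,\dots,T_b$, and a temperature $\tau$. Bin $(i,j)$ has initial assemblies $R_{1,j}=$ the single tiles of $T_j$, and for $i\ge 2$, $R_{i,j}$ is the union of the sets of terminal assemblies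 of the bins $(i-1,k)$ with $(m_{i-1,k},m_{i,j})\in M$; each bin operates at temperature $\tau$. The output of the system is the union of the sets of terminal assemblies of the bins in the final stage $r$. Staged unique assembly verification (staged UAV) problem: given a staged system $\Gamma$ and an assembly $A$, does $\Gamma$ uniquely assemble $A$, i.e. is $A$ the unique terminal assembly (output) of $\Gamma$? Hardness is with respect to polynomial-time many-one reductions; $\mathrm{coNP}^{\mathrm{NP}}=\Pi_2^{\mathrm{P}}$. *)

(* Defs.v *)
From Stdlib Require Import List ZArith Arith Bool.
Import ListNotations.
Set Implicit Arguments.

(* A tile (type): glue labels on its north, east, south, west edges.
   Glues are natural numbers; glue 0 is the null glue. *)
Record Tile := mkTile { tN : nat; tE : nat; tS : nat; tW : nat }.

Definition pos := (Z * Z)%type.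
Definition padd (p d : pos) : pos := (fst p + fst d, snd p + snd d)%Z.
Definition pos_eqb (p q : pos) : bool := Z.eqb (fst p) (fst q) && Z.eqb (snd p) (snd q).

Definition config := list (pos * Tile).

Definition cdom (C : config) : list pos := map fst C.

Definition wf_config (C : config) : Prop := C <> [] /\ NoDup (cdom C).

Definition clookup (C : config) (p : pos) : option Tile :=
  option_map snd (find (fun e => pos_eqb (fst e) p) C).

Definition shift (d : pos) (C : config) : config :=
  map (fun e => (padd (fst e) d, snd e)) C.

Definition asm_eq (C D : config) : Prop :=
  exists d : pos, forall p, clookup C p = clookup D (padd p d).

Definition gluew (str : nat -> nat) (g h : nat) : nat :=
  if Nat.eqb g h then str g else 0.

Definition bondw (str : nat -> nat) (C : config) (p q : pos) : nat :=
  match clookup C p, clookup C q with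
  | Some t, Some u =>
      if pos_eqb q (padd p (1, 0)%Z) then gluew str (tE t) (tW u)
      else if pos_eqb q (padd p (-1, 0)%Z) then gluew str (tW t) (tE u)
      else if pos_eqb q (padd p (0, 1)%Z) then gluew str (tN t) (tS u)
      else if pos_eqb q (padd p (0, -1)%Z) then gluew str (tS t) (tN u)
      else 0
  | _, _ => 0
  end.

Definition cut_weight (str : nat -> nat) (C : config) (S : pos -> bool) : nat :=
  list_sum (map (fun p =>
    list_sum (map (fun q => if S p && negb (S q) then bondw str C p q else 0)
                  (cdom C)))
    (cdom C)).

Definition stable (str : nat -> nat) (tau : nat) (C : config) : Prop :=
  forall S : pos -> bool,
    (exists p, In p (cdom C) /\ S p = true) ->
    (exists q, In q (cdom C) /\ S q = false) ->
    tau <= cut_weight str C S.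

Definition combinable (str : nat -> nat) (tau : nat) (A B C : config) : Prop :=
  exists dA dB : pos,
    (forall p, In p (cdom (shift dA A)) -> ~ In p (cdom (shift dB B))) /\
    wf_config C /\
    asm_eq (shift dA A ++ shift dB B) C /\
    stable str tau C.

Inductive produced (str : nat -> nat) (tau : nat) (S : config -> Prop) : config -> Prop :=
| prod_init : forall A C, S A -> wf_config C -> asm_eq A C -> produced str tau S C
| prod_comb : forall A B C, produced str tau S A -> produced str tau S B ->
    combinable str tau A B C -> produced str tau S C.

Definition terminal (str : nat -> nat) (tau : nat) (S : config -> Prop) (A : config) : Prop :=
  produced str tau S A /\
  forall B, produced str tau S B -> ~ exists C, combinable str tau A B C.

(* Stages are numbered 0 .. r-1 and bins 0 .. b-1 (b = length st_tiles).
   An edge (i, k, j) is the mix-graph edge (m_{i,k}, m_{i+1,j}).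
   st_str lists (glue, strength) pairs; unlisted glues have strength 0.
   st_target is the candidate assembly A, given by a translate with
   nonnegative coordinates. *)
Record UAVInstance := mkInst {
  st_tau : nat;
  st_r : nat;
  st_str : list (nat * nat);
  st_edges : list (nat * nat * nat);
  st_tiles : list (list Tile);
  st_target : list (nat * nat * Tile)
}.

Definition st_b (I : UAVInstance) : nat := length (st_tiles I).

Definition strength (I : UAVInstance) (g : nat) : nat :=
  if Nat.eqb g 0 then 0 else
  match find (fun e => Nat.eqb (fst e) g) (st_str I) with
  | Some e => snd e
  | None => 0
  end.

Definition target_config (I : UAVInstance) : config :=
  map (fun e => match e with (x, y, t) => ((Z.of_nat x, Z.of_nat y), t) end)
      (st_target I).

Definition valid_instance (I : UAVInstance) : Prop :=
  1 <= st_r I /\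
  NoDup (map fst (st_str I)) /\ ~ In 0 (map fst (st_str I)) /\
  (forall i k j, In (i, k, j) (st_edges I) -> i + 1 < st_r I /\ k < st_b I /\ j < st_b I) /\
  wf_config (target_config I).

Fixpoint bin_input (I : UAVInstance) (i j : nat) : config -> Prop :=
  match i with
  | 0 => fun C => exists t, In t (nth j (st_tiles I) []) /\ C = [((0, 0)%Z, t)]
  | S i' => fun C => exists k, In (i', k, j) (st_edges I) /\
                 terminal (strength I) (st_tau I) (bin_input I i' k) C
  end.

Definition output (I : UAVInstance) (C : config) : Prop :=
  exists j, j < st_b I /\ terminal (strength I) (st_tau I) (bin_input I (st_r I - 1) j) C.

Definition uniquely_assembles (I : UAVInstance) : Prop :=
  output I (target_config I) /\
  forall C, output I C -> asm_eq C (target_config I).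

Fixpoint pos_bits (p : positive) : list bool :=
  match p with
  | xH => [true]
  | xO q => false :: pos_bits q
  | xI q => true :: pos_bits q
  end.

Definition nat_bits (n : nat) : list bool :=
  match N.of_nat n with N0 => [] | Npos p => pos_bits p end.

(* self-delimiting code: binary digits doubled, then terminator 01 *)
Definition enc_nat (n : nat) : list bool :=
  flat_map (fun b => [b; b]) (nat_bits n) ++ [false; true].

Definition tile_nats (t : Tile) : list nat := [tN t; tE t; tS t; tW t].

Definition inst_nats (I : UAVInstance) : list nat :=
  [st_tau I; st_r I] ++
  (length (st_str I) :: flat_map (fun e => [fst e; snd e]) (st_str I)) ++
  (length (st_edges I) :: flat_map (fun e => match e with (i, k, j) => [i; k; j] end) (st_edges I)) ++
  (length (st_tiles I) :: flat_map (fun T => length T :: flat_map tile_nats T) (st_tiles I)) ++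
  (length (st_target I) :: flat_map (fun e => match e with (x, y, t) => x :: y :: tile_nats t end)
                                    (st_target I)).

Definition encode (I : UAVInstance) : list bool := flat_map enc_nat (inst_nats I).

Definition StagedUAV_7_2 (w : list bool) : Prop :=
  exists I, w = encode I /\ valid_instance I /\ st_r I = 7 /\ st_tau I = 2 /\
            uniquely_assembles I.

(* Single-tape, two-way infinite tape deterministic TM.  Tape symbols are
   nats, 0 = blank, 1 = bit false, 2 = bit true, 3 = separator.  The
   finite transition table lists ((state, read), (state', write, move));
   the first matching entry applies; the machine halts when none applies.
   Start state 0, accepting (halting) state 1. *)
Inductive move := MoveL | MoveR | Stay.
Record TM := mkTM { tm_delta : list ((nat * nat) * (nat * nat * move)) }.

(* configuration: state, left part (reversed), head symbol, right part *)
Definition tmcfg := (nat * list nat * nat * list nat)%type.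

Definition tm_step (M : TM) (c : tmcfg) : option tmcfg :=
  match c with (q, l, h, r) =>
    match find (fun e => Nat.eqb (fst (fst e)) q && Nat.eqb (snd (fst e)) h) (tm_delta M) with
    | None => None
    | Some (_, (q', w, d)) =>
      Some (match d with
            | MoveL => match l with [] => (q', [], 0, w :: r) | a :: l' => (q', l', a, w :: r) end
            | MoveR => match r with [] => (q', w :: l, 0, []) | a :: r' => (q', w :: l, a, r') end
            | Stay => (q', l, w, r)
            end)
    end
  end.

Fixpoint exec (M : TM) (t : nat) (c : tmcfg) : option tmcfg :=
  match tm_step M c with
  | None => Some c
  | Some c' => match t with 0 => None | S t' => exec M t' c' end
  end.

Definition init_cfg (inp : list nat) : tmcfg :=
  match inp with [] => (0, [], 0, []) | a :: r => (0, [], a, r) end.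

Definition tape_of (x : list bool) : list nat := map (fun b : bool => if b then 2 else 1) x.

Fixpoint read_bits (s : list nat) : list bool :=
  match s with
  | 1 :: s' => false :: read_bits s'
  | 2 :: s' => true :: read_bits s'
  | _ => []
  end.

Definition tm_output (c : tmcfg) : list bool :=
  match c with (_, _, h, r) => read_bits (h :: r) end.

Definition tm_state (c : tmcfg) : nat := match c with (q, _, _, _) => q end.

Definition polyb (c k n : nat) : nat := c * (n + 1) ^ k.

Definition triple_tape (x y z : list bool) : list nat :=
  tape_of x ++ [3] ++ tape_of y ++ [3] ++ tape_of z.

Definition in_Pi2P (L : list bool -> Prop) : Prop :=
  exists (V : TM) (c k : nat),
    (forall x y z, exists cf,
        exec V (polyb c k (length x + length y + length z)) (init_cfg (triple_tape x y z)) = Some cf) /\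
    (forall x, L x <->
       forall y, length y <= polyb c k (length x) ->
         exists z, length z <= polyb c k (length x) /\
           exists cf, exec V (polyb c k (length x + length y + length z))
                         (init_cfg (triple_tape x y z)) = Some cf /\ tm_state cf = 1).

Definition poly_reducible (L1 L2 : list bool -> Prop) : Prop :=
  exists (F : TM) (c k : nat),
    forall x, exists cf,
      exec F (polyb c k (length x)) (init_cfg (tape_of x)) = Some cf /\
      (L1 x <-> L2 (tm_output cf)).

Definition Pi2P_hard (L : list bool -> Prop) : Prop :=
  forall L', in_Pi2P L' -> poly_reducible L' L.

(* Main.v *)
(* Assemblies may grow without bound, and an assembly that can always grow further is never terminal. So a
   staged system can search: unsuccessful assemblies are made to grow forever and leave no trace in the output.

   Let L be decided by a polynomial-time verifier V in the form "for all y there is z such that V accepts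
   (x, y, z)". Bottom rows carrying x and an arbitrary y and columns of arbitrary height are glued to L-shapes,
   which are then filled with interior tiles that need a south and a west neighbour. A row above the bottom one
   simulates one step of V or, when V has rejected (x, y, z), moves on to the next z; the top row checks that
   the last z was rejected. A deviation from a correct computation places error tiles, which propagate to the
   north-east corner and expose a glue at which the assembly then grows forever. Hence a terminal assembly
   other than the target, a single inert tile, exists iff some y has all z rejected, that is, iff x is not in L.

   Such an instance is printed by a sweeping machine: an odometer of k digits in base n + 1 drives
   (n + 1) ^ k insertions, and the position glues of the bottom row are powers of two, whose binary code is
   unary in the position. *)

From Stdlib Require Import List ZArith Lia Arith Bool Permutation Classical Cantor.
From Stdlib Require Import ssreflect.
Require Import Defs.
Import ListNotations.

Set Implicit Arguments.

(** * The instance encoding *)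

(** The obstacle is that whatever gets stuck in a bin counts: a part that finds no partner is
    terminal and is passed on towards the output. So nothing may merely stop. An incomplete chain
    always has an end where a tile fits; there is an error tile for every pair of a state and a
    letter, so a wrong computation still completes its rectangle; and spurious partners absorb
    leftover parts into assemblies that grow forever. Conversely, a correct rectangle has to be
    inert, so all glues that it exposes have strength 0. The search over z takes exponentially many
    steps, but the instance does not depend on their number: the height of a column and the blanks
    around the input are guesses, and a wrong guess forces an error tile. Only the length of y has
    to be bounded by the tile set itself. At temperature 2, glues of strength 1 act only in pairs,
    which makes an interior tile read two inputs; glues of strength 2 form the one-dimensional parts
    and the joints. *)

Definition prefix_inj {X Y : Type} (f : X -> list Y) : Prop :=
  forall x y r r', f x ++ r = f y ++ r' -> x = y /\ r = r'.

Lemma pos_bits_inj p q : pos_bits p = pos_bits q -> p = q.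
Proof.
  assert (N : forall r, pos_bits r <> []) by (destruct r; discriminate).
  revert q; induction p as [p IH|p IH|]; destruct q as [q|q|]; cbn; intros H; try congruence.
  all: try (injection H as H); try (f_equal; now auto).
Qed.

Lemma nat_bits_inj n m : nat_bits n = nat_bits m -> n = m.
Proof.
  assert (N : forall r, pos_bits r <> []) by (destruct r; discriminate).
  unfold nat_bits; intros H; apply Nnat.Nat2N.inj.
  destruct (N.of_nat n), (N.of_nat m); auto.
  - destruct (N p); auto.
  - destruct (N p); auto.
  - f_equal; now apply pos_bits_inj.
Qed.

Definition dbl (l : list bool) : list bool := flat_map (fun b => [b; b]) l.

Lemma enc_nat_prefix_inj : prefix_inj enc_nat.
Proof.
  intros x y r r' H; unfold enc_nat in H; rewrite -!app_assoc /= in H.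
  assert (K : forall l l', dbl l ++ false :: true :: r = dbl l' ++ false :: true :: r' ->
                           l = l' /\ r = r').
  { induction l as [|b l IH]; destruct l' as [|b' l']; cbn; intros E.
    - now inversion E.
    - inversion E; subst; congruence.
    - inversion E; subst; congruence.
    - inversion E; subst. destruct (IH l') as [-> ->]; auto. }
  destruct (K _ _ H) as [E ->]; split; auto using nat_bits_inj.
Qed.

Lemma flat_map_inj {X Y} (f : X -> list Y) :
  prefix_inj f -> (forall x, f x <> []) ->
  forall l l', flat_map f l = flat_map f l' -> l = l'.
Proof.
  intros P N; induction l as [|x l IH]; destruct l' as [|y l']; cbn; intros H; auto.
  - symmetry in H; apply app_eq_nil in H; destruct (N y); tauto.
  - apply app_eq_nil in H; destruct (N x); tauto.
  - destruct (P _ _ _ _ H) as [-> H']; f_equal; auto.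
Qed.

Lemma length_prefixed_inj {X Y} (f : X -> list Y) :
  prefix_inj f -> forall l l' r r', length l = length l' ->
  flat_map f l ++ r = flat_map f l' ++ r' -> l = l' /\ r = r'.
Proof.
  intros P; induction l as [|x l IH]; destruct l' as [|y l']; cbn; intros r r' L H; auto; try discriminate.
  rewrite -!app_assoc in H; destruct (P _ _ _ _ H) as [-> H'].
  destruct (IH l' r r') as [-> ->]; auto.
Qed.

Lemma tile_nats_prefix_inj : prefix_inj tile_nats.
Proof. intros [] [] r r' H; cbn in H; inversion H; subst; auto. Qed.

Lemma inst_nats_inj I J : inst_nats I = inst_nats J -> I = J.
Proof.
  destruct I as [t r s e T g], J as [t' r' s' e' T' g']; unfold inst_nats; cbn [st_tau st_r st_str st_edges st_tiles st_target].
  rewrite -!app_comm_cons !app_nil_l; intros H.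
  injection H as -> -> Hl H.
  eapply length_prefixed_inj in H as [-> H]; auto;
    [|intros [] [] ? ? E; cbn in E; inversion E; subst; auto].
  injection H as Hl' H.
  eapply length_prefixed_inj in H as [-> H]; auto;
    [|intros [[]] [[]] ? ? E; cbn in E; inversion E; subst; auto].
  injection H as Hl'' H.
  eapply length_prefixed_inj in H as [-> H]; auto.
  2:{ intros x y r1 r2 E; rewrite -!app_comm_cons in E; injection E as E1 E2.
      eapply length_prefixed_inj in E2 as [-> ->]; auto using tile_nats_prefix_inj. }
  injection H as Hl3 H.
  rewrite -(app_nil_r (flat_map _ g)) -(app_nil_r (flat_map _ g')) in H.
  eapply length_prefixed_inj in H as [-> H]; auto.
  intros [[]] [[]] ? ? E; cbn in E. inversion E; subst.
  match goal with t : Tile, u : Tile |- _ => destruct t, u end; cbn in *; subst; auto.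
Qed.

(** [StagedUAV_7_2] asks for some instance with the given code; membership of [encode I] says
    something about [I] itself only because no other instance shares the code. *)
Lemma encode_inj I J : encode I = encode J -> I = J.
Proof.
  intros H; apply inst_nats_inj; eapply flat_map_inj; eauto using enc_nat_prefix_inj.
  intros x E; apply app_eq_nil in E; now destruct E.
Qed.

(** Digits come least significant first, so a machine that halves a number repeatedly produces them
    in the order of the code. *)
Lemma nat_bits_step n : 0 < n -> nat_bits n = Nat.odd n :: nat_bits (Nat.div2 n).
Proof.
  intros H; unfold nat_bits.
  rewrite Nnat.Nat2N.inj_div2.
  assert (E : N.odd (N.of_nat n) = Nat.odd n).
  { rewrite -{2}(Nnat.Nat2N.id n). generalize (N.of_nat n); intros m.
    destruct (Nat.odd (N.to_nat m)) eqn:E.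
    - apply Nat.odd_spec in E as [k E]. apply N.odd_spec; exists (N.of_nat k); lia.
    - rewrite <- N.negb_even. apply negb_false_iff.
      assert (E' : Nat.even (N.to_nat m) = true) by (rewrite -Nat.negb_odd E; auto).
      apply Nat.even_spec in E' as [k E']. apply N.even_spec; exists (N.of_nat k); lia. }
  destruct (N.of_nat n) as [|p] eqn:F; [lia|].
  rewrite -E. destruct p; cbn; auto.
Qed.

(** * Configurations up to translation *)

Definition pneg (d : pos) : pos := (- fst d, - snd d)%Z.

Lemma padd_assoc p d e : padd (padd p d) e = padd p (padd d e).
Proof. unfold padd; cbn; f_equal; lia. Qed.
Lemma padd_neg p d : padd (padd p d) (pneg d) = p.
Proof. destruct p; unfold padd, pneg; cbn; f_equal; lia. Qed.
Lemma padd_neg' p d : padd (padd p (pneg d)) d = p.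
Proof. destruct p; unfold padd, pneg; cbn; f_equal; lia. Qed.
Lemma padd_0 p : padd p (0, 0)%Z = p.
Proof. destruct p; unfold padd; cbn; f_equal; lia. Qed.
Lemma padd_inj p q d : padd p d = padd q d -> p = q.
Proof. intros H; rewrite -(padd_neg p d) H padd_neg; auto. Qed.
Lemma padd_comm p q : padd p q = padd q p.
Proof. unfold padd; f_equal; lia. Qed.

Lemma pos_eqbP p q : reflect (p = q) (pos_eqb p q).
Proof.
  destruct p as [a b], q as [c d]; unfold pos_eqb; cbn.
  destruct (Z.eqb_spec a c), (Z.eqb_spec b d); constructor; congruence.
Qed.

Lemma pos_eqb_refl p : pos_eqb p p = true.
Proof. now destruct (pos_eqbP p p). Qed.

Lemma clookup_cons q t C p :
  clookup ((q, t) :: C) p = if pos_eqb q p then Some t else clookup C p.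
Proof. unfold clookup; cbn; destruct (pos_eqb q p); auto. Qed.

Lemma clookup_app A B p :
  clookup (A ++ B) p = match clookup A p with Some t => Some t | None => clookup B p end.
Proof.
  induction A as [|[q t] A IH]; auto.
  rewrite -app_comm_cons !clookup_cons; destruct (pos_eqb q p); auto.
Qed.

Lemma clookup_shift d C p : clookup (shift d C) p = clookup C (padd p (pneg d)).
Proof.
  induction C as [|[q t] C IH]; auto.
  cbn [shift map fst snd]; rewrite !clookup_cons IH.
  destruct (pos_eqbP (padd q d) p), (pos_eqbP q (padd p (pneg d))); subst; auto.
  - now rewrite padd_neg in n.
  - now rewrite padd_neg' in n.
Qed.

Lemma clookup_In C p t : clookup C p = Some t -> In (p, t) C.
Proof.
  induction C as [|[q u] C IH]; [discriminate|].
  rewrite clookup_cons; destruct (pos_eqbP q p); cbn; intros H; auto; left; congruence.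
Qed.

Lemma In_clookup C p t : NoDup (cdom C) -> In (p, t) C -> clookup C p = Some t.
Proof.
  induction C as [|[q u] C IH]; cbn [In]; [tauto|].
  intros N [E|E]; rewrite clookup_cons; inversion N; subst.
  - inversion E; now rewrite pos_eqb_refl.
  - destruct (pos_eqbP q p); auto. subst; destruct H1.
    change p with (fst (p, t)). now apply in_map.
Qed.

Lemma in_cdom C p : In p (cdom C) <-> clookup C p <> None.
Proof.
  induction C as [|[q u] C IH]; [cbn; tauto|].
  rewrite clookup_cons; cbn; destruct (pos_eqbP q p).
  - split; auto; discriminate.
  - rewrite IH; tauto.
Qed.

Lemma in_cdom_ex C p : In p (cdom C) <-> exists t, clookup C p = Some t.
Proof.
  rewrite in_cdom; destruct (clookup C p); split; intros; eauto; try congruence.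
  destruct H; congruence.
Qed.

Lemma not_in_cdom C p : ~ In p (cdom C) <-> clookup C p = None.
Proof. rewrite in_cdom; destruct (clookup C p); split; intros; auto; try congruence. exfalso; apply H; congruence. Qed.

Lemma cdom_shift d C : cdom (shift d C) = map (fun p => padd p d) (cdom C).
Proof. unfold cdom, shift; rewrite !map_map; auto. Qed.

Lemma cdom_app A B : cdom (A ++ B) = cdom A ++ cdom B.
Proof. apply map_app. Qed.

Lemma shift_shift d e C : shift d (shift e C) = shift (padd e d) C.
Proof.
  unfold shift; rewrite map_map; apply map_ext; intros [p t]; cbn; now rewrite padd_assoc.
Qed.

Lemma shift_0 C : shift (0, 0)%Z C = C.
Proof.
  unfold shift; rewrite -{2}(map_id C); apply map_ext; intros [p t]; cbn; now rewrite padd_0.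
Qed.

Lemma shift_app d A B : shift d (A ++ B) = shift d A ++ shift d B.
Proof. apply map_app. Qed.

Lemma NoDup_shift d C : NoDup (cdom C) -> NoDup (cdom (shift d C)).
Proof.
  rewrite cdom_shift; apply FinFun.Injective_map_NoDup; intros p q; apply padd_inj.
Qed.

Lemma wf_shift d C : wf_config C -> wf_config (shift d C).
Proof.
  intros [H1 H2]; split; [|now apply NoDup_shift].
  destruct C; auto; discriminate.
Qed.

Lemma asm_eq_refl C : asm_eq C C.
Proof. exists (0, 0)%Z; intros; now rewrite padd_0. Qed.

Lemma asm_eq_sym C D : asm_eq C D -> asm_eq D C.
Proof. intros [d H]; exists (pneg d); intros p; now rewrite H padd_neg'. Qed.

Lemma asm_eq_trans C D E : asm_eq C D -> asm_eq D E -> asm_eq C E.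
Proof. intros [d H] [e G]; exists (padd d e); intros p; now rewrite H G padd_assoc. Qed.

Lemma asm_eq_shift d C : asm_eq C (shift d C).
Proof. exists d; intros p; now rewrite clookup_shift padd_neg. Qed.

(** * Bonds and cuts *)

Inductive dir := DN | DE | DS | DW.
Definition vec (d : dir) : pos :=
  match d with DN => (0, 1) | DE => (1, 0) | DS => (0, -1) | DW => (-1, 0) end%Z.
Definition opp (d : dir) : dir := match d with DN => DS | DE => DW | DS => DN | DW => DE end.
Definition glue (d : dir) (t : Tile) : nat :=
  match d with DN => tN t | DE => tE t | DS => tS t | DW => tW t end.

Lemma opp_opp d : opp (opp d) = d.
Proof. now destruct d. Qed.

Lemma padd_vec_opp p d : padd (padd p (vec d)) (vec (opp d)) = p.
Proof. destruct p, d; unfold padd; cbn; f_equal; lia. Qed.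

Lemma vec_inj d e : vec d = vec e -> d = e.
Proof. destruct d, e; auto; discriminate. Qed.

(** [bondw] with both tiles supplied instead of looked up, so that bonds between tiles of two
    different configurations can be summed. *)
Definition pbond (str : nat -> nat) (p : pos) (t : Tile) (q : pos) (u : Tile) : nat :=
  if pos_eqb q (padd p (1, 0)%Z) then gluew str (tE t) (tW u)
  else if pos_eqb q (padd p (-1, 0)%Z) then gluew str (tW t) (tE u)
  else if pos_eqb q (padd p (0, 1)%Z) then gluew str (tN t) (tS u)
  else if pos_eqb q (padd p (0, -1)%Z) then gluew str (tS t) (tN u)
  else 0.

Lemma padd_cancel p d e : padd p d = padd p e -> d = e.
Proof. rewrite !(padd_comm p); apply padd_inj. Qed.

Lemma pbond_vec str p t d u :
  pbond str p t (padd p (vec d)) u = gluew str (glue d t) (glue (opp d) u).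
Proof.
  assert (K : forall e, pos_eqb (padd p (vec d)) (padd p (vec e)) = true -> d = e).
  { intros e; destruct (pos_eqbP (padd p (vec d)) (padd p (vec e))) as [H|H]; [|discriminate].
    intros _; apply vec_inj; eapply padd_cancel; eauto. }
  pose proof (pos_eqb_refl (padd p (vec d))) as R.
  unfold pbond.
  change (1, 0)%Z with (vec DE); change (-1, 0)%Z with (vec DW);
    change (0, 1)%Z with (vec DN); change (0, -1)%Z with (vec DS).
  destruct (pos_eqb (padd p (vec d)) (padd p (vec DE))) eqn:E1; [now rewrite (K _ E1)|].
  destruct (pos_eqb (padd p (vec d)) (padd p (vec DW))) eqn:E2; [now rewrite (K _ E2)|].
  destruct (pos_eqb (padd p (vec d)) (padd p (vec DN))) eqn:E3; [now rewrite (K _ E3)|].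
  destruct (pos_eqb (padd p (vec d)) (padd p (vec DS))) eqn:E4; [now rewrite (K _ E4)|].
  destruct d; congruence.
Qed.

Lemma pbond_pos str p t q u : pbond str p t q u > 0 ->
  exists d, q = padd p (vec d) /\ glue d t = glue (opp d) u /\ str (glue d t) > 0 /\
            pbond str p t q u = str (glue d t).
Proof.
  intros H.
  assert (exists d, q = padd p (vec d)) as [d ->].
  { unfold pbond in H.
    repeat match type of H with context [pos_eqb ?a ?b] => destruct (pos_eqbP a b) end;
      [exists DE|exists DW|exists DN|exists DS|]; auto; lia. }
  exists d; split; auto. rewrite pbond_vec in H. rewrite pbond_vec.
  unfold gluew in *; destruct (Nat.eqb_spec (glue d t) (glue (opp d) u)); auto; lia.
Qed.

Lemma pbond_sym str p t q u : pbond str p t q u = pbond str q u p t.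
Proof.
  assert (K : forall p t q u, pbond str p t q u > 0 -> pbond str q u p t = pbond str p t q u).
  { clear; intros p t q u H; destruct (pbond_pos _ _ _ _ _ H) as (d & -> & E & S & B).
    rewrite B -{2}(padd_vec_opp p d) pbond_vec opp_opp /gluew -E Nat.eqb_refl; auto. }
  destruct (pbond str p t q u) eqn:E.
  - destruct (pbond str q u p t) eqn:F; auto.
    rewrite -F -(K q u p t) ?F; auto; lia.
  - rewrite (K p t q u) ?E; auto; lia.
Qed.

Lemma bondw_eq str C p q t u : clookup C p = Some t -> clookup C q = Some u ->
  bondw str C p q = pbond str p t q u.
Proof. unfold bondw, pbond; intros -> ->; auto. Qed.

Definition lsum {X} (f : X -> nat) (l : list X) : nat := list_sum (map f l).

Lemma lsum_cons {X} (f : X -> nat) x l : lsum f (x :: l) = f x + lsum f l.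
Proof. reflexivity. Qed.
Lemma lsum_app {X} (f : X -> nat) l l' : lsum f (l ++ l') = lsum f l + lsum f l'.
Proof. unfold lsum; now rewrite map_app list_sum_app. Qed.
Lemma lsum_ext {X} (f g : X -> nat) l : (forall x, In x l -> f x = g x) -> lsum f l = lsum g l.
Proof. intros H; unfold lsum; f_equal; now apply map_ext_in. Qed.
Lemma lsum_le {X} (f g : X -> nat) l : (forall x, In x l -> f x <= g x) -> lsum f l <= lsum g l.
Proof.
  induction l as [|x l IH]; intros H; auto; rewrite !lsum_cons.
  specialize (IH (fun y Hy => H y (or_intror Hy))). specialize (H x (or_introl eq_refl)). lia.
Qed.
Lemma lsum_0 {X} (f : X -> nat) l : (forall x, In x l -> f x = 0) -> lsum f l = 0.
Proof. intros H; rewrite (@lsum_ext _ f (fun _ => 0)) //; clear; induction l; auto. Qed.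
Lemma lsum_In {X} (f : X -> nat) l x : In x l -> f x <= lsum f l.
Proof.
  induction l as [|y l IH]; [destruct 1|]; intros [->|H]; rewrite lsum_cons; [lia|].
  specialize (IH H); lia.
Qed.
Lemma lsum_In2 {X} (f : X -> nat) l x y : In x l -> In y l -> x <> y -> f x + f y <= lsum f l.
Proof.
  induction l as [|z l IH]; [destruct 1|]; intros [->|H] [->|G] N; rewrite lsum_cons; try congruence.
  - pose proof (lsum_In f _ _ G); lia.
  - pose proof (lsum_In f _ _ H); lia.
  - specialize (IH H G N); lia.
Qed.
Lemma lsum_pos {X} (f : X -> nat) l : lsum f l > 0 -> exists x, In x l /\ f x > 0.
Proof.
  induction l as [|y l IH]; [cbn; lia|]; rewrite lsum_cons; intros H.
  destruct (f y) eqn:E; [destruct IH as (x & ? & ?); [lia|]; exists x; cbn; auto|].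
  exists y; cbn; split; auto; lia.
Qed.
Lemma lsum_perm {X} (f : X -> nat) l l' : Permutation l l' -> lsum f l = lsum f l'.
Proof. induction 1; rewrite ?lsum_cons; lia. Qed.
Lemma lsum_map {X Y} (f : Y -> nat) (g : X -> Y) l : lsum f (map g l) = lsum (fun x => f (g x)) l.
Proof. unfold lsum; now rewrite map_map. Qed.
Lemma lsum_plus {X} (f g : X -> nat) l : lsum (fun x => f x + g x) l = lsum f l + lsum g l.
Proof. induction l; auto; rewrite !lsum_cons; lia. Qed.
Lemma lsum_exchange {X Y} (f : X -> Y -> nat) l l' :
  lsum (fun x => lsum (f x) l') l = lsum (fun y => lsum (fun x => f x y) l) l'.
Proof.
  induction l as [|x l IH].
  - cbn; symmetry; now apply lsum_0.
  - rewrite lsum_cons IH -lsum_plus; now apply lsum_ext.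
Qed.

(** The arithmetic of cooperation: if only two neighbours can bond and each contributes at most 1,
    temperature 2 needs both. *)
Lemma lsum_two {X} (f : X -> nat) l (a b : X) : NoDup l ->
  (forall x, In x l -> f x > 0 -> x = a \/ x = b) -> (forall x, In x l -> f x <= 1) ->
  2 <= lsum f l -> (In a l /\ f a > 0) /\ (In b l /\ f b > 0) /\ a <> b.
Proof.
  intros N H1 H2 H3.
  assert (K : forall c (l : list X), NoDup l -> (forall x, In x l -> f x > 0 -> x = c) ->
             (forall x, In x l -> f x <= 1) -> lsum f l <= 1).
  { clear; intros c; induction l as [|x l IH]; intros N H1 H2; [cbn; lia|]. rewrite lsum_cons.
    inversion N; subst.
    destruct (f x) eqn:E.
    - apply IH; cbn in *; auto.
    - rewrite (@lsum_0 _ f l).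
      + intros y Hy; destruct (f y) eqn:F; auto.
        assert (x = c) by (apply H1; cbn; auto; lia).
        assert (y = c) by (apply H1; cbn; auto; lia). subst; tauto.
      + rewrite -E; specialize (H2 x (or_introl eq_refl)); lia. }
  destruct (classic (In a l /\ f a > 0)) as [A|A].
  - destruct (classic (In b l /\ f b > 0 /\ a <> b)) as [B|B]; [tauto|].
    enough (lsum f l <= 1) by lia. apply (K a); auto.
    intros x Hx Fx; destruct (H1 x Hx Fx); auto; subst.
    destruct (classic (a = b)); auto; tauto.
  - enough (lsum f l <= 1) by lia. apply (K b); auto.
    intros x Hx Fx; destruct (H1 x Hx Fx); auto; subst; tauto.
Qed.

Definition cross (str : nat -> nat) (A B : config) : nat :=
  lsum (fun a => lsum (fun b => pbond str (fst a) (snd a) (fst b) (snd b)) B) A.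

Lemma cross_sym str A B : cross str A B = cross str B A.
Proof.
  unfold cross; rewrite lsum_exchange; apply lsum_ext; intros; apply lsum_ext; intros.
  apply pbond_sym.
Qed.

Lemma pos_eqb_shift d p q : pos_eqb (padd p d) (padd q d) = pos_eqb p q.
Proof.
  destruct (pos_eqbP p q); subst; [apply pos_eqb_refl|].
  destruct (pos_eqbP (padd p d) (padd q d)); auto. now apply padd_inj in e.
Qed.

Lemma pbond_shift str d p t q u : pbond str (padd p d) t (padd q d) u = pbond str p t q u.
Proof.
  unfold pbond.
  assert (E : forall v, padd (padd p d) v = padd (padd p v) d)
    by (intros; rewrite !padd_assoc; f_equal; apply padd_comm).
  now rewrite !E !pos_eqb_shift.
Qed.

(** As a double sum over placed tiles, the weight of a cut is visibly invariant under permutations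
    of the list and splits along [++]. *)
Definition cutw (str : nat -> nat) (C : config) (S : pos -> bool) : nat :=
  lsum (fun a => lsum (fun b =>
     if S (fst a) && negb (S (fst b)) then pbond str (fst a) (snd a) (fst b) (snd b) else 0) C) C.

Lemma cut_weight_cutw str C S : NoDup (cdom C) -> cut_weight str C S = cutw str C S.
Proof.
  intros N; unfold cut_weight, cutw.
  change (lsum (fun p => lsum (fun q => if S p && negb (S q) then bondw str C p q else 0) (cdom C)) (cdom C)
    = cutw str C S).
  unfold cutw, cdom; rewrite lsum_map; apply lsum_ext; intros [p t] Hp; cbn.
  rewrite lsum_map; apply lsum_ext; intros [q u] Hq; cbn.
  destruct (S p && negb (S q)); auto.
  apply bondw_eq; now apply In_clookup.
Qed.

Lemma asm_eq_perm C D : NoDup (cdom C) -> NoDup (cdom D) -> asm_eq C D ->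
  exists d, Permutation (shift d C) D.
Proof.
  intros N1 N2 [d H]; exists d.
  apply NoDup_Permutation.
  - apply (NoDup_map_inv fst). now apply NoDup_shift.
  - apply (NoDup_map_inv fst). exact N2.
  - intros [p t]; split; intros I.
    + apply In_clookup in I; [|now apply NoDup_shift]. rewrite clookup_shift H padd_neg' in I.
      now apply clookup_In.
    + apply In_clookup in I; auto. apply clookup_In. now rewrite clookup_shift H padd_neg'.
Qed.

Lemma cutw_perm str C D S : Permutation C D -> cutw str C S = cutw str D S.
Proof.
  intros P; unfold cutw. rewrite (lsum_perm _ P). apply lsum_ext; intros; now apply lsum_perm.
Qed.

Lemma stable_asm_eq str tau C D : NoDup (cdom C) -> NoDup (cdom D) -> asm_eq C D ->
  stable str tau C -> stable str tau D.
Proof.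
  intros N1 N2 E St S [p [Hp Sp]] [q [Hq Sq]].
  destruct (asm_eq_perm N1 N2 E) as [d P].
  assert (Pd : Permutation (cdom (shift d C)) (cdom D)) by now apply Permutation_map.
  rewrite cut_weight_cutw // -(cutw_perm _ _ P).
  assert (X : cutw str (shift d C) S = cutw str C (fun p => S (padd p d))).
  { unfold cutw, shift; rewrite lsum_map; apply lsum_ext; intros; rewrite lsum_map; cbn.
    apply lsum_ext; intros; rewrite pbond_shift; auto. }
  rewrite X -cut_weight_cutw //. apply St.
  - apply (Permutation_in _ (Permutation_sym Pd)) in Hp. rewrite cdom_shift in Hp.
    apply in_map_iff in Hp as (p' & <- & Hp); eauto.
  - apply (Permutation_in _ (Permutation_sym Pd)) in Hq. rewrite cdom_shift in Hq.
    apply in_map_iff in Hq as (p' & <- & Hq); eauto.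
Qed.

Definition disj (A B : config) : Prop := forall p, In p (cdom A) -> ~ In p (cdom B).

Lemma NoDup_union A B : NoDup (cdom A) -> NoDup (cdom B) -> disj A B -> NoDup (cdom (A ++ B)).
Proof. intros; rewrite cdom_app; apply NoDup_app; auto. Qed.

Lemma wf_union A B : wf_config A -> wf_config B -> disj A B -> wf_config (A ++ B).
Proof.
  intros [? ?] [? ?] D; split; [destruct A; try discriminate; congruence|now apply NoDup_union].
Qed.

(** The cut with [A] on one side and [B] on the other is among those that stability bounds from
    below. *)
Lemma stable_cross str tau A B : wf_config A -> wf_config B -> disj A B ->
  stable str tau (A ++ B) -> tau <= cross str A B.
Proof.
  intros [A0 NA] [B0 NB] D St.
  pose (S := fun p => existsb (pos_eqb p) (cdom A)).
  assert (SA : forall p, In p (cdom A) -> S p = true)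
    by (intros p Hp; apply existsb_exists; exists p; auto using pos_eqb_refl).
  assert (SB : forall p, In p (cdom B) -> S p = false).
  { intros p Hp; destruct (S p) eqn:E; auto. apply existsb_exists in E as (q & Hq & E).
    destruct (pos_eqbP p q); [subst|discriminate]. now destruct (D q). }
  assert (inA : forall a, In a A -> In (fst a) (cdom A)) by (intros; now apply in_map).
  assert (inB : forall a, In a B -> In (fst a) (cdom B)) by (intros; now apply in_map).
  specialize (St S). rewrite cut_weight_cutw in St; [now apply NoDup_union|].
  assert (X : cutw str (A ++ B) S = cross str A B).
  { unfold cutw, cross. rewrite lsum_app [X in _ + X]lsum_0.
    - intros b Hb; apply lsum_0; intros; rewrite SB; auto.
    - rewrite Nat.add_0_r; apply lsum_ext; intros a Ha. rewrite lsum_app [X in X + _]lsum_0.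
      + intros a' Ha'; rewrite !SA; auto.
      + apply lsum_ext; intros b Hb; rewrite SA ?SB; auto. }
  rewrite X in St; apply St.
  - destruct A as [|a A]; [tauto|]. exists (fst a); split; [|apply SA]; rewrite ?cdom_app; cbn; auto.
  - destruct B as [|b B]; [tauto|]. exists (fst b); split; [|apply SB]; rewrite ?cdom_app; cbn; auto.
    apply in_app_iff; cbn; auto.
Qed.

Lemma cutw_app_ge str A B S : cutw str A S <= cutw str (A ++ B) S /\ cutw str B S <= cutw str (A ++ B) S.
Proof.
  unfold cutw; rewrite lsum_app. split.
  - etransitivity; [|apply Nat.le_add_r]. apply lsum_le; intros; rewrite lsum_app; lia.
  - etransitivity; [|rewrite Nat.add_comm; apply Nat.le_add_r]. apply lsum_le; intros; rewrite lsum_app; lia.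
Qed.

(** A cut that splits [A] or [B] already has enough weight inside that part; the only other cut
    separates [A] from [B] and weighs at least [cross]. *)
Lemma stable_union str tau A B : wf_config A -> wf_config B -> disj A B ->
  stable str tau A -> stable str tau B -> tau <= cross str A B -> stable str tau (A ++ B).
Proof.
  intros [A0 NA] [B0 NB] D StA StB X S [p [Hp Sp]] [q [Hq Sq]].
  rewrite cut_weight_cutw; [now apply NoDup_union|].
  destruct (cutw_app_ge str A B S) as [GA GB].
  assert (const : forall C, ~ ((exists p, In p (cdom C) /\ S p = true) /\ (exists q, In q (cdom C) /\ S q = false)) ->
     (forall a, In a C -> S (fst a) = true) \/ (forall a, In a C -> S (fst a) = false)).
  { intros C H. destruct (classic (exists p, In p (cdom C) /\ S p = true)) as [T|T].
    - left; intros a Ha; destruct (S (fst a)) eqn:E; auto. exfalso; apply H; split; auto.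
      exists (fst a); split; auto; now apply in_map.
    - right; intros a Ha; destruct (S (fst a)) eqn:E; auto. exfalso; apply T.
      exists (fst a); split; auto; now apply in_map. }
  destruct (classic ((exists p, In p (cdom A) /\ S p = true) /\ (exists q, In q (cdom A) /\ S q = false))) as [[T F]|NCA].
  { etransitivity; [|exact GA]. rewrite -cut_weight_cutw //; auto. }
  destruct (classic ((exists p, In p (cdom B) /\ S p = true) /\ (exists q, In q (cdom B) /\ S q = false))) as [[T F]|NCB].
  { etransitivity; [|exact GB]. rewrite -cut_weight_cutw //; auto. }
  rewrite cdom_app in_app_iff in Hp. rewrite cdom_app in_app_iff in Hq.
  assert (inv : forall C p, In p (cdom C) -> exists a, In a C /\ fst a = p).
  { intros C r Hr; apply in_map_iff in Hr as (a & ? & ?); eauto. }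
  destruct (const A NCA) as [cA|cA], (const B NCB) as [cB|cB].
  - destruct Hq as [Hq|Hq]; destruct (inv _ _ Hq) as (a & Ha & <-); [rewrite cA in Sq|rewrite cB in Sq]; auto; discriminate.
  - etransitivity; [exact X|]. unfold cross, cutw. rewrite lsum_app.
    etransitivity; [|apply Nat.le_add_r]. apply lsum_le; intros a Ha.
    rewrite lsum_app. etransitivity; [|rewrite Nat.add_comm; apply Nat.le_add_r].
    apply lsum_le; intros b Hb. rewrite cA // cB //.
  - rewrite cross_sym in X. etransitivity; [exact X|]. unfold cross, cutw. rewrite lsum_app.
    etransitivity; [|rewrite Nat.add_comm; apply Nat.le_add_r]. apply lsum_le; intros a Ha.
    rewrite lsum_app. etransitivity; [|apply Nat.le_add_r].
    apply lsum_le; intros b Hb. rewrite cB // cA //.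
  - destruct Hp as [Hp|Hp]; destruct (inv _ _ Hp) as (a & Ha & <-); [rewrite cA in Sp|rewrite cB in Sp]; auto; discriminate.
Qed.

Lemma stable_single str tau p t : stable str tau [(p, t)].
Proof.
  intros S [q [Hq Sq]] [r [Hr Sr]]; cbn in *; destruct Hq as [<-|[]], Hr as [<-|[]]; congruence.
Qed.

Lemma wf_single p t : wf_config [(p, t)].
Proof. split; [discriminate|]. constructor; cbn; auto. constructor. Qed.

(** * Combination and production *)

(** Only the relative displacement matters, so [A] can be kept in place. *)
Lemma combinable_rel str tau A B C : wf_config A -> wf_config B -> combinable str tau A B C ->
  exists e, disj A (shift e B) /\ asm_eq (A ++ shift e B) C /\ wf_config C /\ stable str tau C /\
            tau <= cross str A (shift e B).
Proof.
  intros WA WB (dA & dB & D & WC & E & St).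
  exists (padd dB (pneg dA)).
  assert (X : shift dB B = shift dA (shift (padd dB (pneg dA)) B))
    by (rewrite shift_shift padd_assoc (padd_comm (pneg dA)) -padd_assoc padd_neg; auto).
  rewrite X in D, E.
  assert (D' : disj A (shift (padd dB (pneg dA)) B)).
  { intros p H1 H2. apply (D (padd p dA)); rewrite cdom_shift; now apply in_map with (f := fun p => padd p dA). }
  rewrite -shift_app in E.
  assert (E' : asm_eq (A ++ shift (padd dB (pneg dA)) B) C)
    by (eapply asm_eq_trans; [apply asm_eq_shift|exact E]).
  refine (conj D' (conj E' (conj WC (conj St _)))).
  apply stable_cross; auto using wf_shift.
  eapply stable_asm_eq; [apply WC| |apply asm_eq_sym; exact E'|exact St].
  apply NoDup_union; auto; [apply WA|apply NoDup_shift; apply WB].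
Qed.

Lemma combinable_intro str tau A B e : wf_config A -> wf_config B -> disj A (shift e B) ->
  stable str tau A -> stable str tau B -> tau <= cross str A (shift e B) ->
  combinable str tau A B (A ++ shift e B).
Proof.
  intros WA WB D SA SB X. exists (0, 0)%Z, e. rewrite shift_0.
  refine (conj D (conj _ (conj (asm_eq_refl _) _))).
  - apply wf_union; auto using wf_shift.
  - apply stable_union; auto using wf_shift.
    eapply stable_asm_eq; [apply WB| |apply asm_eq_shift|exact SB]. apply wf_shift, WB.
Qed.

Lemma combinable_asm_eq str tau A A' B B' C : asm_eq A A' -> asm_eq B B' ->
  combinable str tau A B C -> combinable str tau A' B' C.
Proof.
  intros [a HA] [b HB] (dA & dB & D & WC & [c E] & St).
  assert (KA : forall p, clookup (shift (padd dA (pneg a)) A') p = clookup (shift dA A) p).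
  { intros p; rewrite !clookup_shift HA. f_equal. unfold padd, pneg; cbn; f_equal; lia. }
  assert (KB : forall p, clookup (shift (padd dB (pneg b)) B') p = clookup (shift dB B) p).
  { intros p; rewrite !clookup_shift HB. f_equal. unfold padd, pneg; cbn; f_equal; lia. }
  exists (padd dA (pneg a)), (padd dB (pneg b)); refine (conj _ (conj WC (conj _ St))).
  - intros p; rewrite !in_cdom KA KB -!in_cdom; auto.
  - exists c; intros p; rewrite -E !clookup_app KA KB; auto.
Qed.

Lemma combinable_sym str tau A B C : combinable str tau A B C -> combinable str tau B A C.
Proof.
  intros (dA & dB & D & WC & [c E] & St). exists dB, dA.
  assert (D' : forall p, In p (cdom (shift dB B)) -> ~ In p (cdom (shift dA A)))
    by (intros p H1 H2; now apply (D p)).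
  refine (conj D' (conj WC (conj _ St))). exists c; intros p; rewrite -E !clookup_app.
  destruct (clookup (shift dB B) p) eqn:F, (clookup (shift dA A) p) eqn:G; auto.
  exfalso; apply (D p); rewrite in_cdom; congruence.
Qed.

Definition good_init (str : nat -> nat) (tau : nat) (S : config -> Prop) : Prop :=
  forall A, S A -> wf_config A /\ stable str tau A.

Lemma produced_good str tau S C : good_init str tau S -> produced str tau S C ->
  wf_config C /\ stable str tau C.
Proof.
  intros G [A C' SA W E|A B C' PA PB (dA & dB & D & WC & E & St)]; auto.
  split; auto. destruct (G _ SA) as [WA StA]. eapply stable_asm_eq; eauto; [apply WA|apply W].
Qed.

Lemma produced_asm_eq str tau S C D : wf_config D -> asm_eq C D ->
  produced str tau S C -> produced str tau S D.
Proof.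
  intros WD E P; revert E; destruct P as [A C' SA W E'|A B C' PA PB (dA & dB & Ds & WC & E' & St)]; intros E.
  - eapply prod_init; eauto using asm_eq_trans.
  - refine (prod_comb PA PB _). exists dA, dB.
    refine (conj Ds (conj WD (conj (asm_eq_trans E' E) _))).
    eapply stable_asm_eq; eauto; [apply WC|apply WD].
Qed.

Lemma terminal_asm_eq str tau S C D : wf_config D -> asm_eq C D ->
  terminal str tau S C -> terminal str tau S D.
Proof.
  intros WD E [P T]; split; eauto using produced_asm_eq.
  intros B PB [F HF]; apply (T B PB); exists F; eauto using combinable_asm_eq, asm_eq_refl, asm_eq_sym.
Qed.

Lemma terminal_good str tau S : good_init str tau S -> good_init str tau (terminal str tau S).
Proof. intros G A [P _]; eauto using produced_good. Qed.

Lemma produced_ext str tau S S' C : (forall A, S A -> S' A) -> produced str tau S C -> produced str tau S' C.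
Proof.
  intros H; induction 1 as [A C SA W E|A B C PA IHA PB IHB X].
  - eapply prod_init; eauto.
  - exact (prod_comb IHA IHB X).
Qed.

Lemma terminal_ext str tau S S' C : (forall A, S A <-> S' A) -> terminal str tau S C <-> terminal str tau S' C.
Proof.
  intros H; unfold terminal; split; intros [P T]; split;
    try (eapply produced_ext; [|exact P]; intros; now apply H);
    intros B PB; apply T; eapply produced_ext; [|exact PB| |exact PB]; intros; now apply H.
Qed.

(* Terminal assemblies of a bin do not interact, so a bin fed with them passes them on unchanged. *)
Lemma terminal_idem str tau S C : good_init str tau S ->
  terminal str tau (terminal str tau S) C <-> terminal str tau S C.
Proof.
  intros G.
  assert (K : forall C, produced str tau (terminal str tau S) C <-> terminal str tau S C).
  { intros D; split.
    - induction 1 as [A D TA W E|A B D PA IHA PB IHB X].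
      + eauto using terminal_asm_eq.
      + exfalso; apply (proj2 IHA B (proj1 IHB)); eauto.
    - intros T; eapply prod_init; eauto using asm_eq_refl. eapply produced_good; [exact G|apply T]. }
  split; intros T; [apply K; apply T|]. split; [now apply K|].
  intros B PB; apply T; apply K in PB; apply PB.
Qed.

(** * Exposed glues *)

Definition exposed (C : config) (d : dir) (g : nat) : Prop :=
  exists p t, clookup C p = Some t /\ clookup C (padd p (vec d)) = None /\ glue d t = g.

Lemma cross_pos str A B : NoDup (cdom A) -> NoDup (cdom B) -> cross str A B > 0 ->
  exists p d t u, clookup A p = Some t /\ clookup B (padd p (vec d)) = Some u /\
     glue d t = glue (opp d) u /\ str (glue d t) > 0.
Proof.
  intros NA NB H; apply lsum_pos in H as ([p t] & Ha & H); apply lsum_pos in H as ([q u] & Hb & H); cbn in H.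
  apply pbond_pos in H as (d & -> & E & S & _).
  exists p, d, t, u; repeat split; auto; now apply In_clookup.
Qed.

(** The sides that bond were both exposed before. Most impossibility arguments below compare the
    glues that two assemblies expose in opposite directions. *)
Lemma combinable_exposed str A B C tau : 0 < tau -> wf_config A -> wf_config B -> combinable str tau A B C ->
  exists d g, exposed A d g /\ exposed B (opp d) g /\ str g > 0.
Proof.
  intros T0 WA WB H; destruct (combinable_rel WA WB H) as (e & D & _ & _ & _ & X).
  destruct (@cross_pos str A (shift e B)) as (p & d & t & u & Hp & Hq & E & S).
  - apply WA. - apply NoDup_shift, WB. - lia.
  - exists d, (glue d t); split; [|split; auto].
    + exists p, t; repeat split; auto. apply not_in_cdom; intros I; apply (D _ I); rewrite in_cdom; congruence.
    + rewrite clookup_shift in Hq. exists (padd (padd p (vec d)) (pneg e)), u; repeat split; auto.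
      apply not_in_cdom; intros I. apply (D p); [rewrite in_cdom; congruence|].
      rewrite in_cdom clookup_shift.
      rewrite in_cdom in I. intros J; apply I; rewrite -J; f_equal.
      rewrite padd_assoc (padd_comm (pneg e)) -padd_assoc padd_vec_opp; auto.
Qed.

Lemma combinable_single str A q t : wf_config A -> stable str 2 A -> clookup A q = None ->
  2 <= cross str A [(q, t)] -> exists C, combinable str 2 A [((0, 0)%Z, t)] C.
Proof.
  intros WA SA Hq X. exists (A ++ shift q [((0, 0)%Z, t)]).
  assert (E : shift q [((0, 0)%Z, t)] = [(q, t)]).
  { cbn. do 2 f_equal. destruct q; unfold padd; cbn; f_equal; lia. }
  apply combinable_intro; rewrite ?E; auto using wf_single, stable_single.
  intros p Hp; cbn; intros [<-|[]]. now apply not_in_cdom in Hq.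
Qed.

Lemma cross_single_1 str A p d t q u : clookup A p = Some t -> q = padd p (vec d) ->
  glue d t = glue (opp d) u -> 2 <= str (glue d t) -> 2 <= cross str A [(q, u)].
Proof.
  intros Hp -> E S. apply clookup_In in Hp. unfold cross.
  etransitivity; [|apply (lsum_In _ _ _ Hp)]. cbn -[pbond padd].
  rewrite pbond_vec /gluew -E Nat.eqb_refl; lia.
Qed.

Lemma cross_single_2 str A p d t p' d' t' q u :
  clookup A p = Some t -> q = padd p (vec d) -> glue d t = glue (opp d) u -> 1 <= str (glue d t) ->
  clookup A p' = Some t' -> q = padd p' (vec d') -> glue d' t' = glue (opp d') u -> 1 <= str (glue d' t') ->
  d <> d' -> 2 <= cross str A [(q, u)].
Proof.
  intros Hp -> E S Hp' E1 E' S' N. apply clookup_In in Hp. apply clookup_In in Hp'. unfold cross.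
  etransitivity; [|apply (@lsum_In2 _ _ _ (p, t) (p', t') Hp Hp')].
  - cbn -[pbond padd]. rewrite pbond_vec /gluew -E Nat.eqb_refl.
    rewrite E1 pbond_vec /gluew -E' Nat.eqb_refl; lia.
  - intros F; inversion F; subst. apply padd_cancel in E1. now apply vec_inj in E1.
Qed.

(** * One-dimensional bins *)

Definition singles (X : list Tile) (C : config) : Prop := exists t, In t X /\ C = [((0, 0)%Z, t)].

Lemma singles_good str X : good_init str 2 (singles X).
Proof. intros A (t & _ & ->); split; auto using wf_single, stable_single. Qed.

Definition pat (d : dir) (i : Z) : pos := (i * fst (vec d), i * snd (vec d))%Z.

Fixpoint segc (d : dir) (i : Z) (ts : list Tile) : config :=
  match ts with [] => [] | t :: ts' => (pat d i, t) :: segc d (i + 1) ts' end.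

Lemma pat_add d i j : padd (pat d i) (pat d j) = pat d (i + j).
Proof. unfold pat, padd; cbn; f_equal; lia. Qed.
Lemma pat_1 d : pat d 1 = vec d.
Proof. destruct d; reflexivity. Qed.
Lemma pat_DE i : pat DE i = (i, 0)%Z.
Proof. unfold pat; cbn [vec fst snd]; f_equal; lia. Qed.
Lemma pat_DN i : pat DN i = (0, i)%Z.
Proof. unfold pat; cbn [vec fst snd]; f_equal; lia. Qed.
Lemma pat_inj d i j : pat d i = pat d j -> i = j.
Proof. destruct d; unfold pat; cbn; intros H; inversion H; lia. Qed.

Lemma segc_app d i a b : segc d i (a ++ b) = segc d i a ++ segc d (i + Z.of_nat (length a)) b.
Proof.
  revert i; induction a as [|t a IH]; intros i.
  - cbn. f_equal; lia.
  - rewrite -app_comm_cons; cbn [segc length]; rewrite IH -app_comm_cons.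
    do 3 f_equal; lia.
Qed.

Lemma segc_shift d i j ts : shift (pat d j) (segc d i ts) = segc d (i + j) ts.
Proof.
  revert i; induction ts as [|t ts IH]; intros i; auto.
  cbn [segc shift map fst snd]. rewrite pat_add. f_equal.
  change (shift (pat d j) (segc d (i + 1) ts) = segc d (i + j + 1) ts). rewrite IH; f_equal; lia.
Qed.

Lemma segc_In d i ts p t : In (p, t) (segc d i ts) <->
  exists k, nth_error ts k = Some t /\ p = pat d (i + Z.of_nat k).
Proof.
  revert i; induction ts as [|u ts IH]; intros i; cbn [segc In].
  - split; [tauto|]. intros ([|k] & H & _); discriminate.
  - rewrite IH; split.
    + intros [H|(k & H & ->)].
      * inversion H; subst. exists 0; split; auto. f_equal; lia.
      * exists (S k); split; auto. f_equal; lia.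
    + intros ([|k] & H & ->).
      * left. inversion H; subst; do 2 f_equal; lia.
      * right; exists k; split; auto. f_equal; lia.
Qed.

Lemma segc_NoDup d i ts : NoDup (cdom (segc d i ts)).
Proof.
  revert i; induction ts as [|t ts IH]; intros i; constructor; auto.
  intros H; apply in_map_iff in H as ([p u] & E & H); cbn in E; subst p.
  apply segc_In in H as (k & _ & H). apply pat_inj in H; lia.
Qed.

Lemma segc_wf d i ts : ts <> [] -> wf_config (segc d i ts).
Proof. split; [destruct ts; [congruence|discriminate]|apply segc_NoDup]. Qed.

Lemma segc_lookup d i ts p t : clookup (segc d i ts) p = Some t <->
  exists k, nth_error ts k = Some t /\ p = pat d (i + Z.of_nat k).
Proof.
  rewrite -segc_In; split; [apply clookup_In|apply In_clookup, segc_NoDup].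
Qed.

Lemma segc_dom d i ts p : In p (cdom (segc d i ts)) <-> exists k, k < length ts /\ p = pat d (i + Z.of_nat k).
Proof.
  rewrite in_cdom_ex; split.
  - intros (t & H); apply segc_lookup in H as (k & H & ->).
    exists k; split; auto. apply nth_error_Some; congruence.
  - intros (k & H & ->). destruct (nth_error ts k) as [t|] eqn:E.
    + exists t; apply segc_lookup; eauto.
    + apply nth_error_None in E; lia.
Qed.

Section Line.
Variables (str : nat -> nat) (d : dir) (X : list Tile).

Fixpoint chain (ts : list Tile) : Prop :=
  match ts with
  | t :: ((u :: _) as ts') => glue d t = glue (opp d) u /\ 2 <= str (glue d t) /\ chain ts'
  | _ => True
  end.

Lemma chain_app a t u b : chain (a ++ [t]) -> chain (u :: b) -> glue d t = glue (opp d) u ->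
  2 <= str (glue d t) -> chain ((a ++ [t]) ++ u :: b).
Proof.
  induction a as [|x a IH]; [cbn; auto|].
  destruct a as [|y a]; cbn in *; tauto.
Qed.

Lemma chain_app_inv a b : chain (a ++ b) -> chain a /\ chain b.
Proof.
  induction a as [|x a IH]; [cbn; auto|].
  destruct a as [|y a]; cbn in *.
  - destruct b; tauto.
  - tauto.
Qed.

Lemma chain_join a t u b : chain ((a ++ [t]) ++ u :: b) -> glue d t = glue (opp d) u /\ 2 <= str (glue d t).
Proof. induction a as [|x a IH]; [cbn; tauto|]. destruct a as [|y a]; cbn in *; tauto. Qed.

(** Bonds run along [d] only, and each of them alone suffices at temperature 2. So every assembly of
    the bin is a segment, and any two matching ends join. *)
Hypothesis Hside : forall t u e, In t X -> In u X -> e <> d -> e <> opp d ->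
  glue e t = glue (opp e) u -> str (glue e t) = 0.
Hypothesis Hstr : forall t u, In t X -> In u X -> glue d t = glue (opp d) u ->
  str (glue d t) > 0 -> 2 <= str (glue d t).

Definition line (ts : list Tile) : Prop := ts <> [] /\ Forall (fun t => In t X) ts /\ chain ts.

(** If the touching tiles were not the last of one segment and the first of the other, the segments
    would overlap next to the bond. *)
Lemma seg_join a b e p t u : a <> [] -> b <> [] -> disj (segc d 0 a) (shift e (segc d 0 b)) ->
  clookup (segc d 0 a) p = Some t -> clookup (shift e (segc d 0 b)) (padd p (vec d)) = Some u ->
  e = pat d (Z.of_nat (length a)) /\ (exists a', a = a' ++ [t]) /\ (exists b', b = u :: b').
Proof.
  intros A0 B0 D Hp Hq. apply segc_lookup in Hp as (k & Hk & ->).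
  rewrite clookup_shift in Hq. apply segc_lookup in Hq as (j & Hj & E).
  assert (Lk : S k = length a).
  { assert (k < length a) by (apply nth_error_Some; congruence).
    destruct (Nat.eq_dec (S k) (length a)); auto. exfalso.
    apply (D (padd (pat d (0 + Z.of_nat k)) (vec d))).
    - apply segc_dom; exists (S k); split; [lia|]. rewrite -pat_1 pat_add; f_equal; lia.
    - rewrite cdom_shift; apply in_map_iff. exists (pat d (0 + Z.of_nat j)); rewrite -E padd_neg'; split; auto.
      rewrite E; apply segc_dom; exists j; split; auto. apply nth_error_Some; congruence. }
  assert (Ej : e = padd (padd (pat d (0 + Z.of_nat k)) (vec d)) (pat d (- Z.of_nat j))).
  { assert (padd (padd (pat d (0 + Z.of_nat k)) (vec d)) (pneg e) = pat d (Z.of_nat j)) as F by (rewrite E; f_equal; lia).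
    clear - F. revert F; unfold padd, pneg, pat; destruct e; cbn. intros F; inversion F. f_equal; lia. }
  rewrite -pat_1 !pat_add in Ej.
  assert (j = 0) as ->.
  { destruct j; auto. exfalso. apply (D (pat d (Z.of_nat k))).
    - apply segc_dom; exists k; split; [lia|f_equal; lia].
    - rewrite cdom_shift; apply in_map_iff. exists (pat d (Z.of_nat j)); split.
      + rewrite Ej pat_add; f_equal; lia.
      + apply segc_dom. exists j; split; [|f_equal; lia].
        assert (S j < length b) by (apply nth_error_Some; congruence); lia. }
  split; [rewrite Ej; f_equal; lia|]. split.
  - apply nth_error_split in Hk as (a1 & a2 & -> & L). rewrite length_app in Lk; cbn in Lk.
    destruct a2; [eauto|cbn in Lk; lia].
  - destruct b; [discriminate|]. inversion Hj; eauto.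
Qed.

Lemma line_combine a b C : line a -> line b -> combinable str 2 (segc d 0 a) (segc d 0 b) C ->
  exists a' t u b', glue d t = glue (opp d) u /\ 2 <= str (glue d t) /\ asm_eq (segc d 0 ((a' ++ [t]) ++ u :: b')) C /\
   ((a = a' ++ [t] /\ b = u :: b') \/ (b = a' ++ [t] /\ a = u :: b')).
Proof.
  intros (A0 & AX & AC) (B0 & BX & BC) H.
  destruct (combinable_rel (segc_wf d 0 A0) (segc_wf d 0 B0) H) as (e & D & E & _ & _ & K).
  destruct (@cross_pos str (segc d 0 a) (shift e (segc d 0 b))) as (p & f & t & u & Hp & Hq & G & S);
    [apply segc_NoDup|apply NoDup_shift, segc_NoDup|lia|].
  assert (It : In t X).
  { apply segc_lookup in Hp as (k & Hk & _). apply nth_error_In in Hk. rewrite -> Forall_forall in AX; auto. }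
  assert (Iu : In u X).
  { rewrite clookup_shift in Hq. apply segc_lookup in Hq as (k & Hk & _). apply nth_error_In in Hk.
    rewrite -> Forall_forall in BX; auto. }
  destruct (classic (f = d)) as [->|Nd]; [|destruct (classic (f = opp d)) as [->|No]].
  - destruct (@seg_join a b e p t u A0 B0 D Hp Hq) as (Ee & (a' & ->) & (b' & ->)).
    exists a', t, u, b'; split; [|split; [|split]]; auto.
    { apply Hstr with u; auto. }
    rewrite segc_app. rewrite Ee segc_shift in E. exact E.
  (* The same bond seen from the other side: the segments exchange their roles and the displacement
     is negated. *)
  - rewrite opp_opp in G.
    assert (D' : disj (segc d 0 b) (shift (pneg e) (segc d 0 a))).
    { intros q Hb Ha. rewrite cdom_shift in Ha. apply in_map_iff in Ha as (q' & <- & Ha).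
      apply (D _ Ha). rewrite cdom_shift in_map_iff. eexists; split; [|exact Hb]. now rewrite padd_neg'. }
    destruct (@seg_join b a (pneg e) (padd (padd p (vec (opp d))) (pneg e)) u t) as (Ee & (b' & ->) & (a' & ->)); auto.
    + rewrite -clookup_shift; auto.
    + rewrite clookup_shift. rewrite -Hp; f_equal. clear.
      destruct p, e, d; unfold padd, pneg; cbn; f_equal; lia.
    + exists b', u, t, a'. rewrite -G in S |- *. split; [|split; [|split]]; auto.
      * rewrite G; apply (@Hstr u t); auto. now rewrite -G.
      * eapply asm_eq_trans; [|exact E]. apply asm_eq_sym.
        assert (Es : segc d (0 + Z.of_nat (length (b' ++ [u]))) (t :: a') = shift (pneg e) (segc d 0 (t :: a')))
          by (rewrite Ee segc_shift; auto).
        rewrite (segc_app d 0 (b' ++ [u])) Es. exists (pneg e). intros q.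
        rewrite !clookup_app !clookup_shift padd_neg.
        destruct (clookup (segc d 0 (t :: a')) q) eqn:F1, (clookup (segc d 0 (b' ++ [u])) (padd q (pneg e))) eqn:F2; auto.
        exfalso. apply (D q); rewrite ?in_cdom ?clookup_shift; congruence.
  - exfalso. rewrite (@Hside t u f) in S; auto; lia.
Qed.

Lemma produced_line C : produced str 2 (singles X) C -> exists ts, line ts /\ asm_eq (segc d 0 ts) C.
Proof.
  induction 1 as [A C (t & It & ->) W E|A B C PA (a & LA & EA) PB (b & LB & EB) K].
  - exists [t]; split; auto. repeat split; auto. discriminate.
  - apply (combinable_asm_eq (asm_eq_sym EA) (asm_eq_sym EB)) in K.
    destruct (line_combine LA LB K) as (a' & t & u & b' & G & S & E & Y).
    exists ((a' ++ [t]) ++ u :: b'); split; auto.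
    destruct LA as (_ & ? & ?), LB as (_ & ? & ?).
    split; [destruct a'; discriminate|].
    destruct Y as [[-> ->]|[-> ->]]; (split; [apply Forall_app; auto|apply chain_app; auto]).
Qed.

Lemma line_produced ts : line ts -> produced str 2 (singles X) (segc d 0 ts).
Proof.
  induction ts as [|t ts IH] using rev_ind; intros (N & F & C); [tauto|].
  apply Forall_app in F as [F1 F2]. inversion F2; subst.
  destruct ts as [|u ts] using rev_ind; [|clear IHts].
  - cbn. eapply prod_init; [exists t; eauto|apply wf_single|apply asm_eq_refl].
  - assert (L : line (ts ++ [u])).
    { split; [destruct ts; discriminate|]. split; auto. now apply chain_app_inv in C. }
    specialize (IH L). destruct (chain_join _ _ _ _ C) as [G S].
    assert (P1 : produced str 2 (singles X) [((0, 0)%Z, t)]).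
    { eapply prod_init; [exists t; eauto|apply wf_single|apply asm_eq_refl]. }
    refine (prod_comb IH P1 _).
    rewrite (segc_app d 0 (ts ++ [u])).
    assert (E : segc d (0 + Z.of_nat (length (ts ++ [u]))) [t] =
            shift (pat d (Z.of_nat (length (ts ++ [u])))) [((0, 0)%Z, t)]).
    { cbn. do 2 f_equal. }
    rewrite E. apply combinable_intro; auto using wf_single, stable_single.
    + apply segc_wf; destruct ts; discriminate.
    + rewrite -E. intros p I1 I2. apply segc_dom in I1 as (k & K1 & ->). apply segc_dom in I2 as (j & K2 & I2).
      apply pat_inj in I2. lia.
    + eapply produced_good; [apply singles_good|exact IH].
    + rewrite -E. apply (@cross_single_1 str _ (pat d (Z.of_nat (length ts))) d u); auto.
      * apply segc_lookup. exists (length ts); split; [|f_equal; lia].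
        rewrite nth_error_app2; auto. now rewrite Nat.sub_diag.
      * rewrite -pat_1 pat_add length_app; f_equal; cbn; lia.
Qed.

(** Testing single tiles suffices for terminality, because a longer segment attaches by one of its
    end tiles, and that tile alone would attach as well. *)
Definition open_ends (ts : list Tile) : Prop :=
  (exists a t u, ts = a ++ [t] /\ In u X /\ glue d t = glue (opp d) u /\ str (glue d t) > 0) \/
  (exists b t u, ts = t :: b /\ In u X /\ glue d u = glue (opp d) t /\ str (glue d u) > 0).

Lemma terminal_line C : terminal str 2 (singles X) C <->
  wf_config C /\ exists ts, line ts /\ ~ open_ends ts /\ asm_eq (segc d 0 ts) C.
Proof.
  assert (P1 : forall t, In t X -> produced str 2 (singles X) [((0, 0)%Z, t)]).
  { intros t It. eapply prod_init; [exists t; eauto|apply wf_single|apply asm_eq_refl]. }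
  split.
  - intros [P T]. destruct (produced_good (@singles_good str X) P) as [W St]. split; auto.
    destruct (produced_line P) as (ts & L & E). exists ts; split; auto. split; auto.
    destruct L as (N & F & Ch). rewrite -> Forall_forall in F.
    assert (St' : stable str 2 (segc d 0 ts)).
    { eapply stable_asm_eq; [apply W|apply segc_NoDup|apply asm_eq_sym, E|exact St]. }
    intros [(a & t & u & -> & Iu & G & Sp)|(b & t & u & -> & Iu & G & Sp)]; apply (T _ (P1 _ Iu)).
    + destruct (@combinable_single str (segc d 0 (a ++ [t])) (pat d (Z.of_nat (S (length a)))) u) as [D HD];
        auto using segc_wf.
      * apply not_in_cdom; intros H. apply segc_dom in H as (k & K & H). rewrite length_app in K; cbn in K.
        apply pat_inj in H; lia.
      * apply (@cross_single_1 str _ (pat d (Z.of_nat (length a))) d t); auto.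
        -- apply segc_lookup. exists (length a); split; [|f_equal; lia].
           rewrite nth_error_app2; auto. now rewrite Nat.sub_diag.
        -- rewrite -pat_1 pat_add; f_equal; cbn; lia.
        -- apply (Hstr t u); auto. apply F; apply in_app_iff; cbn; auto.
      * exists D. eapply combinable_asm_eq; eauto using asm_eq_refl.
    + destruct (@combinable_single str (segc d 0 (t :: b)) (pat d (-1)) u) as [D HD];
        auto using segc_wf.
      * apply not_in_cdom; intros H. apply segc_dom in H as (k & K & H).
        apply pat_inj in H; lia.
      * rewrite G in Sp. apply (@cross_single_1 str _ (pat d 0) (opp d) t); auto.
        -- destruct d; reflexivity.
        -- rewrite opp_opp; auto.
        -- rewrite -G. apply (Hstr u t); cbn in *; auto. now rewrite G.
      * exists D. eapply combinable_asm_eq; eauto using asm_eq_refl.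
  - intros (W & ts & L & O & E).
    apply (terminal_asm_eq W E). split; [now apply line_produced|].
    intros B PB (C' & HC). destruct (produced_line PB) as (b & LB & EB).
    apply (combinable_asm_eq (asm_eq_refl _) (asm_eq_sym EB)) in HC.
    destruct (line_combine L LB HC) as (a' & t & u & b' & G & Sp & _ & Y).
    apply O. destruct L as (_ & F & _), LB as (_ & FB & _). rewrite -> Forall_forall in F, FB.
    destruct Y as [[-> ->]|[-> ->]].
    + left; exists a', t, u; repeat split; auto; [apply FB; cbn; auto|lia].
    + right; exists b', u, t; repeat split; auto; [apply FB; apply in_app_iff; cbn; auto|lia].
Qed.

End Line.

Unset Implicit Arguments.

(** Two single tiles share at most one edge, so a common glue of strength 1 cannot hold them at
    temperature 2. *)
Lemma inert_pair str t u C : (forall d, glue d t = glue (opp d) u -> str (glue d t) <= 1) ->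
  ~ combinable str 2 [((0, 0)%Z, t)] [((0, 0)%Z, u)] C.
Proof.
  intros H K. apply combinable_rel in K as (e & _ & _ & _ & _ & K); auto using wf_single.
  unfold cross, lsum in K; cbn -[pbond padd] in K. rewrite !Nat.add_0_r in K.
  destruct (pbond_pos str (0, 0)%Z t (padd (0, 0)%Z e) u) as (d & _ & G & S & Bd); [lia|].
  specialize (H d G); lia.
Qed.

Lemma inert_bin str X : (forall t u d, In t X -> In u X -> glue d t = glue (opp d) u -> str (glue d t) <= 1) ->
  forall C, terminal str 2 (singles X) C <-> wf_config C /\ exists t, In t X /\ asm_eq [((0, 0)%Z, t)] C.
Proof.
  intros H.
  assert (K : forall C, produced str 2 (singles X) C -> wf_config C /\ exists t, In t X /\ asm_eq [((0, 0)%Z, t)] C).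
  { induction 1 as [A C (t & It & ->) W E|A B C PA (WA & t & It & EA) PB (WB & u & Iu & EB) K]; [eauto|].
    exfalso. apply (combinable_asm_eq (asm_eq_sym EA) (asm_eq_sym EB)) in K. revert K; apply inert_pair; eauto. }
  intros C; split; [intros [P _]; auto|].
  intros (W & t & It & E). apply (terminal_asm_eq W E). split.
  - eapply prod_init; [exists t; eauto|apply wf_single|apply asm_eq_refl].
  - intros B PB (D & HD). destruct (K B PB) as (WB & v & Iv & EB).
    apply (combinable_asm_eq (asm_eq_refl _) (asm_eq_sym EB)) in HD. revert HD; apply inert_pair; eauto.
Qed.

Lemma closed_terminal str S C : good_init str 2 S -> produced str 2 S C ->
  (forall d g, exposed C d g -> str g = 0) -> terminal str 2 S C.
Proof.
  intros G P H; split; auto. intros B PB (D & HD).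
  destruct (@combinable_exposed str C B D 2) as (d & g & E & _ & K); auto;
    [eapply produced_good; eauto|eapply produced_good; eauto|].
  rewrite (H _ _ E) in K; lia.
Qed.

Lemma least (P : nat -> Prop) : (exists n, P n) -> exists n, P n /\ forall m, m < n -> ~ P m.
Proof.
  intros [n Hn]. revert Hn. induction n as [n IH] using lt_wf_ind; intros Hn.
  destruct (classic (exists m, m < n /\ P m)) as [(m & L & Hm)|N]; [exact (IH m L Hm)|].
  exists n; split; auto. intros m L Hm; apply N; eauto.
Qed.

Lemma padd_DN x y : padd (x, y) (vec DN) = (x, y + 1)%Z.
Proof. unfold padd; cbn [vec fst snd]; f_equal; lia. Qed.
Lemma padd_DE x y : padd (x, y) (vec DE) = (x + 1, y)%Z.
Proof. unfold padd; cbn [vec fst snd]; f_equal; lia. Qed.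
Lemma padd_DS x y : padd (x, y) (vec DS) = (x, y - 1)%Z.
Proof. unfold padd; cbn [vec fst snd]; f_equal; lia. Qed.
Lemma padd_DW x y : padd (x, y) (vec DW) = (x - 1, y)%Z.
Proof. unfold padd; cbn [vec fst snd]; f_equal; lia. Qed.

(** * The tile system of an iterated row relation *)

Section System.
(** Letters of [A] travel north and states of [Q] travel east: [(q, a, a', q')] in [nrms] reads [q]
    from the west and [a] from the south and hands on [a'] and [q']. [isEnd] marks the letters of
    the last column and [top] the states of the top row, beyond which nothing is handed on. [kap]
    joins proper rows to proper columns and [kap'] spurious ones, [kap1] links a column, [gL] starts
    a proper row and [rho] a spurious one. *)
Variables (A Q : Type) (isEnd : A -> bool) (top : Q -> bool) (errL : bool -> A) (errS : bool -> Q).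
Variables (allA : list A) (allQ : list Q) (nrms : list (Q * A * A * Q)) (q0 qT : Q).
Variables (gl : A -> nat) (gs : Q -> nat) (kap kap' kap1 inf inf2 gL rho : nat) (str : nat -> nat).
(* A chain tile (w, a, e) of the bottom row: west glue, letter shown to the north, east glue. *)
Variable cells : list (nat * A * nat).

Hypothesis str0 : str 0 = 0.
Hypothesis str_gl : forall a, In a allA -> str (gl a) = 1.
Hypothesis str_gs : forall q, In q allQ -> str (gs q) = 1.
Hypothesis gs_neq0 : forall q, gs q <> 0.
Hypothesis str_kap : str kap = 2.
Hypothesis str_kap' : str kap' = 2.
Hypothesis str_kap1 : str kap1 = 2.
Hypothesis str_inf : str inf = 2.
Hypothesis str_inf2 : str inf2 = 2.
Hypothesis str_gL : str gL = 2.
Hypothesis str_rho : str rho = 2.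
Hypothesis gl_inj : forall a b, gl a = gl b -> a = b.
Hypothesis gs_inj : forall a b, gs a = gs b -> a = b.
Hypothesis vert_distinct : NoDup [kap; kap'; kap1; inf; inf2].
Hypothesis gL_rho : gL <> rho.
Hypothesis cells_ok : forall w a e, In (w, a, e) cells ->
  str w = 2 /\ (e = 0 \/ str e = 2) /\ w <> rho /\ e <> rho /\ (isEnd a = true <-> e = 0) /\ In a allA.
Hypothesis cells_next : forall w a e, In (w, a, e) cells -> e <> 0 -> exists a' e', In (e, a', e') cells.
Hypothesis cells_prev : forall w a e, In (w, a, e) cells -> w = gL \/ exists w' a', In (w', a', w) cells.
Hypothesis allQ0 : In q0 allQ.
Hypothesis allQT : In qT allQ.
Hypothesis allA_err : forall b, In (errL b) allA.
Hypothesis allQ_err : forall b, In (errS b) allQ.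
Hypothesis nrms_ok : forall q a a' q', In (q, a, a', q') nrms ->
  In q allQ /\ In a allA /\ In a' allA /\ In q' allQ /\ isEnd a' = isEnd a /\ top q' = top q /\
  (forall b, a <> errL b) /\ (forall b, q <> errS b).
Hypothesis isEnd_err : forall b, isEnd (errL b) = b.
Hypothesis top_err : forall b, top (errS b) = b.
Hypothesis top_q0 : top q0 = false.
Hypothesis top_qT : top qT = true.

Definition tcell (c : nat * A * nat) : Tile := let '(w, a, e) := c in mkTile (gl a) e 0 w.
(* The ends [tC0'] and [tK'] build spurious L-shapes in which every interior tile fits, so that no interior
   tile is terminal on its own; the tops of these L-shapes expose [inf], so they produce no terminal either. *)
Definition tC0 : Tile := mkTile kap gL 0 0.
Definition tC0' : Tile := mkTile kap' rho 0 0.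
Definition RT : list Tile := tC0 :: tC0' :: map tcell cells ++ map (fun a => tcell (rho, a, 0)) allA.

(** The east glues start the rows: [q0] the computing ones, [qT] the test in the top row. The link
    [kap1] admits every height from 2 on. *)
Definition tKbot : Tile := mkTile kap1 (gs q0) kap 0.
Definition tK0 : Tile := mkTile kap1 (gs q0) kap1 0.
Definition tKtop : Tile := mkTile 0 (gs qT) kap1 0.
Definition tK' (q : Q) : Tile := mkTile inf (gs q) kap' 0.
Definition CT : list Tile := [tKbot; tK0; tKtop] ++ map tK' allQ.

Definition tnrm (x : Q * A * A * Q) : Tile :=
  let '(q, a, a', q') := x in
  mkTile (if top q then 0 else gl a') (if isEnd a then 0 else gs q') (gl a) (gs q).
(* Error tiles fit everywhere, and errors spread to the north-east corner, where they expose [inf]. *)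
Definition ter (x : Q * A) : Tile :=
  let '(q, a) := x in
  mkTile (if top q then (if isEnd a then inf else 0) else gl (errL (isEnd a)))
         (if isEnd a then 0 else gs (errS (top q))) (gl a) (gs q).
Definition IT : list Tile := map tnrm nrms ++ map ter (list_prod allQ allA).
(* These two tiles extend each other forever, so whatever exposes [inf] never becomes terminal. *)
Definition tinfA : Tile := mkTile inf2 0 inf 0.
Definition tinfB : Tile := mkTile inf 0 inf2 0.

Fixpoint path (g : nat) (bs : list (nat * A * nat)) : Prop :=
  match bs with
  | [] => g = 0
  | (w, a, e) :: bs' => w = g /\ In (w, a, e) cells /\ path e bs'
  end.

Hypothesis path_exists : exists bs, path gL bs.

(** * The bin of bottom rows *)

Lemma RT_inv t : In t RT -> t = tC0 \/ t = tC0' \/ (exists c, In c cells /\ t = tcell c) \/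
  (exists a, In a allA /\ t = tcell (rho, a, 0)).
Proof.
  unfold RT; cbn [In]; rewrite in_app_iff !in_map_iff; intros [<-|[<-|[(c & <- & H)|(c & <- & H)]]]; eauto 7.
Qed.

Lemma CT_inv t : In t CT -> t = tKbot \/ t = tK0 \/ t = tKtop \/ (exists q, In q allQ /\ t = tK' q).
Proof.
  unfold CT; cbn [In app]; rewrite in_map_iff; intros [<-|[<-|[<-|(c & <- & H)]]]; eauto 7.
Qed.

Lemma two_neq0 g : str g = 2 -> g <> 0.
Proof. intros H ->; lia. Qed.

Lemma RT_side t u e : In t RT -> In u RT -> e <> DE -> e <> opp DE ->
  glue e t = glue (opp e) u -> str (glue e t) = 0.
Proof.
  assert (S0 : forall t, In t RT -> tS t = 0).
  { clear t u; intros t H; apply RT_inv in H as [->|[->|[([[w a] x] & _ & ->)|(a & _ & ->)]]]; auto. }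
  intros It Iu N1 N2 G; destruct e; cbn in *; try congruence.
  - rewrite G S0 //.
  - rewrite S0 //.
Qed.

Lemma RT_str t u : In t RT -> In u RT -> glue DE t = glue (opp DE) u ->
  str (glue DE t) > 0 -> 2 <= str (glue DE t).
Proof.
  intros H _ _ S; apply RT_inv in H as [->|[->|[([[w a] x] & H & ->)|(a & _ & ->)]]]; cbn in *; try lia.
  apply cells_ok in H as (_ & [->| ->] & _); lia.
Qed.

Definition row (ws : list Tile) : Prop :=
  (exists bs, path gL bs /\ ws = tC0 :: map tcell bs) \/
  (exists a, In a allA /\ ws = [tC0'; tcell (rho, a, 0)]).

(** A line whose ends are closed can stop only at east glue 0: after any other glue of the chain
    some cell fits by [cells_next], and after [rho] every spurious cell fits. *)
Lemma row_tail t b : In t RT -> line str DE RT (t :: b) ->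
  (forall x y u, t :: b = x ++ [y] -> In u RT -> tE y = tW u -> str (tE y) = 0) ->
  (tE t = rho -> exists a, In a allA /\ b = [tcell (rho, a, 0)]) /\
  (tE t <> rho -> (tE t = gL \/ tE t = 0 \/ exists w a, In (w, a, tE t) cells) ->
     exists bs, path (tE t) bs /\ b = map tcell bs).
Proof.
  revert t; induction b as [|u b IH]; intros t It (_ & F & Ch) O.
  - assert (P : forall u, In u RT -> tE t = tW u -> str (tE t) = 0) by (intros u; apply (O [] t u eq_refl)).
    split.
    + intros E; exfalso. specialize (P (tcell (rho, errL true, 0))). rewrite E str_rho in P.
      discriminate P; auto.
      right; right; apply in_app_iff; right; apply in_map_iff; exists (errL true); auto.
    + intros N D. exists []; split; auto.
      assert (K : (exists a e, In (tE t, a, e) cells) -> tE t = 0).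
      { intros (a & e & H). exfalso. specialize (P (tcell (tE t, a, e))).
        apply cells_ok in H as K. rewrite (proj1 K) in P. discriminate P; auto.
        right; right; apply in_app_iff; left; now apply in_map. }
      destruct D as [D|[D|(w & a & D)]]; auto.
      * apply K. destruct path_exists as ([|[[w a] e] bs] & Hp); cbn in Hp.
        -- exfalso; revert Hp; now apply two_neq0.
        -- destruct Hp as (-> & H & _); rewrite D; eauto.
      * destruct (Nat.eq_dec (tE t) 0); auto. apply K; eapply cells_next; eauto.
  - destruct Ch as (G & S & Ch). inversion F as [|? ? _ F']; subst. inversion F' as [|? ? Iu _]; subst.
    cbn in G, S.
    destruct (IH u Iu) as [IH1 IH2].
    { split; [discriminate|auto]. }
    { intros x y v E; apply (O (t :: x) y v); rewrite E; auto. }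
    split.
    + intros E. apply RT_inv in Iu as [->|[->|[([[w a] e] & H & ->)|(a & Ia & ->)]]]; cbn in G.
      * rewrite G str0 in S; lia.
      * rewrite G str0 in S; lia.
      * apply cells_ok in H as (_ & _ & Hw & _); congruence.
      * exists a; split; auto. destruct b as [|v b]; auto. cbn in Ch; lia.
    + intros N D. apply RT_inv in Iu as [->|[->|[([[w a] e] & H & ->)|(a & Ia & ->)]]]; cbn in G;
        try (rewrite G str0 in S; lia); try congruence.
      cbn in IH2. pose proof (cells_ok _ _ _ H) as (_ & _ & _ & He & _).
      destruct IH2 as (bs & Hp & ->); eauto.
      exists ((w, a, e) :: bs); cbn -[tcell]; auto.
Qed.

Lemma path_line g bs t : tE t = g -> In t RT -> path g bs -> line str DE RT (t :: map tcell bs).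
Proof.
  revert g t; induction bs as [|[[w a] e] bs IH]; intros g t E It; cbn [path].
  - intros _. split; [discriminate|]. split; cbn; auto.
  - intros (-> & H & Hp).
    assert (Iu : In (tcell (g, a, e)) RT) by (right; right; apply in_app_iff; left; now apply in_map).
    destruct (IH e (tcell (g, a, e)) eq_refl Iu Hp) as (_ & F & Ch).
    split; [discriminate|]. split; [constructor; auto|].
    cbn [map]. split; [|split]; auto; cbn; auto.
    rewrite E; apply cells_ok in H; lia.
Qed.

Lemma path_last g bs : path g bs -> g = 0 \/ exists bs' w a, bs = bs' ++ [(w, a, 0)].
Proof.
  revert g; induction bs as [|[[w a] e] bs IH]; intros g; cbn [path]; auto.
  intros (-> & H & Hp); right. destruct (IH _ Hp) as [->|(bs' & w & a' & ->)].
  - destruct bs as [|[[w a'] e] bs].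
    + exists [], g, a; auto.
    + destruct Hp as (-> & H' & _). apply cells_ok in H'; lia.
  - exists ((g, a, e) :: bs'), w, a'; auto.
Qed.

Lemma row_line ws : row ws -> line str DE RT ws /\ ~ open_ends str DE RT ws /\
  exists t b a, ws = t :: b ++ [a] /\ (t = tC0 \/ t = tC0') /\ tE a = 0.
Proof.
  intros H.
  assert (L : line str DE RT ws /\ exists t b a, ws = t :: b ++ [a] /\ (t = tC0 \/ t = tC0') /\ tE a = 0).
  { destruct H as [(bs & Hp & ->)|(a & Ia & ->)].
    - split; [apply path_line with gL; cbn; auto|].
      destruct (path_last _ _ Hp) as [E|(bs' & w & a & ->)]; [exfalso; revert E; now apply two_neq0|].
      exists tC0, (map tcell bs'), (tcell (w, a, 0)). rewrite map_app; auto.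
    - assert (Iu : In (tcell (rho, a, 0)) RT).
      { right; right; apply in_app_iff; right; apply in_map_iff; eauto. }
      split; [|exists tC0', [], (tcell (rho, a, 0)); auto].
      split; [discriminate|]. split; [constructor; [cbn; auto|constructor; [exact Iu|constructor]]|].
      cbn; split; auto; lia. }
  destruct L as [L (t & b & a & E & Ht & Ea)]; split; [auto|split; [|eauto 6]].
  intros [(x & y & u & E' & _ & G & S)|(x & y & u & E' & _ & G & S)]; rewrite E in E'.
  - rewrite app_comm_cons in E'. apply app_inj_tail in E' as [_ <-]. cbn in S. rewrite Ea str0 in S; lia.
  - inversion E'; subst y. cbn in G, S. rewrite G in S. destruct Ht as [->| ->]; cbn in S; lia.
Qed.

(** By [cells_prev] a line that starts with a cell can be extended to the west, so a terminal one
    starts with [tC0] or [tC0']; [row_tail] determines the rest. *)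
Lemma terminal_rows C : terminal str 2 (singles RT) C <->
  wf_config C /\ exists ws, row ws /\ asm_eq (segc DE 0 ws) C.
Proof.
  rewrite (@terminal_line str DE RT RT_side RT_str). split.
  - intros (W & ts & L & O & E); split; auto. exists ts; split; auto.
    destruct ts as [|t b]; [now destruct L|].
    assert (It : In t RT) by (destruct L as (_ & F & _); now inversion F).
    destruct (row_tail t b It L) as [K1 K2].
    { intros x y u Ey Iu G. destruct (Nat.eq_dec (str (tE y)) 0); auto.
      exfalso; apply O; left; exists x, y, u; repeat split; auto; cbn; lia. }
    assert (Hl : forall u, In u RT -> tE u = tW t -> str (tE u) = 0).
    { intros u Iu G. destruct (Nat.eq_dec (str (tE u)) 0); auto.
      exfalso; apply O; right; exists b, t, u; repeat split; auto; cbn; lia. }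
    apply RT_inv in It as [->|[->|[([[w a] e] & H & ->)|(a & Ia & ->)]]].
    + left. destruct K2 as (bs & Hp & ->); cbn; eauto.
    + right. destruct K1 as (a & Ia & ->); cbn; eauto.
    + exfalso. assert (Sw : str w = 2) by now apply cells_ok in H.
      destruct (cells_prev _ _ _ H) as [->|(w' & a' & H')].
      * specialize (Hl tC0). cbn in Hl. rewrite Hl in Sw; auto; discriminate.
      * specialize (Hl (tcell (w', a', w))). cbn in Hl. rewrite Hl in Sw; auto; [|discriminate].
        right; right; apply in_app_iff; left. change (In (tcell (w', a', w)) (map tcell cells)). now apply in_map.
    + exfalso. specialize (Hl tC0'). cbn in Hl. pose proof str_rho as Sr. rewrite Hl in Sr; auto; discriminate.
  - intros (W & ws & R & E); split; auto. exists ws; destruct (row_line _ R) as (? & ? & _); auto.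
Qed.

(** * The bin of columns *)

Definition col (cs : list Tile) : Prop :=
  (exists n, cs = tKbot :: repeat tK0 n ++ [tKtop]) \/ (exists q, In q allQ /\ cs = [tK' q]).

Lemma CT_side t u e : In t CT -> In u CT -> e <> DN -> e <> opp DN ->
  glue e t = glue (opp e) u -> str (glue e t) = 0.
Proof.
  assert (S0 : forall t, In t CT -> tW t = 0).
  { clear t u; intros t H; apply CT_inv in H as [->|[->|[->|(a & _ & ->)]]]; auto. }
  intros It Iu N1 N2 G; destruct e; cbn in *; try congruence.
  - rewrite G S0 //.
  - rewrite S0 //.
Qed.

Lemma CT_str t u : In t CT -> In u CT -> glue DN t = glue (opp DN) u ->
  str (glue DN t) > 0 -> 2 <= str (glue DN t).
Proof.
  intros H _ _ S; apply CT_inv in H as [->|[->|[->|(a & _ & ->)]]]; cbn in *; lia.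
Qed.

Lemma vert_neq : kap <> kap' /\ kap <> kap1 /\ kap <> inf /\ kap <> inf2 /\ kap' <> kap1 /\ kap' <> inf /\
  kap' <> inf2 /\ kap1 <> inf /\ kap1 <> inf2 /\ inf <> inf2.
Proof.
  inversion vert_distinct as [|? ? H1 V1]; subst; inversion V1 as [|? ? H2 V2]; subst;
  inversion V2 as [|? ? H3 V3]; subst; inversion V3 as [|? ? H4 V4]; subst; cbn in *.
  repeat split; intros E; subst; tauto.
Qed.

Lemma col_tail t b : In t CT -> tN t = kap1 -> line str DN CT (t :: b) ->
  (forall x y u, t :: b = x ++ [y] -> In u CT -> tN y = tS u -> str (tN y) = 0) ->
  exists n, b = repeat tK0 n ++ [tKtop].
Proof.
  destruct vert_neq as (V1 & V2 & V3 & V4 & V5 & V6 & V7 & V8 & V9 & V10).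
  revert t; induction b as [|u b IH]; intros t It E (_ & F & Ch) O.
  - specialize (O [] t tK0 eq_refl). rewrite E str_kap1 in O. discriminate O; auto. cbn; auto.
  - destruct Ch as (G & S & Ch). inversion F as [|? ? _ F']; subst. inversion F' as [|? ? Iu _]; subst.
    cbn in G, S.
    specialize (IH u Iu).
    apply CT_inv in Iu as [->|[->|[->|(q & Iq & ->)]]]; cbn in G; try congruence.
    + destruct IH as [n ->]; auto.
      { split; [discriminate|auto]. }
      { intros x y v Ey; apply (O (t :: x) y v); rewrite Ey; auto. }
      exists (Datatypes.S n); auto.
    + exists 0. destruct b as [|v b]; auto. cbn in Ch; lia.
Qed.

Lemma col_line cs : col cs -> line str DN CT cs /\ ~ open_ends str DN CT cs /\
  (exists t b, cs = t :: b /\ (t = tKbot \/ exists q, t = tK' q)) /\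
  exists b t, cs = b ++ [t] /\ (t = tKtop \/ exists q, t = tK' q).
Proof.
  destruct vert_neq as (V1 & V2 & V3 & V4 & V5 & V6 & V7 & V8 & V9 & V10).
  intros H.
  assert (L : line str DN CT cs /\ (exists t b, cs = t :: b /\ (t = tKbot \/ exists q, t = tK' q)) /\
      exists b t, cs = b ++ [t] /\ (t = tKtop \/ exists q, t = tK' q)).
  { destruct H as [(n & ->)|(q & Iq & ->)].
    - split; [|split; [eauto 6|exists (tKbot :: repeat tK0 n), tKtop; eauto]].
      assert (G : forall t, In t CT -> tN t = kap1 -> line str DN CT (t :: repeat tK0 n ++ [tKtop])).
      { induction n as [|n IH]; intros t It E.
        - split; [discriminate|].
          split; [constructor; [exact It|constructor; [cbn; auto|constructor]]|].
          cbn. rewrite E. split; auto; split; [lia|auto].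
        - destruct (IH tK0) as (_ & F & Ch); [right; left; auto|auto|].
          split; [discriminate|]. split; [constructor; auto|].
          cbn [repeat app]. split; [|split]; auto; cbn; rewrite E; auto; lia. }
      apply G; cbn; auto.
    - split; [|split; [exists (tK' q), []; eauto|exists [], (tK' q); eauto]].
      split; [discriminate|]. split; [constructor; [|constructor]|cbn; auto].
      apply in_app_iff; right; now apply in_map. }
  destruct L as (L & Hh & Hl); split; [auto|split; [|auto]].
  destruct Hh as (th & bh & Eh & Hh), Hl as (bl & tl & El & Hl).
  intros [(x & y & u & E' & Iu & G & S)|(x & y & u & E' & Iu & G & S)].
  - rewrite El in E'. apply app_inj_tail in E' as [_ <-]. cbn in G, S.
    destruct Hl as [->|[q ->]]; cbn in G, S; [lia|].
    apply CT_inv in Iu as [->|[->|[->|(q' & _ & ->)]]]; cbn in G; congruence.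
  - rewrite Eh in E'. inversion E'; subst y. cbn in G, S.
    apply CT_inv in Iu as [->|[->|[->|(q' & _ & ->)]]]; destruct Hh as [->|[q ->]]; cbn in G, S; try congruence; lia.
Qed.

(** A north glue [kap1] always admits [tK0] and a south glue [kap1] always admits [tKbot], so only
    complete columns stop growing. Their outer glues [kap], [kap'] and [inf] have no counterpart in
    this bin. *)
Lemma terminal_cols C : terminal str 2 (singles CT) C <->
  wf_config C /\ exists cs, col cs /\ asm_eq (segc DN 0 cs) C.
Proof.
  rewrite (@terminal_line str DN CT CT_side CT_str). split.
  - intros (W & ts & L & O & E); split; auto. exists ts; split; auto.
    destruct ts as [|t b]; [now destruct L|].
    assert (It : In t CT) by (destruct L as (_ & F & _); now inversion F).
    assert (Hr : forall x y u, t :: b = x ++ [y] -> In u CT -> tN y = tS u -> str (tN y) = 0).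
    { intros x y u Ey Iu G. destruct (Nat.eq_dec (str (tN y)) 0); auto.
      exfalso; apply O; left; exists x, y, u; repeat split; auto; cbn; lia. }
    assert (Hl : tS t <> kap1).
    { intros G. apply O; right; exists b, t, tKbot; repeat split; cbn; auto. lia. }
    pose proof It as It'.
    apply CT_inv in It' as [->|[->|[->|(q & Iq & ->)]]]; try (cbn in Hl; congruence).
    + left. destruct (col_tail tKbot b It eq_refl L Hr) as [n ->]; eauto.
    + right. exists q; split; auto. destruct L as (_ & F & Ch). destruct b as [|u b]; auto. exfalso.
      destruct vert_neq as (V1 & V2 & V3 & V4 & V5 & V6 & V7 & V8 & V9 & V10).
      destruct Ch as (G & S & _). inversion F as [|? ? _ F']; subst. inversion F' as [|? ? Iu _]; subst.
      apply CT_inv in Iu as [->|[->|[->|(q' & _ & ->)]]]; cbn in G; congruence.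
  - intros (W & ws & R & E); split; auto. exists ws; destruct (col_line _ R) as (? & ? & _); auto.
Qed.

Lemma row_glues ws k t : row ws -> nth_error ws k = Some t ->
  tS t = 0 /\ (k = 0 -> tW t = 0 /\ (tN t = kap \/ tN t = kap')) /\ (S k = length ws -> tE t = 0) /\
  (k <> 0 -> exists a, In a allA /\ tN t = gl a).
Proof.
  intros R E. destruct (row_line _ R) as (_ & _ & (h & b & l & Ew & Hh & Hl)).
  assert (L : S k = length ws -> tE t = 0).
  { intros L. rewrite Ew app_comm_cons in E L. rewrite nth_error_app2 in E; rewrite length_app in L; cbn in *; [lia|].
    replace (k - S (length b)) with 0 in E by lia. inversion E; subst; auto. }
  assert (H0 : k = 0 -> tW t = 0 /\ (tN t = kap \/ tN t = kap')).
  { intros ->. rewrite Ew in E; inversion E; subst. destruct Hh as [->| ->]; cbn; auto. }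
  assert (H1 : tS t = 0 /\ (k <> 0 -> exists a, In a allA /\ tN t = gl a)).
  { destruct R as [(bs & Hp & ->)|(a & Ia & ->)].
    - destruct k as [|k]; cbn in E.
      + inversion E; split; [auto|congruence].
      + apply nth_error_In, in_map_iff in E as ([[w a] e] & <- & I).
        assert (J : In (w, a, e) cells).
        { revert I Hp. generalize gL. clear. induction bs as [|[[w' a'] e'] bs IH]; cbn [In path]; [tauto|].
          intros g [E|I] (H1 & H2 & H3); [inversion E; subst; auto|]. apply (IH e'); auto. }
        split; auto. intros _; exists a; split; auto. apply cells_ok in J; tauto.
    - destruct k as [|[|[|k]]]; cbn in E; inversion E; subst; cbn; split; auto; try congruence; eauto. }
  tauto.
Qed.

Lemma col_glues cs k t : col cs -> nth_error cs k = Some t ->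
  tW t = 0 /\ (exists q, In q allQ /\ tE t = gs q) /\ (k = 0 -> tS t = kap \/ tS t = kap') /\
  (S k = length cs -> tN t = 0 \/ tN t = inf).
Proof.
  intros R E. destruct (col_line _ R) as ((_ & F & _) & _ & (h & b & Eh & Hh) & (b' & l & El & Hl)).
  assert (It : In t CT) by (rewrite -> Forall_forall in F; apply F; eapply nth_error_In; eauto).
  split; [apply CT_inv in It as [->|[->|[->|(q & Iq & ->)]]]; auto|].
  split; [apply CT_inv in It as [->|[->|[->|(q & Iq & ->)]]]; cbn; eauto|].
  split.
  - intros ->. rewrite Eh in E; inversion E; subst. destruct Hh as [->|[q ->]]; cbn; auto.
  - intros L. rewrite El in E L. rewrite length_app in L; cbn in L.
    rewrite nth_error_app2 in E; [lia|]. replace (k - length b') with 0 in E by lia.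
    inversion E; subst. destruct Hl as [->|[q ->]]; cbn; auto.
Qed.

(** * L-shapes *)

Definition lpair (ws cs : list Tile) : Prop :=
  (exists bs n, path gL bs /\ ws = tC0 :: map tcell bs /\ cs = tKbot :: repeat tK0 n ++ [tKtop]) \/
  (exists a q, In a allA /\ In q allQ /\ ws = [tC0'; tcell (rho, a, 0)] /\ cs = [tK' q]).

Definition Lc (ws cs : list Tile) : config := segc DE 0 ws ++ segc DN 1 cs.

Lemma lpair_row ws cs : lpair ws cs -> row ws /\ col cs.
Proof.
  intros [(bs & n & H & -> & ->)|(a & q & H & H' & -> & ->)]; split; unfold row, col; eauto.
Qed.

Lemma lpair_intro ws cs t u ws' cs' : row ws -> col cs -> ws = t :: ws' -> cs = u :: cs' -> tN t = tS u -> lpair ws cs.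
Proof.
  destruct vert_neq as (V1 & _).
  intros [(bs & H & ->)|(a & H & ->)] [(n & ->)|(q & Hq & ->)] E1 E2 E; inversion E1; inversion E2; subst;
    cbn in E; try congruence; [left|right]; eauto 9.
Qed.

Lemma Lc_disj ws cs : disj (segc DE 0 ws) (segc DN 1 cs).
Proof.
  intros p H1 H2; apply segc_dom in H1 as (k & _ & ->); apply segc_dom in H2 as (j & _ & H2).
  rewrite pat_DE pat_DN in H2. apply pair_equal_spec in H2; lia.
Qed.

Lemma Lc_NoDup ws cs : NoDup (cdom (Lc ws cs)).
Proof. apply NoDup_union; auto using segc_NoDup, Lc_disj. Qed.

Lemma Lc_wf ws cs : ws <> [] -> wf_config (Lc ws cs).
Proof. split; [destruct ws; [congruence|discriminate]|apply Lc_NoDup]. Qed.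

Lemma Lc_lookup ws cs x y t : clookup (Lc ws cs) (x, y) = Some t <->
  (y = 0%Z /\ (0 <= x)%Z /\ nth_error ws (Z.to_nat x) = Some t) \/
  (x = 0%Z /\ (1 <= y)%Z /\ nth_error cs (Z.to_nat (y - 1)) = Some t).
Proof.
  transitivity (In ((x, y), t) (Lc ws cs)).
  { split; [apply clookup_In|apply In_clookup, Lc_NoDup]. }
  unfold Lc; rewrite in_app_iff !segc_In; split.
  - intros [(k & H & E)|(k & H & E)]; rewrite ?pat_DE ?pat_DN in E; apply pair_equal_spec in E as [-> ->].
    + left. split; [lia|]. split; [lia|]. rewrite -H; f_equal; lia.
    + right. split; [lia|]. split; [lia|]. rewrite -H; f_equal; lia.
  - intros [(-> & H & E)|(-> & H & E)].
    + left; exists (Z.to_nat x); split; auto. rewrite ?pat_DE ?pat_DN; f_equal; lia.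
    + right; exists (Z.to_nat (y - 1)); split; auto. rewrite ?pat_DE ?pat_DN; f_equal; lia.
Qed.

Lemma Lc_None ws cs x y : clookup (Lc ws cs) (x, y) = None <->
  ~ (y = 0%Z /\ (0 <= x)%Z /\ Z.to_nat x < length ws) /\
  ~ (x = 0%Z /\ (1 <= y)%Z /\ Z.to_nat (y - 1) < length cs).
Proof.
  destruct (clookup (Lc ws cs) (x, y)) as [t|] eqn:E.
  - split; [discriminate|]. apply Lc_lookup in E as [(H1 & H2 & H3)|(H1 & H2 & H3)];
      assert (K := nth_error_Some); [specialize (K _ ws (Z.to_nat x))|specialize (K _ cs (Z.to_nat (y - 1)))];
      rewrite H3 in K; intros [N1 N2]; exfalso; [apply N1|apply N2]; repeat split; auto; apply K; discriminate.
  - split; auto. intros _; split; intros (H1 & H2 & H3); apply nth_error_Some in H3.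
    + destruct (nth_error ws (Z.to_nat x)) as [t|] eqn:F; [|congruence].
      assert (G : clookup (Lc ws cs) (x, y) = Some t) by (apply Lc_lookup; auto). congruence.
    + destruct (nth_error cs (Z.to_nat (y - 1))) as [t|] eqn:F; [|congruence].
      assert (G : clookup (Lc ws cs) (x, y) = Some t) by (apply Lc_lookup; auto). congruence.
Qed.

Lemma seg_exposed d ts e g : exposed (segc d 0 ts) e g ->
  exists k t, nth_error ts k = Some t /\ glue e t = g /\ (e = d -> S k = length ts) /\ (e = opp d -> k = 0).
Proof.
  intros (p & t & Hp & Hn & G). apply segc_lookup in Hp as (k & Hk & ->).
  exists k, t; repeat split; auto.
  - intros ->. assert (k < length ts) by (apply nth_error_Some; congruence).
    destruct (Nat.eq_dec (S k) (length ts)); auto. exfalso.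
    apply not_in_cdom in Hn; apply Hn, segc_dom. exists (S k); split; [lia|].
    rewrite -pat_1 pat_add; f_equal; lia.
  - intros ->. destruct k; auto. exfalso.
    assert (S k < length ts) by (apply nth_error_Some; congruence).
    apply not_in_cdom in Hn; apply Hn, segc_dom. exists k; split; [lia|].
    replace (pat d (0 + Z.of_nat (S k))) with (padd (pat d (0 + Z.of_nat k)) (vec d))
      by (rewrite -pat_1 pat_add; f_equal; lia).
    now rewrite padd_vec_opp.
Qed.

Lemma row_exposed ws e g : row ws -> exposed (segc DE 0 ws) e g -> str g > 0 -> e = DN.
Proof.
  intros R H S. apply seg_exposed in H as (k & t & Hk & <- & H1 & H2).
  destruct (row_glues _ _ _ R Hk) as (G1 & G2 & G3 & G4). destruct e; auto; exfalso; cbn in S.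
  - rewrite G3 in S; auto; lia.
  - rewrite G1 in S; auto; lia.
  - destruct G2 as [G2 _]; auto. rewrite G2 in S; auto; lia.
Qed.

Lemma col_exposed cs e g : col cs -> exposed (segc DN 0 cs) e g -> str g > 0 ->
  (e = DN /\ g = inf) \/ (e = DE /\ str g = 1) \/ (e = DS /\ (g = kap \/ g = kap')).
Proof.
  intros R H S. apply seg_exposed in H as (k & t & Hk & <- & H1 & H2).
  destruct (col_glues _ _ _ R Hk) as (G1 & (q & Iq & G2) & G3 & G4). destruct e; auto; cbn in *.
  - left; split; auto. destruct G4 as [G|G]; auto. rewrite G in S; lia.
  - rewrite G2 str_gs; auto.
  - right; right; split; auto.
  - rewrite G1 in S; auto; lia.
Qed.

(** An L-shape exposes effective glues only to the north and the east, so two L-shapes never bond.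
    The only one of strength 2 among them is [inf], which is not the south glue of any column. *)
Lemma L_exposed ws cs e g : lpair ws cs -> exposed (Lc ws cs) e g -> str g > 0 ->
  (e = DN /\ (g = inf \/ str g = 1)) \/ (e = DE /\ str g = 1).
Proof.
  intros L ([x y] & t & Hp & Hn & <-) S.
  destruct (lpair_row _ _ L) as [Rw Rc].
  assert (W0 : length ws > 0) by (destruct Rw as [(? & _ & ->)|(? & _ & ->)]; cbn; lia).
  assert (C0 : length cs > 0) by (destruct Rc as [(? & ->)|(? & _ & ->)]; cbn; lia).
  assert (Hn' := Hn). unfold padd in Hn'; cbn [fst snd] in Hn'. apply Lc_None in Hn' as [N1 N2].
  apply Lc_lookup in Hp as [(-> & Hx & Hk)|(-> & Hy & Hk)].
  - destruct (row_glues _ _ _ Rw Hk) as (G1 & G2 & G3 & G4).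
    assert (K : Z.to_nat x < length ws) by (apply nth_error_Some; congruence).
    destruct e; cbn in *.
    + left; split; auto. right. destruct G4 as (a & ? & G4); [|rewrite G4; auto].
      intros E. apply N2; repeat split; lia.
    + rewrite G3 in S; [|lia]. destruct (Nat.eq_dec (Datatypes.S (Z.to_nat x)) (length ws)); auto.
      exfalso; apply N1; repeat split; lia.
    + rewrite G1 in S; lia.
    + destruct G2 as [G2 _]; [|rewrite G2 in S; lia].
      destruct (Nat.eq_dec (Z.to_nat x) 0); auto. exfalso; apply N1; repeat split; lia.
  - destruct (col_glues _ _ _ Rc Hk) as (G1 & (q & Iq & G2) & G3 & G4).
    assert (K : Z.to_nat (y - 1) < length cs) by (apply nth_error_Some; congruence).
    destruct e; cbn in *.
    + left; split; auto. left. destruct G4 as [G|G]; auto; [|rewrite G in S; lia].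
      destruct (Nat.eq_dec (Datatypes.S (Z.to_nat (y - 1))) (length cs)); auto.
      exfalso; apply N2; repeat split; lia.
    + rewrite G2; auto.
    + exfalso. destruct (Z.eq_dec y 1) as [->|].
      * apply N1; repeat split; lia.
      * apply N2; repeat split; lia.
    + rewrite G1 in S; lia.
Qed.

Definition S1 (C : config) : Prop := terminal str 2 (singles RT) C \/ terminal str 2 (singles CT) C.

Lemma S1_good : good_init str 2 S1.
Proof. intros C [H|H]; eapply terminal_good; eauto; apply singles_good. Qed.

Lemma row_nonempty ws : row ws -> ws <> [].
Proof. intros [(? & _ & ->)|(? & _ & ->)]; discriminate. Qed.
Lemma col_nonempty ws : col ws -> ws <> [].
Proof. intros [(? & ->)|(? & _ & ->)]; discriminate. Qed.

Lemma produced_row ws : row ws -> produced str 2 S1 (segc DE 0 ws).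
Proof.
  intros R; eapply prod_init; [left; apply terminal_rows| |apply asm_eq_refl]; [split|]; eauto using asm_eq_refl.
  - apply segc_wf, row_nonempty; auto.
  - apply segc_wf, row_nonempty; auto.
Qed.

Lemma produced_col cs : col cs -> produced str 2 S1 (segc DN 0 cs).
Proof.
  intros R; eapply prod_init; [right; apply terminal_cols| |apply asm_eq_refl]; [split|]; eauto using asm_eq_refl.
  - apply segc_wf, col_nonempty; auto.
  - apply segc_wf, col_nonempty; auto.
Qed.

Lemma lpair_combine ws cs : lpair ws cs -> combinable str 2 (segc DE 0 ws) (segc DN 0 cs) (Lc ws cs).
Proof.
  intros L. destruct (lpair_row _ _ L) as [Rw Rc].
  pose proof (produced_good S1_good (produced_row _ Rw)) as [W1 St1].
  pose proof (produced_good S1_good (produced_col _ Rc)) as [W2 St2].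
  assert (E : segc DN 1 cs = shift (pat DN 1) (segc DN 0 cs)) by now rewrite segc_shift.
  unfold Lc; rewrite E. apply combinable_intro; auto.
  - rewrite -E; apply Lc_disj.
  - rewrite -E. 
    assert (X : exists t u ws' cs', ws = t :: ws' /\ cs = u :: cs' /\ tN t = tS u /\ str (tN t) = 2).
    { destruct L as [(bs & n & H & -> & ->)|(a & q & H & H' & -> & ->)];
      [exists tC0, tKbot|exists tC0', (tK' q)]; do 2 eexists; repeat split; cbn; auto. }
    destruct X as (t & u & ws' & cs' & -> & -> & G & S). cbn [segc].
    change ((pat DN 1, u) :: segc DN (1 + 1) cs') with ([(pat DN 1, u)] ++ segc DN (1 + 1) cs').
    rewrite cross_sym. unfold cross. rewrite lsum_app. 
    transitivity (cross str (segc DE 0 (t :: ws')) [(pat DN 1, u)]).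
    + apply (@cross_single_1 str _ (0, 0)%Z DN t); auto. cbn. lia.
    + rewrite cross_sym. unfold cross; cbn [segc]. lia.
Qed.

Lemma produced_L ws cs : lpair ws cs -> produced str 2 S1 (Lc ws cs).
Proof.
  intros L. destruct (lpair_row _ _ L) as [Rw Rc].
  exact (prod_comb (produced_row _ Rw) (produced_col _ Rc) (lpair_combine _ _ L)).
Qed.

Definition isrow C := exists ws, row ws /\ asm_eq (segc DE 0 ws) C.
Definition iscol C := exists cs, col cs /\ asm_eq (segc DN 0 cs) C.
Definition isL C := exists ws cs, lpair ws cs /\ asm_eq (Lc ws cs) C.

(** A column can be met from below only at its first tile, whose south glue has strength 2, while
    the north glues of a row are letters of strength 1 except at its first tile. So the joint is the
    corner. *)
Lemma row_col_combine ws cs C : row ws -> col cs -> combinable str 2 (segc DE 0 ws) (segc DN 0 cs) C ->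
  lpair ws cs /\ asm_eq (Lc ws cs) C.
Proof.
  intros Rw Rc H.
  assert (W1 := segc_wf DE 0 (row_nonempty _ Rw)). assert (W2 := segc_wf DN 0 (col_nonempty _ Rc)).
  destruct (combinable_rel W1 W2 H) as (e & D & E & _ & _ & K).
  destruct (@cross_pos str (segc DE 0 ws) (shift e (segc DN 0 cs))) as (p & d & t & u & Hp & Hq & G & S);
    [apply W1|apply NoDup_shift, W2|lia|].
  assert (d = DN) as ->.
  { apply (row_exposed ws d (glue d t) Rw); auto. exists p, t; repeat split; auto.
    apply not_in_cdom; intros I; apply (D _ I); rewrite in_cdom; congruence. }
  rewrite clookup_shift in Hq. apply segc_lookup in Hp as (k & Hk & ->). apply segc_lookup in Hq as (j & Hj & Ej).
  destruct (row_glues _ _ _ Rw Hk) as (G1 & G2 & G3 & G4). destruct (col_glues _ _ _ Rc Hj) as (F1 & F2 & F3 & F4).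
  assert (j = 0) as ->.
  { destruct (Nat.eq_dec j 0); auto. exfalso.
    apply (D (pat DE (0 + Z.of_nat k))).
    - apply segc_dom; exists k; split; auto. apply nth_error_Some; congruence.
    - rewrite cdom_shift in_map_iff. exists (pat DN (0 + Z.of_nat (j - 1))); split.
      + revert Ej. clear - n. rewrite !pat_DE !pat_DN; destruct e as [ex ey]; unfold padd, pneg; cbn [vec fst snd]; intros Ej; apply pair_equal_spec in Ej; f_equal; lia.
      + apply segc_dom; exists (j - 1); split; auto.
        assert (j < length cs) by (apply nth_error_Some; congruence). lia. }
  destruct (vert_neq) as (V1 & V2 & _).
  assert (k = 0) as ->.
  { destruct (Nat.eq_dec k 0) as [|Nk]; auto. exfalso. destruct (G4 Nk) as (a & Ia & Ga). cbn in G.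
    pose proof (str_gl a Ia) as Sa. rewrite -Ga G in Sa. destruct F3 as [F3|F3]; auto; rewrite F3 in Sa; lia. }
  assert (e = pat DN 1) as ->.
  { revert Ej; clear; rewrite !pat_DE !pat_DN; destruct e as [ex ey]; unfold padd, pneg; cbn [vec fst snd]; intros Ej; apply pair_equal_spec in Ej; f_equal; lia. }
  split.
  - destruct ws as [|t' ws']; [discriminate|]. destruct cs as [|u' cs']; [discriminate|].
    inversion Hk; inversion Hj; subst. eapply lpair_intro; eauto.
  - rewrite segc_shift in E. exact E.
Qed.

Lemma exp_clash CA CB C : wf_config CA -> wf_config CB -> combinable str 2 CA CB C ->
  (forall e g, exposed CA e g -> str g > 0 -> exposed CB (opp e) g -> False) -> False.
Proof.
  intros WA WB H K. destruct (@combinable_exposed str CA CB C 2) as (d & g & E1 & E2 & S); eauto.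
Qed.

Lemma L_inert CA CB C : isL CA -> isrow CB \/ iscol CB \/ isL CB -> combinable str 2 CA CB C -> False.
Proof.
  destruct (vert_neq) as (V1 & V2 & V3 & V4 & V5 & V6 & V7 & V8 & V9 & V10).
  intros (ws & cs & LA & EA) HB H.
  assert (WA : wf_config (Lc ws cs)) by (apply Lc_wf, row_nonempty; eapply lpair_row; eauto).
  destruct HB as [(w & LB & EB)|[(w & LB & EB)|(w & c & LB & EB)]];
    apply (combinable_asm_eq (asm_eq_sym EA) (asm_eq_sym EB)) in H.
  - refine (exp_clash _ _ _ WA (segc_wf _ _ (row_nonempty _ LB)) H _).
    intros e g X S Y; apply (L_exposed _ _ _ _ LA) in X; auto.
    apply (row_exposed _ _ _ LB) in Y; auto. destruct X as [[-> _]|[-> _]]; discriminate.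
  - refine (exp_clash _ _ _ WA (segc_wf _ _ (col_nonempty _ LB)) H _).
    intros e g X S Y; apply (L_exposed _ _ _ _ LA) in X; auto.
    apply (col_exposed _ _ _ LB) in Y; auto. destruct X as [[-> X]|[-> X]].
    + destruct Y as [[Y _]|[[Y _]|[_ Y]]]; try discriminate. destruct X as [->|X], Y as [->| ->]; try congruence; lia.
    + destruct Y as [[Y _]|[[Y _]|[Y _]]]; discriminate.
  - refine (exp_clash _ _ _ WA (Lc_wf _ _ (row_nonempty _ (proj1 (lpair_row _ _ LB)))) H _).
    intros e g X S Y; apply (L_exposed _ _ _ _ LA) in X; auto.
    apply (L_exposed _ _ _ _ LB) in Y; auto. destruct X as [[-> _]|[-> _]], Y as [[Y _]|[Y _]]; discriminate.
Qed.

Lemma S1_combine CA CB C : isrow CA \/ iscol CA \/ isL CA -> isrow CB \/ iscol CB \/ isL CB ->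
  combinable str 2 CA CB C -> isL C.
Proof.
  destruct (vert_neq) as (V1 & V2 & V3 & V4 & V5 & V6 & V7 & V8 & V9 & V10).
  intros HA HB H.
  destruct HA as [HA|[HA|HA]]; [| |destruct (L_inert _ _ _ HA HB H)];
  destruct HB as [HB|[HB|HB]]; try (destruct (L_inert _ _ _ HB (or_introl HA) (combinable_sym H)));
    try (destruct (L_inert _ _ _ HB (or_intror (or_introl HA)) (combinable_sym H))).
  - destruct HA as (w & LA & EA), HB as (w' & LB & EB).
    apply (combinable_asm_eq (asm_eq_sym EA) (asm_eq_sym EB)) in H. exfalso.
    eapply (exp_clash _ _ _ (segc_wf _ _ (row_nonempty _ LA)) (segc_wf _ _ (row_nonempty _ LB)) H).
    intros e g X S Y. apply (row_exposed _ _ _ LA) in X; apply (row_exposed _ _ _ LB) in Y; auto; subst; discriminate.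
  - destruct HA as (w & LA & EA), HB as (w' & LB & EB).
    apply (combinable_asm_eq (asm_eq_sym EA) (asm_eq_sym EB)) in H.
    apply row_col_combine in H as [? ?]; auto. exists w, w'; auto.
  - destruct HA as (w & LA & EA), HB as (w' & LB & EB).
    apply (combinable_asm_eq (asm_eq_sym EA) (asm_eq_sym EB)), combinable_sym in H.
    apply row_col_combine in H as [? ?]; auto. exists w', w; auto.
  - destruct HA as (w & LA & EA), HB as (w' & LB & EB).
    apply (combinable_asm_eq (asm_eq_sym EA) (asm_eq_sym EB)) in H. exfalso.
    eapply (exp_clash _ _ _ (segc_wf _ _ (col_nonempty _ LA)) (segc_wf _ _ (col_nonempty _ LB)) H).
    intros e g X S Y. apply (col_exposed _ _ _ LA) in X; apply (col_exposed _ _ _ LB) in Y; auto.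
    destruct X as [[-> ->]|[[-> X]|[-> X]]], Y as [[Y1 Y2]|[[Y1 Y2]|[Y1 Y2]]]; try discriminate; subst.
    + destruct Y2; congruence.
    + destruct X; congruence.
Qed.

Lemma produced_S1 C : produced str 2 S1 C -> isrow C \/ iscol C \/ isL C.
Proof.
  induction 1 as [CA C [T|T] W E|CA CB C PA IHA PB IHB H].
  - apply terminal_rows in T as (_ & ws & R & E'). left; exists ws; eauto using asm_eq_trans.
  - apply terminal_cols in T as (_ & ws & R & E'). right; left; exists ws; eauto using asm_eq_trans.
  - right; right. exact (S1_combine _ _ _ IHA IHB H).
Qed.

(** Every row has a column of its kind to join and conversely, so neither survives alone; L-shapes
    bond with nothing in this bin. *)
Lemma terminal_S1 C : terminal str 2 S1 C <-> wf_config C /\ isL C.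
Proof.
  split.
  - intros [P T]. split; [eapply produced_good; [apply S1_good|exact P]|].
    destruct (produced_S1 _ P) as [(ws & R & E)|[(cs & R & E)|?]]; auto; exfalso.
    + assert (X : exists cs, lpair ws cs).
      { destruct R as [(bs & Hp & ->)|(a & Ia & ->)].
        - exists (tKbot :: repeat tK0 0 ++ [tKtop]). left; eauto.
        - exists [tK' q0]; right; eauto 7. }
      destruct X as [cs X]. apply (T _ (produced_col cs (proj2 (lpair_row _ _ X)))).
      exists (Lc ws cs). eapply combinable_asm_eq; [exact E|apply asm_eq_refl|]. now apply lpair_combine.
    + assert (X : exists ws, lpair ws cs).
      { destruct R as [(n & ->)|(q & Iq & ->)].
        - destruct path_exists as [bs Hp]. exists (tC0 :: map tcell bs). left; eauto.
        - exists [tC0'; tcell (rho, errL true, 0)]; right; eauto 7. }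
      destruct X as [ws X]. apply (T _ (produced_row ws (proj1 (lpair_row _ _ X)))).
      exists (Lc ws cs). eapply combinable_asm_eq; [exact E|apply asm_eq_refl|]. now apply combinable_sym, lpair_combine.
  - intros (W & ws & cs & L & E). apply (terminal_asm_eq W E). split; [now apply produced_L|].
    intros B PB (D & HD). eapply L_inert; [|apply produced_S1; exact PB|exact HD].
    exists ws, cs; auto using asm_eq_refl.
Qed.

(** * Interior tiles and partly filled L-shapes *)

Lemma IT_inv t : In t IT -> exists q a, In q allQ /\ In a allA /\ tS t = gl a /\ tW t = gs q /\
  (top q = false -> exists a', In a' allA /\ tN t = gl a' /\ isEnd a' = isEnd a) /\
  (isEnd a = false -> exists q', In q' allQ /\ tE t = gs q' /\ top q' = top q) /\
  (isEnd a = true -> tE t = 0) /\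
  ((exists a' q', In (q, a, a', q') nrms /\ t = tnrm (q, a, a', q')) \/ t = ter (q, a)).
Proof.
  unfold IT; rewrite in_app_iff !in_map_iff; intros [([[[q a] a'] q'] & <- & I)|([q a] & <- & I)]; exists q, a.
  - destruct (nrms_ok _ _ _ _ I) as (H1 & H2 & H3 & H4 & H5 & H6 & _). cbn.
    repeat split; auto.
    + intros ->; eauto. + intros ->; eauto. + intros ->; eauto. + left; eauto.
  - apply in_prod_iff in I as [H1 H2]. cbn. repeat split; auto.
    + intros ->; exists (errL (isEnd a)); auto. + intros ->; exists (errS (top q)); auto. + intros ->; auto.
Qed.

Lemma IT_SW t : In t IT -> str (tS t) = 1 /\ str (tW t) = 1.
Proof. intros H; apply IT_inv in H as (q & a & ? & ? & -> & -> & _); auto. Qed.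

Lemma IT_inert t u d : In t IT -> In u IT -> glue d t = glue (opp d) u -> str (glue d t) <= 1.
Proof.
  intros It Iu G. destruct (IT_SW _ It) as [T1 T2], (IT_SW _ Iu) as [U1 U2].
  destruct d; cbn in *; first [lia|rewrite G; lia].
Qed.

Lemma ter_In q a : In q allQ -> In a allA -> In (ter (q, a)) IT.
Proof. intros; apply in_app_iff; right; apply in_map, in_prod; auto. Qed.

Lemma tnrm_In x : In x nrms -> In (tnrm x) IT.
Proof. intros; apply in_app_iff; left; now apply in_map. Qed.

(** The invariant of growth. The last clause records that every interior tile lies in the rectangle
    spanned by the two arms and agrees with both neighbours through which it was attached. *)
Definition filled (ws cs : list Tile) (C : config) : Prop :=
  lpair ws cs /\ NoDup (cdom C) /\
  (forall p t, clookup (Lc ws cs) p = Some t -> clookup C p = Some t) /\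
  (forall x y t, clookup C (x, y) = Some t -> clookup (Lc ws cs) (x, y) = Some t \/
     (In t IT /\ (1 <= x < Z.of_nat (length ws))%Z /\ (1 <= y <= Z.of_nat (length cs))%Z /\
      (exists tb, clookup C (x, y - 1)%Z = Some tb /\ tN tb = tS t) /\
      (exists tl, clookup C (x - 1, y)%Z = Some tl /\ tE tl = tW t))).

Lemma filled_L ws cs : lpair ws cs -> filled ws cs (Lc ws cs).
Proof. intros H; split; auto. split; [apply Lc_NoDup|]. auto. Qed.

Lemma lpair_len ws cs : lpair ws cs -> 2 <= length ws /\ 1 <= length cs.
Proof.
  intros [(bs & n & H & -> & ->)|(a & q & H & H' & -> & ->)]; cbn; [|lia].
  rewrite length_map; split; [|lia]. destruct bs; cbn; [|lia]. exfalso. revert H; now apply two_neq0.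
Qed.

Lemma filled_wf ws cs C : filled ws cs C -> wf_config C.
Proof.
  intros (L & N & H & _); split; auto. intros ->.
  destruct (lpair_len _ _ L) as [L1 _].
  destruct ws as [|t ws]; [cbn in L1; lia|]. specialize (H (0, 0)%Z t). cbn in H. discriminate H; auto.
Qed.

Lemma filled_exposed ws cs C e g : filled ws cs C -> exposed C e g -> str g > 0 -> e = DN \/ e = DE.
Proof.
  intros (L & N & H & F) ([x y] & t & Hp & Hn & G) S.
  destruct (F _ _ _ Hp) as [Hl|(It & Hx & Hy & (tb & Hb & _) & (tl & Hl & _))].
  - assert (K : exposed (Lc ws cs) e g).
    { exists (x, y), t; repeat split; auto. destruct (clookup (Lc ws cs) (padd (x, y) (vec e))) eqn:E; auto.
      apply H in E; congruence. }
    apply (L_exposed _ _ _ _ L) in K; tauto.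
  - destruct e; auto; rewrite ?padd_DS ?padd_DW in Hn; congruence.
Qed.

(** Exposed glues face north or east, so the new tile can bond only to the tile below and the tile
    on its left. Its south and west glues have strength 1, hence both bonds are present. *)
Lemma filled_attach ws cs C x y t : filled ws cs C -> In t IT -> clookup C (x, y) = None ->
  2 <= cross str C [((x, y), t)] -> filled ws cs (C ++ [((x, y), t)]).
Proof.
  intros HF It Hn X. pose proof HF as (L & N & H & F).
  destruct (IT_SW _ It) as [TS TW].
  set (f := fun a : pos * Tile => lsum (fun b : pos * Tile => pbond str (fst a) (snd a) (fst b) (snd b)) [((x, y), t)]).
  assert (Ef : forall p u, f (p, u) = pbond str p u (x, y) t).
  { intros; unfold f, lsum; cbn -[pbond]; lia. }
  assert (Kf : forall p u, In (p, u) C -> f (p, u) > 0 ->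
     (p = (x, y - 1)%Z /\ tN u = tS t \/ p = (x - 1, y)%Z /\ tE u = tW t) /\ f (p, u) = 1).
  { intros p u I Hf. rewrite Ef in Hf |- *. destruct (pbond_pos _ _ _ _ _ Hf) as (d & E & G & S & ->).
    assert (K : d = DN \/ d = DE).
    { apply (filled_exposed _ _ _ d (glue d u) HF); auto. exists p, u; split; [now apply In_clookup|].
      rewrite -E; auto. }
    destruct p as [px py]. destruct K as [-> | ->]; cbn [glue opp] in G |- *; rewrite ?padd_DN ?padd_DE in E;
      apply pair_equal_spec in E as [-> ->]; rewrite G; (split; [|auto]); [left|right]; split; auto; f_equal; lia. }
  (* The default [t] is a dummy for a missing neighbour: [lsum_two] returns that the pair belongs to
     [C], so the position is in fact occupied. *)
  set (a := ((x, y - 1)%Z, match clookup C (x, y - 1)%Z with Some u => u | None => t end)).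
  set (b := ((x - 1, y)%Z, match clookup C (x - 1, y)%Z with Some u => u | None => t end)).
  destruct (@lsum_two _ f C a b) as ([Ia Fa] & [Ib Fb] & _); [now apply (NoDup_map_inv fst)| | |exact X|].
  { intros [p u] I Hf. destruct (Kf _ _ I Hf) as ([[-> _]|[-> _]] & _); [left|right]; unfold a, b;
      rewrite (In_clookup _ _ _ N I); auto. }
  { intros [p u] I. destruct (f (p, u)) eqn:E; [lia|]. rewrite -E. destruct (Kf _ _ I) as [_ ->]; auto; lia. }
  unfold a in Ia, Fa; unfold b in Ib, Fb; clear a b.
  set (ub := match clookup C (x, y - 1)%Z with Some u => u | None => t end) in *.
  set (ul := match clookup C (x - 1, y)%Z with Some u => u | None => t end) in *.
  assert (Gb : tN ub = tS t).
  { destruct (Kf _ _ Ia Fa) as ([[_ G]|[G _]] & _); auto. apply pair_equal_spec in G; lia. }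
  assert (Gl : tE ul = tW t).
  { destruct (Kf _ _ Ib Fb) as ([[G _]|[_ G]] & _); auto. apply pair_equal_spec in G; lia. }
  apply (In_clookup _ _ _ N) in Ia. apply (In_clookup _ _ _ N) in Ib.
  destruct (lpair_row _ _ L) as [Rw Rc].
  (* The tile below bounds [x] and the tile on the left bounds [y]. Above the corner the glue would
     have strength 2 instead of 1; beyond an arm one of the two neighbours would be missing. *)
  assert (Bx : (1 <= x < Z.of_nat (length ws))%Z /\ (1 <= y <= Z.of_nat (length cs))%Z).
  { split.
    - destruct (F _ _ _ Ia) as [K|(_ & K & _)]; auto. apply Lc_lookup in K as [(E & Hx & K)|(E & Hy & K)].
      + destruct (row_glues _ _ _ Rw K) as (_ & G2 & _).
        assert (Z.to_nat x < length ws) by (apply nth_error_Some; congruence).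
        destruct (Nat.eq_dec (Z.to_nat x) 0) as [E0|]; [|lia]. exfalso. destruct (G2 E0) as [_ [G|G]];
        rewrite -Gb G in TS; lia.
      + exfalso. subst x. destruct (F _ _ _ Ib) as [K'|(_ & K' & _)]; [|lia].
        apply Lc_lookup in K'; lia.
    - destruct (F _ _ _ Ib) as [K|(_ & _ & K & _)]; auto. apply Lc_lookup in K as [(E & Hx & K)|(E & Hy & K)].
      + exfalso. subst y. destruct (F _ _ _ Ia) as [K'|(_ & _ & K' & _)]; [|lia].
        apply Lc_lookup in K'; lia.
      + assert (Z.to_nat (y - 1) < length cs) by (apply nth_error_Some; congruence). lia. }
  assert (Up : forall p u, clookup C p = Some u -> clookup (C ++ [((x, y), t)]) p = Some u).
  { intros p u E; rewrite clookup_app E //. }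
  split; [auto|split; [|split]].
  - apply NoDup_union; auto; [cbn; constructor; auto; constructor|].
    intros p Hp; cbn; intros [<-|[]]. now apply not_in_cdom in Hn.
  - intros p u Hu; auto.
  - intros x' y' t'. rewrite {1}clookup_app. destruct (clookup C (x', y')) as [u|] eqn:E.
    + intros E'; inversion E'; subst u. destruct (F _ _ _ E) as [K|(I' & Hx & Hy & (tb & Hb & Hb') & (tl & Hl & Hl'))]; auto.
      right; repeat split; auto; try lia; eauto.
    + rewrite clookup_cons. destruct (pos_eqbP (x, y) (x', y')) as [E'|]; [|discriminate].
      apply pair_equal_spec in E' as [<- <-]. intros E'; inversion E'; subst t'.
      right; repeat split; auto; try lia; eauto.
Qed.

Definition S2 (C : config) : Prop := terminal str 2 S1 C \/ terminal str 2 (singles IT) C.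

Lemma S2_good : good_init str 2 S2.
Proof. intros C [H|H]; eapply terminal_good; eauto; [apply S1_good|apply singles_good]. Qed.

Definition isF C := exists ws cs C0, filled ws cs C0 /\ asm_eq C0 C.
Definition isI C := exists t, In t IT /\ asm_eq [((0, 0)%Z, t)] C.

Lemma single_shift e t : shift e [((0, 0)%Z, t)] = [(e, t)].
Proof. cbn. do 2 f_equal. destruct e; unfold padd; cbn; f_equal; lia. Qed.

(** Two filled shapes expose glues only to the north and the east, and two interior tiles are too
    weak to bond, so growth proceeds one interior tile at a time. *)
Lemma S2_combine CA CB C : isF CA \/ isI CA -> isF CB \/ isI CB -> combinable str 2 CA CB C -> isF C.
Proof.
  assert (K : forall CA CB, isF CA -> isI CB -> combinable str 2 CA CB C -> isF C).
  { clear CA CB; intros CA CB (ws & cs & C0 & HF & E0) (t & It & E1) H.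
    apply (combinable_asm_eq (asm_eq_sym E0) (asm_eq_sym E1)) in H.
    apply combinable_rel in H as ([x y] & D & E & _ & _ & X); [|eapply filled_wf; eauto|apply wf_single].
    rewrite single_shift in D, E, X. exists ws, cs, (C0 ++ [((x, y), t)]); split; auto.
    apply filled_attach; auto. apply not_in_cdom; intros I; apply (D _ I); cbn; auto. }
  intros [HA|HA] [HB|HB] H; [|eauto|eauto using combinable_sym|].
  - exfalso. destruct HA as (ws & cs & C0 & HF & E0), HB as (ws' & cs' & C1 & HF' & E1).
    apply (combinable_asm_eq (asm_eq_sym E0) (asm_eq_sym E1)) in H.
    refine (exp_clash _ _ _ (filled_wf _ _ _ HF) (filled_wf _ _ _ HF') H _).
    intros e g X S Y. apply (filled_exposed _ _ _ _ _ HF) in X; auto. apply (filled_exposed _ _ _ _ _ HF') in Y; auto.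
    destruct X as [-> | ->], Y; discriminate.
  - exfalso. destruct HA as (t & It & E0), HB as (u & Iu & E1).
    apply (combinable_asm_eq (asm_eq_sym E0) (asm_eq_sym E1)) in H. revert H; apply inert_pair.
    intros d G; eapply IT_inert; eauto.
Qed.

Lemma produced_S2 C : produced str 2 S2 C -> isF C \/ isI C.
Proof.
  induction 1 as [CA C [T|T] W E|CA CB C PA IHA PB IHB H].
  - apply terminal_S1 in T as (_ & ws & cs & L & E'). left; exists ws, cs, (Lc ws cs).
    split; [now apply filled_L|eauto using asm_eq_trans].
  - apply inert_bin in T as (_ & t & It & E'); [|intros; eapply IT_inert; eauto].
    right; exists t; split; eauto using asm_eq_trans.
  - left; exact (S2_combine _ _ _ IHA IHB H).
Qed.

Lemma col_nonlast ws cs k t : lpair ws cs -> nth_error cs k = Some t -> S k < length cs -> tE t = gs q0.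
Proof.
  intros [(bs & n & H & -> & ->)|(a & q & H & H' & -> & ->)]; [|cbn; lia].
  rewrite app_comm_cons length_app; cbn [length]. intros E L.
  rewrite nth_error_app1 in E; [cbn in *; lia|].
  destruct k as [|k]; cbn in E; [inversion E; auto|].
  apply nth_error_In, repeat_spec in E; subst; auto.
Qed.

Lemma path_In g bs c : path g bs -> In c bs -> In c cells.
Proof.
  revert g; induction bs as [|[[w a] e] bs IH]; intros g; cbn; [tauto|].
  intros (_ & H & Hp) [<-|I]; eauto.
Qed.

Lemma path_letters g bs k w a e : path g bs -> nth_error bs k = Some (w, a, e) ->
  (S k < length bs -> isEnd a = false) /\ (S k = length bs -> isEnd a = true).
Proof.
  revert g k; induction bs as [|[[w' a'] e'] bs IH]; intros g k; [destruct k; discriminate|].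
  intros (-> & H & Hp). destruct k as [|k].
  - intros E; inversion E; subst. cbn. pose proof (cells_ok _ _ _ H) as (_ & _ & _ & _ & K & _).
    destruct bs as [|[[w1 a1] e1] bs]; cbn in *; split; try lia; intros _.
    + now apply K.
    + destruct (isEnd a) eqn:Ea; auto. rewrite (proj1 K) in Hp; auto. destruct Hp as (-> & H' & _).
      apply cells_ok in H' as (S' & _). rewrite str0 in S'; discriminate.
  - intros E. destruct (IH _ k Hp E) as [K1 K2]; cbn [length]. split; intros; [apply K1|apply K2]; lia.
Qed.

Lemma row_letters ws cs k t : lpair ws cs -> nth_error ws (S k) = Some t ->
  exists a, In a allA /\ tN t = gl a /\ (S (S k) < length ws -> isEnd a = false).
Proof.
  intros [(bs & n & H & -> & ->)|(a & q & H & H' & -> & ->)].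
  - cbn [nth_error length]. rewrite nth_error_map length_map.
    destruct (nth_error bs k) as [[[w a] e]|] eqn:E; [|discriminate]. intros E'; inversion E'; subst.
    exists a; split; [|split; auto].
    + apply nth_error_In in E. apply (path_In _ _ _ H) in E. apply cells_ok in E; tauto.
    + intros L. eapply path_letters; eauto. lia.
  - destruct k as [|[|]]; cbn; intros E; inversion E; subst. exists a; repeat split; auto. lia.
Qed.

Section Filled.
Variables (ws cs : list Tile) (C : config).
Hypothesis HF : filled ws cs C.
Let w := Z.of_nat (length ws).
Let h := Z.of_nat (length cs).

Lemma filled_inner x y t : clookup C (x, y) = Some t -> (1 <= x)%Z -> (1 <= y)%Z ->
  In t IT /\ (x < w)%Z /\ (y <= h)%Z /\
  (exists tb, clookup C (x, y - 1)%Z = Some tb /\ tN tb = tS t) /\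
  (exists tl, clookup C (x - 1, y)%Z = Some tl /\ tE tl = tW t).
Proof.
  destruct HF as (L & N & H & F). intros E Hx Hy.
  destruct (F _ _ _ E) as [K|(It & Hx' & Hy' & K1 & K2)]; [apply Lc_lookup in K; lia|].
  unfold w, h; repeat split; auto; lia.
Qed.

Lemma filled_col y t : clookup C (0%Z, y) = Some t -> (1 <= y)%Z -> nth_error cs (Z.to_nat (y - 1)) = Some t.
Proof.
  destruct HF as (L & N & H & F). intros E Hy.
  destruct (F _ _ _ E) as [K|(It & Hx' & _)]; [apply Lc_lookup in K; intuition lia|lia].
Qed.

Lemma filled_row x t : clookup C (x, 0%Z) = Some t -> (0 <= x)%Z /\ nth_error ws (Z.to_nat x) = Some t.
Proof.
  destruct HF as (L & N & H & F). intros E.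
  destruct (F _ _ _ E) as [K|(It & _ & Hx' & _)]; [apply Lc_lookup in K; intuition lia|lia].
Qed.

(** Both kinds of interior tiles preserve [top] from west to east, so the value supplied by the
    column reaches the whole row. In the same way [isEnd] is preserved from south to north in
    [filled_end]. *)
Lemma filled_top n x y t q : x = (1 + Z.of_nat n)%Z -> clookup C (x, y) = Some t -> (1 <= y < h)%Z ->
  tW t = gs q -> top q = false.
Proof.
  revert x t q; induction n as [|n IH]; intros x t q Ex E Hy Hq;
    destruct (filled_inner _ _ _ E) as (It & Hx & _ & _ & (tl & Hl & Gl)); try lia; rewrite Hq in Gl.
  - replace (x - 1)%Z with 0%Z in Hl by lia.
    apply filled_col in Hl; [|lia]. destruct HF as (L & _).
    rewrite (col_nonlast _ _ _ _ L Hl) in Gl; [unfold h in *; lia|]. apply gs_inj in Gl as <-; auto.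
  - destruct (filled_inner _ _ _ Hl) as (Il & _); try lia.
    destruct (IT_inv _ Il) as (ql & al & _ & _ & _ & Wl & _ & K1 & K2 & _).
    assert (T : top ql = false) by (apply (IH (x - 1)%Z tl); auto; lia).
    destruct (isEnd al).
    + rewrite K2 in Gl; auto. exfalso; eapply gs_neq0; eauto.
    + destruct K1 as (q' & _ & K & K'); auto. rewrite K in Gl; apply gs_inj in Gl as ->; congruence.
Qed.

Lemma filled_end n x y t a : y = (1 + Z.of_nat n)%Z -> clookup C (x, y) = Some t -> (1 <= x < w - 1)%Z -> (y <= h)%Z ->
  tS t = gl a -> isEnd a = false.
Proof.
  revert y t a; induction n as [|n IH]; intros y t a Ey E Hx Hy Ha;
    destruct (filled_inner _ _ _ E) as (It & _ & _ & (tb & Hb & Gb) & _); try lia; rewrite Ha in Gb.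
  - replace (y - 1)%Z with 0%Z in Hb by lia.
    apply filled_row in Hb as [_ Hb]. destruct HF as (L & _).
    replace (Z.to_nat x) with (S (Z.to_nat (x - 1))) in Hb by lia.
    destruct (row_letters _ _ _ _ L Hb) as (a' & _ & Ea & K). rewrite Ea in Gb; apply gl_inj in Gb as <-.
    apply K; unfold w in Hx; lia.
  - destruct (filled_inner _ _ _ Hb) as (Il & _); try lia.
    destruct (IT_inv _ Il) as (qb & ab & _ & _ & Sb & Wb & K1 & _ & _).
    assert (T : isEnd ab = false) by (apply (IH (y - 1)%Z tb); auto; lia).
    assert (T' : top qb = false).
    { apply (filled_top (Z.to_nat (x - 1)) x (y - 1)%Z tb); auto; lia. }
    destruct K1 as (a' & _ & K & K'); auto. rewrite K in Gb; apply gl_inj in Gb as ->; congruence.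
Qed.

Definition full : Prop := forall x y, (1 <= x < w)%Z -> (1 <= y <= h)%Z -> clookup C (x, y) <> None.

(** Take the lowest row with a gap and the leftmost gap in it: the tiles below and on the left are
    present and show a letter and a state, and the error tile of this pair fits. *)
Lemma not_full_extend : ~ full -> exists x y t, In t IT /\ clookup C (x, y) = None /\ 2 <= cross str C [((x, y), t)].
Proof.
  intros NF. pose proof HF as (L & N & H & F). destruct (lpair_row _ _ L) as [Rw Rc].
  set (P := fun m n => (1 + Z.of_nat n < w)%Z /\ (1 + Z.of_nat m <= h)%Z /\ clookup C (1 + Z.of_nat n, 1 + Z.of_nat m)%Z = None).
  destruct (least (fun m => exists n, P m n)) as (m & [n0 Hm] & Lm).
  { apply NNPP; intros K. apply NF. intros x y Hx Hy E. apply K. exists (Z.to_nat (y - 1)), (Z.to_nat (x - 1)).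
    unfold P. rewrite !Z2Nat.id; try lia. replace (1 + (x - 1))%Z with x by lia. replace (1 + (y - 1))%Z with y by lia.
    repeat split; auto; lia. }
  destruct (least (P m)) as (n & (Hx & Hy & E) & Ln); [eauto|].
  set (x := (1 + Z.of_nat n)%Z) in *. set (y := (1 + Z.of_nat m)%Z) in *.
  assert (Hb : exists tb a, clookup C (x, y - 1)%Z = Some tb /\ In a allA /\ tN tb = gl a).
  { destruct m as [|m].
    - destruct (nth_error ws (S n)) as [tb|] eqn:Eb.
      + destruct (row_letters _ _ _ _ L Eb) as (a & Ia & Ea & _). exists tb, a; split; auto.
        apply H, Lc_lookup. left; split; [lia|split; [lia|]]. rewrite -Eb; f_equal; lia.
      + apply nth_error_None in Eb. unfold w in Hx; lia.
    - destruct (clookup C (x, y - 1)%Z) as [tb|] eqn:Eb.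
      + destruct (filled_inner _ _ _ Eb) as (Il & _); try lia.
        destruct (IT_inv _ Il) as (qb & ab & _ & _ & Sb & Wb & K1 & _ & _).
        destruct K1 as (a' & Ia' & K & _); [|eauto].
        apply (filled_top n x (y - 1)%Z tb); auto; lia.
      + exfalso. apply (Lm m); auto. exists n; unfold P; repeat split; auto; try lia.
        rewrite -Eb; do 2 f_equal; lia. }
  assert (Hl : exists tl q, clookup C (x - 1, y)%Z = Some tl /\ In q allQ /\ tE tl = gs q).
  { destruct n as [|n].
    - destruct (nth_error cs m) as [tl|] eqn:El.
      + destruct (col_glues _ _ _ Rc El) as (_ & (q & Iq & Eq) & _). exists tl, q; split; auto.
        apply H, Lc_lookup. right; split; [lia|split; [lia|]]. rewrite -El; f_equal; lia.
      + apply nth_error_None in El. unfold h in Hy; lia.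
    - destruct (clookup C (x - 1, y)%Z) as [tl|] eqn:El.
      + destruct (filled_inner _ _ _ El) as (Il & _); try lia.
        destruct (IT_inv _ Il) as (ql & al & _ & _ & Sb & Wb & _ & K1 & _).
        destruct K1 as (q' & Iq' & K & _); [|eauto].
        apply (filled_end m (x - 1) y tl); auto; lia.
      + exfalso. apply (Ln n); auto. unfold P; repeat split; auto; try lia.
        rewrite -El; do 2 f_equal; lia. }
  destruct Hb as (tb & a & Hb & Ia & Ga), Hl as (tl & q & Hl & Iq & Gq).
  exists x, y, (ter (q, a)); split; [now apply ter_In|split; [auto|]].
  pose proof (str_gl a Ia) as Sa. pose proof (str_gs q Iq) as Sq.
  apply (@cross_single_2 str C (x, y - 1)%Z DN tb (x - 1, y)%Z DE tl); auto; cbn [glue opp]; try (rewrite ?Ga ?Gq; cbn; lia).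
  - rewrite padd_DN; f_equal; lia.
  - rewrite padd_DE; f_equal; lia.
  - discriminate.
Qed.

End Filled.

Lemma produced_IT t : In t IT -> produced str 2 S2 [((0, 0)%Z, t)].
Proof.
  intros It; eapply prod_init; [right; apply inert_bin; [intros; eapply IT_inert; eauto|]| |apply asm_eq_refl]; auto using wf_single.
  split; [apply wf_single|exists t; auto using asm_eq_refl].
Qed.

(** A filled shape with a gap is extended by an error tile. A lone interior tile is never terminal,
    since the spurious L-shape made from its own two input glues accepts it. *)
Lemma terminal_S2 C : terminal str 2 S2 C -> exists ws cs C0, filled ws cs C0 /\ full ws cs C0 /\ asm_eq C0 C.
Proof.
  intros [P T]. destruct (produced_good S2_good P) as [W St].
  destruct (produced_S2 _ P) as [(ws & cs & C0 & HF & E)|(t & It & E)].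
  - exists ws, cs, C0; split; auto. split; auto. apply NNPP; intros NF.
    destruct (not_full_extend _ _ _ HF NF) as (x & y & t & It & Hn & X).
    apply (T _ (produced_IT _ It)).
    destruct (@combinable_single str C0 (x, y) t) as [D HD]; auto.
    + eapply filled_wf; eauto.
    + eapply stable_asm_eq; [apply W|apply (filled_wf _ _ _ HF)|apply asm_eq_sym; exact E|exact St].
    + exists D. eapply combinable_asm_eq; [exact E|apply asm_eq_refl|exact HD].
  - exfalso. destruct (IT_inv _ It) as (q & a & Iq & Ia & Ga & Gq & _).
    assert (L : lpair [tC0'; tcell (rho, a, 0)] [tK' q]) by (right; eauto 7).
    assert (PL : produced str 2 S2 (Lc [tC0'; tcell (rho, a, 0)] [tK' q])).
    { eapply prod_init; [left; apply terminal_S1; split| |apply asm_eq_refl]; try (apply Lc_wf; discriminate).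
      do 2 eexists; split; [exact L|apply asm_eq_refl]. }
    apply (T _ PL).
    destruct (@combinable_single str (Lc [tC0'; tcell (rho, a, 0)] [tK' q]) (1, 1)%Z t) as [D HD]; auto.
    + apply Lc_wf; discriminate.
    + eapply produced_good; [apply S2_good|exact PL].
    + apply (@cross_single_2 str _ (1, 0)%Z DN (tcell (rho, a, 0)) (0, 1)%Z DE (tK' q)); auto; cbn; auto; try discriminate.
      * rewrite str_gl; auto.
      * rewrite str_gs; auto.
    + exists D. eapply combinable_asm_eq; [exact E|apply asm_eq_refl|]. now apply combinable_sym.
Qed.

(** * Full rectangles as computations *)

Fixpoint run (q : Q) (u v : list A) : Prop :=
  match u, v with
  | [], [] => True
  | a :: u', a' :: v' => exists q', In (q, a, a', q') nrms /\ run q' u' v'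
  | _, _ => False
  end.

Fixpoint rsteps (n : nat) (u v : list A) : Prop :=
  match n with 0 => u = v | S n' => exists u', run q0 u u' /\ rsteps n' u' v end.

Definition letters (bs : list (nat * A * nat)) : list A := map (fun c => snd (fst c)) bs.

(** A column with [n] copies of [tK0] has height [n + 2]: it starts [n + 1] rows in [q0] and the top
    row in [qT]. *)
Definition accepting : Prop := exists bs n v v', path gL bs /\ rsteps (S n) (letters bs) v /\ run qT v v'.

(** Asking for a topmost tile guarantees a free place above it, and this property, unlike mere
    exposure, survives combination. *)
Definition expTop (C : config) : Prop := exists p t, clookup C p = Some t /\
  (forall q, In q (cdom C) -> (snd q <= snd p)%Z) /\ (tN t = inf \/ tN t = inf2).

Definition closed (C : config) : Prop := forall d g, exposed C d g -> str g = 0.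

Section Full.
Variables (bs : list (nat * A * nat)) (n : nat) (C : config).
Hypothesis Hp : path gL bs.
Let ws := tC0 :: map tcell bs.
Let cs := tKbot :: repeat tK0 n ++ [tKtop].
Hypothesis HF : filled ws cs C.
Hypothesis HC : full ws cs C.
Let w := Z.of_nat (length bs).
Let h := Z.of_nat (n + 2).

Lemma real_w : Z.of_nat (length ws) = (w + 1)%Z.
Proof. unfold ws, w; cbn [length]; rewrite length_map; lia. Qed.
Lemma real_h : Z.of_nat (length cs) = h.
Proof. unfold cs, h; cbn [length]; rewrite length_app repeat_length; cbn [length]; lia. Qed.

Lemma real_inner x y : (1 <= x <= w)%Z -> (1 <= y <= h)%Z -> exists t, clookup C (x, y) = Some t /\ In t IT /\
  (exists tb, clookup C (x, y - 1)%Z = Some tb /\ tN tb = tS t) /\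
  (exists tl, clookup C (x - 1, y)%Z = Some tl /\ tE tl = tW t).
Proof.
  intros Hx Hy. pose proof real_w; pose proof real_h.
  destruct (clookup C (x, y)) as [t|] eqn:E; [|apply HC in E; lia].
  exists t; split; auto. destruct (filled_inner _ _ _ HF _ _ _ E) as (K1 & _ & _ & K2 & K3); try lia; auto.
Qed.

Lemma real_L p t : clookup (Lc ws cs) p = Some t -> clookup C p = Some t.
Proof. apply HF. Qed.

Lemma real_row x : (1 <= x <= w)%Z -> exists wl a e, clookup C (x, 0%Z) = Some (tcell (wl, a, e)) /\
  nth_error bs (Z.to_nat (x - 1)) = Some (wl, a, e).
Proof.
  intros Hx. destruct (nth_error bs (Z.to_nat (x - 1))) as [[[wl a] e]|] eqn:E.
  - exists wl, a, e; split; auto. apply real_L, Lc_lookup. left; split; [auto|split; [lia|]].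
    replace (Z.to_nat x) with (S (Z.to_nat (x - 1))) by lia. unfold ws; cbn [nth_error].
    rewrite nth_error_map E; auto.
  - apply nth_error_None in E; unfold w in Hx; lia.
Qed.

Lemma real_col y : (1 <= y <= h)%Z -> exists t, clookup C (0%Z, y) = Some t /\
  ((y < h)%Z -> tE t = gs q0) /\ (y = h -> t = tKtop).
Proof.
  intros Hy. pose proof real_h.
  destruct (nth_error cs (Z.to_nat (y - 1))) as [t|] eqn:E.
  - exists t; split; [apply real_L, Lc_lookup; right; repeat split; auto; lia|]. split.
    + intros L. apply (col_nonlast ws cs (Z.to_nat (y - 1)) t); auto; [apply HF|lia].
    + intros ->. unfold cs in E. rewrite app_comm_cons in E. rewrite nth_error_app2 in E;
        [cbn [length]; rewrite repeat_length; unfold h; lia|]. cbn [length] in E; rewrite repeat_length in E.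
      replace (Z.to_nat (h - 1) - S n) with 0 in E by (unfold h; lia). inversion E; auto.
  - apply nth_error_None in E. lia.
Qed.

Lemma real_end k y t a : y = (1 + Z.of_nat k)%Z -> (y <= h)%Z -> (1 <= w)%Z -> clookup C (w, y) = Some t ->
  tS t = gl a -> isEnd a = true.
Proof.
  revert y t a; induction k as [|k IH]; intros y t a Ey Hy Hw E Ha;
    destruct (real_inner w y) as (t' & E' & It & (tb & Hb & Gb) & _); try lia;
    rewrite E in E'; inversion E'; subst t'; rewrite Ha in Gb.
  - replace (y - 1)%Z with 0%Z in Hb by lia.
    destruct (real_row w) as (wl & a' & e & Hr & Hn); [lia|]. rewrite Hr in Hb; inversion Hb; subst tb.
    cbn in Gb; apply gl_inj in Gb as <-. eapply path_letters; eauto. unfold w in *; lia.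
  - destruct (real_inner w (y - 1)) as (t' & E'' & Ib & _); try lia.
    rewrite Hb in E''; inversion E''; subst t'.
    destruct (IT_inv _ Ib) as (qb & ab & _ & _ & Sb & Wb & K1 & _ & _).
    assert (T : isEnd ab = true) by (apply (IH (y - 1)%Z tb); auto; lia).
    assert (T' : top qb = false).
    { pose proof real_h. apply (filled_top _ _ _ HF (Z.to_nat (w - 1)) w (y - 1)%Z tb); auto; lia. }
    destruct K1 as (a' & _ & K & K'); auto. rewrite K in Gb; apply gl_inj in Gb as ->; congruence.
Qed.

Lemma real_top k x t q : x = (1 + Z.of_nat k)%Z -> (x <= w)%Z -> clookup C (x, h) = Some t ->
  tW t = gs q -> top q = true.
Proof.
  pose proof real_w; pose proof real_h.
  revert x t q; induction k as [|k IH]; intros x t q Ex Hx E Hq;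
    destruct (real_inner x h) as (t' & E' & It & _ & (tl & Hl & Gl)); try (unfold h; lia);
    rewrite E in E'; inversion E'; subst t'; rewrite Hq in Gl.
  - replace (x - 1)%Z with 0%Z in Hl by lia.
    destruct (real_col h) as (t' & E'' & _ & K); [unfold h; lia|]. rewrite E'' in Hl; inversion Hl; subst t'.
    rewrite K in Gl; auto. cbn in Gl; apply gs_inj in Gl as <-; auto.
  - destruct (real_inner (x - 1) h) as (t' & E'' & Ib & _); try (unfold h; lia).
    rewrite Hl in E''; inversion E''; subst t'.
    destruct (IT_inv _ Ib) as (ql & al & _ & _ & Sl & Wl & _ & K1 & _).
    assert (T : top ql = true) by (apply (IH (x - 1)%Z tl); auto; lia).
    assert (T' : isEnd al = false).
    { apply (filled_end _ _ _ HF (Z.to_nat (h - 1)) (x - 1)%Z h tl); auto; unfold h in *; lia. }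
    destruct K1 as (q' & _ & K & K'); auto. rewrite K in Gl; apply gs_inj in Gl as ->; congruence.
Qed.

Lemma w_pos : (1 <= w)%Z.
Proof. unfold w. destruct bs; cbn; [|lia]. exfalso; revert Hp; cbn; now apply two_neq0. Qed.

Lemma bound_y q : In q (cdom C) -> (snd q <= h)%Z.
Proof.
  rewrite in_cdom_ex; intros [t E]. destruct q as [x y]; cbn. pose proof real_h.
  destruct HF as (_ & _ & _ & F). destruct (F _ _ _ E) as [K|(_ & _ & K & _)]; [|lia].
  apply Lc_lookup in K as [K|(_ & _ & K)]; [unfold h; lia|].
  assert (Z.to_nat (y - 1) < length cs) by (apply nth_error_Some; congruence). lia.
Qed.

Definition isnrm (t : Tile) : Prop := exists c, In c nrms /\ t = tnrm c.

(** The letter and the state that arrive at the north-east corner carry [isEnd] and [top]. An error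
    tile there shows [inf] on the upper boundary. *)
Lemma corner_case : expTop C \/ exists t, clookup C (w, h) = Some t /\ isnrm t.
Proof.
  pose proof w_pos. destruct (real_inner w h) as (t & E & It & _); [lia|unfold h; lia|].
  destruct (IT_inv _ It) as (q & a & _ & _ & Sa & Wq & _ & _ & _ & [(a' & q' & I & ->)| ->]).
  - right. exists (tnrm (q, a, a', q')); split; auto. exists (q, a, a', q'); auto.
  - left. exists (w, h), (ter (q, a)); split; auto. split; [intros; now apply bound_y|]. left.
    assert (T : top q = true) by (apply (real_top (Z.to_nat (w - 1)) w (ter (q, a))); auto; lia).
    assert (T' : isEnd a = true) by (apply (real_end (Z.to_nat (h - 1)) h (ter (q, a))); auto; unfold h in *; lia).
    cbn; rewrite T T'; auto.
Qed.

(** The last column hands nothing to the east and the top row nothing to the north, except [inf]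
    from an error tile at the corner, which the hypothesis excludes. The column ends with [tKtop],
    whose north glue is null. *)
Lemma real_closed : (exists t, clookup C (w, h) = Some t /\ isnrm t) -> closed C.
Proof.
  intros (tc & Ec & Nc) d g X. destruct (Nat.eq_dec (str g) 0) as [|S0]; auto. exfalso.
  assert (S : str g > 0) by lia. clear S0.
  pose proof real_w; pose proof real_h; pose proof w_pos.
  assert (Fi : forall x y, (1 <= x <= w)%Z -> (1 <= y <= h)%Z -> clookup C (x, y) = None -> False).
  { intros x y Hx Hy E; apply HC in E; lia. }
  assert (Fc : forall y, (1 <= y <= h)%Z -> clookup C (0%Z, y) = None -> False).
  { intros y Hy E. destruct (real_col y Hy) as (t & E' & _); congruence. }
  assert (Fr : forall x, (1 <= x <= w)%Z -> clookup C (x, 0%Z) = None -> False).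
  { intros y Hy E. destruct (real_row y Hy) as (t & E' & ? & ? & _); congruence. }
  pose proof (filled_exposed _ _ _ _ _ HF X S) as D.
  destruct X as ([x y] & t & E & En & <-).
  destruct HF as (L & _ & _ & F).
  destruct (F _ _ _ E) as [K|(It & Hx & Hy & _)].
  - apply Lc_lookup in K as [(-> & Hx & K)|(-> & Hy & K)].
    + assert (Z.to_nat x < length ws) by (apply nth_error_Some; congruence).
      destruct D as [-> | ->]; rewrite ?padd_DN ?padd_DE in En.
      * destruct (Z.eq_dec x 0) as [->|]; [apply (Fc 1%Z); auto; unfold h; lia|].
        apply (Fi x 1%Z); auto; unfold h in *; lia.
      * destruct (row_glues _ _ _ (proj1 (lpair_row _ _ L)) K) as (_ & _ & G3 & _).
        cbn in S. destruct (Z.eq_dec x w) as [->|].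
        -- rewrite G3 in S; lia.
        -- apply (Fr (x + 1)%Z); auto; lia.
    + assert (Z.to_nat (y - 1) < length cs) by (apply nth_error_Some; congruence).
      destruct D as [-> | ->]; rewrite ?padd_DN ?padd_DE in En.
      * destruct (Z.eq_dec y h) as [->|]; [|apply (Fc (y + 1)%Z); auto; lia].
        destruct (real_col h) as (t' & E' & _ & K'); [lia|]. rewrite E in E'; inversion E'; subst t'.
        rewrite (K' eq_refl) in S; cbn in S; lia.
      * apply (Fi 1%Z y); auto; lia.
  - destruct (IT_inv _ It) as (q & a & _ & _ & Sa & Wq & _ & _ & KE & Kt).
    destruct D as [-> | ->]; rewrite ?padd_DN ?padd_DE in En; cbn in S.
    + destruct (Z.eq_dec y h) as [->|]; [|apply (Fi x (y + 1)%Z); auto; lia].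
      assert (T : top q = true) by (apply (real_top (Z.to_nat (x - 1)) x t); auto; lia).
      destruct Kt as [(a' & q' & _ & ->)| ->]; cbn in S; rewrite T in S; [lia|].
      destruct (Z.eq_dec x w) as [->|].
      (* The corner tile would have both forms [ter] and [tnrm]. Its north glue is then [inf] on the
         one hand and 0 or a letter glue on the other, and the strengths differ. *)
      * rewrite E in Ec; inversion Ec; subst tc. destruct Nc as ([[[q1 a1] a2] q2] & I & N).
        apply (f_equal tN) in N; cbn in N; rewrite T in N.
        assert (T' : isEnd a = true) by (apply (real_end (Z.to_nat (h - 1)) h (ter (q, a))); auto; unfold h in *; lia).
        rewrite T' in N, S.
        assert (T1 : top q1 = true).
        { assert (Q1 : tW (ter (q, a)) = gs q1).
          { destruct (Nat.eq_dec (gs q) (gs q1)); auto. exfalso. destruct (top q1) eqn:T1.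
            - revert N; apply two_neq0; auto.
            - pose proof (str_gl a2) as K; rewrite -N in K. pose proof (nrms_ok _ _ _ _ I) as (_ & _ & Ia2 & _). specialize (K Ia2); lia. }
          apply (real_top (Z.to_nat (w - 1)) w (ter (q, a))); auto; lia. }
        rewrite T1 in N. revert N; apply two_neq0; auto.
      * assert (T' : isEnd a = false).
        { apply (filled_end _ _ _ HF (Z.to_nat (h - 1)) x h (ter (q, a))); auto; unfold h in *; lia. }
        rewrite T' in S; lia.
    + destruct (Z.eq_dec x w) as [->|]; [|apply (Fi (x + 1)%Z y); auto; lia].
      rewrite KE in S; [|lia]. apply (real_end (Z.to_nat (y - 1)) y t); auto; lia.
Qed.

(** An error tile hands an error state to the east, which no normal transition reads; so normality
    passes from a tile to its western neighbour. [nrm_up] is the same with letters, and together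
    they spread normality from the corner over the rectangle. *)
Lemma nrm_right x y : (1 <= x < w)%Z -> (1 <= y <= h)%Z ->
  (exists t, clookup C (x + 1, y)%Z = Some t /\ isnrm t) -> exists t, clookup C (x, y) = Some t /\ isnrm t.
Proof.
  intros Hx Hy (t & E & [[[q a] a'] q'] & I & ->). pose proof real_w; pose proof real_h.
  destruct (real_inner (x + 1) y) as (t' & E' & _ & _ & (tl & Hl & Gl)); try lia.
  rewrite E in E'; inversion E'; subst t'. replace (x + 1 - 1)%Z with x in Hl by lia.
  exists tl; split; auto. destruct (real_inner x y) as (t' & E'' & It & _); try lia.
  rewrite Hl in E''; inversion E''; subst t'.
  destruct (IT_inv _ It) as (ql & al & _ & _ & Sl & _ & _ & _ & _ & [(a1 & q1 & I' & ->)| ->]).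
  - exists (ql, al, a1, q1); auto.
  - exfalso. assert (T' : isEnd al = false).
    { apply (filled_end _ _ _ HF (Z.to_nat (y - 1)) x y (ter (ql, al))); auto; unfold h in *; lia. }
    cbn in Gl; rewrite T' in Gl. apply gs_inj in Gl. apply nrms_ok in I as (_ & _ & _ & _ & _ & _ & _ & K).
    eapply K; eauto.
Qed.

Lemma nrm_up x y : (1 <= x <= w)%Z -> (1 <= y < h)%Z ->
  (exists t, clookup C (x, y + 1)%Z = Some t /\ isnrm t) -> exists t, clookup C (x, y) = Some t /\ isnrm t.
Proof.
  intros Hx Hy (t & E & [[[q a] a'] q'] & I & ->). pose proof real_w; pose proof real_h.
  destruct (real_inner x (y + 1)) as (t' & E' & _ & (tl & Hl & Gl) & _); try lia.
  rewrite E in E'; inversion E'; subst t'. replace (y + 1 - 1)%Z with y in Hl by lia.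
  exists tl; split; auto. destruct (real_inner x y) as (t' & E'' & It & _); try lia.
  rewrite Hl in E''; inversion E''; subst t'.
  destruct (IT_inv _ It) as (ql & al & _ & _ & Sl & _ & _ & _ & _ & [(a1 & q1 & I' & ->)| ->]).
  - exists (ql, al, a1, q1); auto.
  - exfalso. assert (T' : top ql = false).
    { apply (filled_top _ _ _ HF (Z.to_nat (x - 1)) x y (ter (ql, al))); auto; unfold h in *; lia. }
    cbn in Gl; rewrite T' in Gl. apply gl_inj in Gl. apply nrms_ok in I as (_ & _ & _ & _ & _ & _ & K & _).
    eapply K; eauto.
Qed.

Hypothesis HN : exists t, clookup C (w, h) = Some t /\ isnrm t.

Lemma all_nrm i j x y : x = (w - Z.of_nat i)%Z -> y = (h - Z.of_nat j)%Z -> (1 <= x)%Z -> (1 <= y)%Z ->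
  exists t, clookup C (x, y) = Some t /\ isnrm t.
Proof.
  revert x y i; induction j as [|j IHj]; intros x y i -> ->.
  - induction i as [|i IHi]; intros Hx Hy.
    + replace (w - Z.of_nat 0)%Z with w by lia. replace (h - Z.of_nat 0)%Z with h by lia. auto.
    + apply nrm_right; try lia. replace (w - Z.of_nat (S i) + 1)%Z with (w - Z.of_nat i)%Z by lia. apply IHi; lia.
  - intros Hx Hy. apply nrm_up; try lia. apply (IHj _ _ i); lia.
Qed.

Definition shows (x y : Z) (u : list A) : Prop :=
  forall i a, nth_error u i = Some a -> exists t, clookup C (x + Z.of_nat i, y)%Z = Some t /\ tN t = gl a.

(** Since [gl] and [gs] are injective, equal glues on shared edges mean equal letters and states, so
    consecutive normal tiles compose to a run. *)
Lemma read_row u x y q : (1 <= x)%Z -> (1 <= y <= h)%Z -> (x + Z.of_nat (length u) = w + 1)%Z ->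
  shows x (y - 1) u -> (exists tl, clookup C (x - 1, y)%Z = Some tl /\ tE tl = gs q) ->
  exists u', length u' = length u /\ run q u u' /\ ((y < h)%Z -> shows x y u').
Proof.
  pose proof real_w; pose proof real_h.
  revert x q; induction u as [|a u IH]; intros x q Hx Hy Hl Hs (tl & El & Gl).
  - exists []; cbn; repeat split; auto. intros _ i a; destruct i; discriminate.
  - cbn [length] in Hl. destruct (all_nrm (Z.to_nat (w - x)) (Z.to_nat (h - y)) x y) as (t & E & [[[q1 a1] a'] q'] & I & ->); try lia.
    destruct (real_inner x y) as (t' & E' & It & (tb & Hb & Gb) & (tl' & Hl' & Gl')); try lia.
    rewrite E in E'; inversion E'; subst t'. rewrite El in Hl'; inversion Hl'; subst tl'.
    destruct (Hs 0 a eq_refl) as (tb' & Hb' & Gb'). rewrite Z.add_0_r Hb in Hb'; inversion Hb'; subst tb'.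
    cbn in Gb, Gl'. rewrite Gb' in Gb; apply gl_inj in Gb as <-. rewrite Gl in Gl'; apply gs_inj in Gl' as <-.
    assert (T : (y < h)%Z -> top q = false).
    { intros Hh. apply (filled_top _ _ _ HF (Z.to_nat (x - 1)) x y (tnrm (q, a, a', q'))); auto; unfold h in *; lia. }
    destruct u as [|b u].
    + exists [a']; split; [auto|split; [exists q'; cbn; auto|]]. intros Hh [|i] c; [|destruct i; discriminate].
      intros Ec; inversion Ec; subst c. rewrite Z.add_0_r. exists (tnrm (q, a, a', q')); split; auto. cbn; rewrite T; auto.
    + destruct (IH (x + 1)%Z q') as (u' & Lu & Ru & Su); try lia.
      * intros i c Hc. destruct (Hs (S i) c Hc) as (t & Et & Gt). exists t; split; auto. rewrite -Et; do 2 f_equal; lia.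
      * exists (tnrm (q, a, a', q')). replace (x + 1 - 1)%Z with x by lia. split; auto.
        assert (T' : isEnd a = false).
        { cbn [length] in Hl. apply (filled_end _ _ _ HF (Z.to_nat (y - 1)) x y (tnrm (q, a, a', q'))); auto; unfold h in *; lia. }
        cbn; rewrite T'; auto.
      * exists (a' :: u'); split; [cbn in *; lia|]. split; [exists q'; auto|].
        intros Hh [|i] c.
        -- intros Ec; inversion Ec; subst c. rewrite Z.add_0_r. exists (tnrm (q, a, a', q')); split; auto. cbn; rewrite T; auto.
        -- intros Hc. destruct (Su Hh i c Hc) as (t & Et & Gt). exists t; split; auto. rewrite -Et; do 2 f_equal; lia.
Qed.

Lemma read_rows k u y : (1 <= y)%Z -> (y + Z.of_nat k = h)%Z -> Z.of_nat (length u) = w -> shows 1 (y - 1) u ->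
  exists v v', rsteps k u v /\ run qT v v'.
Proof.
  revert u y; induction k as [|k IH]; intros u y Hy Hk Lu Su.
  - destruct (read_row u 1 y qT) as (u' & _ & R & _); auto; try lia.
    + destruct (real_col y) as (t & E & _ & K); [lia|]. exists t; split; auto. rewrite K; auto; lia.
    + exists u, u'; cbn; auto.
  - destruct (read_row u 1 y q0) as (u' & Lu' & R & S'); auto; try lia.
    + destruct (real_col y) as (t & E & K & _); [lia|]. exists t; split; auto. rewrite K; auto; lia.
    + destruct (IH u' (y + 1)%Z) as (v & v' & R1 & R2); try lia.
      * replace (y + 1 - 1)%Z with y by lia. apply S'; lia.
      * exists v, v'; split; auto. exists u'; auto.
Qed.

Lemma real_accepting : accepting.
Proof.
  destruct (read_rows (S n) (letters bs) 1%Z) as (v & v' & R1 & R2); try (unfold h; lia).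
  - unfold letters; rewrite length_map; auto.
  - intros i a Ha. unfold letters in Ha; rewrite nth_error_map in Ha.
    destruct (nth_error bs i) as [c|] eqn:E; [|discriminate]. inversion Ha; subst a.
    assert (i < length bs) by (apply nth_error_Some; congruence).
    destruct (real_row (1 + Z.of_nat i)) as (wl & a' & e & Hr & Hn); [unfold w; lia|].
    replace (Z.to_nat (1 + Z.of_nat i - 1)) with i in Hn by lia. rewrite E in Hn; inversion Hn; subst c.
    eexists; split; [exact Hr|auto].
  - exists bs, n, v, v'; auto.
Qed.

End Full.

(** A spurious L-shape has height 1 above its row, so the [inf] on top of its column is already
    topmost, whatever fills the interior. *)
Lemma full_cases ws cs C : filled ws cs C -> full ws cs C -> expTop C \/ (closed C /\ accepting).
Proof.
  intros HF HC. pose proof HF as (L & N & H & F).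
  destruct L as [(bs & n & Hp & -> & ->)|(a & q & Ha & Hq & -> & ->)].
  - destruct (corner_case bs n C Hp HF HC) as [K|K]; auto. right; split.
    + eapply real_closed; eauto.
    + eapply real_accepting; eauto.
  - left. exists (0, 1)%Z, (tK' q). split; [apply H; reflexivity|]. split; [|left; auto].
    intros [x y] I. apply in_cdom_ex in I as [t E]. cbn.
    destruct (F _ _ _ E) as [K|(_ & _ & K & _)]; [|cbn in K; lia].
    apply Lc_lookup in K as [K|(_ & _ & K)]; [lia|].
    assert (Z.to_nat (y - 1) < length [tK' q]) by (apply nth_error_Some; congruence). cbn in *; lia.
Qed.

(** * Endless growth *)

Definition S3 (C : config) : Prop :=
  terminal str 2 S2 C \/ terminal str 2 (singles [tinfA]) C \/ terminal str 2 (singles [tinfB]) C.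

Lemma S3_good : good_init str 2 S3.
Proof. intros C [H|[H|H]]; eapply terminal_good; eauto; [apply S2_good|apply singles_good|apply singles_good]. Qed.

Lemma expTop_asm_eq C D : asm_eq C D -> expTop C -> expTop D.
Proof.
  intros [d H] (p & t & E & M & K). exists (padd p d), t; split; [now rewrite -H|split; auto].
  intros q Hq. specialize (M (padd q (pneg d))).
  rewrite in_cdom H padd_neg' -in_cdom in M. specialize (M Hq). unfold padd, pneg in *; cbn in *; lia.
Qed.

Lemma exposed_asm_eq C D d g : asm_eq C D -> exposed C d g -> exposed D d g.
Proof.
  intros [e H] (p & t & E & En & G). exists (padd p e), t; repeat split; auto.
  - now rewrite -H.
  - rewrite -En H. f_equal. rewrite !padd_assoc. f_equal; apply padd_comm.
Qed.

Lemma closed_asm_eq C D : asm_eq C D -> closed C -> closed D.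
Proof. intros E K d g X; apply (K d g). eapply exposed_asm_eq; [apply asm_eq_sym, E|exact X]. Qed.

Lemma expTop_union C D : disj C D -> expTop C -> expTop D -> expTop (C ++ D).
Proof.
  intros Dj (p & t & E & M & K) (q & u & E' & M' & K').
  destruct (Z.le_ge_cases (snd p) (snd q)) as [L|L].
  - exists q, u; split; [|split; auto].
    + rewrite clookup_app. destruct (clookup C q) eqn:X; auto.
      exfalso; apply (Dj q); rewrite in_cdom; congruence.
    + intros r; rewrite cdom_app in_app_iff; intros [I|I]; auto. specialize (M _ I); lia.
  - exists p, t; split; [|split; auto].
    + rewrite clookup_app E; auto.
    + intros r; rewrite cdom_app in_app_iff; intros [I|I]; auto. specialize (M' _ I); lia.
Qed.

Lemma closed_not_combinable CA CB C : wf_config CA -> wf_config CB -> closed CA -> ~ combinable str 2 CA CB C.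
Proof.
  intros WA WB K H. apply (exp_clash _ _ _ WA WB H). intros e g X S _. rewrite (K _ _ X) in S; lia.
Qed.

(** The two growth tiles are kept in separate bins until they are used: in a common bin they would
    extend each other forever and nothing terminal would be passed on. *)
Lemma inf_inert t : t = tinfA \/ t = tinfB ->
  forall C, terminal str 2 (singles [t]) C <-> wf_config C /\ asm_eq [((0, 0)%Z, t)] C.
Proof.
  destruct vert_neq as (V1 & V2 & V3 & V4 & V5 & V6 & V7 & V8 & V9 & V10).
  intros Ht C. rewrite inert_bin.
  - intros u v d [<-|[]] [<-|[]] G. destruct Ht as [-> | ->], d; cbn in *; try congruence; lia.
  - split; [intros (W & u & [<-|[]] & E); auto|]. intros (W & E); split; auto. exists t; cbn; auto.
Qed.

Lemma produced_inf t : t = tinfA \/ t = tinfB -> produced str 2 S3 [((0, 0)%Z, t)].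
Proof.
  intros Ht. eapply prod_init; [|apply wf_single|apply asm_eq_refl].
  destruct Ht as [-> | ->]; right; [left|right]; apply inf_inert; auto; split; auto using wf_single, asm_eq_refl.
Qed.

(** In a union, the higher of the two topmost tiles is topmost and still shows [inf] or [inf2];
    closed assemblies take part in no combination. *)
Lemma produced_S3 C : produced str 2 S3 C -> expTop C \/ (closed C /\ accepting).
Proof.
  induction 1 as [CA C T W E|CA CB C PA IHA PB IHB H].
  - assert (K : expTop CA \/ closed CA /\ accepting).
    { assert (I : forall t, t = tinfA \/ t = tinfB -> asm_eq [((0, 0)%Z, t)] CA -> expTop CA).
      { intros t Ht E'. eapply expTop_asm_eq; [exact E'|]. exists (0, 0)%Z, t; split; [reflexivity|].
        split; [intros q [<-|[]]; cbn; lia|]. destruct Ht as [-> | ->]; cbn; auto. }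
      destruct T as [T|[T|T]].
      - apply terminal_S2 in T as (ws & cs & C0 & HF & HC & E').
        destruct (full_cases _ _ _ HF HC) as [K|[K K']]; [left; eapply expTop_asm_eq; eauto|right].
        split; auto. eapply closed_asm_eq; eauto.
      - left. apply inf_inert in T as [_ T]; auto. eapply (I tinfA); auto.
      - left. apply inf_inert in T as [_ T]; auto. eapply (I tinfB); auto. }
    destruct K as [K|[K K']]; [left; eapply expTop_asm_eq; eauto|right; split; auto; eapply closed_asm_eq; eauto].
  - destruct (produced_good S3_good PA) as [WA _], (produced_good S3_good PB) as [WB _].
    destruct IHA as [KA|[KA _]]; [|exfalso; revert H; now apply closed_not_combinable].
    destruct IHB as [KB|[KB _]]; [|exfalso; apply combinable_sym in H; revert H; now apply closed_not_combinable].
    left. destruct (combinable_rel WA WB H) as (e & D & E & _).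
    eapply expTop_asm_eq; [exact E|]. apply expTop_union; auto.
    eapply expTop_asm_eq; [apply asm_eq_shift|auto].
Qed.

Lemma terminal_S3_accepting C : terminal str 2 S3 C -> accepting.
Proof.
  intros [P T]. destruct (produced_S3 _ P) as [(p & t & E & M & K)|[_ K]]; auto. exfalso.
  destruct (produced_good S3_good P) as [W St].
  set (u := if Nat.eqb (tN t) inf then tinfA else tinfB).
  assert (Hu : u = tinfA \/ u = tinfB) by (unfold u; destruct (Nat.eqb (tN t) inf); auto).
  assert (Gu : tN t = tS u /\ str (tN t) = 2).
  { unfold u; destruct (Nat.eqb_spec (tN t) inf) as [G|G]; rewrite ?G; auto.
    destruct K as [K|K]; [congruence|]. rewrite K; auto. }
  apply (T _ (produced_inf _ Hu)).
  apply (@combinable_single str C (padd p (vec DN)) u); auto.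
  - apply not_in_cdom; intros I. specialize (M _ I). unfold padd in M; cbn in M; lia.
  - apply (@cross_single_1 str C p DN t); auto; cbn; [tauto|lia].
Qed.

(** * Building the rectangle of an accepting computation *)

Section Build.
Variables (bs : list (nat * A * nat)) (n : nat).
Hypothesis Hp : path gL bs.
Let ws := tC0 :: map tcell bs.
Let cs := tKbot :: repeat tK0 n ++ [tKtop].
Let w := Z.of_nat (length bs).
Let h := Z.of_nat (n + 2).

Definition partial (C : config) : Prop := filled ws cs C /\ produced str 2 S2 C.

(** Tiles attach from west to east: each one finds its letter below and the state that its
    predecessor hands on. *)
Lemma fill_row u v x y q C : run q u v -> partial C -> (1 <= x)%Z -> (1 <= y <= h)%Z ->
  (x + Z.of_nat (length u) = w + 1)%Z -> shows C x (y - 1) u ->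
  (u <> [] -> exists tl, clookup C (x - 1, y)%Z = Some tl /\ tE tl = gs q) ->
  (forall x', (x <= x')%Z -> clookup C (x', y) = None) ->
  exists C', partial C' /\ ((y < h)%Z -> shows C' x y v) /\
    (forall p t, clookup C p = Some t -> clookup C' p = Some t) /\
    (forall x' y', (y' <> y \/ x' < x)%Z -> clookup C' (x', y') = clookup C (x', y')) /\
    (forall x', (x <= x' <= w)%Z -> exists t, clookup C' (x', y) = Some t /\ isnrm t).
Proof.
  pose proof (real_w bs n) as Lw; pose proof (real_h bs n) as Lh.
  revert v x q C; induction u as [|a u IH]; intros v x q C R [HF PC] Hx Hy Hl Hs Hleft Hfree.
  - destruct v; [|destruct R]. cbn in Hl. exists C; split; [split; auto|]. split; [intros _ i a; destruct i; discriminate|].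
    repeat split; auto. intros; lia.
  - destruct v as [|a' v]; [destruct R|]. destruct R as (q' & I & R). cbn [length] in Hl.
    destruct (Hs 0 a eq_refl) as (tb & Eb & Gb). rewrite Z.add_0_r in Eb.
    destruct Hleft as (tl & El & Gl); [discriminate|].
    set (t := tnrm (q, a, a', q')).
    assert (It : In t IT) by now apply tnrm_In.
    assert (En : clookup C (x, y) = None) by (apply Hfree; lia).
    assert (X : 2 <= cross str C [((x, y), t)]).
    { pose proof (nrms_ok _ _ _ _ I) as (Iq & Ia & _).
      pose proof (str_gl a Ia) as Sa. pose proof (str_gs q Iq) as Sq.
      apply (@cross_single_2 str C (x, y - 1)%Z DN tb (x - 1, y)%Z DE tl); auto; cbn [glue opp];
        try (rewrite ?Gb ?Gl; cbn; lia).
      - rewrite padd_DN; f_equal; lia.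
      - rewrite padd_DE; f_equal; lia.
      - discriminate. }
    set (C1 := C ++ [((x, y), t)]).
    assert (HF1 : filled ws cs C1) by now apply filled_attach.
    assert (PC1 : produced str 2 S2 C1).
    { refine (prod_comb PC (produced_IT _ It) _). unfold C1. rewrite -(single_shift (x, y) t).
      apply combinable_intro; rewrite ?single_shift; auto using wf_single, stable_single.
      - eapply filled_wf; eauto.
      - intros p H1; cbn; intros [<-|[]]. now apply not_in_cdom in En.
      - eapply produced_good; [apply S2_good|exact PC]. }
    assert (E1 : forall p, p <> (x, y) -> clookup C1 p = clookup C p).
    { intros p Np. unfold C1. rewrite clookup_app clookup_cons. destruct (clookup C p); auto.
      destruct (pos_eqbP (x, y) p); auto. congruence. }
    assert (E2 : clookup C1 (x, y) = Some t).
    { unfold C1. rewrite clookup_app En clookup_cons pos_eqb_refl; auto. }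
    assert (N1 : forall x' y', (y' <> y \/ x' <> x)%Z -> clookup C1 (x', y') = clookup C (x', y')).
    { intros x' y' D; apply E1; intros K; apply pair_equal_spec in K; lia. }
    assert (T : (y < h)%Z -> top q = false).
    { intros Hh. apply (filled_top _ _ _ HF1 (Z.to_nat (x - 1)) x y t); auto; unfold ws, cs in *; lia. }
    destruct (IH v (x + 1)%Z q' C1) as (C' & PC' & S' & M' & N' & G'); auto; try lia.
    + split; auto.
    + intros i c Hc. destruct (Hs (S i) c Hc) as (t' & Et & Gt). exists t'; split; auto.
      rewrite N1; [left; lia|]. rewrite -Et; do 2 f_equal; lia.
    + intros Nu. exists t. replace (x + 1 - 1)%Z with x by lia.
      assert (T' : isEnd a = false).
      { destruct u as [|b u]; [congruence|]. cbn [length] in Hl.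
        apply (filled_end _ _ _ HF1 (Z.to_nat (y - 1)) x y t); auto; unfold ws, cs, h in *; lia. }
      split; auto. cbn; rewrite T'; auto.
    + intros x' Hx'. rewrite N1; [right; lia|]. apply Hfree; lia.
    + exists C'; split; auto. split; [|split; [|split]].
      * intros Hh [|i] c.
        -- intros Ec; inversion Ec; subst c. rewrite Z.add_0_r. exists t; split; auto. cbn; rewrite T; auto.
        -- intros Hc. destruct (S' Hh i c Hc) as (t' & Et & Gt). exists t'; split; auto. rewrite -Et; do 2 f_equal; lia.
      * intros p t' Et. apply M'. rewrite E1; auto. intros ->; congruence.
      * intros x' y' D. rewrite N'; [lia|]. apply N1; lia.
      * intros x' Hx'. destruct (Z.eq_dec x' x) as [->|]; [exists t; split; auto; exists (q, a, a', q'); auto|].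
        apply G'; lia.
Qed.

Lemma fill_rows k u v v' y C : rsteps k u v -> run qT v v' -> partial C -> (1 <= y)%Z -> (y + Z.of_nat k = h)%Z ->
  Z.of_nat (length u) = w -> shows C 1 (y - 1) u ->
  (forall x' y', (1 <= x')%Z -> (y <= y')%Z -> clookup C (x', y') = None) ->
  exists C', partial C' /\ (forall x' y', (y' < y)%Z -> clookup C' (x', y') = clookup C (x', y')) /\
    (forall x' y', (1 <= x' <= w)%Z -> (y <= y' <= h)%Z -> exists t, clookup C' (x', y') = Some t /\ isnrm t).
Proof.
  pose proof (real_w bs n) as Lw; pose proof (real_h bs n) as Lh.
  assert (run_len : forall u v q, run q u v -> length v = length u).
  { clear. induction u as [|a u IH]; intros [|b v] q; cbn; try tauto; auto.
    intros (q' & _ & H). f_equal; eauto. }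
  revert u y C; induction k as [|k IH]; intros u y C R RT' PC Hy Hk Lu Su Hfree.
  - cbn in R; subst v.
    destruct (fill_row u v' 1%Z y qT C RT' PC) as (C' & PC' & _ & M' & N' & G'); auto; try lia.
    + intros _. destruct PC as [HF _]. destruct (real_col bs n C HF y) as (t & E & _ & K); [lia|].
      exists t; split; auto. rewrite K; auto; lia.
    + intros x' Hx'; apply Hfree; lia.
    + exists C'; split; auto. split; [intros; apply N'; lia|]. intros x' y' Hx' Hy'.
      replace y' with y by lia. apply G'; auto.
  - destruct R as (u' & R1 & R2).
    destruct (fill_row u u' 1%Z y q0 C R1 PC) as (C1 & PC1 & S1' & M1 & N1 & G1); auto; try lia.
    + intros _. destruct PC as [HF _]. destruct (real_col bs n C HF y) as (t & E & K & _); [lia|].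
      exists t; split; auto. rewrite K; auto; lia.
    + intros x' Hx'; apply Hfree; lia.
    + destruct (IH u' (y + 1)%Z C1) as (C' & PC' & N' & G'); auto; try lia.
      * rewrite -Lu. f_equal; eauto.
      * replace (y + 1 - 1)%Z with y by lia. apply S1'; lia.
      * intros x' y' Hx' Hy'. rewrite N1; [lia|]. apply Hfree; lia.
      * exists C'; split; auto. split.
        -- intros x' y' Hy'. rewrite N'; [lia|]. apply N1; lia.
        -- intros x' y' Hx' Hy'. destruct (Z.eq_dec y' y) as [->|].
           ++ rewrite N'; [lia|]. apply G1; lia.
           ++ apply G'; lia.
Qed.

Lemma build v v' : rsteps (S n) (letters bs) v -> run qT v v' ->
  exists C, partial C /\ full ws cs C /\ exists t, clookup C (w, h) = Some t /\ isnrm t.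
Proof.
  intros R1 R2. pose proof (real_w bs n) as Lw; pose proof (real_h bs n) as Lh.
  assert (L : lpair ws cs) by (left; exists bs, n; auto).
  assert (P : partial (Lc ws cs)).
  { split; [now apply filled_L|]. eapply prod_init; [left; apply terminal_S1; split| |apply asm_eq_refl];
      try (apply Lc_wf; discriminate). exists ws, cs; auto using asm_eq_refl. }
  destruct (fill_rows (S n) (letters bs) v v' 1%Z _ R1 R2 P) as (C & PC & _ & G); try lia.
  - unfold letters, w; rewrite length_map; auto.
  - intros i a Ha. unfold letters in Ha; rewrite nth_error_map in Ha.
    destruct (nth_error bs i) as [[[wl a'] e]|] eqn:E; [|discriminate]. inversion Ha; subst a.
    exists (tcell (wl, a', e)); split; auto. apply Lc_lookup. left; split; [lia|split; [lia|]].
    replace (Z.to_nat (1 + Z.of_nat i)) with (S i) by lia. unfold ws; cbn [nth_error]. rewrite nth_error_map E; auto.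
  - intros x' y' Hx' Hy'. apply Lc_None; lia.
  - exists C; split; auto. split.
    + intros x y Hx Hy. unfold ws, cs in *. destruct (G x y) as (t & E & _); [unfold w; lia|unfold h in *; lia|]. congruence.
    + destruct (lpair_len _ _ L) as [L2 _]. unfold ws in L2. apply G; unfold w, h; lia.
Qed.

End Build.

(** The rectangle of a correct computation is closed, hence terminal in the second mixture and,
    passed on, in the third. The two occupied positions tell it apart from the one-tile target. *)
Lemma accepting_terminal_S3 : accepting -> exists C, terminal str 2 S3 C /\ exists p t q u,
  clookup C p = Some t /\ clookup C q = Some u /\ p <> q.
Proof.
  intros (bs & n & v & v' & Hp & R1 & R2).
  destruct (build bs n Hp v v' R1 R2) as (C & [HF PC] & HC & HN).
  pose proof (real_closed bs n C Hp HF HC HN) as K.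
  assert (T2 : terminal str 2 S2 C) by (apply closed_terminal; auto using S2_good).
  exists C; split.
  - apply closed_terminal; auto using S3_good. eapply prod_init; [left; exact T2| |apply asm_eq_refl].
    eapply filled_wf; eauto.
  - destruct HF as (_ & _ & H & _). exists (0, 0)%Z, tC0, (0, 1)%Z, tKbot.
    split; [apply H; reflexivity|split; [|discriminate]].
    apply H, Lc_lookup. right; repeat split; lia.
Qed.

End System.

(** * The seven stages *)

(* Bin 0 grows the assembly; bins 1-5 hold the columns, the interior tiles, the two tiles that extend [inf],
   and the target, and pass them on until they are used. *)
Definition edges7 : list (nat * nat * nat) :=
  [(0,0,0); (0,1,0); (0,2,2); (0,3,3); (0,4,4); (0,5,5);
   (1,0,0); (1,2,0); (1,3,3); (1,4,4); (1,5,5);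
   (2,0,0); (2,3,0); (2,4,0); (2,5,5);
   (3,0,0); (3,5,5); (4,0,0); (4,5,5); (5,0,0); (5,5,5)].

Definition tnull : Tile := mkTile 0 0 0 0.

Section Stages.
Variables (I : UAVInstance) (R Cc Ti Ia Ib : list Tile).
Hypothesis Itau : st_tau I = 2.
Hypothesis Ir : st_r I = 7.
Hypothesis Ie : st_edges I = edges7.
Hypothesis It : st_tiles I = [R; Cc; Ti; Ia; Ib; [tnull]].
Hypothesis Itg : st_target I = [(0, 0, tnull)].

Let str := strength I.
Definition X1 C := terminal str 2 (singles R) C \/ terminal str 2 (singles Cc) C.
Definition X2 C := terminal str 2 X1 C \/ terminal str 2 (singles Ti) C.
Definition X3 C := terminal str 2 X2 C \/ terminal str 2 (singles Ia) C \/ terminal str 2 (singles Ib) C.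

Lemma bin_good i j : good_init str 2 (bin_input I i j).
Proof.
  revert j; induction i as [|i IH]; intros j; cbn [bin_input].
  - intros A (t & _ & ->); split; auto using wf_single, stable_single.
  - intros A (k & _ & T). rewrite Itau in T. exact (terminal_good (IH k) T).
Qed.

Lemma bin_succ i j C : bin_input I (S i) j C <->
  exists k, In (i, k, j) edges7 /\ terminal str 2 (bin_input I i k) C.
Proof. cbn [bin_input]. rewrite Ie Itau. reflexivity. Qed.

Lemma edges_sources i j ks : (forall k, In (i, k, j) edges7 <-> In k ks) ->
  forall C, bin_input I (S i) j C <-> exists k, In k ks /\ terminal str 2 (bin_input I i k) C.
Proof.
  intros H C; rewrite bin_succ; split; intros (k & Hk & T); exists k; split; auto; now apply H.
Qed.

Ltac solve_edges := intros k; unfold edges7; cbn [In]; split; intros H;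
  repeat match goal with
  | H : _ \/ _ |- _ => destruct H as [H|H]
  | H : False |- _ => destruct H
  | H : (_, _, _) = (_, _, _) |- _ => apply pair_equal_spec in H as [H ?]; apply pair_equal_spec in H as [? ?]; try lia; subst
  end; subst; tauto.

Lemma bin_pass i j : (forall k, In (i, k, j) edges7 <-> In k [j]) ->
  forall C, terminal str 2 (bin_input I (S i) j) C <-> terminal str 2 (bin_input I i j) C.
Proof.
  intros H C. rewrite -(terminal_idem C (bin_good i j)). apply terminal_ext. intros D.
  rewrite (edges_sources _ _ _ H). split; [intros (k & [<-|[]] & T); auto|intros T; exists j; cbn; auto].
Qed.

Lemma stage1_bin0 C : terminal str 2 (bin_input I 1 0) C <-> terminal str 2 X1 C.
Proof.
  apply terminal_ext; intros D. rewrite (edges_sources 0 0 [0; 1]); [solve_edges|].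
  unfold X1, singles; cbn [bin_input]; rewrite It; cbn [nth]. split.
  - intros (k & [<-|[<-|[]]] & T); auto.
  - intros [T|T]; [exists 0|exists 1]; cbn; auto.
Qed.

Lemma stage2_bin0 C : terminal str 2 (bin_input I 2 0) C <-> terminal str 2 X2 C.
Proof.
  apply terminal_ext; intros D. rewrite (edges_sources 1 0 [0; 2]); [solve_edges|].
  assert (K : terminal str 2 (bin_input I 1 2) D <-> terminal str 2 (singles Ti) D).
  { rewrite bin_pass; [solve_edges|]. cbn [bin_input]; rewrite It; reflexivity. }
  unfold X2. rewrite -stage1_bin0 -K. split.
  - intros (k & [<-|[<-|[]]] & T); auto.
  - intros [T|T]; [exists 0|exists 2]; cbn [In]; auto.
Qed.

Lemma stage3_bin0 C : terminal str 2 (bin_input I 3 0) C <-> terminal str 2 X3 C.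
Proof.
  apply terminal_ext; intros D. rewrite (edges_sources 2 0 [0; 3; 4]); [solve_edges|].
  assert (Ka : terminal str 2 (bin_input I 2 3) D <-> terminal str 2 (singles Ia) D).
  { rewrite bin_pass; [solve_edges|]. rewrite bin_pass; [solve_edges|]. cbn [bin_input]; rewrite It; reflexivity. }
  assert (Kb : terminal str 2 (bin_input I 2 4) D <-> terminal str 2 (singles Ib) D).
  { rewrite bin_pass; [solve_edges|]. rewrite bin_pass; [solve_edges|]. cbn [bin_input]; rewrite It; reflexivity. }
  unfold X3. rewrite -stage2_bin0 -Ka -Kb. split.
  - intros (k & [<-|[<-|[<-|[]]]] & T); auto.
  - intros [T|[T|T]]; [exists 0|exists 3|exists 4]; cbn [In]; auto.
Qed.

(** Counting stages from 0, bin 0 has received everything by stage 3 and is only relayed afterwards,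
    which [terminal_idem] makes harmless. Bins 1 to 4 receive nothing in the last stage, so they
    output nothing. *)
Lemma output_spec C : output I C <-> terminal str 2 X3 C \/ terminal str 2 (singles [tnull]) C.
Proof.
  assert (K0 : terminal str 2 (bin_input I 6 0) C <-> terminal str 2 X3 C).
  { do 3 (rewrite bin_pass; [solve_edges|]). apply stage3_bin0. }
  assert (K5 : terminal str 2 (bin_input I 6 5) C <-> terminal str 2 (singles [tnull]) C).
  { do 6 (rewrite bin_pass; [solve_edges|]). cbn [bin_input]; rewrite It; reflexivity. }
  assert (Kn : forall j, j <> 0 -> j <> 5 -> ~ terminal str 2 (bin_input I 6 j) C).
  { clear K0 K5. intros j N0 N5 [P _]. induction P as [A D SA W E|A B D PA IHA PB IHB H]; auto.
    apply bin_succ in SA as (k & Hk & _). revert Hk; unfold edges7; cbn [In]; intros H.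
    repeat (destruct H as [H|H]; [injection H; lia|]); destruct H. }
  unfold output; rewrite Ir Itau. cbn [Nat.sub]. rewrite -K0 -K5. split.
  - intros (j & _ & T). destruct (Nat.eq_dec j 0) as [->|N0]; auto. destruct (Nat.eq_dec j 5) as [->|N5]; auto.
    exfalso; exact (Kn j N0 N5 T).
  - unfold st_b; rewrite It; cbn [length]. intros [T|T]; [exists 0|exists 5]; split; auto; lia.
Qed.

(** [tnull] has null glues only and stays alone in bin 5, so the target is always an output. It is
    unique exactly if bin 0 has no terminal: [acc] provides one with two tiles, which is not a
    translate of the target. *)
Lemma uniquely_assembles_spec (acc : Prop) :
  (forall C, terminal str 2 X3 C -> acc) ->
  (acc -> exists C, terminal str 2 X3 C /\ exists p t q u, clookup C p = Some t /\ clookup C q = Some u /\ p <> q) ->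
  uniquely_assembles I <-> ~ acc.
Proof.
  intros H1 H2.
  assert (Et : target_config I = [((0, 0)%Z, tnull)]) by (unfold target_config; rewrite Itg; reflexivity).
  assert (Tn : forall C, terminal str 2 (singles [tnull]) C <-> wf_config C /\ asm_eq [((0, 0)%Z, tnull)] C).
  { intros C; rewrite inert_bin.
    - intros t u d [<-|[]] _ _; destruct d; cbn; unfold strength; cbn; lia.
    - split; [intros (W & t & [<-|[]] & E); auto|intros (W & E); split; auto; exists tnull; cbn; auto]. }
  unfold uniquely_assembles; rewrite Et. split.
  - intros [_ U] A. destruct (H2 A) as (C & T & p & t & q & u & Ep & Eq & N).
    destruct (U C) as [d E]; [apply output_spec; auto|].
    rewrite E in Ep; rewrite E in Eq. rewrite clookup_cons in Ep. rewrite clookup_cons in Eq.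
    destruct (pos_eqbP (0, 0)%Z (padd p d)) as [F|]; [|cbn in Ep; discriminate].
    destruct (pos_eqbP (0, 0)%Z (padd q d)) as [G|]; [|cbn in Eq; discriminate].
    apply N. apply (@padd_inj p q d); congruence.
  - intros NA. split.
    + apply output_spec; right; apply Tn; split; auto using wf_single, asm_eq_refl.
    + intros C O. apply output_spec in O as [T|T]; [exfalso; eauto|]. apply Tn in T as [_ T].
      now apply asm_eq_sym.
Qed.

End Stages.

(** * Rows that search all certificates *)

(* [Raw o z] is a symbol of the bottom row, z telling whether it belongs to the certificate zone.
   [Cell o z s hd] keeps that symbol and adds the current tape symbol s and the state hd of the head, if it is here. *)
Inductive letter :=
| LM | RM
| Raw (o : nat) (z : bool)
| Cell (o : nat) (z : bool) (s : nat) (hd : option nat)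
| ErrL (b : bool).

(* States of a pass over a row: [Ld] loads the input, [St0], [StR], [StL], [St1] simulate one step,
   [Nx] replaces the certificate by the next one after a rejection and reloads, [Tp] checks that the last
   certificate (all 2s) has been rejected. *)
Inductive rstate :=
| Q0 | QT | ErrS (b : bool)
| Ld (seen : bool) | St0 | StR (q : nat) | StL (q : nat) | St1
| Nx (carry seen : bool) | Tp.

Definition isEndL (a : letter) : bool := match a with RM => true | ErrL b => b | _ => false end.
Definition topS (q : rstate) : bool := match q with QT | Tp => true | ErrS b => b | _ => false end.

Section Rows.
Variable V : TM.

Definition delta (q s : nat) : option (nat * nat * move) :=
  option_map snd (find (fun e => Nat.eqb (fst (fst e)) q && Nat.eqb (snd (fst e)) s) (tm_delta V)).

Definition syms : list nat := [0; 1; 2; 3] ++ map (fun e => snd (fst (snd e))) (tm_delta V).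
Definition sts : list nat := 0 :: map (fun e => fst (fst (snd e))) (tm_delta V).

(* An original symbol 4 marks the blanks to the left of the input. *)
Definition symof (o : nat) : nat := if Nat.eqb o 4 then 0 else o.

(** True of cells without the head, so that a conjunction over the whole row says that the machine
    has halted in a state other than the accepting state 1. *)
Definition haltrej (s : nat) (hd : option nat) : bool :=
  match hd with
  | None => true
  | Some q => negb (Nat.eqb q 1) && match delta q s with None => true | Some _ => false end
  end.

(** The head starts in state 0 on the first symbol that is not a left blank; [seen] tells whether
    this symbol has been passed. *)
Definition ldcell (seen : bool) (o : nat) : option nat * bool :=
  if seen then (None, true) else if Nat.eqb o 4 then (None, false) else (Some 0, true).

(* The certificate is a little-endian bijective base-2 numeral with digits 1, 2; 0 is an unused position. *)
Definition inccell (z c : bool) (o : nat) : nat * bool :=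
  if z && c then (match o with 0 => (1, false) | 1 => (2, false) | _ => (1, true) end) else (o, c).

(** [Q0] guesses at the left marker which kind of pass the row is. A row is swept from the west, so
    a left move concerns the cell before the head: [St0] guesses that the head arrives there in
    state [q'], and [StL q'] has the next cell confirm it. A wrong guess meets an empty list of
    successors and leaves the place to an error tile. *)
Definition succ (q : rstate) (a : letter) : list (letter * rstate) :=
  match q, a with
  | Q0, LM => [(LM, Ld false); (LM, St0); (LM, Nx true false)]
  | QT, LM => [(LM, Tp)]
  | Ld b, Raw o z => let (hd, b') := ldcell b o in [(Cell o z (symof o) hd, Ld b')]
  | Ld true, RM => [(RM, Q0)]
  | St0, Cell o z s None => (Cell o z s None, St0) :: map (fun q' => (Cell o z s (Some q'), StL q')) sts
  | St0, Cell o z s (Some q) =>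
      match delta q s with
      | Some (q', w, MoveR) => [(Cell o z w None, StR q')]
      | Some (q', w, Stay) => [(Cell o z w (Some q'), St1)]
      | _ => []
      end
  | StR q', Cell o z s None => [(Cell o z s (Some q'), St1)]
  | StL q', Cell o z s (Some q) =>
      match delta q s with
      | Some (q'', w, MoveL) => if Nat.eqb q'' q' then [(Cell o z w None, St1)] else []
      | _ => []
      end
  | St1, Cell o z s None => [(Cell o z s None, St1)]
  | St1, RM => [(RM, Q0)]
  | Nx c b, Cell o z s hd =>
      if haltrej s hd then
        let (o', c') := inccell z c o in let (hd', b') := ldcell b o in
        [(Cell o' z (symof o') hd', Nx c' b')]
      else []
  | Nx false true, RM => [(RM, Q0)]
  | Tp, Cell o z s hd => if haltrej s hd && (negb z || Nat.eqb o 2) then [(Cell o z s hd, Tp)] else []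
  | Tp, RM => [(RM, Tp)]
  | _, _ => []
  end.

Definition origs : list nat := [0; 1; 2; 3; 4].
Definition allA : list letter :=
  [LM; RM; ErrL true; ErrL false] ++ map (fun x => Raw (fst x) (snd x)) (list_prod origs [true; false]) ++
  map (fun x => Cell (fst (fst (fst x))) (snd (fst (fst x))) (snd (fst x)) (snd x))
    (list_prod (list_prod (list_prod origs [true; false]) syms) (None :: map Some sts)).
Definition allQ : list rstate :=
  [Q0; QT; ErrS true; ErrS false; Ld true; Ld false; St0; St1; Nx true true; Nx true false; Nx false true; Nx false false; Tp]
  ++ map StR sts ++ map StL sts.
Definition nrms : list (rstate * letter * letter * rstate) :=
  flat_map (fun x => map (fun y => (fst x, snd x, fst y, snd y)) (succ (fst x) (snd x))) (list_prod allQ allA).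

Lemma in_nrms q a a' q' : In (q, a, a', q') nrms <-> In q allQ /\ In a allA /\ In (a', q') (succ q a).
Proof.
  unfold nrms; rewrite in_flat_map; split.
  - intros ([q1 a1] & H1 & H2). apply in_prod_iff in H1 as [H0 H1]. apply in_map_iff in H2 as ([a2 q2] & E & H2).
    cbn in *. inversion E; subst; auto.
  - intros (H1 & H2 & H3). exists (q, a); split; [now apply in_prod|].
    apply in_map_iff. exists (a', q'); auto.
Qed.

Lemma succ_Ld b o z : succ (Ld b) (Raw o z) = [(Cell o z (symof o) (fst (ldcell b o)), Ld (snd (ldcell b o)))].
Proof. destruct b; cbn; auto. destruct (Nat.eqb o 4); auto. Qed.

Lemma succ_Nx c b o z s hd : succ (Nx c b) (Cell o z s hd) = if haltrej s hd then
  [(Cell (fst (inccell z c o)) z (symof (fst (inccell z c o))) (fst (ldcell b o)), Nx (snd (inccell z c o)) (snd (ldcell b o)))] else [].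
Proof. destruct c, b; cbn [succ]; destruct (haltrej s hd); auto; destruct (inccell z _ o), (ldcell _ o); auto. Qed.

Lemma bool_In (b : bool) : In b [true; false].
Proof. destruct b; cbn; auto. Qed.

Lemma in_allA_Raw o z : In (Raw o z) allA <-> In o origs.
Proof.
  unfold allA; rewrite !in_app_iff !in_map_iff; split.
  - intros [H|[([o1 z1] & E & H)|(x & E & _)]]; [exfalso; cbn in H; repeat (destruct H as [H|H]; [discriminate H|]); exact H| |discriminate E].
    inversion E; subst. apply in_prod_iff in H; tauto.
  - intros H; right; left. exists (o, z); split; auto. apply in_prod; auto using bool_In.
Qed.

Lemma in_allA_Cell o z s hd : In (Cell o z s hd) allA <->
  In o origs /\ In s syms /\ (forall q, hd = Some q -> In q sts).
Proof.
  unfold allA; split.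
  - intros H; apply in_app_iff in H as [H|H]; [exfalso; cbn in H; repeat (destruct H as [H|H]; [discriminate H|]); exact H|].
    apply in_app_iff in H as [H|H]; apply in_map_iff in H as (x & E & H); [discriminate E|].
    destruct x as [[[o1 z1] s1] h1]. cbn in E; inversion E; subst.
    apply in_prod_iff in H as [H1 H2]. apply in_prod_iff in H1 as [H0 H1].
    apply in_prod_iff in H0 as [H0 _]. split; auto. split; auto. intros q ->.
    destruct H2 as [H2|H2]; [discriminate H2|]. apply in_map_iff in H2 as (q' & E' & H2). now inversion E'; subst.
  - intros (H0 & H1 & H2). apply in_app_iff; right. apply in_app_iff; right. apply in_map_iff.
    exists (o, z, s, hd); split; auto.
    repeat apply in_prod; auto using bool_In. destruct hd as [q|]; cbn [In]; auto.
    right; apply in_map; auto.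
Qed.

Lemma delta_In q s q' w m : delta q s = Some (q', w, m) -> In q' sts /\ In w syms.
Proof.
  unfold delta. destruct (find _ _) as [[k v]|] eqn:E; [|discriminate]. cbn; intros H; inversion H; subst v.
  apply find_some in E as [E _]. split.
  - right. apply in_map_iff. exists (k, (q', w, m)); auto.
  - do 4 right. apply in_map_iff. exists (k, (q', w, m)); auto.
Qed.

Lemma symof_syms o : In o origs -> In (symof o) syms.
Proof. intros [<-|[<-|[<-|[<-|[<-|[]]]]]]; cbn; auto. Qed.

Lemma st_StR q : In q sts -> In (StR q) allQ.
Proof. intros; unfold allQ; rewrite !in_app_iff; right; left; now apply in_map. Qed.
Lemma st_StL q : In q sts -> In (StL q) allQ.
Proof. intros; unfold allQ; rewrite !in_app_iff; right; right; now apply in_map. Qed.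
Lemma StR_inv q : In (StR q) allQ -> In q sts.
Proof.
  unfold allQ; rewrite !in_app_iff !in_map_iff; intros [H|[(x & E & H)|(x & E & H)]]; [exfalso; cbn in H; repeat (destruct H as [H|H]; [discriminate H|]); exact H| |discriminate E].
  now inversion E; subst.
Qed.

Lemma succ_closed q a a' q' : In q allQ -> In a allA -> In (a', q') (succ q a) -> In a' allA /\ In q' allQ.
Proof.
  intros Hq Ha H.
  assert (C0 : forall q, In q [Q0; QT; ErrS true; ErrS false; Ld true; Ld false; St0; St1; Nx true true; Nx true false;
    Nx false true; Nx false false; Tp] -> In q allQ) by (intros; unfold allQ; rewrite in_app_iff; auto).
  assert (A0 : forall a, In a [LM; RM; ErrL true; ErrL false] -> In a allA)
    by (intros; unfold allA; rewrite in_app_iff; auto).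
  assert (O0 : forall o : nat, forall q, None = Some q -> In q sts) by discriminate.
  assert (Z0 : forall q, Some 0 = Some q -> In q sts) by (intros ? E; inversion E; cbn; auto).
  assert (KNx : forall carry seen o z s hd, In (Cell o z s hd) allA -> In (a', q') (succ (Nx carry seen) (Cell o z s hd)) ->
    In a' allA /\ In q' allQ).
  { clear q a Hq Ha H. intros carry seen o z s hd Ha H. cbn [succ] in H.
    apply in_allA_Cell in Ha as (Ho & Hs & Hh). destruct (haltrej s hd); [|destruct carry, seen; destruct H].
    destruct (inccell z carry o) as [o1 c1] eqn:Ei. destruct (ldcell seen o) as [h1 b1] eqn:El.
    assert (H' : In (a', q') [(Cell o1 z (symof o1) h1, Nx c1 b1)]) by (destruct carry, seen; exact H).
    clear H; destruct H' as [H|[]]; inversion H; subst.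
    assert (Ho1 : In o1 origs).
    { unfold inccell in Ei. destruct (z && carry); [|now inversion Ei; subst].
      destruct o as [|[|]]; inversion Ei; subst; cbn; auto. }
    split.
    + apply in_allA_Cell; split; [auto|split; [auto using symof_syms|]]. intros q ->. unfold ldcell in El.
      destruct seen; [discriminate El|]. destruct (Nat.eqb o 4); inversion El; cbn; auto.
    + apply C0. destruct c1, b1; cbn; tauto. }
  destruct q as [| |b|[|]| |q|q| |[|] [|]|], a as [| |o z|o z s hd|b']; cbn [succ] in H; try (destruct H; fail);
    try (repeat (destruct H as [H|H]; [inversion H; subst; split; [apply A0|apply C0]; cbn; tauto|]); destruct H; fail).
  - apply in_allA_Raw in Ha. cbn in H. destruct H as [H|[]]; inversion H; subst; split;
      [apply in_allA_Cell; auto using symof_syms|apply C0; cbn; tauto].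
  - apply in_allA_Raw in Ha. unfold ldcell in H.
    destruct (Nat.eqb o 4); destruct H as [H|[]]; inversion H; subst; split;
      [apply in_allA_Cell; auto using symof_syms|apply C0; cbn; tauto|apply in_allA_Cell; auto using symof_syms|apply C0; cbn; tauto].
  - apply in_allA_Cell in Ha as (Ho & Hs & Hh). destruct hd as [q|].
    + destruct (delta q s) as [[[q1 w] []]|] eqn:D; try (destruct H; fail); destruct (delta_In _ _ _ _ _ D) as [D1 D2];
        destruct H as [H|[]]; inversion H; subst; split; auto using st_StR;
        try (apply in_allA_Cell; split; [auto|split; [auto|intros ? E; inversion E; subst; auto]]);
        apply C0; cbn; tauto.
    + destruct H as [H|H].
      * inversion H; subst; split; [apply in_allA_Cell; auto|apply C0; cbn; tauto].
      * apply in_map_iff in H as (q1 & E & H); inversion E; subst. split; auto using st_StL.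
        apply in_allA_Cell; split; [auto|split; [auto|intros ? E'; inversion E'; subst; auto]].
  - apply in_allA_Cell in Ha as (Ho & Hs & Hh). destruct hd; [destruct H|]. destruct H as [H|[]]; inversion H; subst.
    apply StR_inv in Hq. split; [|apply C0; cbn; tauto].
    apply in_allA_Cell; split; [auto|split; [auto|intros ? E'; inversion E'; subst; auto]].
  - apply in_allA_Cell in Ha as (Ho & Hs & Hh). destruct hd as [q1|]; [|destruct H].
    destruct (delta q1 s) as [[[q2 w] []]|] eqn:D; try (destruct H; fail). destruct (delta_In _ _ _ _ _ D) as [D1 D2].
    destruct (Nat.eqb q2 q); [|destruct H]. destruct H as [H|[]]; inversion H; subst.
    split; [apply in_allA_Cell; auto|apply C0; cbn; tauto].
  - apply in_allA_Cell in Ha as (Ho & Hs & Hh). destruct hd; [destruct H|]. destruct H as [H|[]]; inversion H; subst.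
    split; [|apply C0; cbn; tauto]. apply in_allA_Cell; auto.
  - exact (KNx true true _ _ _ _ Ha H).
  - exact (KNx true false _ _ _ _ Ha H).
  - exact (KNx false true _ _ _ _ Ha H).
  - exact (KNx false false _ _ _ _ Ha H).
  - destruct (haltrej s hd && (negb z || Nat.eqb o 2)); [|destruct H]. destruct H as [H|[]]; inversion H; subst; auto.
Qed.

Lemma nrms_facts q a a' q' : In (q, a, a', q') nrms ->
  In q allQ /\ In a allA /\ In a' allA /\ In q' allQ /\ isEndL a' = isEndL a /\ topS q' = topS q /\
  (forall b, a <> ErrL b) /\ (forall b, q <> ErrS b).
Proof.
  intros H; apply in_nrms in H as (Hq & Ha & H). destruct (succ_closed _ _ _ _ Hq Ha H) as [Ha' Hq'].
  split; [auto|split; [auto|split; [auto|split; [auto|]]]]. clear Hq Ha Ha' Hq'.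
  destruct q as [| |b|[|]| |q|q| |[|] [|]|], a; cbn [succ] in H; try (destruct H; fail);
  repeat match type of H with
  | context [let (_, _) := ?x in _] => destruct x
  | In _ (if ?b then _ else _) => destruct b
  | In _ (match ?b with _ => _ end) => destruct b
  | In _ (map _ _) => apply in_map_iff in H as (? & H & _)
  | In _ (_ :: _) => destruct H as [H|H]
  | In _ [] => destruct H
  end; inversion H; subst; repeat split; auto; discriminate.
Qed.

(** [run] without the membership in the finite lists [allQ] and [allA], which [succ_closed]
    restores. *)
Fixpoint runs (q : rstate) (u v : list letter) : Prop :=
  match u, v with
  | [], [] => True
  | a :: u', a' :: v' => exists q', In (a', q') (succ q a) /\ runs q' u' v'
  | _, _ => False
  end.

Lemma run_runs q u v : run letter rstate nrms q u v -> runs q u v.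
Proof.
  revert q v; induction u as [|a u IH]; intros q [|b v]; cbn; auto.
  intros (q' & H & R). apply in_nrms in H as (_ & _ & H). eauto.
Qed.

Lemma runs_run q u v : In q allQ -> Forall (fun a => In a allA) u -> runs q u v ->
  run letter rstate nrms q u v /\ Forall (fun a => In a allA) v.
Proof.
  revert q v; induction u as [|a u IH]; intros q [|b v] Hq Hu; cbn [runs run]; [auto|intros []|intros []|].
  intros (q' & H & R). inversion Hu; subst. destruct (succ_closed _ _ _ _ Hq H2 H) as [Hb Hq'].
  destruct (IH q' v Hq' H3 R) as [R' F]. split; [|constructor; auto]. exists q'; split; auto. apply in_nrms; auto.
Qed.

Definition rawrow (os : list (nat * bool)) : list letter := LM :: map (fun x => Raw (fst x) (snd x)) os ++ [RM].
Definition mk (x : (nat * bool) * (nat * option nat)) : letter := Cell (fst (fst x)) (snd (fst x)) (fst (snd x)) (snd (snd x)).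
Definition rowof (os : list (nat * bool)) (ts : list (nat * option nat)) : list letter :=
  LM :: map mk (combine os ts) ++ [RM].

Fixpoint load (seen : bool) (os : list (nat * bool)) : list (nat * option nat) :=
  match os with
  | [] => []
  | (o, _) :: os' => (symof o, fst (ldcell seen o)) :: load (snd (ldcell seen o)) os'
  end.

Fixpoint seenall (seen : bool) (os : list (nat * bool)) : bool :=
  match os with [] => seen | (o, _) :: os' => seenall (snd (ldcell seen o)) os' end.

Lemma load_length b os : length (load b os) = length os.
Proof. revert b; induction os as [|[o z] os IH]; intros b; cbn; auto. Qed.

Lemma runs_Ld b os v : runs (Ld b) (map (fun x => Raw (fst x) (snd x)) os ++ [RM]) v <->
  seenall b os = true /\ v = map mk (combine os (load b os)) ++ [RM].
Proof.
  revert b v; induction os as [|[o z] os IH]; intros b v.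
  - cbn. destruct v as [|a v]; [split; [tauto|intros [_ H]; discriminate H]|]. split.
    + intros (q' & H & R). destruct b; [|destruct H]. destruct H as [H|[]]; inversion H; subst.
      destruct v; [auto|destruct R].
    + intros [-> H]. inversion H; subst. exists Q0; cbn; auto.
  - cbn [map app fst snd load combine seenall]. destruct v as [|a v]; [split; [cbn; tauto|intros [_ H]; discriminate H]|].
    cbn [runs]. rewrite succ_Ld. destruct (ldcell b o) as [hd b'] eqn:E. cbn [fst snd]. split.
    + intros (q' & H & R). destruct H as [H|[]]; inversion H; subst. apply IH in R as [S ->]. auto.
    + intros [S H]. inversion H; subst. eexists; split; [left; reflexivity|]. apply IH; auto.
Qed.

Lemma runs_raw os v : runs Q0 (rawrow os) v <-> seenall false os = true /\ v = rowof os (load false os).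
Proof.
  unfold rawrow, rowof; destruct v as [|a v]; [split; [cbn; tauto|intros [_ H]; discriminate H]|].
  cbn [runs succ]. split.
  - intros (q' & H & R).
    assert (q' = Ld false /\ a = LM) as [-> ->].
    { destruct H as [H|[H|[H|[]]]]; inversion H; subst; auto; exfalso;
      destruct os as [|[o z] os], v; cbn in R; try (destruct R as (? & [] & _)); auto. }
    apply runs_Ld in R as [S ->]; auto.
  - intros [S H]; inversion H; subst. exists (Ld false); split; [cbn; auto|]. apply runs_Ld; auto.
Qed.

Definition N (l : list nat) : list (nat * option nat) := map (fun s => (s, None)) l.

Lemma N_app a b : N (a ++ b) = N a ++ N b.
Proof. apply map_app. Qed.

Lemma runs_St1 os ts v : length os = length ts -> runs St1 (map mk (combine os ts) ++ [RM]) v <->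
  exists l, ts = N l /\ v = map mk (combine os ts) ++ [RM].
Proof.
  revert os v; induction ts as [|[s hd] ts IH]; intros [|[o z] os] v L; try discriminate.
  - cbn. destruct v as [|a v]; [split; [tauto|intros (l & _ & H); discriminate H]|]. split.
    + intros (q' & [H|[]] & R); inversion H; subst. destruct v; [exists []; auto|destruct R].
    + intros (l & _ & H). inversion H; subst. exists Q0; cbn; auto.
  - cbn in L; injection L as L. cbn [combine map app]; change (mk ((o, z), (s, hd))) with (Cell o z s hd). destruct v as [|a v]; [split; [cbn; tauto|intros (l & _ & H); discriminate H]|].
    cbn [runs succ]. split.
    + intros (q' & H & R). destruct hd; [destruct H|]. destruct H as [H|[]]; inversion H; subst.
      apply IH in R as (l & -> & ->); auto. exists (s :: l); auto.
    + intros (l & E & H). destruct l as [|s' l]; [discriminate|]. cbn in E; inversion E; subst. inversion H; subst.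
      exists St1; split; [cbn; auto|]. apply IH; auto. exists l; auto.
Qed.

(** One machine step on a row of fixed width: no rule moves past either end, so a row with too few
    blanks blocks. *)
Inductive stepT : list (nat * option nat) -> list (nat * option nat) -> Prop :=
| stepS l s q r q' w : delta q s = Some (q', w, Stay) ->
    stepT (N l ++ (s, Some q) :: N r) (N l ++ (w, Some q') :: N r)
| stepR l s q s2 r q' w : delta q s = Some (q', w, MoveR) ->
    stepT (N l ++ (s, Some q) :: (s2, None) :: N r) (N l ++ (w, None) :: (s2, Some q') :: N r)
| stepL l s1 s q r q' w : delta q s = Some (q', w, MoveL) ->
    stepT (N l ++ (s1, None) :: (s, Some q) :: N r) (N l ++ (s1, Some q') :: (w, None) :: N r).

Lemma stepT_cons s ts ts' : stepT ts ts' -> stepT ((s, None) :: ts) ((s, None) :: ts').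
Proof. intros []; [apply (stepS (s :: l))|apply (stepR (s :: l))|apply (stepL (s :: l))]; auto. Qed.

Lemma stepT_length ts ts' : stepT ts ts' -> length ts' = length ts.
Proof. intros []; rewrite !length_app; cbn; auto. Qed.

Lemma runs_St0_sound os ts v : length os = length ts -> runs St0 (map mk (combine os ts) ++ [RM]) v ->
  exists ts', stepT ts ts' /\ v = map mk (combine os ts') ++ [RM].
Proof.
  revert os v; induction ts as [|[s hd] ts IH]; intros [|[o z] os] v L; try discriminate.
  - cbn. destruct v as [|a v]; [tauto|]. intros (q' & [] & _).
  - cbn in L; injection L as L. cbn [combine map app]; change (mk ((o, z), (s, hd))) with (Cell o z s hd). destruct v as [|a v]; [cbn; tauto|].
    cbn [runs succ]. intros (q' & H & R). destruct hd as [q|].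
    + destruct (delta q s) as [[[q1 w] []]|] eqn:D; try (destruct H; fail); destruct H as [H|[]]; inversion H; subst.
      * destruct ts as [|[s2 h2] ts], os as [|[o2 z2] os]; try discriminate; [destruct v; cbn in R; [tauto|destruct R as (? & [] & _)]|].
        destruct v as [|a v]; [destruct R|]. cbn in R. destruct R as (q2 & H2 & R).
        destruct h2; [destruct H2|]. destruct H2 as [H2|[]]; inversion H2; subst.
        injection L as L. apply runs_St1 in R as (l & -> & ->); auto.
        eexists; split; [apply (stepR [] s q s2 l q1 w D)|]. reflexivity.
      * apply runs_St1 in R as (l & -> & ->); auto.
        eexists; split; [apply (stepS [] s q l q1 w D)|]. reflexivity.
    + destruct H as [H|H].
      * inversion H; subst. apply IH in R as (ts' & St & ->); auto.
        exists ((s, None) :: ts'); split; [now apply stepT_cons|reflexivity].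
      * apply in_map_iff in H as (q1 & E & H); inversion E; subst.
        destruct ts as [|[s2 h2] ts], os as [|[o2 z2] os]; try discriminate; [destruct v; cbn in R; [tauto|destruct R as (? & [] & _)]|].
        destruct v as [|a v]; [destruct R|]. cbn in R. destruct R as (q2 & H2 & R).
        destruct h2 as [q|]; [|destruct H2].
        destruct (delta q s2) as [[[q3 w] []]|] eqn:D; try (destruct H2; fail).
        destruct (Nat.eqb_spec q3 q1); [subst|destruct H2]. destruct H2 as [H2|[]]; inversion H2; subst.
        injection L as L. apply runs_St1 in R as (l & -> & ->); auto.
        eexists; split; [apply (stepL [] s s2 q l q1 w D)|]. reflexivity.
Qed.

Lemma runs_St0_complete os ts ts' : length os = length ts -> stepT ts ts' ->
  runs St0 (map mk (combine os ts) ++ [RM]) (map mk (combine os ts') ++ [RM]).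
Proof.
  intros L H; revert os L.
  assert (K : forall l r r', (forall os, length os = length r -> runs St0 (map mk (combine os r) ++ [RM]) (map mk (combine os r') ++ [RM])) ->
     forall os, length os = length (N l ++ r) -> runs St0 (map mk (combine os (N l ++ r)) ++ [RM]) (map mk (combine os (N l ++ r')) ++ [RM])).
  { intros l r r' Hr; induction l as [|s l IH]; intros os L; [now apply Hr|].
    destruct os as [|[o z] os]; [discriminate|]. cbn in L; injection L as L.
    exists St0; split; [cbn; auto|]. now apply IH. }
  destruct H; apply K; clear K; intros os L.
  - destruct os as [|[o z] os]; [discriminate|]. cbn in L; injection L as L.
    exists St1; split; [cbn; rewrite H; cbn; auto|]. apply runs_St1; auto. exists r; auto.
  - destruct os as [|[o z] [|[o2 z2] os]]; try discriminate. cbn in L; injection L as L.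
    exists (StR q'); split; [cbn; rewrite H; cbn; auto|]. exists St1; split; [cbn; auto|].
    apply runs_St1; auto. exists r; auto.
  - destruct os as [|[o z] [|[o2 z2] os]]; try discriminate. cbn in L; injection L as L.
    exists (StL q'); split.
    + right. change (In (Cell o z s1 (Some q'), StL q') (map (fun q' => (Cell o z s1 (Some q'), StL q')) sts)).
      apply in_map_iff. exists q'; split; auto. eapply delta_In; eauto.
    + exists St1; split; [cbn; rewrite H Nat.eqb_refl; cbn; auto|].
      apply runs_St1; auto. exists r; auto.
Qed.

Definition allrej (ts : list (nat * option nat)) : bool := forallb (fun x => haltrej (fst x) (snd x)) ts.

Fixpoint incos (c : bool) (os : list (nat * bool)) : list (nat * bool) :=
  match os with [] => [] | (o, z) :: os' => (fst (inccell z c o), z) :: incos (snd (inccell z c o)) os' end.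
Fixpoint carryout (c : bool) (os : list (nat * bool)) : bool :=
  match os with [] => c | (o, z) :: os' => carryout (snd (inccell z c o)) os' end.

(** Keeps the mark 4 of left blanks out of the certificate, so that incrementing the certificate
    does not affect where the head is placed. *)
Definition zone_ok (os : list (nat * bool)) : Prop := forall o, In (o, true) os -> o <> 4.

Lemma inccell_4 z c o : (z = true -> o <> 4) -> ldcell false (fst (inccell z c o)) = ldcell false o /\
  forall b, ldcell b (fst (inccell z c o)) = ldcell b o.
Proof.
  intros H. assert (K : forall b, ldcell b (fst (inccell z c o)) = ldcell b o); [|auto].
  intros b. unfold inccell, ldcell. destruct z, c; cbn; auto. specialize (H eq_refl).
  destruct o as [|[|[|[|[|o]]]]]; cbn; auto; congruence.
Qed.

(** One pass verifies the rejection, increments the certificate and reloads the tape. A carry left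
    over at the right marker means that the certificate zone was exhausted. *)
Lemma runs_Nx c b os ts v : zone_ok os -> length os = length ts -> runs (Nx c b) (map mk (combine os ts) ++ [RM]) v <->
  allrej ts = true /\ carryout c os = false /\ seenall b os = true /\
  v = map mk (combine (incos c os) (load b (incos c os))) ++ [RM].
Proof.
  revert c b ts v; induction os as [|[o z] os IH]; intros c b [|[s hd] ts] v ZO L; try discriminate.
  - cbn. destruct v as [|a v]; [split; [tauto|intros (_ & _ & _ & H); discriminate H]|]. split.
    + intros (q' & H & R). destruct c, b; try (destruct H; fail). destruct H as [H|[]]; inversion H; subst.
      destruct v; [auto|destruct R].
    + intros (_ & -> & -> & H). inversion H; subst. exists Q0; cbn; auto.
  - cbn in L; injection L as L. cbn [combine map app fst snd]. destruct v as [|a v]; [split; [cbn; tauto|intros (_ & _ & _ & H); discriminate H]|].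
    assert (ZO' : zone_ok os) by (intros o' Ho'; apply ZO; cbn; auto).
    destruct (inccell_4 z c o) as [_ K4]; [intros ->; apply ZO; cbn; auto|].
    cbn [allrej forallb fst snd carryout seenall incos load combine map app runs]. change (forallb _ ts) with (allrej ts).
    unfold mk at 1; cbn [fst snd]. rewrite succ_Nx K4.
    destruct (inccell z c o) as [o' c'] eqn:Ei. destruct (ldcell b o) as [hd' b'] eqn:El. cbn [fst snd].
    split.
    + intros (q' & H & R). destruct (haltrej s hd); [|destruct H]. destruct H as [H|[]]; inversion H; subst.
      apply IH in R as (K1 & K2 & K3 & ->); auto.
    + intros (K1 & K2 & K3 & H). apply andb_true_iff in K1 as [-> K1]. inversion H; subst.
      eexists; split; [left; reflexivity|]. apply IH; auto.
Qed.

Lemma runs_Tp os ts v : length os = length ts -> runs Tp (map mk (combine os ts) ++ [RM]) v <->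
  allrej ts = true /\ (forall o, In (o, true) os -> o = 2) /\ v = map mk (combine os ts) ++ [RM].
Proof.
  revert ts v; induction os as [|[o z] os IH]; intros [|[s hd] ts] v L; try discriminate.
  - cbn. destruct v as [|a v]; [split; [tauto|intros (_ & _ & H); discriminate H]|]. split.
    + intros (q' & [H|[]] & R); inversion H; subst. destruct v; [repeat split; auto; tauto|destruct R].
    + intros (_ & _ & H). inversion H; subst. exists Tp; cbn; auto.
  - cbn in L; injection L as L. cbn [combine map app fst snd]. destruct v as [|a v]; [split; [cbn; tauto|intros (_ & _ & H); discriminate H]|].
    cbn [allrej forallb fst snd runs]. change (forallb _ ts) with (allrej ts).
    unfold mk at 1; cbn [fst snd succ]. split.
    + intros (q' & H & R). destruct (haltrej s hd); [|destruct H].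
      destruct (negb z || Nat.eqb o 2) eqn:Z; [|destruct H]. destruct H as [H|[]]; inversion H; subst.
      apply IH in R as (K1 & K2 & ->); auto. split; auto. split; auto.
      intros o' [E|I]; [inversion E; subst|auto]. cbn in Z. now apply Nat.eqb_eq in Z.
    + intros (K1 & K2 & H). apply andb_true_iff in K1 as [-> K1]. inversion H; subst.
      exists Tp; split.
      * assert (Z : negb z || Nat.eqb o 2 = true) by (destruct z; auto; cbn; apply Nat.eqb_eq, K2; cbn; auto).
        rewrite Z; cbn; auto.
      * apply IH; auto. split; auto. split; auto. intros; apply K2; cbn; auto.
Qed.

(** Of the three guesses of [Q0], loading blocks on a row that is already loaded; the other two give
    the two alternatives. *)
Lemma runs_cells os ts v : zone_ok os -> length os = length ts -> runs Q0 (rowof os ts) v <->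
  (exists ts', stepT ts ts' /\ v = rowof os ts') \/
  (allrej ts = true /\ carryout true os = false /\ seenall false os = true /\
    v = rowof (incos true os) (load false (incos true os))).
Proof.
  intros ZO L. unfold rowof. destruct v as [|a v].
  { split; [cbn; tauto|]. intros [(? & _ & H)|(_ & _ & _ & H)]; discriminate H. }
  cbn [runs succ]. split.
  - intros (q' & [H|[H|[H|[]]]] & R); inversion H; subst.
    + exfalso. destruct os as [|[o z] os], ts as [|[s hd] ts], v; try discriminate; cbn in R; auto; destruct R as (? & [] & _).
    + apply runs_St0_sound in R as (ts' & St & ->); auto. left; eauto.
    + apply runs_Nx in R as (K1 & K2 & K3 & ->); auto.
  - intros [(ts' & St & H)|(K1 & K2 & K3 & H)]; inversion H; subst.
    + exists St0; split; [cbn; auto|]. now apply runs_St0_complete.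
    + exists (Nx true false); split; [cbn; auto|]. apply runs_Nx; auto.
Qed.

Lemma runs_top os ts v : length os = length ts -> runs QT (rowof os ts) v <->
  allrej ts = true /\ (forall o, In (o, true) os -> o = 2) /\ v = rowof os ts.
Proof.
  intros L. unfold rowof. destruct v as [|a v].
  { split; [cbn; tauto|]. intros (_ & _ & H); discriminate H. }
  cbn [runs succ]. split.
  - intros (q' & [H|[]] & R); inversion H; subst. apply runs_Tp in R as (K1 & K2 & ->); auto.
  - intros (K1 & K2 & H); inversion H; subst. exists Tp; split; [cbn; auto|]. apply runs_Tp; auto.
Qed.

End Rows.

(** * Machine runs and the enumeration of certificates *)

Fixpoint msteps (M : TM) (n : nat) (c c' : tmcfg) : Prop :=
  match n with 0 => c = c' | S n' => exists c1, tm_step M c = Some c1 /\ msteps M n' c1 c' end.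

Lemma msteps_app M n m c c1 c' : msteps M n c c1 -> msteps M m c1 c' -> msteps M (n + m) c c'.
Proof.
  revert c; induction n as [|n IH]; intros c; [intros ->; auto|].
  intros (c2 & E & H) H'; exists c2; auto.
Qed.

Lemma exec_msteps M t c cf : exec M t c = Some cf -> exists m, m <= t /\ msteps M m c cf /\ tm_step M cf = None.
Proof.
  revert c; induction t as [|t IH]; intros c; cbn; destruct (tm_step M c) as [c'|] eqn:E; try discriminate.
  - intros H; inversion H; subst; exists 0; cbn; auto.
  - intros H; apply IH in H as (m & L & H & H'). exists (S m); repeat split; auto; [lia|]. exists c'; auto.
  - intros H; inversion H; subst; exists 0; cbn; repeat split; auto; lia.
Qed.

Lemma msteps_exec M m t c cf : m <= t -> msteps M m c cf -> tm_step M cf = None -> exec M t c = Some cf.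
Proof.
  revert m c; induction t as [|t IH]; intros m c L H H'.
  - replace m with 0 in H by lia. cbn in H; subst. cbn; rewrite H'; auto.
  - destruct m as [|m]; cbn in H.
    + subst; cbn; rewrite H'; auto.
    + destruct H as (c1 & E & H). cbn; rewrite E. apply (IH m); auto; lia.
Qed.

(** Successor of a little-endian bijective base-2 numeral with digits 1 for [false] and 2 for
    [true]. Starting from the empty word, [zat] reaches every word, and lengths never decrease. *)
Fixpoint nextz (z : list bool) : list bool :=
  match z with [] => [false] | true :: z' => false :: nextz z' | false :: z' => true :: z' end.
Fixpoint zat (k : nat) : list bool := match k with 0 => [] | S k' => nextz (zat k') end.
Fixpoint zval (z : list bool) : nat := match z with [] => 0 | b :: z' => (if b then 2 else 1) + 2 * zval z' end.

Lemma zval_inj z z' : zval z = zval z' -> z = z'.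
Proof.
  revert z'; induction z as [|[] z IH]; intros [|[] z']; cbn [zval]; intros H; try lia; auto; f_equal; apply IH; lia.
Qed.

Lemma zval_nextz z : zval (nextz z) = S (zval z).
Proof. induction z as [|[] z IH]; cbn [nextz zval]; lia. Qed.

Lemma zat_zval z : zat (zval z) = z.
Proof.
  apply zval_inj. assert (K : forall k, zval (zat k) = k); [|auto].
  induction k as [|k IH]; auto. cbn [zat]; rewrite zval_nextz; auto.
Qed.

Lemma nextz_length z : length z <= length (nextz z) <= S (length z).
Proof. induction z as [|[] z IH]; cbn [nextz length]; lia. Qed.

Lemma zat_mono k k' : k <= k' -> length (zat k) <= length (zat k').
Proof. induction 1 as [|k' _ IH]; auto. cbn [zat]; pose proof (nextz_length (zat k')); lia. Qed.

(** The word of [p] twos is thus followed by a longer one: it is the last word of length at most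
    [p], and [Tp] recognises it. *)
Lemma nextz_true p : length (nextz (repeat true p)) = S p.
Proof. induction p as [|p IH]; cbn; auto. Qed.

(** * The search as a sequence of rows *)

Section Search.
Variables (V : TM) (x y : list bool) (p a b : nat).

Notation N := N.

Lemma tm_step_delta q l h r : tm_step V (q, l, h, r) =
  match delta V q h with
  | None => None
  | Some (q', w, d) => Some (match d with
      | MoveL => match l with [] => (q', [], 0, w :: r) | a :: l' => (q', l', a, w :: r) end
      | MoveR => match r with [] => (q', w :: l, 0, []) | a :: r' => (q', w :: l, a, r') end
      | Stay => (q', l, w, r)
      end)
  end.
Proof. unfold tm_step, delta. destruct (find _ _) as [[k [[q' w] d]]|]; auto. Qed.

(** [i] and [j] count the blank cells of the row beyond the part of the tape that the machine
    configuration stores. *)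
Definition rep (ts : list (nat * option nat)) (c : tmcfg) (i j : nat) : Prop :=
  match c with (q, l, h, r) => ts = N (repeat 0 i ++ rev l) ++ (h, Some q) :: N (r ++ repeat 0 j) end.

Lemma N_split l1 s1 q1 r1 l2 s2 q2 r2 :
  N l1 ++ (s1, Some q1) :: N r1 = N l2 ++ (s2, Some q2) :: N r2 -> l1 = l2 /\ s1 = s2 /\ q1 = q2 /\ r1 = r2.
Proof.
  revert l2; induction l1 as [|u l1 IH]; intros [|v l2]; cbn; intros H; inversion H; subst; auto.
  - repeat split; auto. clear H. revert r2 H3; induction r1 as [|u r1 IH]; intros [|v r2]; cbn; intros H; inversion H; auto.
    f_equal; auto.
  - destruct (IH l2 H2) as (-> & -> & -> & ->); auto.
Qed.

Lemma rep_sound ts ts' c i j : rep ts c i j -> stepT V ts ts' ->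
  exists c' i' j', tm_step V c = Some c' /\ rep ts' c' i' j'.
Proof.
  destruct c as [[[q l] h] r]. cbn [rep]. intros E St. rewrite tm_step_delta. destruct St as [l0 s q0 r0 q' w D|l0 s q0 s2 r0 q' w D|l0 s1 s q0 r0 q' w D].
  - apply N_split in E as (-> & -> & -> & ->). rewrite D. eexists _, i, j; split; [reflexivity|]. reflexivity.
  - change ((s2, None) :: N r0) with (N (s2 :: r0)) in E. apply N_split in E as (-> & -> & -> & E). rewrite D.
    destruct r as [|u r].
    + destruct j as [|j]; [discriminate|]. inversion E; subst. eexists _, i, j; split; [reflexivity|].
      cbn [rep rev]. rewrite app_assoc [in RHS]N_app -app_assoc. reflexivity.
    + inversion E; subst. eexists _, i, j; split; [reflexivity|].
      cbn [rep rev]. rewrite app_assoc [in RHS]N_app -app_assoc. reflexivity.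
  - assert (E' : N (l0 ++ [s1]) ++ (s, Some q0) :: N r0 = N (repeat 0 i ++ rev l) ++ (h, Some q) :: N (r ++ repeat 0 j)).
    { rewrite N_app -app_assoc; exact E. }
    apply N_split in E' as (E' & -> & -> & ->). rewrite D. destruct l as [|u l].
    + cbn in E'. rewrite app_nil_r in E'. destruct i as [|i]; [destruct l0; discriminate|].
      cbn [repeat] in E'. rewrite repeat_cons in E'. apply app_inj_tail in E' as [-> ->].
      eexists _, i, j; split; [reflexivity|]. cbn [rep rev]. rewrite app_nil_r; reflexivity.
    + cbn [rev] in E'. rewrite app_assoc in E'. apply app_inj_tail in E' as [-> ->].
      eexists _, i, j; split; [reflexivity|]. reflexivity.
Qed.

(** One step uses up at most one spare blank on each side, so a run of [m] steps needs [m] of them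
    on either side. *)
Lemma rep_complete ts c c' i j : rep ts c (S i) (S j) -> tm_step V c = Some c' ->
  exists ts' i' j', stepT V ts ts' /\ rep ts' c' i' j' /\ i <= i' /\ j <= j'.
Proof.
  destruct c as [[[q l] h] r]. cbn [rep]. intros -> E. rewrite tm_step_delta in E.
  destruct (delta V q h) as [[[q' w] []]|] eqn:D; [| | |discriminate E].
  - destruct l as [|u l]; inversion E; subst; clear E.
    + eexists _, i, (S j). split; [|split; [reflexivity|lia]]. cbn [rev repeat]. rewrite !app_nil_r repeat_cons N_app -app_assoc.
      apply (stepL V _ 0 h q _ q' w D).
    + eexists _, (S i), (S j). split; [|split; [reflexivity|lia]]. cbn [rev]. rewrite app_assoc N_app -app_assoc.
      apply (stepL V _ u h q _ q' w D).
  - assert (Ew : N (repeat 0 (S i) ++ rev l ++ [w]) = N (repeat 0 (S i) ++ rev l) ++ [(w, None)])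
      by (rewrite app_assoc N_app; reflexivity).
    destruct r as [|u r]; inversion E; subst; clear E.
    + eexists _, (S i), j. split; [|split; [reflexivity|lia]]. cbn [rev]. rewrite Ew -app_assoc. apply (stepR V _ h q 0 _ q' w D).
    + eexists _, (S i), (S j). split; [|split; [reflexivity|lia]]. cbn [rev]. rewrite Ew -app_assoc. apply (stepR V _ h q u _ q' w D).
  - inversion E; subst; clear E. eexists _, (S i), (S j). split; [|split; [reflexivity|lia]].
    apply (stepS V _ h q _ q' w D).
Qed.

Lemma allrej_app t1 t2 : allrej V (t1 ++ t2) = allrej V t1 && allrej V t2.
Proof. apply forallb_app. Qed.

Lemma allrej_N l : allrej V (N l) = true.
Proof. induction l; auto. Qed.

Lemma allrej_rep ts c i j : rep ts c i j -> allrej V ts = true <-> tm_step V c = None /\ tm_state c <> 1.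
Proof.
  destruct c as [[[q l] h] r]. cbn [rep]. intros ->. rewrite allrej_app allrej_N tm_step_delta.
  cbn [andb]. change (allrej V ((h, Some q) :: N (r ++ repeat 0 j))) with (haltrej V h (Some q) && allrej V (N (r ++ repeat 0 j))).
  rewrite allrej_N andb_true_r. cbn [haltrej tm_state]. rewrite andb_true_iff negb_true_iff Nat.eqb_neq.
  destruct (delta V q h) as [[[q' w] d]|]; split; intros [? ?]; split; auto; discriminate.
Qed.

Definition xy : list nat := tape_of x ++ [3] ++ tape_of y ++ [3].
Definition base (zz : list nat) : list (nat * bool) :=
  repeat (4, false) a ++ map (fun o => (o, false)) xy ++ map (fun o => (o, true)) zz ++ repeat (0, false) b.
Definition zonefor (z : list bool) : list nat := tape_of z ++ repeat 0 (p - length z).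
Definition start (z : list bool) : tmcfg := init_cfg (triple_tape x y z).

Lemma tape_of_range z o : In o (tape_of z) -> o = 1 \/ o = 2.
Proof. intros H; apply in_map_iff in H as ([] & <- & _); auto. Qed.

Lemma xy_range o : In o xy -> o = 1 \/ o = 2 \/ o = 3.
Proof.
  unfold xy; intros H; repeat (apply in_app_iff in H as [H|H]); try (apply tape_of_range in H; tauto);
    destruct H as [<-|[]]; auto.
Qed.

Lemma zonefor_range z o : In o (zonefor z) -> o <= 2.
Proof.
  unfold zonefor; intros H; apply in_app_iff in H as [H|H]; [apply tape_of_range in H; lia|].
  apply repeat_spec in H; lia.
Qed.

Lemma load_true os : load true os = N (map (fun x => symof (fst x)) os).
Proof. induction os as [|[o z] os IH]; cbn; auto. f_equal; exact IH. Qed.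

Lemma load_pad n os : load false (repeat (4, false) n ++ os) = N (repeat 0 n) ++ load false os.
Proof. induction n as [|n IH]; auto. cbn. f_equal; exact IH. Qed.

Lemma seenall_pad n os : seenall false (repeat (4, false) n ++ os) = seenall false os.
Proof. induction n as [|n IH]; auto. Qed.

Lemma seenall_true os : seenall true os = true.
Proof. induction os as [|[o z] os IH]; auto. Qed.

Lemma xy_cons : exists h r, xy = h :: r /\ Nat.eqb h 4 = false /\ symof h = h.
Proof. unfold xy; destruct x as [|[] x']; cbn; do 2 eexists; repeat split; reflexivity. Qed.

Lemma seenall_base zz : seenall false (base zz) = true.
Proof.
  unfold base; rewrite seenall_pad. destruct xy_cons as (h & r & -> & E & _). cbn. rewrite E. apply seenall_true.
Qed.

Lemma symof_small o : o <= 3 -> symof o = o.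
Proof. destruct o as [|[|[|[|]]]]; auto; lia. Qed.

Lemma map_id_on {X} (f : X -> X) l : (forall u, In u l -> f u = u) -> map f l = l.
Proof. intros H; rewrite -{2}(map_id l); now apply map_ext_in. Qed.

Lemma load_base z : exists i j, rep (load false (base (zonefor z))) (start z) i j /\ a <= i /\ b <= j.
Proof.
  exists a, (p - length z + b). split; [|lia]. unfold start, rep.
  assert (Et : triple_tape x y z = xy ++ tape_of z)
    by (unfold triple_tape, xy; rewrite -!app_assoc; reflexivity).
  rewrite Et; clear Et.
  unfold base; rewrite load_pad. pose proof xy_range as XR.
  destruct xy_cons as (h & r & E & E4 & Eh). rewrite E in XR |- *.
  cbn [app init_cfg map load fst snd ldcell]. rewrite E4 Eh load_true. cbn [fst snd]. rewrite app_nil_r.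
  do 2 f_equal. rewrite map_app map_app !map_map. cbn [fst].
  rewrite (map_id_on _ r); [intros u Hu; apply symof_small; destruct (XR u) as [->|[->| ->]]; cbn; auto|].
  rewrite (map_id_on _ (zonefor z)); [intros u Hu; apply symof_small; apply zonefor_range in Hu; lia|].
  rewrite map_repeat. unfold zonefor. rewrite repeat_app -!app_assoc; reflexivity.
Qed.

Lemma base_zone_ok z : zone_ok (base (zonefor z)).
Proof.
  intros o H. unfold base in H. apply in_app_iff in H as [H|H]; [apply repeat_spec in H; discriminate H|].
  apply in_app_iff in H as [H|H]; [apply in_map_iff in H as (u & E & _); discriminate E|].
  apply in_app_iff in H as [H|H]; [|apply repeat_spec in H; discriminate H].
  apply in_map_iff in H as (u & E & H); inversion E; subst. apply zonefor_range in H; lia.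
Qed.

Lemma incos_nozone c l os : incos c (map (fun o => (o, false)) l ++ os) = map (fun o => (o, false)) l ++ incos c os.
Proof. induction l as [|o l IH]; auto. cbn; f_equal; auto. Qed.
Lemma carryout_nozone c l os : carryout c (map (fun o => (o, false)) l ++ os) = carryout c os.
Proof. induction l as [|o l IH]; auto. Qed.
Lemma repeat_map n o : repeat (o, false) n = map (fun o : nat => (o, false)) (repeat o n).
Proof. now rewrite map_repeat. Qed.

Fixpoint incl (c : bool) (zz : list nat) : list nat :=
  match zz with [] => [] | o :: zz' => fst (inccell true c o) :: incl (snd (inccell true c o)) zz' end.
Fixpoint carryl (c : bool) (zz : list nat) : bool :=
  match zz with [] => c | o :: zz' => carryl (snd (inccell true c o)) zz' end.

Lemma incos_zone c zz os : incos c (map (fun o => (o, true)) zz ++ os) =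
  map (fun o => (o, true)) (incl c zz) ++ incos (carryl c zz) os.
Proof. revert c; induction zz as [|o zz IH]; intros c; cbn; auto. rewrite IH; auto. Qed.
Lemma carryout_zone c zz os : carryout c (map (fun o => (o, true)) zz ++ os) = carryout (carryl c zz) os.
Proof. revert c; induction zz as [|o zz IH]; intros c; cbn; auto. Qed.

Lemma incos_base zz : incos true (base zz) = base (incl true zz) /\ carryout true (base zz) = carryl true zz.
Proof.
  unfold base; rewrite !repeat_map; split.
  - rewrite !incos_nozone incos_zone. do 3 f_equal. rewrite -(app_nil_r (map _ (repeat 0 b))) incos_nozone; auto.
  - rewrite !carryout_nozone carryout_zone. rewrite -(app_nil_r (map _ (repeat 0 b))) carryout_nozone; auto.
Qed.

Lemma incl_false zz : incl false zz = zz /\ carryl false zz = false.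
Proof. induction zz as [|o zz [IH1 IH2]]; cbn; auto. now rewrite IH1. Qed.

Lemma incl_zone z m : (carryl true (tape_of z ++ repeat 0 m) = false <-> length (nextz z) <= length z + m) /\
  (length (nextz z) <= length z + m ->
   incl true (tape_of z ++ repeat 0 m) = tape_of (nextz z) ++ repeat 0 (length z + m - length (nextz z))).
Proof.
  induction z as [|[] z [IH1 IH2]].
  - destruct m as [|m]; cbn.
    + split; [split; intros; [discriminate|lia]|lia].
    + rewrite (proj1 (incl_false _)) (proj2 (incl_false _)). split; [split; intros; auto; lia|].
      intros _. rewrite Nat.sub_0_r; auto.
  - cbn [tape_of map app nextz length incl carryl inccell andb fst snd]. change (map _ z) with (tape_of z).
    change (map _ (nextz z)) with (tape_of (nextz z)).
    rewrite IH1. split; [lia|]. intros H. rewrite IH2; [lia|]. f_equal.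
  - cbn [tape_of map app nextz length incl carryl inccell andb fst snd]. change (map _ z) with (tape_of z).
    rewrite (proj1 (incl_false _)) (proj2 (incl_false _)). split; [split; intros; auto; lia|].
    intros _. do 3 f_equal; lia.
Qed.

Definition rejects (z : list bool) (m : nat) : Prop :=
  exists cf, msteps V m (start z) cf /\ tm_step V cf = None /\ tm_state cf <> 1.

(** The invariant of the loaded rows: all certificates before number [k] have been rejected, and the
    row shows the machine after [m] steps on certificate [k]. *)
Definition searching (u : list letter) : Prop :=
  exists k ts c i j m, u = rowof (base (zonefor (zat k))) ts /\ length (base (zonefor (zat k))) = length ts /\
    rep ts c i j /\ msteps V m (start (zat k)) c /\
    length (zat k) <= p /\ forall k', k' < k -> exists m, rejects (zat k') m.

Lemma zonefor_next z : length z <= p -> carryl true (zonefor z) = false ->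
  length (nextz z) <= p /\ incl true (zonefor z) = zonefor (nextz z).
Proof.
  intros L H. unfold zonefor in *. destruct (incl_zone z (p - length z)) as [K1 K2].
  apply K1 in H. split; [lia|]. rewrite K2; auto. do 2 f_equal; lia.
Qed.

Lemma searching_load k : length (zat k) <= p -> (forall k', k' < k -> exists m, rejects (zat k') m) ->
  searching (rowof (base (zonefor (zat k))) (load false (base (zonefor (zat k))))).
Proof.
  intros L H. destruct (load_base (zat k)) as (i & j & R & _).
  exists k, (load false (base (zonefor (zat k)))), (start (zat k)), i, j, 0.
  rewrite load_length; repeat split; auto.
Qed.

Lemma searching_step u v : searching u -> runs V Q0 u v -> searching v.
Proof.
  intros (k & ts & c & i & j & m & -> & L & R & M & Lz & Hr) H.
  apply runs_cells in H; [|apply base_zone_ok|auto].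
  destruct H as [(ts' & St & ->)|(Rj & Ct & _ & ->)].
  - destruct (rep_sound _ _ _ _ _ R St) as (c' & i' & j' & E & R').
    exists k, ts', c', i', j', (m + 1). repeat split; auto.
    + rewrite (stepT_length _ _ _ St); auto.
    + apply msteps_app with c; auto. exists c'; cbn; auto.
  - destruct (incos_base (zonefor (zat k))) as [E1 E2]. rewrite E2 in Ct. rewrite E1.
    destruct (zonefor_next _ Lz Ct) as [Ln ->]. apply (searching_load (S k)); auto.
    intros k' Hk'. destruct (Nat.eq_dec k' k) as [->|]; [|apply Hr; lia].
    apply (allrej_rep _ _ _ _ R) in Rj as [Hn Hs]. exists m, c; auto.
Qed.

(** The test in the top row finds the certificate full of twos and rejected. Every word of length at
    most [p] comes no later in the enumeration, so it has been rejected too. *)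
Lemma search_sound n v v' : rsteps letter rstate (nrms V) Q0 (S n) (rawrow (base (zonefor []))) v ->
  run letter rstate (nrms V) QT v v' -> forall z, length z <= p -> exists m, rejects z m.
Proof.
  intros (u & R1 & Rn) RT.
  apply run_runs, runs_raw in R1 as [_ ->].
  assert (K : searching (rowof (base (zonefor [])) (load false (base (zonefor []))))).
  { apply (searching_load 0); cbn; [lia|]. intros; lia. }
  revert K Rn. generalize (rowof (base (zonefor [])) (load false (base (zonefor [])))). induction n as [|n IH]; intros u K Rn.
  - cbn in Rn; subst u. destruct K as (k & ts & c & i & j & m & -> & L & R & M & Lz & Hr).
    apply run_runs, runs_top in RT as (Rj & Z & _); auto.
    apply (allrej_rep _ _ _ _ R) in Rj as [Hn Hs].
    assert (Zk : zat k = repeat true p).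
    { assert (Z' : forall o, In o (zonefor (zat k)) -> o = 2).
      { intros o Ho; apply Z. unfold base. rewrite !in_app_iff !in_map_iff. right; right; left. exists o; auto. }
      unfold zonefor in Z'.
      assert (p - length (zat k) = 0).
      { destruct (p - length (zat k)); auto. specialize (Z' 0). discriminate Z'. apply in_app_iff; right; cbn; auto. }
      replace p with (length (zat k)) by lia.
      assert (Z2 : forall o, In o (tape_of (zat k)) -> o = 2) by (intros; apply Z', in_app_iff; auto).
      revert Z2. generalize (zat k). clear. induction l as [|[] l IH]; cbn; intros Z2; auto.
      - f_equal; auto.
      - specialize (Z2 1). discriminate Z2; auto. }
    intros z Hz. rewrite -(zat_zval z) in Hz |- *. destruct (lt_eq_lt_dec (zval z) k) as [[Lt|<-]|Gt].
    + auto.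
    + exists m, c; auto.
    (* A word enumerated after [p] twos is longer than [p]. *)
    + exfalso. pose proof (zat_mono (S k) (zval z) Gt) as Mo. cbn [zat] in Mo. rewrite Zk nextz_true in Mo. lia.
  - destruct Rn as (u' & R & Rn). apply (IH u'); auto. eapply searching_step; eauto. now apply run_runs.
Qed.

Lemma rsteps_app n m u v w : rsteps letter rstate (nrms V) Q0 n u v -> rsteps letter rstate (nrms V) Q0 m v w ->
  rsteps letter rstate (nrms V) Q0 (n + m) u w.
Proof.
  revert u; induction n as [|n IH]; intros u; [intros ->; auto|].
  intros (u' & E & H) H'; exists u'; auto.
Qed.

Definition goodrow (u : list letter) : Prop := Forall (fun c => In c (allA V)) u.

Lemma sim_complete os m ts c cf i j : zone_ok os -> length os = length ts -> goodrow (rowof os ts) ->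
  rep ts c i j -> m <= i -> m <= j -> msteps V m c cf ->
  exists ts' i' j', rsteps letter rstate (nrms V) Q0 m (rowof os ts) (rowof os ts') /\ rep ts' cf i' j' /\
     length os = length ts' /\ goodrow (rowof os ts').
Proof.
  intros ZO; revert ts c i j; induction m as [|m IH]; intros ts c i j L G R Hi Hj H.
  - cbn in H; subst. exists ts, i, j; cbn; auto.
  - destruct H as (c1 & E & H). destruct i as [|i]; [lia|]. destruct j as [|j]; [lia|].
    destruct (rep_complete _ _ _ _ _ R E) as (ts1 & i1 & j1 & St & R1 & Hi1 & Hj1).
    assert (Rn : runs V Q0 (rowof os ts) (rowof os ts1)).
    { apply runs_cells; auto. left; eauto. }
    apply runs_run in Rn as [Rn G1]; auto; [|left; auto].
    destruct (IH ts1 c1 i1 j1) as (ts' & i' & j' & Rs & R' & L' & G'); auto; try lia.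
    { rewrite (stepT_length _ _ _ St); auto. }
    exists ts', i', j'; repeat split; auto. exists (rowof os ts1); auto.
Qed.

Lemma raw_good : goodrow (rawrow (base (zonefor []))).
Proof.
  unfold rawrow. constructor; [left; auto|]. apply Forall_app; split; [|constructor; [right; left; auto|constructor]].
  apply Forall_forall. intros u Hu. apply in_map_iff in Hu as ([o z] & <- & H). apply in_allA_Raw; cbn [fst].
  unfold base in H. repeat (apply in_app_iff in H as [H|H]).
  - apply repeat_spec in H; inversion H; cbn; tauto.
  - apply in_map_iff in H as (u & E & H); inversion E; subst. apply xy_range in H as [->|[->| ->]]; cbn; tauto.
  - apply in_map_iff in H as (u & E & H); inversion E; subst. apply zonefor_range in H. cbn; lia.
  - apply repeat_spec in H; inversion H; cbn; tauto.
Qed.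

(** A run of at most [T] steps stays inside a row with [T] blanks on both sides. So each certificate
    can be simulated up to its rejection and replaced by the next one, until [Tp] applies to the
    word of [p] twos. *)
Lemma search_complete (T : nat) : T <= a -> T <= b ->
  (forall z, length z <= p -> exists m, m <= T /\ rejects z m) ->
  exists n v v', rsteps letter rstate (nrms V) Q0 (S n) (rawrow (base (zonefor []))) v /\
    run letter rstate (nrms V) QT v v'.
Proof.
  intros Ta Tb H.
  assert (K : forall k, length (zat k) <= p -> exists n,
    rsteps letter rstate (nrms V) Q0 (S n) (rawrow (base (zonefor [])))
      (rowof (base (zonefor (zat k))) (load false (base (zonefor (zat k))))) /\
    goodrow (rowof (base (zonefor (zat k))) (load false (base (zonefor (zat k)))))).
  { induction k as [|k IH]; intros Lk.
    - exists 0. assert (R : runs V Q0 (rawrow (base (zonefor []))) (rowof (base (zonefor [])) (load false (base (zonefor []))))).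
      { apply runs_raw; split; auto using seenall_base. }
      apply runs_run in R as [R G]; [|left; auto|apply raw_good]. split; auto. eexists; split; [exact R|reflexivity].
    - cbn [zat] in Lk. pose proof (nextz_length (zat k)) as NL.
      destruct IH as (n & Rn & G); [lia|].
      destruct (H (zat k)) as (m & Hm & cf & M & Hh & Hs); [lia|].
      destruct (load_base (zat k)) as (i & j & R & Hi & Hj).
      destruct (sim_complete _ m _ _ cf i j (base_zone_ok (zat k)) (eq_sym (load_length _ _)) G R) as (ts' & i' & j' & Rs & R' & L' & G'); auto; try lia.
      assert (Cy : carryl true (zonefor (zat k)) = false) by (apply incl_zone; lia).
      destruct (incos_base (zonefor (zat k))) as [E1 E2].
      destruct (zonefor_next (zat k)) as [_ E3]; [lia|auto|].
      assert (Nx' : runs V Q0 (rowof (base (zonefor (zat k))) ts')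
         (rowof (base (zonefor (zat (S k)))) (load false (base (zonefor (zat (S k))))))).
      { apply runs_cells; auto using base_zone_ok. right. rewrite E1 E2 E3. split; [|split; [|split]]; auto using seenall_base.
        apply (allrej_rep _ _ _ _ R'); auto. }
      apply runs_run in Nx' as [Nx' G'']; auto; [|left; auto].
      exists (n + (m + 1)). split; auto. change (S (n + (m + 1))) with (S n + (m + 1)).
      eapply rsteps_app; [exact Rn|]. eapply rsteps_app; [exact Rs|]. eexists; split; [exact Nx'|reflexivity]. }
  set (k := zval (repeat true p)).
  assert (Zk : zat k = repeat true p) by apply zat_zval.
  destruct (K k) as (n & Rn & G); [rewrite Zk repeat_length; lia|].
  destruct (H (zat k)) as (m & Hm & cf & M & Hh & Hs); [rewrite Zk repeat_length; lia|].
  destruct (load_base (zat k)) as (i & j & R & Hi & Hj).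
  destruct (sim_complete _ m _ _ cf i j (base_zone_ok (zat k)) (eq_sym (load_length _ _)) G R) as (ts' & i' & j' & Rs & R' & L' & G'); auto; try lia.
  assert (Tp' : runs V QT (rowof (base (zonefor (zat k))) ts') (rowof (base (zonefor (zat k))) ts')).
  { apply runs_top; auto. split; [apply (allrej_rep _ _ _ _ R'); auto|]. split; auto.
    intros o Ho. unfold base in Ho. repeat (apply in_app_iff in Ho as [Ho|Ho]).
    - apply repeat_spec in Ho; discriminate Ho.
    - apply in_map_iff in Ho as (u & E & _); discriminate E.
    - apply in_map_iff in Ho as (u & E & Ho); inversion E; subst. rewrite Zk in Ho. unfold zonefor in Ho.
      rewrite repeat_length Nat.sub_diag app_nil_r in Ho. apply in_map_iff in Ho as (w & <- & Ho).
      apply repeat_spec in Ho; subst; auto.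
    - apply repeat_spec in Ho; discriminate Ho. }
  apply runs_run in Tp' as [Tp' _]; auto; [|right; left; auto].
  exists (n + m), (rowof (base (zonefor (zat k))) ts'), (rowof (base (zonefor (zat k))) ts'). split; auto.
  change (S (n + m)) with (S n + m). eapply rsteps_app; eauto.
Qed.

End Search.

(** * Sweeping machines *)

Lemma find_app {X} (f : X -> bool) l l' :
  find f (l ++ l') = match find f l with Some e => Some e | None => find f l' end.
Proof. induction l as [|e l IH]; cbn; auto. destruct (f e); auto. Qed.

(* A sweeping machine repeatedly passes over its word from left to right with a Mealy machine
   and then, depending on the state reached, appends a word at the right end or stops. *)
Section Sweeper.
Variables (S A : Type) (cS : S -> nat) (cA : A -> nat) (allS : list S) (allA : list A).
Variables (dlt : S -> A -> S * A) (turn : S -> option (list A * S)) (s0 : S) (bit : bool -> A) (isbit : A -> bool).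
Hypothesis cS_inj : forall s s', cS s = cS s' -> s = s'.
Hypothesis cA_inj : forall a a', cA a = cA a' -> a = a'.
Hypothesis cA_pos : forall a, cA a <> 0.
Hypothesis cS0 : cS s0 = 0.
Hypothesis s0_in : In s0 allS.
Hypothesis bit_in : forall b, In (bit b) allA.
Hypothesis bit_code : forall b, cA (bit b) = if b then 2 else 1.
Hypothesis bit_isbit : forall b, isbit (bit b) = true.
Hypothesis dlt_in : forall s a, In s allS -> In a allA -> In (fst (dlt s a)) allS /\ In (snd (dlt s a)) allA.
Hypothesis turn_in : forall s w s', In s allS -> turn s = Some (w, s') -> In s' allS /\ Forall (fun a => In a allA) w.

Fixpoint sweep (s : S) (U : list A) : S * list A :=
  match U with
  | [] => (s, [])
  | a :: U' => let (s1, a1) := dlt s a in let (s2, U2) := sweep s1 U' in (s2, a1 :: U2)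
  end.

Fixpoint srun (n : nat) (s : S) (U : list A) (s' : S) (U' : list A) : Prop :=
  match n with
  | 0 => s = s' /\ U = U'
  | Datatypes.S n' => exists s1 U1 w s2, sweep s U = (s1, U1) /\ turn s1 = Some (w, s2) /\ srun n' s2 (U1 ++ w) s' U'
  end.

Lemma srun_app n m s U s1 U1 s' U' : srun n s U s1 U1 -> srun m s1 U1 s' U' -> srun (n + m) s U s' U'.
Proof.
  revert s U; induction n as [|n IH]; intros s U; [intros [-> ->]; auto|].
  intros (s2 & U2 & w & s3 & E & T & H) H'. exists s2, U2, w, s3; auto.
Qed.

Lemma sweep_length s U : length (snd (sweep s U)) = length U.
Proof.
  revert s; induction U as [|a U IH]; intros s; auto. cbn.
  destruct (dlt s a) as [s1 a1]. specialize (IH s1). destruct (sweep s1 U); cbn in *; auto.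
Qed.

Lemma sweep_app s U1 U2 s1 V1 s2 V2 : sweep s U1 = (s1, V1) -> sweep s1 U2 = (s2, V2) ->
  sweep s (U1 ++ U2) = (s2, V1 ++ V2).
Proof.
  revert s V1; induction U1 as [|a U IH]; intros s V1; cbn.
  - intros H; inversion H; auto.
  - destruct (dlt s a) as [s3 a1]. destruct (sweep s3 U) as [s4 V4] eqn:E. intros H; inversion H; subst.
    intros H2. rewrite (IH _ _ E H2); auto.
Qed.

Lemma srun_length n s U s' U' : srun n s U s' U' -> length U <= length U'.
Proof.
  revert s U; induction n as [|n IH]; intros s U; [intros [-> ->]; auto|].
  intros (s2 & U2 & w & s3 & E & T & H). apply IH in H. rewrite length_app in H.
  pose proof (sweep_length s U) as L; rewrite E in L; cbn in L. lia.
Qed.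

(** [Rt] sweeps right, [Wr] appends a word letter by letter, [Lf] returns. After the last sweep [FL]
    returns and [FR] walks to the first bit and halts there, because the output of a machine is read
    from its head on. *)
Inductive ts := Rt (s : S) | Lf (s : S) | Wr (s : S) (i : nat) | FL | FR.

Definition tcode (q : ts) : nat :=
  match q with
  | Rt s => to_nat (0, cS s)
  | Lf s => to_nat (1, cS s)
  | Wr s i => to_nat (2, to_nat (cS s, i))
  | FL => to_nat (3, 0)
  | FR => to_nat (4, 0)
  end.

Lemma to_nat_inj p q : to_nat p = to_nat q -> p = q.
Proof. intros H; rewrite -(cancel_of_to p) -(cancel_of_to q) H; auto. Qed.

Lemma tcode_inj q q' : tcode q = tcode q' -> q = q'.
Proof.
  destruct q, q'; cbn -[to_nat]; intros H; apply to_nat_inj in H; try discriminate H; auto.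
  - injection H as H; f_equal; auto.
  - injection H as H; f_equal; auto.
  - apply pair_equal_spec in H as [_ H]. apply to_nat_inj in H. injection H as H ->. f_equal; auto.
Qed.

Definition csym (o : option A) : nat := match o with None => 0 | Some a => cA a end.

Lemma csym_inj o o' : csym o = csym o' -> o = o'.
Proof.
  destruct o, o'; cbn; intros H; auto.
  - f_equal; auto.
  - destruct (cA_pos _ H).
  - symmetry in H; destruct (cA_pos _ H).
Qed.

Definition tstep (q : ts) (o : option A) : option (ts * option A * move) :=
  match q, o with
  | Rt s, Some a => Some (Rt (fst (dlt s a)), Some (snd (dlt s a)), MoveR)
  | Rt s, None => match turn s with Some _ => Some (Wr s 0, None, Stay) | None => Some (FL, None, MoveL) end
  | Wr s i, None => match turn s with
                    | Some (w, s') => match nth_error w i with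
                                      | Some a => Some (Wr s (i + 1), Some a, MoveR)
                                      | None => Some (Lf s', None, MoveL)
                                      end
                    | None => None
                    end
  | Lf s, Some a => Some (Lf s, Some a, MoveL)
  | Lf s, None => Some (Rt s, None, MoveR)
  | FL, Some a => Some (FL, Some a, MoveL)
  | FL, None => Some (FR, None, MoveR)
  | FR, Some a => if isbit a then None else Some (FR, Some a, MoveR)
  | _, _ => None
  end.

Definition wlen (s : S) : nat := match turn s with Some (w, _) => length w | None => 0 end.
Definition allT : list ts :=
  map Rt allS ++ map Lf allS ++ flat_map (fun s => map (Wr s) (seq 0 (wlen s + 1))) allS ++ [FL; FR].
Definition allO : list (option A) := None :: map Some allA.

Definition entry (x : ts * option A) : list ((nat * nat) * (nat * nat * move)) :=
  match tstep (fst x) (snd x) with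
  | Some (q', o', m) => [((tcode (fst x), csym (snd x)), (tcode q', csym o', m))]
  | None => []
  end.
Definition machine : TM := mkTM (flat_map entry (list_prod allT allO)).

Definition keyed (q : ts) (o : option A) (e : (nat * nat) * (nat * nat * move)) : bool :=
  Nat.eqb (fst (fst e)) (tcode q) && Nat.eqb (snd (fst e)) (csym o).

(** The table is searched for its first match. Both codings are injective, so every entry with the
    same key comes from the same pair, and repetitions in the list do no harm. *)
Lemma find_entry l q o : (tstep q o = None \/ In (q, o) l) ->
  find (keyed q o) (flat_map entry l) =
  match tstep q o with Some (q', o', m) => Some ((tcode q, csym o), (tcode q', csym o', m)) | None => None end.
Proof.
  induction l as [|[q1 o1] l IH]; intros H.
  - destruct H as [->|[]]; auto.
  - cbn [flat_map]. rewrite find_app.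
    assert (D : (q1 = q /\ o1 = o) \/ forall y, keyed q o ((tcode q1, csym o1), y) = false).
    { destruct (Nat.eqb_spec (tcode q1) (tcode q)) as [E|E]; [|right; intros y; unfold keyed; cbn [fst]; now apply Nat.eqb_neq in E as ->].
      destruct (Nat.eqb_spec (csym o1) (csym o)) as [E'|E']; [|right; intros y; unfold keyed; cbn [fst snd]; apply Nat.eqb_neq in E' as ->; apply andb_false_r].
      left; split; [now apply tcode_inj|now apply csym_inj]. }
    unfold entry at 1; cbn [fst snd]. destruct D as [[-> ->]|D].
    + destruct (tstep q o) as [[[q2 o2] m2]|] eqn:T.
      * cbn [find]. unfold keyed at 1; cbn [fst snd]. rewrite !Nat.eqb_refl; auto.
      * cbn [find]. apply IH; auto.
    + assert (Hn : find (keyed q o) (match tstep q1 o1 with Some (q', o', m) => [((tcode q1, csym o1), (tcode q', csym o', m))] | None => [] end) = None).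
      { destruct (tstep q1 o1) as [[[q2 o2] m2]|]; auto. cbn [find]. rewrite D; auto. }
      rewrite Hn. apply IH. destruct H as [H|[H|H]]; auto. inversion H; subst. exfalso.
      specialize (D (0, 0, Stay)). unfold keyed in D; cbn [fst snd] in D. rewrite !Nat.eqb_refl in D; discriminate D.
Qed.

Lemma tm_step_machine q l o r : In q allT -> In o allO -> tm_step machine (tcode q, l, csym o, r) =
  match tstep q o with
  | None => None
  | Some (q', o', m) => Some (match m with
      | MoveL => match l with [] => (tcode q', [], 0, csym o' :: r) | a :: l' => (tcode q', l', a, csym o' :: r) end
      | MoveR => match r with [] => (tcode q', csym o' :: l, 0, []) | a :: r' => (tcode q', csym o' :: l, a, r') end
      | Stay => (tcode q', l, csym o', r)
      end)
  end.
Proof.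
  intros Hq Ho. unfold tm_step, machine. cbn [tm_delta].
  change (find _ _) with (find (keyed q o) (flat_map entry (list_prod allT allO))).
  rewrite find_entry; [right; now apply in_prod|]. destruct (tstep q o) as [[[q' o'] m]|]; auto.
Qed.

Lemma tm_step_blank q l r : In q allT -> tm_step machine (tcode q, l, 0, r) =
  match tstep q None with
  | None => None
  | Some (q', o', m) => Some (match m with
      | MoveL => match l with [] => (tcode q', [], 0, csym o' :: r) | a :: l' => (tcode q', l', a, csym o' :: r) end
      | MoveR => match r with [] => (tcode q', csym o' :: l, 0, []) | a :: r' => (tcode q', csym o' :: l, a, r') end
      | Stay => (tcode q', l, csym o', r)
      end)
  end.
Proof. intros Hq. apply (tm_step_machine q l None r Hq). left; auto. Qed.

Lemma Rt_in s : In s allS -> In (Rt s) allT.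
Proof. intros; apply in_app_iff; left; now apply in_map. Qed.
Lemma Lf_in s : In s allS -> In (Lf s) allT.
Proof. intros; apply in_app_iff; right; apply in_app_iff; left; now apply in_map. Qed.
Lemma Wr_in s i w s' : In s allS -> turn s = Some (w, s') -> i <= length w -> In (Wr s i) allT.
Proof.
  intros H E L; apply in_app_iff; right; apply in_app_iff; right; apply in_app_iff; left.
  apply in_flat_map. exists s; split; auto. apply in_map, in_seq. unfold wlen; rewrite E; lia.
Qed.
Lemma FL_in : In FL allT.
Proof. do 3 (apply in_app_iff; right). cbn; auto. Qed.
Lemma FR_in : In FR allT.
Proof. do 3 (apply in_app_iff; right). cbn; auto. Qed.
Lemma Some_in a : In a allA -> In (Some a) allO.
Proof. intros; right; now apply in_map. Qed.

Definition cfgR (q : nat) (l rs : list nat) : tmcfg := match rs with [] => (q, l, 0, []) | a :: r => (q, l, a, r) end.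
Definition cfgL (q : nat) (l rs : list nat) : tmcfg := match l with [] => (q, [], 0, rs) | a :: l' => (q, l', a, rs) end.

Definition goodword (U : list A) : Prop := Forall (fun a => In a allA) U.

Lemma sweep_good s U s' U' : In s allS -> goodword U -> sweep s U = (s', U') -> In s' allS /\ goodword U'.
Proof.
  revert s U'; induction U as [|a U IH]; intros s U' Hs HU; cbn.
  - intros H; inversion H; subst; auto.
  - inversion HU; subst. destruct (dlt_in s a Hs H1) as [D1 D2]. destruct (dlt s a) as [s1 a1]; cbn in D1, D2.
    destruct (sweep s1 U) as [s2 U2] eqn:E. intros H; inversion H; subst.
    destruct (IH _ _ D1 H2 E) as [K1 K2]. split; auto. constructor; auto.
Qed.

Lemma msteps_sweep s U s' U' l rs : In s allS -> goodword U -> sweep s U = (s', U') ->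
  msteps machine (length U) (cfgR (tcode (Rt s)) l (map cA U ++ rs)) (cfgR (tcode (Rt s')) (rev (map cA U') ++ l) rs).
Proof.
  revert s U' l; induction U as [|a U IH]; intros s U' l Hs HU; cbn [sweep].
  - intros H; inversion H; subst. reflexivity.
  - inversion HU; subst. destruct (dlt_in s a Hs H1) as [D1 D2]. destruct (dlt s a) as [s1 a1] eqn:Ed; cbn in D1, D2.
    destruct (sweep s1 U) as [s2 U2] eqn:E. intros H; inversion H; subst.
    exists (cfgR (tcode (Rt s1)) (cA a1 :: l) (map cA U ++ rs)). split.
    + change (cfgR (tcode (Rt s)) l (map cA (a :: U) ++ rs)) with (tcode (Rt s), l, csym (Some a), map cA U ++ rs).
      rewrite tm_step_machine; auto using Rt_in, Some_in. cbn [tstep]. rewrite Ed; auto.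
    + cbn [map rev]. rewrite -app_assoc. apply (IH s1 U2 (cA a1 :: l)); auto.
Qed.

Lemma msteps_left q U l rs : In q allT -> (forall a, tstep q (Some a) = Some (q, Some a, MoveL)) -> goodword U ->
  msteps machine (length U) (cfgL (tcode q) (rev (map cA U) ++ l) rs) (cfgL (tcode q) l (map cA U ++ rs)).
Proof.
  intros Hq T; revert rs; induction U as [|a U IH] using rev_ind; intros rs HU; [reflexivity|].
  apply Forall_app in HU as [HU Ha]. inversion Ha; subst.
  rewrite length_app Nat.add_comm !map_app rev_app_distr -!app_assoc. cbn [length map rev app Nat.add].
  exists (cfgL (tcode q) (rev (map cA U) ++ l) (cA a :: rs)). split; [|now apply IH].
  change (cfgL (tcode q) (cA a :: rev (map cA U) ++ l) rs) with (tcode q, rev (map cA U) ++ l, csym (Some a), rs).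
  rewrite tm_step_machine; auto using Some_in. rewrite T. auto.
Qed.

Lemma msteps_write s w s' : In s allS -> turn s = Some (w, s') -> forall w1 w2 l j, w = w1 ++ w2 ->
  exists j', msteps machine (length w2) (tcode (Wr s (length w1)), l, 0, repeat 0 j)
    (tcode (Wr s (length w)), rev (map cA w2) ++ l, 0, repeat 0 j').
Proof.
  intros Hs T w1 w2; revert w1; induction w2 as [|a w2 IH]; intros w1 l j E.
  - rewrite app_nil_r in E; subst. exists j. reflexivity.
  - destruct (IH (w1 ++ [a]) (cA a :: l) (j - 1)) as [j' H]; [rewrite -app_assoc; auto|].
    exists j'. eexists; split.
    + rewrite tm_step_blank; auto.
      * eapply Wr_in; eauto. rewrite E length_app; lia.
      * cbn [tstep]. rewrite T E nth_error_app2; auto. rewrite Nat.sub_diag. cbn [nth_error]. reflexivity.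
    + rewrite length_app in H; cbn [length] in H. cbn [map rev]. rewrite -app_assoc. cbn [app].
      destruct j; cbn [repeat]; [exact H|]. cbn [Nat.sub] in H. rewrite Nat.sub_0_r in H. exact H.
Qed.

Lemma cfgR_repeat q l j : cfgR q l (repeat 0 j) = (q, l, 0, repeat 0 (j - 1)).
Proof. destruct j; cbn; rewrite ?Nat.sub_0_r; auto. Qed.
Lemma cfgL_repeat q rs j : cfgL q (repeat 0 j) rs = (q, repeat 0 (j - 1), 0, rs).
Proof. destruct j; cbn; rewrite ?Nat.sub_0_r; auto. Qed.

(** Blanks once visited remain on the tape as explicit zeros; their numbers on both sides are left
    open. *)
Lemma superstep s U s1 U1 w s2 i j : In s allS -> goodword U -> sweep s U = (s1, U1) -> turn s1 = Some (w, s2) ->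
  exists i' j', msteps machine (2 * length U + 2 * length w + 3)
    (cfgR (tcode (Rt s)) (repeat 0 i) (map cA U ++ repeat 0 j))
    (cfgR (tcode (Rt s2)) (repeat 0 i') (map cA (U1 ++ w) ++ repeat 0 j')).
Proof.
  intros Hs HU E T. destruct (sweep_good _ _ _ _ Hs HU E) as [H1 HU1]. destruct (turn_in _ _ _ H1 T) as [H2 Hw].
  assert (L : length U1 = length U) by (pose proof (sweep_length s U) as L; rewrite E in L; auto).
  destruct (msteps_write s1 w s2 H1 T [] w (rev (map cA U1) ++ repeat 0 i) (j - 1) eq_refl) as [j' Mw].
  exists (1 + (i - 1)), (1 + j').
  replace (2 * length U + 2 * length w + 3) with (length U + (1 + (length w + (1 + (length (U1 ++ w) + 1)))))
    by (rewrite length_app; lia).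
  eapply msteps_app; [apply msteps_sweep; eauto|]. rewrite cfgR_repeat.
  eapply (msteps_app _ 1).
  { eexists; split; [|reflexivity]. rewrite tm_step_blank; auto using Rt_in. cbn [tstep]. rewrite T. reflexivity. }
  eapply msteps_app; [exact Mw|].
  eapply (msteps_app _ 1).
  { eexists; split; [|reflexivity]. rewrite tm_step_blank; eauto using Wr_in. cbn [tstep]. rewrite T.
    assert (K : nth_error w (length w) = None) by (apply nth_error_None; lia). rewrite K. reflexivity. }
  rewrite app_assoc -rev_app_distr -map_app. cbn [csym].
  change (0 :: repeat 0 j') with (repeat 0 (1 + j')).
  change (match rev (map cA (U1 ++ w)) ++ repeat 0 i with [] => (tcode (Lf s2), [], 0, repeat 0 (1 + j')) | a :: l' => (tcode (Lf s2), l', a, repeat 0 (1 + j')) end)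
    with (cfgL (tcode (Lf s2)) (rev (map cA (U1 ++ w)) ++ repeat 0 i) (repeat 0 (1 + j'))).
  eapply msteps_app; [apply msteps_left; auto using Lf_in; apply Forall_app; auto|].
  rewrite cfgL_repeat. eexists; split; [|reflexivity]. rewrite tm_step_blank; auto using Lf_in.
Qed.

(** The word never shrinks, so each round is charged at the final length. *)
Lemma srun_msteps n s U s' U' i j : In s allS -> goodword U -> srun n s U s' U' ->
  In s' allS /\ goodword U' /\ exists i' j' t, t <= n * (4 * length U' + 3) /\
    msteps machine t (cfgR (tcode (Rt s)) (repeat 0 i) (map cA U ++ repeat 0 j))
      (cfgR (tcode (Rt s')) (repeat 0 i') (map cA U' ++ repeat 0 j')).
Proof.
  revert s U i j; induction n as [|n IH]; intros s U i j Hs HU.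
  - intros [-> ->]. split; auto. split; auto. exists i, j, 0; split; [lia|reflexivity].
  - intros (s1 & U1 & w & s2 & E & T & R).
    destruct (superstep _ _ _ _ _ _ i j Hs HU E T) as (i1 & j1 & M).
    destruct (sweep_good _ _ _ _ Hs HU E) as [H1 HU1]. destruct (turn_in _ _ _ H1 T) as [H2 Hw].
    destruct (IH s2 (U1 ++ w) i1 j1 H2) as (K1 & K2 & i' & j' & t & Lt & M'); [apply Forall_app; auto|auto|].
    split; auto. split; auto. exists i', j', (2 * length U + 2 * length w + 3 + t). split; [|eapply msteps_app; eauto].
    pose proof (srun_length _ _ _ _ _ R) as L. rewrite length_app in L.
    pose proof (sweep_length s U) as L'; rewrite E in L'; cbn [snd] in L'. lia.
Qed.

Lemma read_bits_map B n : read_bits (map (fun b : bool => if b then 2 else 1) B ++ repeat 0 n) = B.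
Proof. induction B as [|[] B IH]; cbn; rewrite ?IH; auto. destruct n; auto. Qed.

(** The additional round in [n + 1] pays for the last sweep, the return to the left end and the walk
    over [C] to the first bit. *)
Theorem machine_computes n x s U s1 C B : srun n s0 (map bit x) s U -> sweep s U = (s1, C ++ map bit B) ->
  turn s1 = None -> Forall (fun a => isbit a = false) C -> B <> [] ->
  exists cf, tm_output cf = B /\
    forall t, (n + 1) * (4 * (length C + length B) + 3) <= t -> exec machine t (init_cfg (tape_of x)) = Some cf.
Proof.
  intros R E T HC HB.
  assert (G0 : goodword (map bit x)).
  { apply Forall_forall; intros a Ha; apply in_map_iff in Ha as (b & <- & _); auto. }
  destruct (srun_msteps _ _ _ _ _ 0 0 s0_in G0 R) as (Hs & HU & i & j & t & Lt & M).
  destruct (sweep_good _ _ _ _ Hs HU E) as [H1 HU1].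
  pose proof (sweep_length s U) as L; rewrite E in L; cbn [snd] in L. rewrite length_app length_map in L.
  assert (bits : forall B, map cA (map bit B) = map (fun b : bool => if b then 2 else 1) B).
  { intros B0; rewrite map_map; apply map_ext; auto. }
  assert (I : cfgR (tcode (Rt s0)) (repeat 0 0) (map cA (map bit x) ++ repeat 0 0) = init_cfg (tape_of x)).
  { rewrite bits app_nil_r. unfold tape_of, tcode; rewrite cS0. reflexivity. }
  rewrite I in M. set (W := C ++ map bit B) in *.
  assert (M1 : msteps machine (length U + (1 + (length W + 1)))
     (cfgR (tcode (Rt s)) (repeat 0 i) (map cA U ++ repeat 0 j))
     (cfgR (tcode FR) (repeat 0 (1 + (i - 1))) (map cA W ++ repeat 0 (1 + (j - 1))))).
  { eapply msteps_app; [apply msteps_sweep; eauto|]. rewrite cfgR_repeat.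
    eapply (msteps_app _ 1).
    { eexists; split; [|reflexivity]. rewrite tm_step_blank; auto using Rt_in. cbn [tstep]. rewrite T. reflexivity. }
    cbn [csym]. change (0 :: repeat 0 (j - 1)) with (repeat 0 (1 + (j - 1))).
    change (match rev (map cA W) ++ repeat 0 i with [] => (tcode FL, [], 0, repeat 0 (1 + (j - 1))) | a :: l' => (tcode FL, l', a, repeat 0 (1 + (j - 1))) end)
      with (cfgL (tcode FL) (rev (map cA W) ++ repeat 0 i) (repeat 0 (1 + (j - 1)))).
    eapply msteps_app; [apply msteps_left; auto using FL_in|].
    rewrite cfgL_repeat. eexists; split; [|reflexivity]. rewrite tm_step_blank; auto using FL_in. }
  assert (M2 : forall C l rs, goodword C -> Forall (fun a => isbit a = false) C ->
     msteps machine (length C) (cfgR (tcode FR) l (map cA C ++ rs)) (cfgR (tcode FR) (rev (map cA C) ++ l) rs)).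
  { clear - cS_inj cA_inj cA_pos. induction C as [|a C IH]; intros l rs G F; [reflexivity|]. inversion G; inversion F; subst.
    eexists; split.
    - change (cfgR (tcode FR) l (map cA (a :: C) ++ rs)) with (tcode FR, l, csym (Some a), map cA C ++ rs).
      rewrite tm_step_machine; auto using FR_in, Some_in. cbn [tstep]. rewrite H5. reflexivity.
    - cbn [map rev]. rewrite -app_assoc. apply (IH (cA a :: l)); auto. }
  apply Forall_app in HU1 as [GC GB].
  assert (M3 := M2 C (repeat 0 (1 + (i - 1))) (map cA (map bit B) ++ repeat 0 (1 + (j - 1))) GC HC).
  unfold W in M1 at 2. rewrite map_app -app_assoc in M1.
  destruct B as [|b B]; [congruence|].
  set (cf := cfgR (tcode FR) (rev (map cA C) ++ repeat 0 (1 + (i - 1))) (map cA (map bit (b :: B)) ++ repeat 0 (1 + (j - 1)))) in *.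
  exists cf; split.
  - unfold cf. rewrite bits. cbn [map app cfgR tm_output].
    change (read_bits (map (fun b : bool => if b then 2 else 1) (b :: B) ++ repeat 0 (1 + (j - 1))) = b :: B). apply read_bits_map.
  - intros t' Lt'. eapply msteps_exec; [|eapply msteps_app; [exact M|eapply msteps_app; [exact M1|exact M3]]|].
    + unfold W. rewrite !length_app length_map. nia.
    + unfold cf. change (tm_step machine (tcode FR, rev (map cA C) ++ repeat 0 (1 + (i - 1)), csym (Some (bit b)), map cA (map bit B) ++ repeat 0 (1 + (j - 1))) = None).
      rewrite tm_step_machine; auto using FR_in, Some_in. cbn [tstep]. rewrite bit_isbit; auto.
Qed.

End Sweeper.

(** * The bottom rows *)

Section Bottom.
Variables (name : nat -> nat) (gL gB gZ gT rho : nat) (x : list bool) (p : nat).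
Hypothesis name_inj : forall i j, name i = name j -> i = j.
Hypothesis name_neq : forall i, name i <> 0 /\ name i <> gL /\ name i <> gB /\ name i <> gZ /\ name i <> gT /\ name i <> rho.
Hypothesis consts : NoDup [0; gL; gB; gZ; gT; rho].

Definition bitc (b : bool) : nat := if b then 2 else 1.
Let n := length x.
(** The names follow the numbering of the printed tiles: [n] tiles for x, three for the separators,
    then five for each position [g]. The glue of y and the glue of the certificate at [g] differ in
    their residue modulo 5. *)
Definition yname (g : nat) : nat := name (n + 3 + 5 * g).
Definition zname (g : nat) : nat := name (n + 4 + 5 * g).

(** The loops at [gB] and [gT] allow any number of blanks. The word y can end after each bit by
    passing to [gZ]; after [p] bits without that, the glue [yname p] leads only to itself, so a
    chain with a longer y never becomes terminal. *)
Definition cells : list (nat * letter * nat) :=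
  [(gL, LM, gB); (gB, Raw 4 false, gB); (gB, Raw 4 false, name 0); (gT, Raw 0 false, gT); (gT, RM, 0);
   (name n, Raw 3 false, name (n + 3)); (name n, Raw 3 false, gZ); (gZ, Raw 3 false, name (n + 4));
   (yname p, Raw 0 false, yname p); (zname p, Raw 0 false, gT)] ++
  map (fun c => (name (fst c), Raw (bitc (snd c)) false, name (S (fst c)))) (combine (seq 0 n) x) ++
  flat_map (fun g => [(yname g, Raw 1 false, yname (S g)); (yname g, Raw 2 false, yname (S g));
    (yname g, Raw 1 false, gZ); (yname g, Raw 2 false, gZ); (zname g, Raw 0 true, zname (S g))]) (seq 0 p).

Inductive cell : nat -> letter -> nat -> Prop :=
| cellL : cell gL LM gB
| cellB : cell gB (Raw 4 false) gB
| cellB0 : cell gB (Raw 4 false) (name 0)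
| cellT : cell gT (Raw 0 false) gT
| cellR : cell gT RM 0
| cellS : cell (name n) (Raw 3 false) (name (n + 3))
| cellSZ : cell (name n) (Raw 3 false) gZ
| cellZS : cell gZ (Raw 3 false) (name (n + 4))
| cellTrap : cell (yname p) (Raw 0 false) (yname p)
| cellTail : cell (zname p) (Raw 0 false) gT
| cellX i b : nth_error x i = Some b -> cell (name i) (Raw (bitc b) false) (name (S i))
| cellY g b : g < p -> cell (yname g) (Raw (bitc b) false) (yname (S g))
| cellYZ g b : g < p -> cell (yname g) (Raw (bitc b) false) gZ
| cellZ g : g < p -> cell (zname g) (Raw 0 true) (zname (S g)).

Lemma in_combine_seq k (l : list bool) i b : In (i, b) (combine (seq k (length l)) l) <->
  exists j, i = k + j /\ nth_error l j = Some b.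
Proof.
  revert k; induction l as [|c l IH]; intros k; cbn [length seq combine In].
  - split; [tauto|]. intros ([|j] & _ & H); discriminate H.
  - rewrite IH; split.
    + intros [H|(j & -> & H)]; [inversion H; subst; exists 0; split; auto; lia|exists (S j); split; auto; lia].
    + intros ([|j] & -> & H); [left; cbn in H; inversion H; f_equal; lia|right; exists j; split; auto; lia].
Qed.

Lemma in_cells w a e : In (w, a, e) cells <-> cell w a e.
Proof.
  unfold cells; split.
  - intros H; apply in_app_iff in H as [H|H]; [|apply in_app_iff in H as [H|H]].
    + cbn [In] in H. repeat (destruct H as [H|H]; [inversion H; subst; constructor|]). destruct H.
    + apply in_map_iff in H as ([i b] & E & H). apply in_combine_seq in H as (j & -> & H).
      cbn in E. inversion E; subst. now constructor.
    + apply in_flat_map in H as (g & Hg & H). apply in_seq in Hg. cbn [In] in H.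
      destruct H as [H|[H|[H|[H|[H|[]]]]]]; inversion H; subst.
      * apply (cellY g false); lia.
      * apply (cellY g true); lia.
      * apply (cellYZ g false); lia.
      * apply (cellYZ g true); lia.
      * apply cellZ; lia.
  - assert (G : forall g, g < p -> In g (seq 0 p)) by (intros; apply in_seq; lia).
    intros [| | | | | | | | | |i b Hi|g b Hg|g b Hg|g Hg]; try (apply in_app_iff; left; cbn; tauto).
    + apply in_app_iff; right; apply in_app_iff; left. apply in_map_iff. exists (i, b); split; auto.
      apply in_combine_seq. exists i; auto.
    + do 2 (apply in_app_iff; right). apply in_flat_map; exists g; split; auto. destruct b; cbn; auto.
    + do 2 (apply in_app_iff; right). apply in_flat_map; exists g; split; auto. destruct b; cbn; auto.
    + do 2 (apply in_app_iff; right). apply in_flat_map; exists g; split; auto. cbn; auto 6.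
Qed.

Lemma const_neq : 0 <> gL /\ 0 <> gB /\ 0 <> gZ /\ 0 <> gT /\ gL <> gB /\ gL <> gZ /\ gL <> gT /\
  gB <> gZ /\ gB <> gT /\ gZ <> gT /\ gL <> rho /\ gB <> rho /\ gZ <> rho /\ gT <> rho.
Proof.
  inversion consts as [|? ? H1 V1]; subst; inversion V1 as [|? ? H2 V2]; subst;
  inversion V2 as [|? ? H3 V3]; subst; inversion V3 as [|? ? H4 V4]; subst; inversion V4 as [|? ? H5 V5]; subst; cbn in *.
  repeat split; intros E; subst; tauto.
Qed.

Definition spells (g : nat) (l : list letter) : Prop := exists bs, path letter cells g bs /\ letters letter bs = l.

Lemma cell_west w a e : cell w a e -> w <> 0.
Proof.
  destruct const_neq as (? & ? & ? & ? & _).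
  intros []; auto; apply name_neq.
Qed.

Lemma spells_0 l : spells 0 l <-> l = [].
Proof.
  split.
  - intros ([|[[w a] e] bs] & H & <-); auto. destruct H as (-> & H & _). apply in_cells, cell_west in H; congruence.
  - intros ->; exists []; cbn; auto.
Qed.

Lemma spells_S g l : g <> 0 -> spells g l <-> exists a e l', l = a :: l' /\ cell g a e /\ spells e l'.
Proof.
  intros G; split.
  - intros ([|[[w a] e] bs] & H & <-); [destruct (G H)|]. destruct H as (-> & H & Hp).
    exists a, e, (letters letter bs); split; auto. split; [now apply in_cells|exists bs; auto].
  - intros (a & e & l' & -> & H & bs & Hp & <-). exists ((g, a, e) :: bs). split; auto.
    split; auto. split; auto. now apply in_cells.
Qed.

Ltac names := match goal with
  | H : name _ = name _ |- _ => apply name_inj in H; try lia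
  | H : name ?i = _ |- _ => destruct (name_neq i) as (? & ? & ? & ? & ? & ?); congruence
  | H : _ = name ?i |- _ => destruct (name_neq i) as (? & ? & ? & ? & ? & ?); congruence
  end.

Lemma cell_inv w a e : cell w a e ->
  (w = gL -> a = LM /\ e = gB) /\
  (w = gB -> a = Raw 4 false /\ (e = gB \/ e = name 0)) /\
  (w = gT -> (a = Raw 0 false /\ e = gT) \/ (a = RM /\ e = 0)) /\
  (w = gZ -> a = Raw 3 false /\ e = zname 0) /\
  (forall i, w = name i -> i < n -> exists b, nth_error x i = Some b /\ a = Raw (bitc b) false /\ e = name (S i)) /\
  (w = name n -> a = Raw 3 false /\ (e = yname 0 \/ e = gZ)) /\
  (forall g, w = yname g -> g < p -> exists b, a = Raw (bitc b) false /\ (e = yname (S g) \/ e = gZ)) /\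
  (w = yname p -> e = yname p) /\
  (forall g, w = zname g -> g < p -> a = Raw 0 true /\ e = zname (S g)) /\
  (w = zname p -> a = Raw 0 false /\ e = gT).
Proof.
  destruct const_neq as (? & ? & ? & ? & ? & ? & ? & ? & ? & ? & ? & ? & ? & ?).
  unfold yname, zname.
  assert (Ny : n + 3 + 5 * 0 = n + 3) by lia. assert (Nz : n + 4 + 5 * 0 = n + 4) by lia.
  rewrite Ny Nz.
  assert (Hx : forall i b, nth_error x i = Some b -> i < n) by (intros i b E; apply nth_error_Some; congruence).
  intros [| | | | | | | | | |i b Hi|g b Hg|g b Hg|g Hg]; unfold yname, zname in *; try (apply Hx in Hi as Hi');
    (split; [intros E|split; [intros E|split; [intros E|split; [intros E|split; [intros i' E L|split; [intros E|split; [intros g' E L|split; [intros E|split; [intros g' E L|intros E]]]]]]]]]);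
    try congruence; try names; auto; try (subst; eauto; fail).
  all: assert (g' = g) by lia; subst; eauto.
Qed.

Definition raws (os : list (nat * bool)) : list letter := map (fun o => Raw (fst o) (snd o)) os.

Lemma spells_T l : spells gT l <-> exists b, l = raws (repeat (0, false) b) ++ [RM].
Proof.
  destruct const_neq as (? & ? & ? & ? & ? & ? & ? & ? & ? & ? & ? & ? & ? & ?).
  split.
  - induction l as [|a l IH]; intros S; apply spells_S in S as (a' & e & l' & E & C & S); auto; [discriminate|].
    inversion E; subst a' l'. apply cell_inv in C as (_ & _ & C & _). destruct (C eq_refl) as [[-> ->]|[-> ->]].
    + destruct (IH S) as [b ->]. exists (Datatypes.S b); auto.
    + apply spells_0 in S as ->. exists 0; auto.
  - intros [b ->]; induction b as [|b IH]; apply spells_S; auto.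
    + exists RM, 0, []; split; auto. split; [constructor|now apply spells_0].
    + exists (Raw 0 false), gT, (raws (repeat (0, false) b) ++ [RM]); split; auto. split; [constructor|auto].
Qed.

Lemma name_nz i : name i <> 0.
Proof. apply name_neq. Qed.

Lemma spells_Z k g l : g + k = p -> spells (zname g) l <->
  exists b, l = raws (repeat (0, true) k ++ repeat (0, false) (S b)) ++ [RM].
Proof.
  revert g l; induction k as [|k IH]; intros g l E; rewrite spells_S; try apply name_nz.
  - replace g with p by lia. split.
    + intros (a & e & l' & -> & C & S). apply cell_inv in C as (_ & _ & _ & _ & _ & _ & _ & _ & _ & C).
      destruct (C eq_refl) as [-> ->]. apply spells_T in S as [b ->]. exists b; auto.
    + intros [b ->]. exists (Raw 0 false), gT, (raws (repeat (0, false) b) ++ [RM]); split; auto.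
      split; [constructor|apply spells_T; eauto].
  - split.
    + intros (a & e & l' & -> & C & S). apply cell_inv in C as (_ & _ & _ & _ & _ & _ & _ & _ & C & _).
      destruct (C g eq_refl) as [-> ->]; [lia|]. apply IH in S as [b ->]; [|lia]. exists b; auto.
    + intros [b ->]. exists (Raw 0 true), (zname (S g)), (raws (repeat (0, true) k ++ repeat (0, false) (S b)) ++ [RM]); split; auto.
      split; [constructor; lia|apply IH; [lia|eauto]].
Qed.

Definition ztail (b : nat) : list letter := raws ((3, false) :: repeat (0, true) p ++ repeat (0, false) (S b)) ++ [RM].

Lemma spells_gZ l : spells gZ l <-> exists b, l = ztail b.
Proof.
  destruct const_neq as (? & ? & ? & ? & ? & ? & ? & ? & ? & ? & ? & ? & ? & ?).
  rewrite spells_S; auto. split.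
  - intros (a & e & l' & -> & C & S). apply cell_inv in C as (_ & _ & _ & C & _). destruct (C eq_refl) as [-> ->].
    apply (spells_Z p) in S as [b ->]; auto. exists b; auto.
  - intros [b ->]. exists (Raw 3 false), (zname 0), (raws (repeat (0, true) p ++ repeat (0, false) (S b)) ++ [RM]).
    split; auto. split; [|apply (spells_Z p); eauto].
    unfold zname. replace (n + 4 + 5 * 0) with (n + 4) by lia. constructor.
Qed.

Lemma spells_trap l : ~ spells (yname p) l.
Proof.
  induction l as [|a l IH]; intros S; apply spells_S in S as (a' & e & l' & E & C & S); try apply name_nz; [discriminate|].
  inversion E; subst. apply cell_inv in C as (_ & _ & _ & _ & _ & _ & _ & C & _). rewrite (C eq_refl) in S; auto.
Qed.

Definition bits (y : list bool) : list (nat * bool) := map (fun o => (o, false)) (tape_of y).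

Lemma spells_Y k g l : g + k = p -> spells (yname g) l <->
  exists y b, y <> [] /\ length y <= k /\ l = raws (bits y) ++ ztail b.
Proof.
  revert g l; induction k as [|k IH]; intros g l E.
  - replace g with p by lia. split; [intros S; destruct (spells_trap _ S)|].
    intros ([|c y] & b & N & L & _); [congruence|cbn in L; lia].
  - rewrite spells_S; [apply name_nz|]. split.
    + intros (a & e & l' & -> & C & S). apply cell_inv in C as (_ & _ & _ & _ & _ & _ & C & _).
      destruct (C g eq_refl) as (c & -> & [->| ->]); [lia| |].
      * apply IH in S as (y & b & N & L & ->); [|lia]. exists (c :: y), b. split; [discriminate|split; [cbn; lia|]].
        destruct c; auto.
      * apply spells_gZ in S as [b ->]. exists [c], b. split; [discriminate|split; [cbn; lia|]]. destruct c; auto.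
    + intros ([|c y] & b & N & L & ->); [congruence|]. exists (Raw (bitc c) false).
      destruct y as [|d y].
      * exists gZ, (ztail b); split; [destruct c; auto|]. split; [constructor; lia|apply spells_gZ; eauto].
      * exists (yname (S g)), (raws (bits (d :: y)) ++ ztail b); split; [destruct c; auto|].
        split; [constructor; lia|]. apply IH; [lia|]. exists (d :: y), b; split; [discriminate|split; [cbn in *; lia|auto]].
Qed.

Definition xtail (y : list bool) (b : nat) : list letter := raws ((3, false) :: bits y) ++ ztail b.

Lemma spells_x l i x' : x = l ++ x' -> i = length l -> forall u, spells (name i) u <->
  exists y b, length y <= p /\ u = raws (bits x') ++ xtail y b.
Proof.
  revert l i; induction x' as [|c x' IH]; intros l i E Ei u; rewrite spells_S; try apply name_nz.
  - rewrite app_nil_r in E. assert (i = n) as -> by (unfold n; congruence). split.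
    + intros (a & e & l' & -> & C & S). apply cell_inv in C as (_ & _ & _ & _ & _ & C & _).
      destruct (C eq_refl) as [-> [->| ->]].
      * apply (spells_Y p) in S as (y & b & N & L & ->); auto. exists y, b; auto.
      * apply spells_gZ in S as [b ->]. exists [], b; split; [cbn; lia|auto].
    + intros (y & b & L & ->). exists (Raw 3 false). destruct y as [|d y].
      * exists gZ, (ztail b); split; auto. split; [constructor|apply spells_gZ; eauto].
      * exists (yname 0), (raws (bits (d :: y)) ++ ztail b); split; auto.
        split; [unfold yname; replace (n + 3 + 5 * 0) with (n + 3) by lia; constructor|].
        apply (spells_Y p); auto. exists (d :: y), b; split; [discriminate|auto].
  - assert (Hi : nth_error x i = Some c).
    { rewrite E Ei nth_error_app2; auto. now rewrite Nat.sub_diag. }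
    assert (Li : i < n) by (apply nth_error_Some; congruence).
    assert (IH' := fun u => IH (l ++ [c]) (S i) ltac:(rewrite -app_assoc; auto) ltac:(rewrite length_app; cbn; lia) u).
    split.
    + intros (a & e & l' & -> & C & S). apply cell_inv in C as (_ & _ & _ & _ & C & _).
      destruct (C i eq_refl Li) as (c' & Hc & -> & ->). rewrite Hi in Hc; inversion Hc; subst c'.
      apply IH' in S as (y & b & L & ->). exists y, b; split; auto. 
    + intros (y & b & L & ->). exists (Raw (bitc c) false), (name (S i)), (raws (bits x') ++ xtail y b).
      split; [destruct c; auto|]. split; [constructor; auto|]. apply IH'; eauto.
Qed.

Lemma spells_B u : spells gB u <-> exists a y b, length y <= p /\
  u = raws (repeat (4, false) (S a) ++ bits x) ++ xtail y b.
Proof.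
  destruct const_neq as (? & ? & ? & ? & ? & ? & ? & ? & ? & ? & ? & ? & ? & ?).
  split.
  - induction u as [|c u IH]; intros S; apply spells_S in S as (c' & e & l' & E & C & S); auto; [discriminate|].
    inversion E; subst c' l'. apply cell_inv in C as (_ & C & _). destruct (C eq_refl) as [-> [->| ->]].
    + destruct (IH S) as (a & y & b & L & ->). exists (Datatypes.S a), y, b; auto.
    + apply (spells_x [] 0 x) in S as (y & b & L & ->); auto. exists 0, y, b; auto.
  - intros (a & y & b & L & ->); induction a as [|a IH]; apply spells_S; auto.
    + exists (Raw 4 false), (name 0), (raws (bits x) ++ xtail y b); split; auto. split; [constructor|].
      apply (spells_x [] 0 x); eauto.
    + exists (Raw 4 false), gB, (raws (repeat (4, false) (S a) ++ bits x) ++ xtail y b); split; auto.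
      split; [constructor|auto].
Qed.

(** There is at least one blank on each side, because the chain leaves [gB] and enters [gT] by a
    blank cell. Nothing starting at the trap [yname p] ends, which bounds y. *)
Lemma bottom_rows u : spells gL u <-> exists y a b, length y <= p /\
  u = rawrow (base x y (S a) (S b) (zonefor p [])).
Proof.
  destruct const_neq as (? & ? & ? & ? & ? & ? & ? & ? & ? & ? & ? & ? & ? & ?).
  assert (R : forall a y b, rawrow (base x y (S a) (S b) (zonefor p [])) =
     LM :: raws (repeat (4, false) (S a) ++ bits x) ++ xtail y b).
  { intros a y b.
    assert (E : base x y (S a) (S b) (zonefor p []) = (repeat (4, false) (S a) ++ bits x) ++
      ((3, false) :: bits y) ++ ((3, false) :: repeat (0, true) p ++ repeat (0, false) (S b))).
    { unfold base, xy, zonefor, bits. rewrite Nat.sub_0_r. change (tape_of []) with (@nil nat). cbn [app].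
      rewrite !map_app map_repeat -!app_assoc. cbn [map app]. rewrite !map_app -!app_assoc. reflexivity. }
    unfold rawrow. change (map (fun o : nat * bool => Raw (fst o) (snd o))) with raws. rewrite E.
    unfold xtail, ztail, raws. rewrite !map_app -!app_assoc. reflexivity. }
  rewrite spells_S; auto. split.
  - intros (c & e & l' & -> & C & S). apply cell_inv in C as (C & _). destruct (C eq_refl) as [-> ->].
    apply spells_B in S as (a & y & b & L & ->). exists y, a, b; split; auto.
  - intros (y & a & b & L & ->). rewrite R. do 3 eexists; split; [reflexivity|]. split; [constructor|].
    apply spells_B; exists a, y, b; auto.
Qed.

Lemma cells_next w a e : In (w, a, e) cells -> e <> 0 -> exists a' e', In (e, a', e') cells.
Proof.
  intros H E0. apply in_cells in H.
  assert (K : forall e a' e', cell e a' e' -> exists a' e', In (e, a', e') cells).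
  { intros e1 a1 e2 C; exists a1, e2; now apply in_cells. }
  assert (X : forall i, i <= n -> exists a' e', In (name i, a', e') cells).
  { intros i Hi. destruct (nth_error x i) as [b|] eqn:Eb.
    - eapply K, (cellX i b Eb).
    - apply nth_error_None in Eb. replace i with n by (unfold n in *; lia). eapply K, cellS. }
  assert (Y : forall g, g <= p -> exists a' e', In (yname g, a', e') cells).
  { intros g Hg. destruct (Nat.eq_dec g p) as [->|]; [eapply K, cellTrap|eapply K, (cellY g true); lia]. }
  assert (Z : forall g, g <= p -> exists a' e', In (zname g, a', e') cells).
  { intros g Hg. destruct (Nat.eq_dec g p) as [->|]; [eapply K, cellTail|eapply K, (cellZ g); lia]. }
  destruct H as [| | | | | | | | | |i b Hi|g b Hg|g b Hg|g Hg]; try congruence.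
  - eapply K, cellB.
  - eapply K, cellB.
  - apply X; lia.
  - eapply K, cellT.
  - specialize (Y 0). unfold yname in Y. replace (n + 3 + 5 * 0) with (n + 3) in Y by lia. apply Y; lia.
  - eapply K, cellZS.
  - specialize (Z 0). unfold zname in Z. replace (n + 4 + 5 * 0) with (n + 4) in Z by lia. apply Z; lia.
  - apply Y; lia.
  - eapply K, cellT.
  - apply X. assert (i < n) by (apply nth_error_Some; congruence). lia.
  - apply Y; lia.
  - eapply K, cellZS.
  - apply Z; lia.
Qed.

Lemma cells_prev w a e : In (w, a, e) cells -> w = gL \/ exists w' a', In (w', a', w) cells.
Proof.
  intros H. apply in_cells in H.
  assert (K : forall w' a' e, cell w' a' e -> exists w' a', In (w', a', e) cells).
  { intros e1 a1 e2 C; exists e1, a1; now apply in_cells. }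
  assert (X : forall i, i <= n -> exists w' a', In (w', a', name i) cells).
  { intros [|i] Hi; [eapply K, cellB0|]. destruct (nth_error x i) as [b|] eqn:Eb.
    - eapply K, (cellX i b Eb).
    - apply nth_error_None in Eb. unfold n in *; lia. }
  assert (Y : forall g, g <= p -> exists w' a', In (w', a', yname g) cells).
  { intros [|g] Hg; [|eapply K, (cellY g true); lia].
    unfold yname. replace (n + 3 + 5 * 0) with (n + 3) by lia. eapply K, cellS. }
  assert (Z : forall g, g <= p -> exists w' a', In (w', a', zname g) cells).
  { intros [|g] Hg; [|eapply K, (cellZ g); lia].
    unfold zname. replace (n + 4 + 5 * 0) with (n + 4) by lia. eapply K, cellZS. }
  destruct H as [| | | | | | | | | |i b Hi|g b Hg|g b Hg|g Hg]; auto; right.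
  - eapply K, cellL.
  - eapply K, cellL.
  - eapply K, cellTail.
  - eapply K, cellTail.
  - eapply K, cellSZ.
  - apply X. assert (i < n) by (apply nth_error_Some; congruence). lia.
  - apply Y; lia.
  - apply Y; lia.
  - apply Z; lia.
Qed.

Lemma cells_letters V w a e : In (w, a, e) cells -> (isEndL a = true <-> e = 0) /\ In a (allA V).
Proof.
  destruct const_neq as (? & ? & ? & ? & _).
  intros HC; apply in_cells in HC.
  assert (R : forall o z, o <= 4 -> In (Raw o z) (allA V)) by (intros; apply in_allA_Raw; cbn; lia).
  assert (B : forall b, bitc b <= 4) by (intros []; cbn; lia).
  destruct HC as [| | | | | | | | | |i b Hi|g b Hg|g b Hg|g Hg]; (split; [|auto]);
    try (apply R; lia); try (left; auto; fail); try (right; left; auto; fail);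
    cbn; split; try discriminate; auto; intros E; exfalso; try congruence; eapply name_nz; eauto.
Qed.

Lemma cells_glues w a e : In (w, a, e) cells ->
  (w = gL \/ w = gB \/ w = gZ \/ w = gT \/ exists i, i <= n + 4 + 5 * p /\ w = name i) /\
  (e = 0 \/ e = gB \/ e = gZ \/ e = gT \/ exists i, i <= n + 4 + 5 * p /\ e = name i).
Proof.
  intros H; apply in_cells in H.
  assert (Hx : forall i b, nth_error x i = Some b -> i < n) by (intros i b E; apply nth_error_Some; congruence).
  destruct H as [| | | | | | | | | |i b Hi|g b Hg|g b Hg|g Hg]; unfold yname, zname; try (apply Hx in Hi);
    split; auto; do 4 right; eexists; (split; [|reflexivity]); lia.
Qed.

End Bottom.

(** * The instance *)

Definition pr (i j : nat) : nat := to_nat (i, j).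
Definition odd (n : nat) : nat := 2 * n + 1.
Definition nm (m : nat) : nat := 2 ^ (m + 8).

Definition b2n (b : bool) : nat := if b then 1 else 0.
Definition lcode (a : letter) : nat :=
  match a with
  | LM => pr 0 0
  | RM => pr 1 0
  | Raw o z => pr 2 (pr o (b2n z))
  | Cell o z s hd => pr 3 (pr (pr o (b2n z)) (pr s (match hd with None => 0 | Some q => S q end)))
  | ErrL b => pr 4 (b2n b)
  end.
Definition scode (q : rstate) : nat :=
  match q with
  | Q0 => pr 0 0
  | QT => pr 1 0
  | ErrS b => pr 2 (b2n b)
  | Ld b => pr 3 (b2n b)
  | St0 => pr 4 0
  | StR q => pr 5 q
  | StL q => pr 6 q
  | St1 => pr 7 0
  | Nx c b => pr 8 (pr (b2n c) (b2n b))
  | Tp => pr 9 0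
  end.

(* Constant glues are odd and position glues are powers of two, which a machine can print in unary. *)
Definition gl (a : letter) : nat := odd (pr 0 (lcode a)).
Definition gs (q : rstate) : nat := odd (pr 1 (scode q)).
Definition gk (i : nat) : nat := odd (pr 2 i).

Lemma pr_inj i j i' j' : pr i j = pr i' j' -> i = i' /\ j = j'.
Proof. unfold pr; intros H; apply to_nat_inj in H; now apply pair_equal_spec in H. Qed.
Lemma b2n_inj b b' : b2n b = b2n b' -> b = b'.
Proof. destruct b, b'; auto; discriminate. Qed.
Lemma odd_inj n m : odd n = odd m -> n = m.
Proof. unfold odd; lia. Qed.

#[global] Opaque pr.

Lemma lcode_inj a a' : lcode a = lcode a' -> a = a'.
Proof.
  destruct a, a'; cbn [lcode]; intros H; apply pr_inj in H as [E H]; try discriminate E; auto.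
  - apply pr_inj in H as [-> H]. apply b2n_inj in H as ->; auto.
  - apply pr_inj in H as [H1 H]. apply pr_inj in H1 as [-> H1]. apply b2n_inj in H1 as ->.
    apply pr_inj in H as [-> H]. destruct hd, hd0; inversion H; auto.
  - apply b2n_inj in H as ->; auto.
Qed.

Lemma scode_inj a a' : scode a = scode a' -> a = a'.
Proof.
  destruct a, a'; cbn [scode]; intros H; apply pr_inj in H as [E H]; try discriminate E; auto.
  - apply b2n_inj in H as ->; auto.
  - apply b2n_inj in H as ->; auto.
  - apply pr_inj in H as [H1 H2]. apply b2n_inj in H1 as ->. apply b2n_inj in H2 as ->; auto.
Qed.

Lemma gl_inj a a' : gl a = gl a' -> a = a'.
Proof. intros H; apply odd_inj, pr_inj in H as [_ H]. now apply lcode_inj. Qed.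
Lemma gs_inj a a' : gs a = gs a' -> a = a'.
Proof. intros H; apply odd_inj, pr_inj in H as [_ H]. now apply scode_inj. Qed.
Lemma gk_inj i j : gk i = gk j -> i = j.
Proof. intros H; apply odd_inj, pr_inj in H; tauto. Qed.
Lemma gl_gk a q : gl a <> gk q.
Proof. intros H; apply odd_inj, pr_inj in H as [H _]; discriminate H. Qed.
Lemma gs_gk a q : gs a <> gk q.
Proof. intros H; apply odd_inj, pr_inj in H as [H _]; discriminate H. Qed.

Lemma nm_even m : exists k, nm m = 2 * k /\ k <> 0.
Proof.
  exists (2 ^ (m + 7)). unfold nm. replace (m + 8) with (S (m + 7)) by lia. split; [auto|].
  apply Nat.pow_nonzero; lia.
Qed.
Lemma nm_odd m n : nm m <> odd n.
Proof. destruct (nm_even m) as (k & -> & _). unfold odd; lia. Qed.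
Lemma nm_pos m : nm m <> 0.
Proof. destruct (nm_even m) as (k & -> & H). lia. Qed.
Lemma nm_inj m n : nm m = nm n -> m = n.
Proof. unfold nm; intros H. apply Nat.pow_inj_r in H; lia. Qed.
Lemma odd_pos n : odd n <> 0.
Proof. unfold odd; lia. Qed.

Definition kap := gk 0.
Definition kap' := gk 1.
Definition kap1 := gk 2.
Definition inf := gk 3.
Definition inf2 := gk 4.
Definition gL := gk 5.
Definition rho := gk 6.
Definition gB := gk 7.
Definition gZ := gk 8.
Definition gT := gk 9.

Inductive field := Const (c : nat) | Index (o : nat).
(** As [nm j = 2 ^ (j + 8)], [Index o] in tile number [i] names position [i + o - 7]: 7 stands for
    the own number of the tile, smaller offsets refer back and larger ones ahead. *)
Definition num (i : nat) (f : field) : nat := match f with Const c => c | Index o => 2 ^ (S i + o) end.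
(** Each letter of the printed word stands for one row tile and one strength entry, so a single word
    determines both lists and both have its length. A letter without its own entry declares the
    position glue of its number. *)
Record spec := mkSpec { sst : option (nat * nat); sN : field; sE : field; sS : field; sW : field }.
Definition tileof (i : nat) (k : spec) : Tile := mkTile (num i (sN k)) (num i (sE k)) (num i (sS k)) (num i (sW k)).
Definition strof (i : nat) (k : spec) : nat * nat := match sst k with Some e => e | None => (nm i, 2) end.

Definition ctile (t : Tile) : spec := mkSpec None (Const (tN t)) (Const (tE t)) (Const (tS t)) (Const (tW t)).
Definition chain3 (w : field) (a : letter) (e : field) : spec := mkSpec None (Const (gl a)) e (Const 0) w.

Fixpoint imap {X Y} (f : nat -> X -> Y) (i : nat) (l : list X) : list Y :=
  match l with [] => [] | a :: l' => f i a :: imap f (S i) l' end.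

Lemma imap_app {X Y} (f : nat -> X -> Y) i l l' : imap f i (l ++ l') = imap f i l ++ imap f (i + length l) l'.
Proof.
  revert i; induction l as [|a l IH]; intros i; cbn.
  - f_equal; lia.
  - rewrite IH. do 3 f_equal; lia.
Qed.
Lemma imap_length {X Y} (f : nat -> X -> Y) i l : length (imap f i l) = length l.
Proof. revert i; induction l as [|a l IH]; intros i; cbn; auto. Qed.
Lemma imap_In {X Y} (f : nat -> X -> Y) i l y : In y (imap f i l) <-> exists j a, nth_error l j = Some a /\ y = f (i + j) a.
Proof.
  revert i; induction l as [|a l IH]; intros i; cbn [imap In].
  - split; [tauto|]. intros ([|j] & a & H & _); discriminate H.
  - rewrite IH; split.
    + intros [<-|(j & b & H & ->)]; [exists 0, a; split; auto; f_equal; lia|exists (S j), b; split; auto; f_equal; lia].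
    + intros ([|j] & b & H & ->); [left; inversion H; f_equal; lia|right; exists j, b; split; auto; f_equal; lia].
Qed.
Lemma imap_index {X Y} (f : nat -> X -> Y) (g : nat -> Y) i l : (forall j a, In a l -> f j a = g j) ->
  imap f i l = map g (seq i (length l)).
Proof.
  revert i; induction l as [|a l IH]; intros i H; cbn; auto.
  rewrite H; cbn; auto. f_equal; apply IH; intros; apply H; cbn; auto.
Qed.

Section Instance.
Variable V : TM.
Notation allA := (allA V).
Notation allQ := (allQ V).

(** Kinds 0 and 1 are the bits of x, 2 to 4 the separators, 5 to 9 the group repeated for each
    certificate position, 10 and 11 the trap and the end of the certificate zone. The offsets
    compensate for the place of the tile within its group. *)
Definition headspecs : list spec :=
  [chain3 (Index 7) (Raw 1 false) (Index 8); chain3 (Index 7) (Raw 2 false) (Index 8);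
   chain3 (Index 7) (Raw 3 false) (Index 10); chain3 (Index 6) (Raw 3 false) (Const gZ);
   chain3 (Const gZ) (Raw 3 false) (Index 9);
   chain3 (Index 7) (Raw 1 false) (Index 12); chain3 (Index 6) (Raw 2 false) (Index 11);
   chain3 (Index 5) (Raw 1 false) (Const gZ); chain3 (Index 4) (Raw 2 false) (Const gZ);
   chain3 (Index 4) (Raw 0 true) (Index 9);
   chain3 (Index 7) (Raw 0 false) (Index 7); chain3 (Index 7) (Raw 0 false) (Const gT)].

Definition constTiles : list Tile :=
  [tC0 kap gL; tC0' kap' rho] ++
  map (tcell letter gl) ([(gL, LM, gB); (gB, Raw 4 false, gB); (gB, Raw 4 false, nm 0); (gT, Raw 0 false, gT); (gT, RM, 0)] ++
    map (fun a => (rho, a, 0)) allA).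

(** A valid instance lists each glue once, whereas the lists of letters and states repeat whatever
    the table of [V] repeats; hence [nodup]. *)
Definition constStr : list (nat * nat) :=
  map (fun g => (g, 1)) (nodup Nat.eq_dec (map gl allA ++ map gs allQ)) ++ map (fun i => (gk i, 2)) (seq 0 10).

Definition specs : list spec := headspecs ++ map ctile constTiles ++
  map (fun e => mkSpec (Some e) (Const kap) (Const gL) (Const 0) (Const 0)) constStr.
Definition spec_at (k : nat) : spec := nth k specs (ctile tnull).

Definition group : list nat := [5; 6; 7; 8; 9].
Definition groups (p : nat) : list nat := concat (repeat group p).
Definition lastkinds : list nat := seq 10 (length specs - 10).
Definition kinds (x : list bool) (p : nat) : list nat :=
  map b2n x ++ [2; 3; 4] ++ groups p ++ lastkinds.

Definition rowtiles (U : list nat) : list Tile := imap (fun i k => tileof i (spec_at k)) 0 U.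
Definition strengths (U : list nat) : list (nat * nat) := imap (fun i k => strof i (spec_at k)) 0 U.

Definition colT : list Tile := CT rstate allQ Q0 QT gs kap kap' kap1 inf.
Definition intT : list Tile := IT letter rstate isEndL topS ErrL ErrS allA allQ (nrms V) gl gs inf.

Definition inst (U : list nat) : UAVInstance :=
  mkInst 2 7 (strengths U) edges7 [rowtiles U; colT; intT; [tinfA inf inf2]; [tinfB inf inf2]; [tnull]] [(0, 0, tnull)].

Section Word.
Variables (x : list bool) (p : nat).
Let n := length x.
Let U := kinds x p.
Let bcells := cells nm gL gB gZ gT x p.

Lemma groups_length : length (groups p) = 5 * p.
Proof. unfold groups; induction p as [|q IH]; auto. cbn [repeat concat]; rewrite length_app IH; cbn; lia. Qed.

Lemma imap_groups {Y} (f : nat -> nat -> Y) i y : In y (imap f i (groups p)) <->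
  exists g, g < p /\ In y (imap f (i + 5 * g) group).
Proof.
  unfold groups; revert i; induction p as [|q IH]; intros i.
  - cbn. split; [tauto|]. intros (g & H & _); lia.
  - cbn [repeat concat]. rewrite imap_app in_app_iff IH. cbn [length group]. split.
    + intros [H|(g & H & H')].
      * exists 0; split; [lia|]. rewrite Nat.add_0_r; auto.
      * exists (S g); split; [lia|]. replace (i + 5 * S g) with (i + 5 + 5 * g) by lia; auto.
    + intros ([|g] & H & H').
      * left. rewrite Nat.add_0_r in H'; auto.
      * right; exists g; split; [lia|]. replace (i + 5 + 5 * g) with (i + 5 * S g) by lia; auto.
Qed.

Lemma lastkinds_split : lastkinds = [10; 11] ++ seq 12 (length constTiles) ++ seq (12 + length constTiles) (length constStr).
Proof.
  assert (E : length specs - 10 = 2 + (length constTiles + length constStr)).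
  { unfold specs. generalize constTiles constStr; intros l l'. rewrite !length_app !length_map. cbn [headspecs length]. lia. }
  unfold lastkinds. rewrite E. generalize (length constTiles) (length constStr); intros l l'. rewrite seq_app seq_app. reflexivity.
Qed.

Lemma spec_tile j t : nth_error constTiles j = Some t -> spec_at (12 + j) = ctile t.
Proof.
  intros H. assert (j < length constTiles) by (apply nth_error_Some; congruence).
  unfold spec_at, specs. rewrite app_nth2; cbn [headspecs length]; [lia|].
  replace (12 + j - 12) with j by lia. rewrite app_nth1; [rewrite length_map; auto|].
  apply nth_error_nth. rewrite nth_error_map H; auto.
Qed.

Lemma spec_str j e : nth_error constStr j = Some e ->
  spec_at (12 + length constTiles + j) = mkSpec (Some e) (Const kap) (Const gL) (Const 0) (Const 0).
Proof.
  intros H. unfold spec_at, specs. rewrite app_nth2; cbn [headspecs length]; [lia|].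
  replace (12 + length constTiles + j - 12) with (length constTiles + j) by lia.
  rewrite app_nth2; rewrite length_map; [lia|]. replace (length constTiles + j - length constTiles) with j by lia.
  apply nth_error_nth. rewrite nth_error_map H; auto.
Qed.

Lemma nth_error_seq a l j : j < l -> nth_error (seq a l) j = Some (a + j).
Proof.
  revert a j; induction l as [|l IH]; intros a j H; [lia|]. destruct j as [|j]; cbn; [f_equal; lia|].
  rewrite IH; [lia|]. f_equal; lia.
Qed.

Lemma in_constrow i t : In t (imap (fun i k => tileof i (spec_at k)) i (seq 12 (length constTiles))) <-> In t constTiles.
Proof.
  rewrite imap_In; split.
  - intros (j & k & H & ->).
    assert (L : j < length constTiles) by (rewrite -(length_seq (length constTiles) 12); apply nth_error_Some; congruence).
    rewrite nth_error_seq in H; auto. inversion H; subst k.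
    destruct (nth_error constTiles j) as [t|] eqn:E; [|apply nth_error_None in E; lia].
    rewrite (spec_tile _ _ E). destruct t; cbn. apply nth_error_In in E; auto.
  - intros H; apply In_nth_error in H as [j H]. exists j, (12 + j).
    assert (L : j < length constTiles) by (apply nth_error_Some; congruence).
    rewrite nth_error_seq; auto. split; auto. rewrite (spec_tile _ _ H). destruct t; auto.
Qed.

Lemma in_conststr i t : In t (imap (fun i k => tileof i (spec_at k)) i (seq (12 + length constTiles) (length constStr))) -> t = tC0 kap gL.
Proof.
  intros H. apply imap_In in H as (j & k & H & ->).
  assert (L : j < length constStr) by (rewrite -(length_seq (length constStr) (12 + length constTiles)); apply nth_error_Some; congruence).
  rewrite nth_error_seq in H; auto. inversion H; subst k.
  destruct (nth_error constStr j) as [e|] eqn:E; [|apply nth_error_None in E; lia].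
  pose proof (spec_str _ _ E) as K. cbn [Nat.add] in K. rewrite K. reflexivity.
Qed.

Lemma rowtiles_split : rowtiles U = imap (fun i k => tileof i (spec_at k)) 0 (map b2n x) ++
  imap (fun i k => tileof i (spec_at k)) n [2; 3; 4] ++ imap (fun i k => tileof i (spec_at k)) (n + 3) (groups p) ++
  imap (fun i k => tileof i (spec_at k)) (n + 3 + 5 * p) [10; 11] ++
  imap (fun i k => tileof i (spec_at k)) (n + 5 + 5 * p) (seq 12 (length constTiles)) ++
  imap (fun i k => tileof i (spec_at k)) (n + 5 + 5 * p + length constTiles) (seq (12 + length constTiles) (length constStr)).
Proof.
  unfold rowtiles, U, kinds. rewrite lastkinds_split !imap_app !length_map groups_length length_seq.
  fold n. change (length [2; 3; 4]) with 3. change (length [10; 11]) with 2.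
  replace (0 + n) with n by lia. replace (n + 3 + 5 * p + 2) with (n + 5 + 5 * p) by lia. reflexivity.
Qed.

Lemma tile_nm i o j : S i + o = j + 8 -> num i (Index o) = nm j.
Proof. unfold num, nm; intros ->; auto. Qed.

(** Only the set of tiles of a bin matters, so the order, and the copies of [tC0] attached to the
    strength entries of constant glues, are immaterial. *)
Lemma rowtiles_RT t : In t (rowtiles U) <-> In t (RT letter allA gl kap kap' gL rho bcells).
Proof.
  rewrite rowtiles_split !in_app_iff imap_groups in_constrow.
  assert (C : forall w a e, cell nm gL gB gZ gT x p w a e -> In (tcell letter gl (w, a, e)) (RT letter allA gl kap kap' gL rho bcells)).
  { intros w a e H. right; right; apply in_app_iff; left; apply in_map. now apply (in_cells nm gL gB gZ gT x p nm_inj). }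
  assert (E3 : forall i k w a e, spec_at k = chain3 w a e -> tileof i (spec_at k) = tcell letter gl (num i w, a, num i e))
    by (intros i k w a e ->; auto).
  assert (N : forall i o j, S i + o = j + 8 -> num i (Index o) = nm j) by apply tile_nm.
  split.
  - intros [H|[H|[(g & Hg & H)|[H|[H|H]]]]].
    + apply imap_In in H as (j & k & H & ->). rewrite nth_error_map in H.
      destruct (nth_error x j) as [b|] eqn:Eb; [|discriminate H]. inversion H; subst k.
      assert (Hs : spec_at (b2n b) = chain3 (Index 7) (Raw (bitc b) false) (Index 8)) by (destruct b; reflexivity).
      rewrite (E3 _ _ _ _ _ Hs) (N _ 7 j) ?(N _ 8 (S j)); try lia. apply C. now constructor.
    + cbn [imap In] in H. destruct H as [<-|[<-|[<-|[]]]].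
      * rewrite (E3 _ 2 _ _ _ eq_refl) (N _ 7 n) ?(N _ 10 (n + 3)); try lia. apply C, cellS.
      * rewrite (E3 _ 3 _ _ _ eq_refl) (N _ 6 n); try lia. apply C, cellSZ.
      * rewrite (E3 _ 4 _ _ _ eq_refl) (N _ 9 (n + 4)); try lia. apply C, cellZS.
    + cbn [imap In group] in H. destruct H as [<-|[<-|[<-|[<-|[<-|[]]]]]].
      * rewrite (E3 _ 5 _ _ _ eq_refl) (N _ 7 (n + 3 + 5 * g)) ?(N _ 12 (n + 3 + 5 * S g)); try lia. apply C, (cellY nm gL gB gZ gT x p g false Hg).
      * rewrite (E3 _ 6 _ _ _ eq_refl) (N _ 6 (n + 3 + 5 * g)) ?(N _ 11 (n + 3 + 5 * S g)); try lia. apply C, (cellY nm gL gB gZ gT x p g true Hg).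
      * rewrite (E3 _ 7 _ _ _ eq_refl) (N _ 5 (n + 3 + 5 * g)); try lia. apply C, (cellYZ nm gL gB gZ gT x p g false Hg).
      * rewrite (E3 _ 8 _ _ _ eq_refl) (N _ 4 (n + 3 + 5 * g)); try lia. apply C, (cellYZ nm gL gB gZ gT x p g true Hg).
      * rewrite (E3 _ 9 _ _ _ eq_refl) (N _ 4 (n + 4 + 5 * g)) ?(N _ 9 (n + 4 + 5 * S g)); try lia. apply C, (cellZ nm gL gB gZ gT x p g Hg).
    + cbn [imap In] in H. destruct H as [<-|[<-|[]]].
      * rewrite (E3 _ 10 _ _ _ eq_refl) (N _ 7 (n + 3 + 5 * p)); try lia. apply C, cellTrap.
      * rewrite (E3 _ 11 _ _ _ eq_refl) (N _ 7 (n + 4 + 5 * p)); try lia. apply C, cellTail.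
    + unfold constTiles in H. apply in_app_iff in H as [[<-|[<-|[]]]|H]; [left; auto|right; left; auto|].
      apply in_map_iff in H as (c & <- & H). apply in_app_iff in H as [H|H].
      * cbn [In] in H. destruct H as [<-|[<-|[<-|[<-|[<-|[]]]]]]; apply C; constructor.
      * apply in_map_iff in H as (a & <- & H). right; right; apply in_app_iff; right; apply in_map_iff; eauto.
    + apply in_conststr in H as ->. left; auto.
  - assert (CT' : forall c, In c ([(gL, LM, gB); (gB, Raw 4 false, gB); (gB, Raw 4 false, nm 0); (gT, Raw 0 false, gT); (gT, RM, 0)] ++
       map (fun a => (rho, a, 0)) allA) -> In (tcell letter gl c) constTiles).
    { intros c Hc. apply in_app_iff; right. now apply in_map. }
    intros [<-|[<-|H]]; [do 4 right; left; left; auto|do 4 right; left; right; left; auto|].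
    apply in_app_iff in H as [H|H].
    + apply in_map_iff in H as ([[w a] e] & <- & H). apply (in_cells nm gL gB gZ gT x p nm_inj) in H.
      destruct H as [| | | | | | | | | |i b Hi|g b Hg|g b Hg|g Hg];
        try (do 4 right; left; apply CT'; cbn; tauto).
      * right; left; left. rewrite (E3 _ 2 _ _ _ eq_refl) (N _ 7 n) ?(N _ 10 (n + 3)); auto; lia.
      * right; left; right; left. rewrite (E3 _ 3 _ _ _ eq_refl) (N _ 6 n); auto; lia.
      * right; left; right; right; left. rewrite (E3 _ 4 _ _ _ eq_refl) (N _ 9 (n + 4)); auto; lia.
      * do 3 right; left; left. rewrite (E3 _ 10 _ _ _ eq_refl) (N _ 7 (n + 3 + 5 * p)); auto; lia.
      * do 3 right; left; right; left. rewrite (E3 _ 11 _ _ _ eq_refl) (N _ 7 (n + 4 + 5 * p)); auto; lia.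
      * left. apply imap_In. exists i, (b2n b). rewrite nth_error_map Hi; split; auto.
        assert (Hs : spec_at (b2n b) = chain3 (Index 7) (Raw (bitc b) false) (Index 8)) by (destruct b; reflexivity).
        rewrite (E3 _ _ _ _ _ Hs) (N _ 7 i) ?(N _ 8 (S i)); auto; lia.
      * do 2 right; left. exists g; split; auto. destruct b; [right; left|left].
        -- rewrite (E3 _ 6 _ _ _ eq_refl) (N _ 6 (n + 3 + 5 * g)) ?(N _ 11 (n + 3 + 5 * S g)); auto; lia.
        -- rewrite (E3 _ 5 _ _ _ eq_refl) (N _ 7 (n + 3 + 5 * g)) ?(N _ 12 (n + 3 + 5 * S g)); auto; lia.
      * do 2 right; left. exists g; split; auto. destruct b; [right; right; right; left|right; right; left].
        -- rewrite (E3 _ 8 _ _ _ eq_refl) (N _ 4 (n + 3 + 5 * g)); auto; lia.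
        -- rewrite (E3 _ 7 _ _ _ eq_refl) (N _ 5 (n + 3 + 5 * g)); auto; lia.
      * do 2 right; left. exists g; split; auto. right; right; right; right; left.
        rewrite (E3 _ 9 _ _ _ eq_refl) (N _ 4 (n + 4 + 5 * g)) ?(N _ 9 (n + 4 + 5 * S g)); auto; lia.
    + apply in_map_iff in H as (a & <- & H). do 4 right; left. apply (CT' (rho, a, 0)).
      apply in_app_iff; right; apply in_map_iff; eauto.
Qed.

Lemma strengths_split : strengths U = map (fun i => (nm i, 2)) (seq 0 (n + 5 + 5 * p + length constTiles)) ++ constStr.
Proof.
  unfold strengths, U, kinds. rewrite lastkinds_split.
  set (K := map b2n x ++ [2; 3; 4] ++ groups p ++ [10; 11] ++ seq 12 (length constTiles)).
  replace (map b2n x ++ _) with (K ++ seq (12 + length constTiles) (length constStr)) by (unfold K; rewrite -!app_assoc; auto).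
  rewrite imap_app. f_equal.
  - rewrite (imap_index _ (fun i => (nm i, 2))).
    + intros j k Hk. unfold strof.
      assert (E : sst (spec_at k) = None); [|rewrite E; auto].
      assert (L : k < 12 -> sst (spec_at k) = None) by (intros; do 12 (destruct k as [|k]; [reflexivity|]); lia).
      unfold K in Hk. repeat (apply in_app_iff in Hk as [Hk|Hk]).
      * apply L. apply in_map_iff in Hk as (b & <- & _); destruct b; cbn; lia.
      * apply L. cbn in Hk; lia.
      * apply L. unfold groups in Hk. apply in_concat in Hk as (l & Hl & Hk). apply repeat_spec in Hl; subst l. cbn in Hk; lia.
      * apply L. cbn in Hk; lia.
      * apply in_seq in Hk. destruct (nth_error constTiles (k - 12)) as [t|] eqn:Et; [|apply nth_error_None in Et; lia].
        pose proof (spec_tile _ _ Et) as Es. replace (12 + (k - 12)) with k in Es by lia. rewrite Es; auto.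
    + f_equal. f_equal. unfold K. rewrite !length_app length_map groups_length length_seq. cbn [length]. unfold n; lia.
  - generalize (0 + length K). intros i.
    assert (H : forall l j, skipn j constStr = l -> imap (fun i k => strof i (spec_at k)) (i + j) (seq (12 + length constTiles + j) (length l)) = l).
    { induction l as [|e l IH]; intros j Ej; auto. cbn [length seq imap].
      assert (He : nth_error constStr j = Some e).
      { rewrite -(firstn_skipn j constStr) Ej nth_error_app2; rewrite length_firstn; [lia|].
        assert (j < length constStr).
        { destruct (Nat.lt_ge_cases j (length constStr)); auto. rewrite skipn_all2 in Ej; auto; discriminate Ej. }
        replace (j - Nat.min j (length constStr)) with 0 by lia. auto. }
      rewrite (spec_str _ _ He). f_equal.
      replace (S (i + j)) with (i + S j) by lia. replace (S (12 + length constTiles + j)) with (12 + length constTiles + S j) by lia.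
      apply IH. replace (S j) with (1 + j) by lia. rewrite -skipn_skipn Ej; auto. }
    specialize (H constStr 0 eq_refl). rewrite !Nat.add_0_r in H. exact H.
Qed.

Lemma constStr_NoDup : NoDup (map fst constStr).
Proof.
  unfold constStr. rewrite map_app !map_map. cbn [fst]. rewrite map_id.
  apply NoDup_app.
  - apply NoDup_nodup.
  - apply FinFun.Injective_map_NoDup; [intros i j; apply gk_inj|apply seq_NoDup].
  - intros g Hg Hk. apply nodup_In in Hg. apply in_map_iff in Hk as (i & <- & _).
    apply in_app_iff in Hg as [Hg|Hg]; apply in_map_iff in Hg as (a & E & _); [now apply gl_gk in E|now apply gs_gk in E].
Qed.

Lemma constStr_odd g s : In (g, s) constStr -> exists k, g = odd k.
Proof.
  intros H; apply in_app_iff in H as [H|H]; apply in_map_iff in H as (h & E & H); inversion E; subst.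
  - apply nodup_In, in_app_iff in H as [H|H]; apply in_map_iff in H as (a & <- & _); eexists; reflexivity.
  - eexists; reflexivity.
Qed.

Lemma strengths_NoDup : NoDup (map fst (strengths U)).
Proof.
  rewrite strengths_split map_app map_map. cbn [fst]. apply NoDup_app.
  - apply FinFun.Injective_map_NoDup; [intros i j; apply nm_inj|apply seq_NoDup].
  - apply constStr_NoDup.
  - intros g Hg Hk. apply in_map_iff in Hg as (i & <- & _). apply in_map_iff in Hk as ([g s] & E & Hk).
    cbn in E; subst g. apply constStr_odd in Hk as [k E]. now apply nm_odd in E.
Qed.

Lemma strengths_pos : ~ In 0 (map fst (strengths U)).
Proof.
  rewrite strengths_split map_app map_map in_app_iff. cbn [fst]. intros [H|H].
  - apply in_map_iff in H as (i & E & _). now apply nm_pos in E.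
  - apply in_map_iff in H as ([g s] & E & H). cbn in E; subst g. apply constStr_odd in H as [k E]. symmetry in E; now apply odd_pos in E.
Qed.

Lemma find_NoDup (l : list (nat * nat)) g s : NoDup (map fst l) -> In (g, s) l -> find (fun e => Nat.eqb (fst e) g) l = Some (g, s).
Proof.
  induction l as [|[h r] l IH]; intros N; [destruct 1|]. inversion N; subst. intros [E|I]; cbn.
  - inversion E; subst. rewrite Nat.eqb_refl; auto.
  - destruct (Nat.eqb_spec h g) as [->|]; auto. exfalso. apply H1. change g with (fst (g, s)). now apply in_map.
Qed.

Let str := strength (inst U).

Lemma str_In g s : In (g, s) (strengths U) -> str g = s.
Proof.
  intros H. unfold str, strength, inst; cbn [st_str].
  rewrite (find_NoDup _ _ _ strengths_NoDup H).
  destruct (Nat.eqb_spec g 0) as [->|]; auto. exfalso; apply strengths_pos.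
  change 0 with (fst (0, s)). now apply in_map.
Qed.

Lemma str_gl a : In a allA -> str (gl a) = 1.
Proof.
  intros H; apply str_In. rewrite strengths_split. apply in_app_iff; right; apply in_app_iff; left.
  apply in_map_iff. exists (gl a); split; auto. apply nodup_In, in_app_iff; left; now apply in_map.
Qed.
Lemma str_gs q : In q allQ -> str (gs q) = 1.
Proof.
  intros H; apply str_In. rewrite strengths_split. apply in_app_iff; right; apply in_app_iff; left.
  apply in_map_iff. exists (gs q); split; auto. apply nodup_In, in_app_iff; right; now apply in_map.
Qed.
Lemma str_gk i : i < 10 -> str (gk i) = 2.
Proof.
  intros H; apply str_In. rewrite strengths_split. apply in_app_iff; right; apply in_app_iff; right.
  apply in_map_iff. exists i; split; auto. apply in_seq; lia.
Qed.
Lemma str_nm i : i <= n + 4 + 5 * p -> str (nm i) = 2.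
Proof.
  intros H; apply str_In. rewrite strengths_split. apply in_app_iff; left.
  apply in_map_iff. exists i; split; auto. apply in_seq; lia.
Qed.

Lemma nm_neqs i : nm i <> 0 /\ nm i <> gL /\ nm i <> gB /\ nm i <> gZ /\ nm i <> gT /\ nm i <> rho.
Proof. split; [apply nm_pos|]. repeat split; apply nm_odd. Qed.

Lemma gk_list l : NoDup l -> NoDup (map gk l).
Proof. apply FinFun.Injective_map_NoDup; intros i j; apply gk_inj. Qed.

Lemma chain_consts : NoDup [0; gL; gB; gZ; gT; rho].
Proof.
  constructor.
  - cbn; intros H; repeat (destruct H as [H|H]; [revert H; apply odd_pos|]); auto.
  - apply (gk_list [5; 7; 8; 9; 6]). repeat constructor; cbn; lia.
Qed.

Definition accept_run : Prop := accepting letter rstate (nrms V) Q0 QT gL bcells.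

Lemma accept_run_spec : accept_run <-> exists y a b, length y <= p /\ exists m v v',
  rsteps letter rstate (nrms V) Q0 (S m) (rawrow (base x y (S a) (S b) (zonefor p []))) v /\ run letter rstate (nrms V) QT v v'.
Proof.
  assert (B := bottom_rows nm gL gB gZ gT rho x p nm_inj nm_neqs chain_consts).
  split.
  - intros (bs & m & v & v' & Hp & R1 & R2).
    destruct (proj1 (B (letters letter bs))) as (y & a & b & L & E); [exists bs; auto|].
    exists y, a, b; split; auto. exists m, v, v'. rewrite -E; auto.
  - intros (y & a & b & L & m & v & v' & R1 & R2).
    destruct (proj2 (B (rawrow (base x y (S a) (S b) (zonefor p []))))) as (bs & Hp & E); [eauto|].
    exists bs, m, v, v'. rewrite E; auto.
Qed.

Lemma inst_uniquely : uniquely_assembles (inst U) <-> ~ accept_run.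
Proof.
  assert (Hcells : forall w a e, In (w, a, e) bcells ->
     str w = 2 /\ (e = 0 \/ str e = 2) /\ w <> rho /\ e <> rho /\ (isEndL a = true <-> e = 0) /\ In a allA).
  { intros w a e H. pose proof chain_consts as CC.
    destruct (const_neq nm gL gB gZ gT rho nm_neqs CC) as (? & ? & ? & ? & ? & ? & ? & ? & ? & ? & ? & ? & ? & ?).
    destruct (cells_letters nm gL gB gZ gT rho x p nm_inj nm_neqs CC V _ _ _ H) as [K1 K2].
    destruct (cells_glues nm gL gB gZ gT x p nm_inj _ _ _ H) as [Hw He].
    split; [|split; [|split; [|split]]]; auto.
    - destruct Hw as [->|[->|[->|[->|(i & Hi & ->)]]]]; try (apply str_gk; lia). apply str_nm; auto.
    - destruct He as [->|[->|[->|[->|(i & Hi & ->)]]]]; auto; right; try (apply str_gk; lia). apply str_nm; auto.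
    - destruct Hw as [->|[->|[->|[->|(i & Hi & ->)]]]]; auto. apply nm_neqs.
    - destruct He as [->|[->|[->|[->|(i & Hi & ->)]]]]; auto; try apply nm_neqs. intros E; symmetry in E; revert E; apply odd_pos. }
  assert (Hpath : exists bs, path letter bcells gL bs).
  { destruct (proj2 (bottom_rows nm gL gB gZ gT rho x p nm_inj nm_neqs chain_consts (rawrow (base x [] 1 1 (zonefor p []))))) as (bs & H & _).
    - exists [], 0, 0; split; [cbn; lia|auto].
    - eauto. }
  assert (Hv : NoDup [kap; kap'; kap1; inf; inf2]).
  { apply (gk_list [0; 1; 2; 3; 4]). repeat constructor; cbn; lia. }
  assert (HgL : gL <> rho) by (intros E; apply gk_inj in E; discriminate E).
  assert (S0 : str 0 = 0) by reflexivity.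
  (* The two descriptions of the stages differ only in the list of row tiles, and terminality
     depends on the initial assemblies as a set. *)
  assert (Ext : forall C, terminal str 2 (X3 (inst U) (rowtiles U) colT intT [tinfA inf inf2] [tinfB inf inf2]) C <->
    terminal str 2 (S3 letter rstate isEndL topS ErrL ErrS allA allQ (nrms V) Q0 QT gl gs kap kap' kap1 inf inf2 gL rho str bcells) C).
  { intros C. apply terminal_ext. intros C3. unfold X3, S3.
    assert (E2 : terminal str 2 (X2 (inst U) (rowtiles U) colT intT) C3 <->
      terminal str 2 (S2 letter rstate isEndL topS ErrL ErrS allA allQ (nrms V) Q0 QT gl gs kap kap' kap1 inf gL rho str bcells) C3).
    { apply terminal_ext. intros C2. unfold X2, S2.
      assert (E1 : terminal str 2 (X1 (inst U) (rowtiles U) colT) C2 <->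
        terminal str 2 (S1 letter rstate allA allQ Q0 QT gl gs kap kap' kap1 inf gL rho str bcells) C2).
      { apply terminal_ext. intros C1. unfold X1, S1.
        assert (E0 : terminal str 2 (singles (rowtiles U)) C1 <-> terminal str 2 (singles (RT letter allA gl kap kap' gL rho bcells)) C1).
        { apply terminal_ext. intros C0. unfold singles. split; intros (t & It & ->); exists t; split; auto; now apply rowtiles_RT. }
        fold str. rewrite E0. reflexivity. }
      fold str. rewrite E1. reflexivity. }
    fold str. rewrite E2. reflexivity. }
  apply (uniquely_assembles_spec (inst U) (rowtiles U) colT intT [tinfA inf inf2] [tinfB inf inf2]); auto.
  - intros C T. apply Ext in T. revert T.
    apply terminal_S3_accepting; auto using str_gl, str_gs, gl_inj, gs_inj; try (apply str_gk; lia).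
    + intros q; apply odd_pos.
    + intros w a e; apply (cells_next nm gL gB gZ gT x p nm_inj).
    + intros w a e; apply (cells_prev nm gL gB gZ gT x p nm_inj).
    + left; auto.
    + right; left; auto.
    + intros []; [right; right; left|right; right; right; left]; auto.
    + intros []; [right; right; left|right; right; right; left]; auto.
    + apply nrms_facts.
  - intros Hacc.
    destruct (accepting_terminal_S3 letter rstate isEndL topS ErrL ErrS allA allQ (nrms V) Q0 QT gl gs kap kap' kap1 inf inf2 gL rho str bcells) as (C & T & HC);
      auto using str_gl, str_gs, gl_inj, gs_inj; try (apply str_gk; lia).
    + intros q; apply odd_pos.
    + intros w a e; apply (cells_next nm gL gB gZ gT x p nm_inj).
    + intros w a e; apply (cells_prev nm gL gB gZ gT x p nm_inj).
    + left; auto.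
    + right; left; auto.
    + intros []; [right; right; left|right; right; right; left]; auto.
    + intros []; [right; right; left|right; right; right; left]; auto.
    + apply nrms_facts.
    + exists C; split; auto. now apply Ext.
Qed.

Lemma inst_valid : valid_instance (inst U).
Proof.
  split; [cbn; lia|]. split; [apply strengths_NoDup|]. split; [apply strengths_pos|]. split.
  - intros i k j H. cbn [st_edges inst] in H. unfold st_b; cbn [st_r st_tiles inst length].
    unfold edges7 in H; cbn [In] in H. repeat (destruct H as [H|H]; [inversion H; subst; lia|]). destruct H.
  - apply wf_single.
Qed.

End Word.

Lemma polyb_mono c k n m : n <= m -> polyb c k n <= polyb c k m.
Proof. intros H; apply Nat.mul_le_mono_l, Nat.pow_le_mono_l; lia. Qed.

(** An accepting run of rows exists exactly if some y has all its certificates rejected, which is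
    the negation of the condition that defines [L]. *)
Lemma inst_correct (L : list bool -> Prop) c k x :
  (forall x y z, exists cf, exec V (polyb c k (length x + length y + length z)) (init_cfg (triple_tape x y z)) = Some cf) ->
  (forall x, L x <-> forall y, length y <= polyb c k (length x) -> exists z, length z <= polyb c k (length x) /\
     exists cf, exec V (polyb c k (length x + length y + length z)) (init_cfg (triple_tape x y z)) = Some cf /\ tm_state cf = 1) ->
  uniquely_assembles (inst (kinds x (polyb c k (length x)))) <-> L x.
Proof.
  intros Tot Spec. rewrite inst_uniquely accept_run_spec Spec. set (p := polyb c k (length x)). split.
  - intros H y Hy. apply NNPP; intros N. apply H.
    (* A time bound common to all y and z of length at most [p]; it also serves as the number of
       guessed blanks on each side. *)
    set (T := polyb c k (length x + p + p)).
    destruct (search_complete V x y p (S T) (S T) T) as (m & v & v' & R); auto.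
    + intros z Hz. destruct (Tot x y z) as [cf E]. destruct (exec_msteps _ _ _ _ E) as (m & Lm & M & St).
      exists m; split; [etransitivity; [exact Lm|apply polyb_mono; lia]|].
      exists cf; split; auto. split; auto. intros A. apply N. exists z; split; auto. exists cf; auto.
    + exists y, T, T; split; auto. exists m, v, v'; auto.
  - intros H (y & a & b & Ly & m & v & v' & R1 & R2). destruct (H y Ly) as (z & Lz & cf & E & A).
    destruct (search_sound _ _ _ _ _ _ _ _ _ R1 R2 z Lz) as (m' & cf' & M' & St' & A').
    destruct (exec_msteps _ _ _ _ E) as (m1 & _ & M1 & St1).
    (* Both halting runs fit into the time [m1 + m'], so they end in the same configuration, which
       would be accepting and rejecting at once. *)
    assert (E1 := msteps_exec V m1 (m1 + m') _ _ (Nat.le_add_r _ _) M1 St1).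
    assert (E2 : exec V (m1 + m') (init_cfg (triple_tape x y z)) = Some cf') by (apply (msteps_exec V m'); auto; lia).
    rewrite E1 in E2; inversion E2; subst; auto.
Qed.

End Instance.

(** * A sweeping machine that prints the instance *)

Fixpoint bvec (k : nat) : Type := match k with 0 => unit | S k' => (bool * bvec k')%type end.
Definition vcons {k : nat} (b : bool) (v : bvec k) : bvec (S k) := (b, v).
Definition vhd {k : nat} (v : bvec (S k)) : bool := fst v.
Definition vtl {k : nat} (v : bvec (S k)) : bvec k := snd v.
Fixpoint vconst (b : bool) (k : nat) : bvec k := match k with 0 => tt | S k' => vcons b (vconst b k') end.
Fixpoint vand {k : nat} : bvec k -> bvec k -> bvec k :=
  match k with 0 => fun _ _ => tt | S k' => fun v w => vcons (vhd v && vhd w) (vand (vtl v) (vtl w)) end.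
Fixpoint vall {k : nat} : bvec k -> bool :=
  match k with 0 => fun _ => true | S k' => fun v => vhd v && vall (vtl v) end.
(* Digit j of the odometer is the number of positions whose j-th bit is set; f tells which digits are full.
   Incrementing resets the leading full digits and sets one more bit of the first other digit. *)
Fixpoint vincr {k : nat} : bvec k -> bvec k -> bool -> bvec k * bool :=
  match k with
  | 0 => fun _ _ placed => (tt, placed)
  | S k' => fun f v placed =>
      if vhd f then (vcons false (fst (vincr (vtl f) (vtl v) placed)), snd (vincr (vtl f) (vtl v) placed))
      else (vcons (vhd v || negb placed) (vtl v), placed || negb (vhd v))
  end.
Fixpoint vcode {k : nat} : bvec k -> nat :=
  match k with 0 => fun _ => 0 | S k' => fun v => pr (b2n (vhd v)) (vcode (vtl v)) end.
Fixpoint allbvec (k : nat) : list (bvec k) :=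
  match k with 0 => [tt] | S k' => list_prod [false; true] (allbvec k') end.

Lemma vcons_eta k (v : bvec (S k)) : vcons (vhd v) (vtl v) = v.
Proof. now destruct v. Qed.

Lemma vcode_inj k (v w : bvec k) : vcode v = vcode w -> v = w.
Proof.
  induction k as [|k IH]; cbn; [destruct v, w; auto|]. intros H.
  apply pr_inj in H as [H1 H2]. apply b2n_inj in H1. apply IH in H2. now rewrite -(vcons_eta _ v) H1 H2 vcons_eta.
Qed.

Lemma in_allbvec k (v : bvec k) : In v (allbvec k).
Proof.
  induction k as [|k IH]; [left; now destruct v|]. destruct v as [b v].
  apply in_prod; auto. destruct b; cbn; auto.
Qed.

(* [Run] stands for the number of the cell, in unary: it prints two bits for every cell up to it. *)
Inductive item := Word (w : list bool) | Run.
Definition den_item (i : nat) (e : item) : list bool := match e with Word w => w | Run => repeat false (2 * i) end.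
Definition den (i : nat) (es : list item) : list bool := flat_map (den_item i) es.

Section Emitter.
Variables (k K J : nat) (heads loop tails : list nat) (pre mid suf : list bool) (prog : bool -> nat -> list item).
Hypothesis K2 : 2 <= K.
Hypothesis heads_lt : Forall (fun q => q < K) heads.
Hypothesis loop_lt : Forall (fun q => q < K) loop.
Hypothesis tails_lt : Forall (fun q => q < K) tails.
Hypothesis prog_J : forall ph q, length (prog ph q) <= J.

(** Input bits turn into odometer cells [SOdo] and later into [SCell]s of the same kind. In an
    [SCell], [done] says that its program has been started, and [mark] serves for counting. *)
Inductive sym := SBit (b : bool) | SOdo (b : bool) (v : bvec k) | SCell (q : nat) (done mark : bool).
(** [PTest] finds the full digits of the odometer and alternates with [PIncr]; [PConv] makes the
    odometer cells ordinary. There are two printing phases, [ph = false] for the strengths and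
    [ph = true] for the row tiles. Each prints the number of cells by [PHalve], clears the marks and
    runs the programs of the cells from left to right. *)
Inductive ctl :=
| PInit | PTest (f : bvec k) | PIncr (f : bvec k) (placed : bool) | PConv
| PHalve (ph par any : bool) | PReset (ph : bool) | PFind (ph : bool) | PFound (ph : bool) (q : nat)
| PExec (ph : bool) (q j : nat) (hit : bool) | PClear (ph : bool) (q j : nat) | PEnd.

Definition new (q : nat) : sym := SCell q false false.

Definition edlt (s : ctl) (a : sym) : ctl * sym :=
  match s, a with
  | PInit, SBit b => (PInit, SOdo b (vconst false k))
  | PTest f, SOdo b v => (PTest (vand f v), a)
  | PIncr f placed, SOdo b v => let (v', placed') := vincr f v placed in (PIncr f placed', SOdo b v')
  | PConv, SOdo b v => (PConv, new (b2n b))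
  | PHalve ph par any, SCell q d false => (PHalve ph (negb par) true, SCell q d (negb par))
  | PReset ph, SCell q _ _ => (PReset ph, new q)
  | PFind ph, SCell q false m => (PFound ph q, SCell q true m)
  | PExec ph q j false, SCell q' true false =>
      match nth_error (prog ph q) j with Some Run => (PExec ph q j true, SCell q' true true) | _ => (s, a) end
  | PClear ph q j, SCell q' d _ => (s, SCell q' d false)
  | _, _ => (s, a)
  end.

Definition eturn (s : ctl) : option (list sym * ctl) :=
  match s with
  | PInit => Some (map new heads, PTest (vconst true k))
  | PTest f => Some (map new loop, if vall f then PConv else PIncr f false)
  | PIncr _ _ => Some ([], PTest (vconst true k))
  | PConv => Some (map new tails ++ map SBit pre, PHalve false false false)
  | PHalve ph par any =>
      if any then Some (map SBit [par; par], PHalve ph false false) else Some (map SBit [false; true], PReset ph)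
  | PReset ph => Some ([], PFind ph)
  | PFind ph => if ph then Some (map SBit suf, PEnd) else Some (map SBit mid, PHalve true false false)
  | PFound ph q => Some ([], PExec ph q 0 false)
  | PExec ph q j hit =>
      if hit then Some (map SBit [false; false], PExec ph q j false) else
      match nth_error (prog ph q) j with
      | Some (Word w) => Some (map SBit w, PExec ph q (S j) false)
      | Some Run => Some ([], PClear ph q j)
      | None => Some ([], PFind ph)
      end
  | PClear ph q j => Some ([], PExec ph q (S j) false)
  | PEnd => None
  end.

Notation esweep := (sweep ctl sym edlt).
Notation esrun := (srun ctl sym edlt eturn).

(** * Codes and finiteness of the control states and symbols *)

Definition scod (s : ctl) : nat :=
  match s with
  | PInit => 0
  | PTest f => S (pr 0 (vcode f))
  | PIncr f b => S (pr 1 (pr (vcode f) (b2n b)))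
  | PConv => S (pr 2 0)
  | PHalve a b c => S (pr 3 (pr (b2n a) (pr (b2n b) (b2n c))))
  | PReset a => S (pr 4 (b2n a))
  | PFind a => S (pr 5 (b2n a))
  | PFound a q => S (pr 6 (pr (b2n a) q))
  | PExec a q j b => S (pr 7 (pr (pr (b2n a) q) (pr j (b2n b))))
  | PClear a q j => S (pr 8 (pr (b2n a) (pr q j)))
  | PEnd => S (pr 9 0)
  end.
Definition acod (a : sym) : nat :=
  match a with
  | SBit b => if b then 2 else 1
  | SOdo b v => 3 + pr 0 (pr (b2n b) (vcode v))
  | SCell q d m => 3 + pr 1 (pr q (pr (b2n d) (b2n m)))
  end.

Ltac unpr := repeat match goal with
  | H : pr _ _ = pr _ _ |- _ => apply pr_inj in H as [? ?]
  | H : b2n _ = b2n _ |- _ => apply b2n_inj in H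
  | H : vcode _ = vcode _ |- _ => apply vcode_inj in H end; subst.

Lemma scod_inj s s' : scod s = scod s' -> s = s'.
Proof. destruct s, s'; cbn [scod]; intros H; try discriminate H; try injection H as H; unpr; auto; discriminate. Qed.
Lemma acod_inj s s' : acod s = acod s' -> s = s'.
Proof.
  destruct s, s'; cbn [acod]; intros H; try (destruct b; discriminate H); try (destruct b0; discriminate H);
    try injection H as H; unpr; auto; try discriminate. destruct b, b0; auto; discriminate H.
Qed.

Definition bools := [false; true].
Definition ctlph (a : bool) : list ctl :=
  [PReset a; PFind a] ++ flat_map (fun b => map (PHalve a b) bools) bools ++ map (PFound a) (seq 0 K) ++
  flat_map (fun q => map (PClear a q) (seq 0 (length (prog a q))) ++
    flat_map (fun j => map (PExec a q j) bools) (seq 0 (S (length (prog a q))))) (seq 0 K).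
Definition allctl : list ctl :=
  [PInit; PConv; PEnd] ++ map PTest (allbvec k) ++
  flat_map (fun f => map (PIncr f) bools) (allbvec k) ++ flat_map ctlph bools.
Definition allsym : list sym :=
  map SBit bools ++ flat_map (fun b => map (SOdo b) (allbvec k)) bools ++
  flat_map (fun q => flat_map (fun d => map (SCell q d) bools) bools) (seq 0 K).

Definition okctl (s : ctl) : Prop :=
  match s with PFound _ q => q < K | PExec a q j _ => q < K /\ j <= length (prog a q) | PClear a q j => q < K /\ j < length (prog a q) | _ => True end.
Definition oksym (a : sym) : Prop := match a with SCell q _ _ => q < K | _ => True end.

Lemma in_bools b : In b bools.
Proof. destruct b; cbn; auto. Qed.

Lemma in_allsym a : In a allsym <-> oksym a.
Proof.
  split.
  - unfold allsym; intros H; apply in_app_iff in H as [H|H]; [|apply in_app_iff in H as [H|H]].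
    + apply in_map_iff in H as (b & <- & _); exact I.
    + apply in_flat_map in H as (b & _ & H). apply in_map_iff in H as (v & <- & _); exact I.
    + apply in_flat_map in H as (q & Hq & H). apply in_flat_map in H as (d & _ & H).
      apply in_map_iff in H as (m & <- & _). apply in_seq in Hq; cbn; lia.
  - destruct a as [b|b v|q d m]; intros H; unfold allsym.
    + apply in_app_iff; left; apply in_map, in_bools.
    + apply in_app_iff; right; apply in_app_iff; left.
      apply in_flat_map; exists b; split; [apply in_bools|]. apply in_map, in_allbvec.
    + do 2 (apply in_app_iff; right). apply in_flat_map; exists q; split; [apply in_seq; cbn in H; lia|]. apply in_flat_map; exists d; split; [apply in_bools|].
      apply in_map, in_bools.
Qed.

Lemma in_allctl s : In s allctl <-> okctl s.
Proof.
  split.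
  - unfold allctl; intros H; apply in_app_iff in H as [H|H]; [|apply in_app_iff in H as [H|H]; [|apply in_app_iff in H as [H|H]]].
    + cbn in H; destruct H as [<-|[<-|[<-|[]]]]; exact I.
    + apply in_map_iff in H as (f & <- & _); exact I.
    + apply in_flat_map in H as (f & _ & H). apply in_map_iff in H as (b & <- & _); exact I.
    + apply in_flat_map in H as (a & _ & H); apply in_app_iff in H as [H|H]; [|apply in_app_iff in H as [H|H]; [|apply in_app_iff in H as [H|H]]].
      * cbn in H; destruct H as [<-|[<-|[]]]; exact I.
      * apply in_flat_map in H as (b & _ & H). apply in_map_iff in H as (c & <- & _); exact I.
      * apply in_map_iff in H as (q & <- & H). apply in_seq in H; cbn; lia.
      * apply in_flat_map in H as (q & Hq & H). apply in_seq in Hq. apply in_app_iff in H as [H|H].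
        -- apply in_map_iff in H as (j & <- & Hj). apply in_seq in Hj. cbn; lia.
        -- apply in_flat_map in H as (j & Hj & H). apply in_seq in Hj. apply in_map_iff in H as (c & <- & _); cbn; lia.
  - assert (E : forall a s, In s (ctlph a) -> In s allctl).
    { intros a s' H; do 3 (apply in_app_iff; right). apply in_flat_map; exists a; split; auto using in_bools. }
    destruct s; intros H; cbn [okctl] in H.
    + left; auto.
    + apply in_app_iff; right; apply in_app_iff; left. apply in_map, in_allbvec.
    + do 2 (apply in_app_iff; right). apply in_app_iff; left.
      apply in_flat_map. exists f; split; [apply in_allbvec|apply in_map, in_bools].
    + right; left; auto.
    + apply (E ph), in_app_iff; right; apply in_app_iff; left.
      apply in_flat_map; exists par; split; [apply in_bools|apply in_map, in_bools].
    + apply (E ph). left; auto.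
    + apply (E ph). right; left; auto.
    + apply (E ph). do 2 (apply in_app_iff; right). apply in_app_iff; left. apply in_map, in_seq; lia.
    + apply (E ph). do 3 (apply in_app_iff; right).
      apply in_flat_map; exists q; split; [apply in_seq; lia|]. apply in_app_iff; right.
      apply in_flat_map; exists j; split; [apply in_seq; lia|apply in_map, in_bools].
    + apply (E ph). do 3 (apply in_app_iff; right).
      apply in_flat_map; exists q; split; [apply in_seq; lia|]. apply in_app_iff; left. apply in_map, in_seq; lia.
    + do 2 right; left; auto.
Qed.

Lemma edlt_in s a : In s allctl -> In a allsym -> In (fst (edlt s a)) allctl /\ In (snd (edlt s a)) allsym.
Proof.
  rewrite !in_allctl !in_allsym. destruct s, a; cbn; auto.
  - destruct (vincr f v placed); cbn; auto.
  - destruct b; cbn; intros _ _; split; auto; lia.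
  - destruct mark; cbn; auto.
  - destruct done; cbn; auto.
  - destruct hit; cbn; auto.
  - destruct hit; cbn; auto.
  - destruct hit; [cbn; auto|]. destruct done; [|cbn; auto]. destruct mark; [cbn; auto|].
    destruct (nth_error (prog ph q) j) as [[]|]; cbn; auto.
Qed.

Lemma Forall_new l : Forall (fun q => q < K) l -> Forall (fun a => In a allsym) (map new l).
Proof. intros H. apply Forall_map. eapply Forall_impl; [|exact H]. intros q Hq; now apply in_allsym. Qed.
Lemma Forall_bits l : Forall (fun a => In a allsym) (map SBit l).
Proof. apply Forall_forall; intros a Ha; apply in_map_iff in Ha as (b & <- & _). now apply in_allsym. Qed.

Lemma eturn_in s w s' : In s allctl -> eturn s = Some (w, s') -> In s' allctl /\ Forall (fun a => In a allsym) w.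
Proof.
  rewrite !in_allctl. destruct s; cbn [eturn okctl]; intros H E.
  - injection E as <- <-. auto using Forall_new.
  - injection E as <- <-. split; [destruct (vall f); exact I|]. auto using Forall_new.
  - injection E as <- <-. cbn; auto.
  - injection E as <- <-. split; [exact I|]. apply Forall_app; auto using Forall_new, Forall_bits.
  - destruct any; injection E as <- <-; split; try exact I; apply (Forall_bits [_; _]).
  - injection E as <- <-. cbn; auto.
  - destruct ph; injection E as <- <-; cbn; auto using Forall_bits.
  - injection E as <- <-. split; auto. cbn; lia.
  - destruct hit.
    + injection E as <- <-. split; [exact H|apply (Forall_bits [_; _])].
    + destruct (nth_error (prog ph q) j) as [[w0|]|] eqn:Ej; injection E as <- <-; split; auto using Forall_bits.
      * assert (j < length (prog ph q)) by (apply nth_error_Some; congruence). cbn; lia.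
      * assert (j < length (prog ph q)) by (apply nth_error_Some; congruence). cbn; lia.
      * exact I.
  - injection E as <- <-. split; [cbn; lia|auto].
  - discriminate E.
Qed.

Definition reach (t : nat) (s : ctl) (C : list sym) (B : list bool) (s' : ctl) (C' : list sym) (B' : list bool) : Prop :=
  exists m, m <= t /\ esrun m s (C ++ map SBit B) s' (C' ++ map SBit B').

Lemma reach_trans t t' s C B s1 C1 B1 s' C' B' :
  reach t s C B s1 C1 B1 -> reach t' s1 C1 B1 s' C' B' -> reach (t + t') s C B s' C' B'.
Proof. intros (m & L & R) (m' & L' & R'). exists (m + m'); split; [lia|]. eapply srun_app; eauto. Qed.
Lemma reach_le t t' s C B s' C' B' : t <= t' -> reach t s C B s' C' B' -> reach t' s C B s' C' B'.
Proof. intros H (m & L & R). exists m; split; [lia|auto]. Qed.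

Lemma sweep_fix s U : Forall (fun a => edlt s a = (s, a)) U -> esweep s U = (s, U).
Proof. induction 1 as [|a U E F IH]; auto. cbn [sweep]. rewrite E IH; auto. Qed.

Lemma reach_turn s C B s1 C1 ls v s2 : esweep s C = (s1, C1) -> s1 <> PInit ->
  eturn s1 = Some (map new ls ++ map SBit v, s2) -> ls = [] \/ B = [] ->
  reach 1 s C B s2 (C1 ++ map new ls) (B ++ v).
Proof.
  intros E N T H. exists 1; split; auto. exists s1, (C1 ++ map SBit B), (map new ls ++ map SBit v), s2. split; [|split; auto].
  - eapply sweep_app; [exact E|]. apply sweep_fix, Forall_map, Forall_forall. intros b _. destruct s1; auto; try congruence. destruct hit; auto.
  - cbn. split; auto. rewrite map_app. destruct H as [->| ->]; cbn [map app]; rewrite ?app_nil_r -?app_assoc; auto.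
Qed.

Lemma reach_bits s C B s1 C1 v s2 : esweep s C = (s1, C1) -> s1 <> PInit ->
  eturn s1 = Some (map SBit v, s2) -> reach 1 s C B s2 C1 (B ++ v).
Proof. intros E N T. rewrite -(app_nil_r C1). apply (reach_turn s C B s1 C1 [] v s2); auto. Qed.

Lemma reach_silent s C B s1 C1 s2 : esweep s C = (s1, C1) -> s1 <> PInit ->
  eturn s1 = Some ([], s2) -> reach 1 s C B s2 C1 B.
Proof. intros E N T. rewrite -{2}(app_nil_r B). eapply reach_bits; eauto. Qed.

(** * The odometer *)

Definition ones (l : list bool) : nat := count_occ bool_dec l true.

(** With [n] cells a digit, being a number of set bits, ranges from 0 to [n]; hence base [n + 1]. *)
Fixpoint oval (n : nat) {j : nat} : list (bvec j) -> nat :=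
  match j with 0 => fun _ => 0 | S j' => fun V => ones (map vhd V) + (n + 1) * oval n (map vtl V) end.

Fixpoint vsweep {j : nat} (f : bvec j) (V : list (bvec j)) (placed : bool) : list (bvec j) :=
  match V with [] => [] | v :: V' => fst (vincr f v placed) :: vsweep f V' (snd (vincr f v placed)) end.

Definition fulld {j : nat} (V : list (bvec j)) : bvec j := fold_left vand V (vconst true j).

Lemma oval_S n j (V : list (bvec (S j))) : oval n V = ones (map vhd V) + (n + 1) * oval n (map vtl V).
Proof. reflexivity. Qed.

Lemma full_S j (V : list (bvec (S j))) : fulld V = vcons (fold_left andb (map vhd V) true) (fulld (map vtl V)).
Proof.
  unfold fulld; cbn [vconst]. generalize true (vconst true j).
  induction V as [|v V IH]; intros b f; auto. cbn [fold_left map]. rewrite -IH. reflexivity.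
Qed.

Lemma ones_le l : ones l <= length l.
Proof. apply count_occ_bound. Qed.

Lemma fold_andb_false l : fold_left andb l false = false.
Proof. induction l; auto. Qed.

Lemma fold_andb l : fold_left andb l true = true <-> ones l = length l.
Proof.
  unfold ones; induction l as [|[] l IH]; cbn; [tauto| |].
  - rewrite IH; lia.
  - rewrite fold_andb_false. split; [discriminate|]. intros H. pose proof (ones_le l); unfold ones in *; lia.
Qed.

Lemma oval_lt n j (V : list (bvec j)) : length V <= n -> oval n V < (n + 1) ^ j.
Proof.
  intros H; induction j as [|j IH]; [cbn; lia|]. rewrite oval_S; cbn [Nat.pow].
  specialize (IH (map vtl V)). rewrite length_map in IH. specialize (IH H).
  pose proof (ones_le (map vhd V)) as L. rewrite length_map in L.
  apply (Nat.mul_le_mono_l _ _ (n + 1)) in IH. lia.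
Qed.

Lemma oval_full j (V : list (bvec j)) : vall (fulld V) = true -> S (oval (length V) V) = (length V + 1) ^ j.
Proof.
  remember (length V) as n eqn:En.
  induction j as [|j IH]; [auto|]. rewrite full_S. cbn [vall fst snd]. intros H. apply andb_prop in H as [H1 H2].
  apply fold_andb in H1. rewrite length_map in H1. rewrite oval_S; cbn [Nat.pow]. rewrite H1.
  rewrite -(IH (map vtl V)) ?length_map; auto. nia.
Qed.

Lemma vsweep_full j (f : bvec j) (V : list (bvec (S j))) placed :
  vsweep (vcons true f) V placed = map (vcons false) (vsweep f (map vtl V) placed).
Proof. revert placed; induction V as [|v V IH]; intros placed; auto. cbn. rewrite -IH; auto. Qed.

Lemma vsweep_placed j (f : bvec j) (V : list (bvec (S j))) : vsweep (vcons false f) V true = V.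
Proof. induction V as [|v V IH]; auto. cbn. now rewrite orb_false_r IH vcons_eta. Qed.

(** [placed] becomes true at the first cell whose bit is not set, so a sweep sets exactly one bit of
    the digit. *)
Lemma vsweep_set j (f : bvec j) (V : list (bvec (S j))) : fold_left andb (map vhd V) true = false ->
  map vtl (vsweep (vcons false f) V false) = map vtl V /\
  ones (map vhd (vsweep (vcons false f) V false)) = S (ones (map vhd V)).
Proof.
  induction V as [|v V IH]; [discriminate|]. cbn. destruct (vhd v) eqn:E; cbn.
  - intros H. destruct (IH H) as [E1 E2]. rewrite E1. split; auto.
  - intros _. rewrite vsweep_placed. auto.
Qed.

Lemma vsweep_length j (f : bvec j) V placed : length (vsweep f V placed) = length V.
Proof. revert placed; induction V as [|v V IH]; intros placed; cbn; auto. Qed.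

Lemma oval_incr j (V : list (bvec j)) : vall (fulld V) = false ->
  oval (length V) (vsweep (fulld V) V false) = S (oval (length V) V).
Proof.
  remember (length V) as n eqn:En.
  induction j as [|j IH]; [discriminate|]. rewrite full_S. cbn [vall fst snd].
  destruct (fold_left andb (map vhd V) true) eqn:E; cbn [andb]; intros H.
  - rewrite vsweep_full. rewrite !oval_S. rewrite !map_map. cbn [fst snd]. rewrite map_id.
    rewrite (IH (map vtl V)) ?length_map; auto. apply fold_andb in E. rewrite length_map in E.
    assert (Z : forall U : list (bvec j), ones (map (fun _ => false) U) = 0).
    { induction U; auto. }
    rewrite Z. nia.
  - destruct (vsweep_set _ (fulld (map vtl V)) V E) as [E1 E2]. rewrite !oval_S. rewrite E1 E2. lia.
Qed.

Definition oword (O : list (bool * bvec k)) : list sym := map (fun e => SOdo (fst e) (snd e)) O.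

Lemma sweep_test f O : esweep (PTest f) (oword O) = (PTest (fold_left vand (map snd O) f), oword O).
Proof. revert f; induction O as [|[b v] O IH]; intros f; auto. cbn [oword map fold_left snd fst sweep edlt]. fold (oword O). rewrite IH; auto. Qed.

Lemma sweep_incr f placed O : exists placed' O', esweep (PIncr f placed) (oword O) = (PIncr f placed', oword O') /\
  map fst O' = map fst O /\ map snd O' = vsweep f (map snd O) placed.
Proof.
  revert placed; induction O as [|[b v] O IH]; intros placed; [exists placed, []; auto|].
  cbn [oword map fst snd sweep edlt vsweep]. destruct (vincr f v placed) as [v' pl] eqn:E. cbn [fst snd].
  destruct (IH pl) as (pl' & O' & E' & E1 & E2). fold (oword O). rewrite E'.
  exists pl', ((b, v') :: O'). cbn. rewrite E1 E2; auto.
Qed.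

Lemma sweep_new s L : (forall q, edlt s (new q) = (s, new q)) -> esweep s (map new L) = (s, map new L).
Proof. intros H. apply sweep_fix, Forall_map, Forall_forall; auto. Qed.

(** Here [d] is the number of increments still to come. A copy of [loop] is appended at each test,
    including the last one, which finds all digits full; hence [S d] copies. *)
Lemma odometer d : forall O L, S (oval (length O) (map snd O)) + d = (length O + 1) ^ k -> exists O',
  map fst O' = map fst O /\
  reach (2 * d + 1) (PTest (vconst true k)) (oword O ++ map new L) [] PConv (oword O' ++ map new (L ++ concat (repeat loop (S d)))) [].
Proof.
  induction d as [|d IH]; intros O L Hd.
  - exists O; split; auto. rewrite map_app app_assoc. apply (reach_turn _ _ [] (PTest (fulld (map snd O))) _ _ []); auto; try discriminate.
    + eapply sweep_app; [apply sweep_test|now apply sweep_new].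
    + cbn [eturn concat repeat map]. rewrite !app_nil_r. do 2 f_equal.
      destruct (vall (fulld (map snd O))) eqn:E; auto. exfalso.
      pose proof (oval_incr _ _ E) as HI. rewrite length_map in HI.
      pose proof (oval_lt (length O) _ (vsweep (fulld (map snd O)) (map snd O) false)) as HL.
      rewrite vsweep_length length_map in HL. specialize (HL (le_n _)). lia.
  - destruct (vall (fulld (map snd O))) eqn:E.
    { pose proof (oval_full _ _ E) as HF. rewrite length_map in HF. lia. }
    destruct (sweep_incr (fulld (map snd O)) false O) as (pl & O1 & E1 & F1 & F2).
    assert (LO : length O1 = length O) by (rewrite -(length_map fst O1) F1 length_map; auto).
    destruct (IH O1 (L ++ loop)) as (O' & F & R).
    { rewrite LO F2. pose proof (oval_incr _ _ E) as HI. rewrite length_map in HI. rewrite HI. lia. }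
    exists O'; split; [congruence|]. rewrite -app_assoc in R.
    replace (2 * S d + 1) with (1 + (1 + (2 * d + 1))) by lia.
    eapply reach_trans; [|eapply reach_trans; [|exact R]].
    + apply (reach_turn _ _ [] (PTest (fulld (map snd O))) (oword O ++ map new L) loop []); auto; try discriminate.
      * eapply sweep_app; [apply sweep_test|now apply sweep_new].
      * cbn [eturn]. rewrite E app_nil_r; auto.
    + rewrite -app_assoc -map_app. eapply reach_silent; [eapply sweep_app; [exact E1|now apply sweep_new]|discriminate|auto].
Qed.

Lemma sweep_conv O : esweep PConv (oword O) = (PConv, map new (map b2n (map fst O))).
Proof. induction O as [|[b v] O IH]; auto. cbn [oword map fst snd sweep edlt]. fold (oword O). rewrite IH; auto. Qed.

(** * Printing a number by repeated halving *)

Definition cword (d : bool) (L : list (nat * bool)) : list sym := map (fun e => SCell (fst e) d (snd e)) L.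
Definition free (L : list (nat * bool)) : nat := length (filter (fun e => negb (snd e)) L).

(** A pass marks every other free cell, starting with the first: the parity of the number of free
    cells is the next binary digit, and half of them, rounded down, remain free. *)
Lemma sweep_halve ph d L : forall par any, exists L', map fst L' = map fst L /\ free L' = Nat.div2 (free L + b2n par) /\
  esweep (PHalve ph par any) (cword d L) = (PHalve ph (xorb par (Nat.odd (free L))) (any || negb (free L =? 0)), cword d L').
Proof.
  induction L as [|[q m] L IH]; intros par any.
  - exists []. cbn. rewrite orb_false_r xorb_false_r. destruct par; auto.
  - destruct m.
    + destruct (IH par any) as (L' & F & N & E). exists ((q, true) :: L').
      cbn [cword map fst snd sweep edlt]. fold (cword d L). rewrite E. cbn. rewrite F; auto.
    + destruct (IH (negb par) true) as (L' & F & N & E). exists ((q, negb par) :: L').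
      cbn [cword map fst snd sweep edlt]. fold (cword d L). rewrite E. cbn [map fst]. rewrite F. split; auto.
      assert (FE : free ((q, false) :: L) = S (free L)) by reflexivity. rewrite FE. split.
      * destruct par; cbn [negb b2n] in *.
        -- change (free ((q, false) :: L')) with (S (free L')). rewrite N Nat.add_0_r Nat.add_1_r; auto.
        -- change (free ((q, true) :: L')) with (free L'). rewrite N Nat.add_0_r Nat.add_1_r; auto.
      * rewrite Nat.odd_succ -Nat.negb_odd. cbn [Nat.eqb orb negb]. rewrite orb_true_r.
        destruct par, (Nat.odd (free L)); auto.
Qed.

Lemma enc_nat_step m : 0 < m -> enc_nat m = [Nat.odd m; Nat.odd m] ++ enc_nat (Nat.div2 m).
Proof. intros H. unfold enc_nat. rewrite (nat_bits_step H). auto. Qed.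

Lemma halve_loop ph d m : forall L B, free L = m -> exists L', map fst L' = map fst L /\
  reach (m + 1) (PHalve ph false false) (cword d L) B (PReset ph) (cword d L') (B ++ enc_nat m).
Proof.
  induction m as [m IH] using lt_wf_ind. intros L B Hm.
  destruct (sweep_halve ph d L false false) as (L1 & F & N & E). rewrite Hm in E, N. cbn [b2n] in N. rewrite Nat.add_0_r in N.
  destruct (Nat.eqb_spec m 0) as [->|Hm0].
  - exists L1; split; auto. apply (reach_bits _ _ _ _ _ [false; true] _ E); auto; discriminate.
  - assert (Hd : Nat.div2 m < m) by (apply Nat.lt_div2; lia).
    destruct (IH _ Hd L1 (B ++ [Nat.odd m; Nat.odd m]) N) as (L' & F' & R).
    exists L'; split; [congruence|]. rewrite enc_nat_step; [lia|]. rewrite app_assoc.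
    apply (reach_le (1 + (Nat.div2 m + 1))); [lia|]. eapply reach_trans; [|exact R].
    apply (reach_bits _ _ _ _ _ [Nat.odd m; Nat.odd m] _ E); [discriminate|]. rewrite xorb_false_l; auto.
Qed.

Lemma sweep_reset ph d L : esweep (PReset ph) (cword d L) = (PReset ph, map new (map fst L)).
Proof. induction L as [|[q m] L IH]; auto. cbn [cword map fst snd sweep edlt]. fold (cword d L). rewrite IH; auto. Qed.

(** * Running the programs of the cells *)

Definition dword (m : bool) (U : list nat) : list sym := map (fun q => SCell q true m) U.

Lemma sweep_dword s m U : (forall q, edlt s (SCell q true m) = (s, SCell q true m)) -> esweep s (dword m U) = (s, dword m U).
Proof. intros H. apply sweep_fix, Forall_map, Forall_forall; auto. Qed.

(** The cells that are already done form a unary counter: each round marks one of them and prints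
    two bits, until none is left. *)
Lemma run_loop ph q j U B : nth_error (prog ph q) j = Some Run -> forall V2 V1,
  reach (length V2 + 1) (PExec ph q j false) (dword true V1 ++ dword false V2 ++ map new U) B
    (PClear ph q j) (dword true (V1 ++ V2) ++ map new U) (B ++ repeat false (2 * length V2)).
Proof.
  intros Hj V2; revert B; induction V2 as [|r V2 IH]; intros B V1.
  - rewrite !app_nil_r. eapply (reach_silent _ _ _ (PExec ph q j false)); [|discriminate|cbn; now rewrite Hj].
    eapply sweep_app; [now apply sweep_dword|now apply sweep_new].
  - specialize (IH (B ++ [false; false]) (V1 ++ [r])). rewrite -!app_assoc in IH.
    replace (B ++ repeat false (2 * length (r :: V2))) with (B ++ [false; false] ++ repeat false (2 * length V2)).
    2: { cbn [length]. replace (2 * S (length V2)) with (S (S (2 * length V2))) by lia. auto. }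
    eapply (reach_trans 1); [|exact IH].
    replace (dword true (V1 ++ [r]) ++ dword false V2 ++ map new U) with (dword true V1 ++ SCell r true true :: dword false V2 ++ map new U)
      by (unfold dword; rewrite map_app -app_assoc; auto).
    apply (reach_bits _ _ _ (PExec ph q j true) _ [false; false]); [|discriminate|auto].
    eapply sweep_app; [now apply sweep_dword|]. cbn [dword map app sweep edlt]. rewrite Hj.
    fold (dword false V2). rewrite (sweep_app ctl sym edlt _ _ _ _ _ _ _ (sweep_dword (PExec ph q j true) false V2 (fun _ => eq_refl)) (sweep_new (PExec ph q j true) U (fun _ => eq_refl))); auto.
Qed.

Lemma clear_step ph q j W U B :
  reach 1 (PClear ph q j) (dword true W ++ map new U) B (PExec ph q (S j) false) (dword false W ++ map new U) B.
Proof.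
  eapply (reach_silent _ _ _ (PClear ph q j)); [|discriminate|reflexivity]. eapply sweep_app; [|now apply sweep_new].
  induction W as [|r W IH]; auto. cbn [dword map sweep edlt]. fold (dword true W) (dword false W). rewrite IH; auto.
Qed.

Lemma exec_prog ph q W U es : forall j B, skipn j (prog ph q) = es ->
  reach (length es * (length W + 2) + 1) (PExec ph q j false) (dword false W ++ map new U) B
    (PFind ph) (dword false W ++ map new U) (B ++ den (length W) es).
Proof.
  induction es as [|e es IH]; intros j B Hj.
  - rewrite app_nil_r. destruct (nth_error (prog ph q) j) as [e|] eqn:Ej.
    { rewrite -(firstn_skipn j (prog ph q)) Hj app_nil_r in Ej.
      assert (L : j < length (firstn j (prog ph q))) by (apply nth_error_Some; congruence).
      rewrite length_firstn in L; lia. }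
    eapply (reach_silent _ _ _ (PExec ph q j false)); [|discriminate|cbn; now rewrite Ej].
    eapply sweep_app; [apply sweep_dword|apply sweep_new]; auto. intros r; cbn; rewrite Ej; auto.
  - assert (Lj : j < length (prog ph q)).
    { destruct (Nat.lt_ge_cases j (length (prog ph q))); auto. rewrite skipn_all2 in Hj; auto; discriminate Hj. }
    assert (Ej : nth_error (prog ph q) j = Some e).
    { rewrite -(firstn_skipn j (prog ph q)) Hj nth_error_app2; rewrite length_firstn; [lia|].
      replace (j - Nat.min j (length (prog ph q))) with 0 by lia. auto. }
    assert (Hs : skipn (S j) (prog ph q) = es).
    { replace (S j) with (1 + j) by lia. rewrite -skipn_skipn Hj; auto. }
    specialize (IH (S j) (B ++ den_item (length W) e) Hs). unfold den in *. cbn [flat_map]. rewrite app_assoc.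
    cbn [length Nat.mul]. rewrite -Nat.add_assoc. eapply reach_trans; [|exact IH].
    destruct e as [w|]; cbn [den_item].
    + apply (reach_le 1); [lia|]. apply (reach_bits _ _ _ (PExec ph q j false)); [|discriminate|cbn; now rewrite Ej].
      eapply sweep_app; [apply sweep_dword|apply sweep_new]; auto. intros r; cbn; rewrite Ej; auto.
    + replace (length W + 2) with (length W + 1 + 1) by lia. eapply reach_trans; [apply (run_loop ph q j U B Ej W [])|apply clear_step].
Qed.

(** A cell is done before its own program runs, so [Run] counts it as well. This is the origin of
    [S i], here and in the exponent of [num]. *)
Definition prints (ph : bool) (i : nat) (U : list nat) : list bool := concat (imap (fun i q => den (S i) (prog ph q)) i U).

Lemma print_cells ph N U2 : forall U1 B, length U1 + length U2 <= N ->
  reach (length U2 * (J * (N + 2) + 2)) (PFind ph) (dword false U1 ++ map new U2) B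
    (PFind ph) (dword false (U1 ++ U2)) (B ++ prints ph (length U1) U2).
Proof.
  induction U2 as [|q U2 IH]; intros U1 B HN.
  - cbn. rewrite !app_nil_r. exists 0; split; auto. split; auto. 
  - cbn [length] in *. specialize (IH (U1 ++ [q]) (B ++ den (S (length U1)) (prog ph q))).
    rewrite length_app -!app_assoc in IH. cbn [length app] in IH. rewrite Nat.add_1_r in IH. specialize (IH ltac:(lia)).
    cbn [Nat.mul]. eapply reach_trans; [|exact IH].
    apply (reach_le (1 + (length (prog ph q) * (length (U1 ++ [q]) + 2) + 1))).
    { specialize (prog_J ph q). rewrite length_app; cbn [length]. nia. }
    eapply reach_trans; [|rewrite -(Nat.add_1_r (length U1)) -(length_app U1 [q]); exact (exec_prog ph q (U1 ++ [q]) U2 _ 0 B eq_refl)].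
    eapply (reach_silent _ _ _ (PFound ph q)); [|discriminate|auto]. unfold dword; rewrite map_app -app_assoc.
    eapply sweep_app; [now apply sweep_dword|]. cbn [map sweep edlt new app].
    rewrite (sweep_new (PFound ph q) U2); auto.
Qed.

Lemma print_phase ph d U B : reach (length U + 1 + (1 + length U * (J * (length U + 2) + 2)))
  (PHalve ph false false) (map (fun q => SCell q d false) U) B
  (PFind ph) (dword false U) (B ++ enc_nat (length U) ++ prints ph 0 U).
Proof.
  assert (F : free (map (fun q => (q, false)) U) = length U) by (induction U; cbn; auto).
  destruct (halve_loop ph d _ _ B F) as (L & E & R). rewrite map_map map_id in E.
  unfold cword in R at 1. rewrite map_map in R. rewrite app_assoc.
  eapply reach_trans; [exact R|]. eapply reach_trans; [|exact (print_cells ph (length U) U [] _ (le_n _))].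
  eapply (reach_silent _ _ _ (PReset ph)); [rewrite sweep_reset E|discriminate|]; reflexivity.
Qed.

Definition printed (x : list bool) : list nat := map b2n x ++ heads ++ concat (repeat loop ((length x + 1) ^ k)) ++ tails.
Definition result (U : list nat) : list bool :=
  pre ++ (enc_nat (length U) ++ prints false 0 U) ++ mid ++ (enc_nat (length U) ++ prints true 0 U) ++ suf.

Definition sweeps (n N : nat) : nat := 2 * (n + 1) ^ k + 1 + 2 * (N + 1 + (1 + N * (J * (N + 2) + 2)) + 1).

Lemma printer_run x : exists m, m <= sweeps (length x) (length (printed x)) /\
  esrun m PInit (map SBit x) PEnd (dword false (printed x) ++ map SBit (result (printed x))).
Proof.
  set (U := printed x). set (n := length x).
  set (O := map (fun b => (b, vconst false k)) x).
  assert (LO : length O = n) by apply length_map.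
  assert (Z : oval n (map snd O) = 0).
  { unfold O. rewrite map_map. cbn [snd]. clear. generalize k; intros j; induction j as [|j IH]; auto.
    rewrite oval_S !map_map. cbn. rewrite IH. clear; induction x; cbn; auto. }
  assert (P : 1 <= (n + 1) ^ k) by (apply Nat.neq_0_lt_0, Nat.pow_nonzero; lia).
  destruct (odometer ((n + 1) ^ k - 1) O heads) as (O' & EO & R1); [rewrite LO Z; lia|].
  replace (S ((n + 1) ^ k - 1)) with ((n + 1) ^ k) in R1 by lia.
  assert (R2 : reach 1 PConv (oword O' ++ map new (heads ++ concat (repeat loop ((n + 1) ^ k)))) []
    (PHalve false false false) (map (fun q => SCell q false false) U) pre).
  { replace (map (fun q => SCell q false false) U) with
      ((map new (map b2n (map fst O')) ++ map new (heads ++ concat (repeat loop ((n + 1) ^ k)))) ++ map new tails).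
    - apply (reach_turn _ _ [] PConv _ tails pre); auto; [|discriminate].
      eapply sweep_app; [apply sweep_conv|now apply sweep_new].
    - rewrite -!map_app -!app_assoc EO. unfold O. rewrite !map_map. reflexivity. }
  assert (R3 := print_phase false false U pre).
  assert (R4 := print_phase true true U ((pre ++ enc_nat (length U) ++ prints false 0 U) ++ mid)).
  assert (T : forall ph B v s, eturn (PFind ph) = Some (map SBit v, s) -> reach 1 (PFind ph) (dword false U) B s (dword false U) (B ++ v)).
  { intros ph B v s E. apply (reach_bits _ _ _ (PFind ph)); auto; [|discriminate]. now apply sweep_dword. }
  assert (R := reach_trans _ _ _ _ _ _ _ _ _ _ _ R1 (reach_trans _ _ _ _ _ _ _ _ _ _ _ R2 (reach_trans _ _ _ _ _ _ _ _ _ _ _ R3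
    (reach_trans _ _ _ _ _ _ _ _ _ _ _ (T false _ mid _ eq_refl) (reach_trans _ _ _ _ _ _ _ _ _ _ _ R4 (T true _ suf _ eq_refl)))))).
  destruct R as (m & Lm & R). exists (S m). split.
  { unfold sweeps. lia. }
  exists PInit, (oword O), (map new heads), (PTest (vconst true k)). split; [|split; [reflexivity|]].
  - clear. unfold O. induction x as [|b x IH]; auto. cbn [map oword sweep edlt fst snd]. unfold oword in IH. rewrite IH; auto.
  - rewrite app_nil_r in R. unfold result. rewrite -!app_assoc in R |- *. exact R.
Qed.

(** * Time and length bounds *)

Hypothesis prog_word : forall ph q w, In (Word w) (prog ph q) -> length w <= J.

(** Bounds what one sweep appends; with polynomially many sweeps the word, and so the cost of a
    sweep, stays polynomial. *)
Definition growth : nat := length heads + length loop + length tails + length pre + length mid + length suf + J + 2.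

Lemma eturn_growth s w s' : eturn s = Some (w, s') -> length w <= growth.
Proof.
  unfold growth. destruct s; cbn [eturn]; intros E.
  - injection E as <- _. rewrite length_map; lia.
  - injection E as <- _. rewrite length_map; lia.
  - injection E as <- _. cbn; lia.
  - injection E as <- _. rewrite length_app !length_map; lia.
  - destruct any; injection E as <- _; cbn; lia.
  - injection E as <- _. cbn; lia.
  - destruct ph; injection E as <- _; rewrite length_map; lia.
  - injection E as <- _. cbn; lia.
  - destruct hit; [injection E as <- _; cbn; lia|]. destruct (nth_error (prog ph q) j) as [[v|]|] eqn:Ej; injection E as <- _; cbn; try lia.
    apply nth_error_In, prog_word in Ej. rewrite length_map; lia.
  - injection E as <- _. cbn; lia.
  - discriminate E.
Qed.

Lemma srun_growth m : forall s U s' U', esrun m s U s' U' -> length U' <= length U + m * growth.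
Proof.
  induction m as [|m IH]; intros s U s' U'; cbn [srun].
  - intros [_ ->]; lia.
  - intros (s1 & U1 & w & s2 & E & T & R). apply IH in R. apply eturn_growth in T.
    pose proof (sweep_length ctl sym edlt s U) as L. rewrite E in L. cbn [snd] in L. rewrite length_app in R. lia.
Qed.

Definition isbit (a : sym) : bool := match a with SBit _ => true | _ => false end.
Definition printer : TM := machine ctl sym scod acod allctl allsym edlt eturn isbit.

Theorem printer_output x : exists cf, tm_output cf = result (printed x) /\
  forall t, (sweeps (length x) (length (printed x)) + 1) *
      (4 * (length x + sweeps (length x) (length (printed x)) * growth) + 3) <= t ->
    exec printer t (init_cfg (tape_of x)) = Some cf.
Proof.
  destruct (printer_run x) as (m & Lm & R). pose proof (srun_growth _ _ _ _ _ R) as G. rewrite length_app !length_map in G.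
  destruct (machine_computes ctl sym scod acod allctl allsym edlt eturn PInit SBit isbit) with
    (n := m) (x := x) (s := PEnd) (U := dword false (printed x) ++ map SBit (result (printed x))) (s1 := PEnd)
    (C := dword false (printed x)) (B := result (printed x)) as (cf & Ho & He).
  - apply scod_inj.
  - apply acod_inj.
  - intros [[]| |]; cbn; lia.
  - reflexivity.
  - now apply in_allctl.
  - intros b; now apply in_allsym.
  - intros []; reflexivity.
  - reflexivity.
  - apply edlt_in.
  - apply eturn_in.
  - exact R.
  - eapply sweep_app; [now apply sweep_dword|]. apply sweep_fix, Forall_map, Forall_forall; auto.
  - reflexivity.
  - apply Forall_map, Forall_forall; auto.
  - unfold result, enc_nat. intros E. apply (f_equal (@length bool)) in E. rewrite !length_app in E. cbn [length] in E. lia.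
  - exists cf; split; auto. intros t Ht. apply He. etransitivity; [|exact Ht].
    assert (G' : length (dword false (printed x)) + length (result (printed x)) <= length x + sweeps (length x) (length (printed x)) * growth).
    { unfold dword; rewrite length_map. nia. }
    nia.
Qed.

Definition polybound (f : nat -> nat) : Prop := exists c e, forall n, f n <= polyb c e n.

Lemma polybound_const a : polybound (fun _ => a).
Proof. exists a, 0; intros n; unfold polyb; cbn; lia. Qed.
Lemma polybound_id : polybound (fun n => n).
Proof. exists 1, 1; intros n; unfold polyb; cbn; lia. Qed.
Lemma polybound_pow e : polybound (fun n => (n + 1) ^ e).
Proof. exists 1, e; intros n; unfold polyb; lia. Qed.
Lemma polybound_mul f g : polybound f -> polybound g -> polybound (fun n => f n * g n).
Proof.
  intros (c & e & H) (c' & e' & H'). exists (c * c'), (e + e'). intros n. specialize (H n); specialize (H' n).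
  unfold polyb in *. rewrite Nat.pow_add_r. etransitivity; [apply Nat.mul_le_mono; eauto|]. apply Nat.eq_le_incl. lia.
Qed.
Lemma polybound_add f g : polybound f -> polybound g -> polybound (fun n => f n + g n).
Proof.
  intros (c & e & H) (c' & e' & H'). exists (c + c'), (e + e'). intros n. specialize (H n); specialize (H' n).
  unfold polyb in *. assert (P : forall a b, (n + 1) ^ a <= (n + 1) ^ (a + b)) by (intros; apply Nat.pow_le_mono_r; lia).
  pose proof (P e e') as P1. pose proof (P e' e) as P2. rewrite (Nat.add_comm e' e) in P2. nia.
Qed.

Lemma printed_length x : length (printed x) = length x + (length heads + ((length x + 1) ^ k * length loop + length tails)).
Proof.
  unfold printed. rewrite !length_app length_map. do 3 f_equal.
  induction ((length x + 1) ^ k) as [|m IH]; auto. cbn [repeat concat]. rewrite length_app IH; lia.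
Qed.

Theorem printer_poly : exists c e, forall x, exists cf, tm_output cf = result (printed x) /\
  exec printer (polyb c e (length x)) (init_cfg (tape_of x)) = Some cf.
Proof.
  set (N := fun n => n + (length heads + ((n + 1) ^ k * length loop + length tails))).
  assert (P : polybound (fun n => (sweeps n (N n) + 1) * (4 * (n + sweeps n (N n) * growth) + 3))).
  { unfold sweeps, N. repeat first [apply polybound_add|apply polybound_mul|apply polybound_const|apply polybound_id|apply polybound_pow]. }
  destruct P as (c & e & P). exists c, e. intros x. destruct (printer_output x) as (cf & Ho & He).
  exists cf; split; auto. apply He. rewrite printed_length. apply P.
Qed.

End Emitter.

(** * Printing the instance *)

Lemma nat_bits_pow m : nat_bits (2 ^ m) = repeat false m ++ [true].
Proof.
  induction m as [|m IH]; [reflexivity|].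
  assert (P : 0 < 2 ^ m) by (apply Nat.neq_0_lt_0, Nat.pow_nonzero; lia).
  rewrite Nat.pow_succ_r'. rewrite nat_bits_step; [lia|]. rewrite Nat.odd_even Nat.div2_double IH. reflexivity.
Qed.

Lemma dbl_repeat b m : dbl (repeat b m) = repeat b (2 * m).
Proof.
  induction m as [|m IH]; auto. replace (2 * S m) with (S (S (2 * m))) by lia.
  cbn [repeat dbl flat_map app]. unfold dbl in IH. rewrite IH; auto.
Qed.

Lemma enc_nat_pow m : enc_nat (2 ^ m) = repeat false (2 * m) ++ [true; true; false; true].
Proof.
  unfold enc_nat. rewrite nat_bits_pow flat_map_app. change (flat_map (fun b : bool => [b; b]) (repeat false m)) with (dbl (repeat false m)).
  rewrite dbl_repeat -app_assoc. reflexivity.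
Qed.

(** The code of [2 ^ (S i + o)] consists of [2 * (S i + o)] zeros and the bits 1101. [Run] prints
    the share of the zeros that depends on the cell, the rest is a fixed word. *)
Definition print_field (f : field) : list item :=
  match f with Const c => [Word (enc_nat c)] | Index o => [Run; Word (repeat false (2 * o) ++ [true; true; false; true])] end.
Definition print_spec (tiles : bool) (e : spec) : list item :=
  if tiles then flat_map print_field [sN e; sE e; sS e; sW e]
  else match sst e with Some (g, s) => [Word (enc_nat g ++ enc_nat s)] | None => print_field (Index 7) ++ [Word (enc_nat 2)] end.

Lemma den_field i f : den (S i) (print_field f) = enc_nat (num i f).
Proof.
  destruct f as [c|o]; [apply app_nil_r|]. cbn [print_field num]. rewrite enc_nat_pow Nat.mul_add_distr_l repeat_app -app_assoc.
  unfold den. cbn [flat_map den_item]. rewrite app_nil_r. auto.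
Qed.

Lemma den_tile i e : den (S i) (print_spec true e) = flat_map enc_nat (tile_nats (tileof i e)).
Proof.
  unfold print_spec, tile_nats, tileof. cbn [flat_map tN tE tS tW]. unfold den. rewrite !flat_map_app.
  fold (den (S i) (print_field (sN e))) (den (S i) (print_field (sE e))) (den (S i) (print_field (sS e))) (den (S i) (print_field (sW e))).
  rewrite !den_field. auto.
Qed.

Lemma den_str i e : den (S i) (print_spec false e) = flat_map enc_nat [fst (strof i e); snd (strof i e)].
Proof.
  unfold print_spec, strof. destruct (sst e) as [[g s]|].
  - cbn. now rewrite !app_nil_r.
  - unfold den. rewrite flat_map_app. fold (den (S i) (print_field (Index 7))). rewrite den_field.
    cbn [num flat_map den_item fst snd]. replace (S i + 7) with (i + 8) by lia. reflexivity.
Qed.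

Lemma encode_shape str R Ts : encode (mkInst 2 7 str edges7 (R :: Ts) [(0, 0, tnull)]) =
  flat_map enc_nat [2; 7] ++ (enc_nat (length str) ++ flat_map enc_nat (flat_map (fun e => [fst e; snd e]) str)) ++
  flat_map enc_nat ((length edges7 :: flat_map (fun e => match e with (i, k, j) => [i; k; j] end) edges7) ++ [S (length Ts)]) ++
  (enc_nat (length R) ++ flat_map enc_nat (flat_map tile_nats R)) ++
  flat_map enc_nat (flat_map (fun T => length T :: flat_map tile_nats T) Ts ++ 1 :: 0 :: 0 :: tile_nats tnull).
Proof.
  (* Abstracting the constants keeps the simplification from computing their codes. *)
  unfold encode, inst_nats; cbn [st_tau st_r st_str st_edges st_tiles st_target]. generalize edges7 tnull enc_nat; intros E t g.
  change (length (R :: Ts)) with (S (length Ts)). cbn [flat_map app length tile_nats].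
  rewrite !flat_map_app. cbn [flat_map app]. rewrite ?flat_map_app -?app_assoc. cbn [flat_map app]. rewrite ?flat_map_app -?app_assoc. cbn [flat_map app]. reflexivity.
Qed.

Section Printed.
Variables (V : TM) (c k : nat).
Let prog (ph : bool) (q : nat) : list item := print_spec ph (spec_at V q).

Lemma prints_str i U : prints prog false i U =
  flat_map enc_nat (flat_map (fun e => [fst e; snd e]) (imap (fun i q => strof i (spec_at V q)) i U)).
Proof.
  unfold prints. revert i; induction U as [|q U IH]; intros i; auto.
  cbn [imap concat flat_map]. rewrite IH flat_map_app. f_equal. apply den_str.
Qed.
Lemma prints_tiles i U : prints prog true i U =
  flat_map enc_nat (flat_map tile_nats (imap (fun i q => tileof i (spec_at V q)) i U)).
Proof.
  unfold prints. revert i; induction U as [|q U IH]; intros i; auto.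
  cbn [imap concat flat_map]. rewrite IH flat_map_app. f_equal. apply den_tile.
Qed.

Let pre := flat_map enc_nat [2; 7].
Let mid := flat_map enc_nat ((length edges7 :: flat_map (fun e => match e with (i, k, j) => [i; k; j] end) edges7) ++ [6]).
Let suf := flat_map enc_nat
  (flat_map (fun T => length T :: flat_map tile_nats T) [colT V; intT V; [tinfA inf inf2]; [tinfB inf inf2]; [tnull]] ++
   1 :: 0 :: 0 :: tile_nats tnull).

(** The input enters the code only through the strengths and the tiles of bin 0. Everything else
    depends on [V] alone and is printed as the fixed words [pre], [mid] and [suf]. *)
Lemma encode_inst U : encode (inst V U) = result pre mid suf prog U.
Proof.
  unfold inst. rewrite encode_shape. unfold strengths, rowtiles. rewrite !imap_length -prints_str -prints_tiles. reflexivity.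
Qed.

Lemma list_bound {X} (f : X -> nat) l a : In a l -> f a <= list_max (map f l).
Proof.
  intros H. assert (F := proj1 (list_max_le (map f l) _) (le_n _)).
  rewrite Forall_forall in F. apply F, in_map, H.
Qed.

Lemma print_bound : exists J, (forall ph q, length (prog ph q) <= J) /\ (forall ph q w, In (Word w) (prog ph q) -> length w <= J).
Proof.
  set (size := fun e : item => match e with Word w => length w | Run => 0 end).
  set (weight := fun es : list item => length es + list_max (map size es)).
  set (l := ctile tnull :: specs V).
  set (J := fun ph => list_max (map (fun e => weight (print_spec ph e)) l)).
  assert (HJ : forall ph q, weight (prog ph q) <= J true + J false).
  { intros ph q. assert (I : In (spec_at V q) l) by (unfold spec_at, l; destruct (nth_in_or_default q (specs V) (ctile tnull)) as [H| ->]; [right; exact H|left; reflexivity]).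
    apply (list_bound (fun e => weight (print_spec ph e))) in I. fold (J ph) in I. fold (prog ph q) in I. destruct ph; lia. }
  exists (J true + J false); split.
  - intros ph q. specialize (HJ ph q). unfold weight in HJ. lia.
  - intros ph q w H. specialize (HJ ph q). apply (list_bound size) in H. unfold weight in HJ. cbn [size] in H. lia.
Qed.

(** As [polyb c k n] is [c * (n + 1) ^ k], printing [groups c] once for each value of the odometer
    yields one group for each certificate position. *)
Lemma groups_mul m : concat (repeat (groups c) m) = groups (c * m).
Proof.
  induction m as [|m IH]; [rewrite Nat.mul_0_r; auto|]. cbn [repeat concat]. rewrite IH Nat.mul_succ_r Nat.add_comm.
  unfold groups. rewrite repeat_app concat_app; auto.
Qed.

Lemma inst_printer : exists (F : TM) (c' k' : nat), forall x, exists cf,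
  tm_output cf = encode (inst V (kinds V x (polyb c k (length x)))) /\
  exec F (polyb c' k' (length x)) (init_cfg (tape_of x)) = Some cf.
Proof.
  destruct print_bound as (J & J1 & J2).
  assert (LK : 12 <= length (specs V)) by (unfold specs; rewrite length_app; cbn [headspecs length]; lia).
  destruct (printer_poly k (length (specs V)) J [2; 3; 4] (groups c) (lastkinds V) pre mid suf prog) as (c' & k' & H); auto.
  - lia.
  - do 3 (constructor; [lia|]). constructor.
  - apply Forall_forall; intros q Hq. unfold groups in Hq. apply in_concat in Hq as (l & Hl & Hq).
    apply repeat_spec in Hl; subst l. cbn in Hq; lia.
  - apply Forall_forall; intros q Hq. apply in_seq in Hq. lia.
  - exists (printer k (length (specs V)) [2; 3; 4] (groups c) (lastkinds V) pre mid suf prog), c', k'.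
    intros x. destruct (H x) as (cf & Ho & He). exists cf; split; auto. rewrite Ho encode_inst. f_equal.
    unfold printed, kinds. rewrite groups_mul. reflexivity.
Qed.

End Printed.

Lemma StagedUAV_inst V x p : StagedUAV_7_2 (encode (inst V (kinds V x p))) <-> uniquely_assembles (inst V (kinds V x p)).
Proof.
  split.
  - intros (I & E & _ & _ & _ & U). apply encode_inj in E as ->. auto.
  - intros U. exists (inst V (kinds V x p)). split; auto. split; [apply inst_valid|]. auto.
Qed.

Theorem mainTheorem4 : Pi2P_hard StagedUAV_7_2.
Proof.
  intros L (V & c & k & Tot & Spec). destruct (inst_printer V c k) as (F & c' & k' & H).
  exists F, c', k'. intros x. destruct (H x) as (cf & Ho & He). exists cf; split; auto.
  rewrite Ho StagedUAV_inst. symmetry. now apply inst_correct.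
Qed.
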